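(* Let $\rho_0>0$, $T>0$, $\alpha_r\ge 1$, $\beta>0$, $\alpha_0,\alpha_1,\alpha_2,\alpha_3>0$, and let $r$, $b_{j,k}$ ($j=0,1,2,3$, $k\ge 0$) and $f_I$ be as described in the context. Consider the initial value problem $$f_t-f_{yyy}=\sum_{j=0}^{3} b_j(y,t;f)\,\partial_y^j f+r(y,t),\qquad f(y,0)=f_I(y),\qquad b_j(y,t;f)=\sum_{k=0}^\infty b_{j,k}(y,t)f^k .$$ Then for any $T>0$ and any $0<\phi<\pi/6$ there exists $\tilde\rho>0$ such that this problem has a unique solution $f$ that is analytic in $y$ and $O(y^{-1})$ as $y\to\infty$ for $(y,t)\in\mathcal D_{\phi,\tilde\rho}$. Moreover this solution satisfies $f=O(y^{-\alpha_r})$ as $y\to\infty$ in $\mathcal D_{\phi,\tilde\rho}$.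
   Context: Here $y$ is a complex variable, $t$ real, $\arg$ is the principal argument and $\partial_y^j f$ the $j$-th partial derivative in $y$. Let $\mathcal D_{\rho_0}=\{(y,t):\arg y\in(-2\pi/3,2\pi/3),\ |y|>\rho_0,\ 0\le t\le T\}$ and, for $0<\phi<\pi/6$ and $\rho>\rho_0$, $\mathcal D_{\phi,\rho}=\{(y,t):\arg y\in(-\pi/2-\phi,\pi/2+\phi),\ |y|>\rho,\ 0\le t\le T\}$. Standing assumptions: $r(y,t)$ is analytic in $y$ on $\mathcal D_{\rho_0}$ and $|y^{\alpha_r}r(y,t)|<A_r(T)$ there, where $\alpha_r\ge1$ does not depend on $T$. Each $b_{j,k}(y,t)$ is analytic in $y$ on $\mathcal D_{\rho_0}$ and $|y^{\alpha_j+k\beta}b_{j,k}(y,t)|<A_b(T)$ there, with $\beta,\alpha_j>0$ independent of $k$ and $T$ and $A_b(T)$ independent of $j,k$; the series $\sum_k b_{j,k}f^k$ converges in $\mathcal D_{\phi,\rho}$ whenever $|f|<\rho^\beta$. The initial datum $f_I$ is analytic for $|y|>\rho_0$, $|\arg y|<2\pi/3$, and $|y^{\alpha_r}f_I(y)|<A_{f_I}$ there. A solution is a function $f(y,t)$ analytic in $y$ on the stated domain satisfying the equation and the initial condition there.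
   Formalization: It is additionally assumed that, for each fixed y, r(y,t) and every b_{j,k}(y,t) are continuous in t on [0,T]; without this the claim fails, e.g. for b=0, f_I=0 and r equal to y^{-2} for t≥T/2 and 0 before, since f_t cannot have a jump. *)

(* Defs.v *)
From Stdlib Require Import Reals.
From Coquelicot Require Import Coquelicot.

Open Scope R_scope.

(* [in_sector th z]: z <> 0 and the principal argument of z lies in (-th, th).
   For 0 < th <= PI this is exactly "arg z in (-th, th)" (z = |z| e^{i a}). *)
Definition in_sector (th : R) (z : C) : Prop :=
  exists (rad a : R), 0 < rad /\ - th < a < th /\
    z = (rad * cos a, rad * sin a)%R.

Definition Dom0 (rho0 T : R) (y : C) (t : R) : Prop :=
  in_sector (2 * PI / 3) y /\ rho0 < Cmod y /\ 0 <= t <= T.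

Definition Dphi (phi rho T : R) (y : C) (t : R) : Prop :=
  in_sector (PI / 2 + phi) y /\ rho < Cmod y /\ 0 <= t <= T.

Definition Cderiv (g : C -> C) (z l : C) : Prop :=
  @is_derive C_AbsRing C_NormedModule g z l.

Definition analytic_on (U : C -> Prop) (g : C -> C) : Prop :=
  forall z, U z -> exists l, Cderiv g z l.

Definition tderiv_within (T : R) (g : R -> C) (t : R) (d : C) : Prop :=
  filterlim (fun h : R => Cdiv (Cminus (g (t + h)) (g t)) (RtoC h))
    (within (fun h : R => h <> 0 /\ 0 <= t + h <= T) (locally 0))
    (locally d).

Definition Cseries (a : nat -> C) (l : C) : Prop :=
  @is_series C_AbsRing C_NormedModule a l.

Definition Cex_series (a : nat -> C) : Prop := exists l, Cseries a l.

Definition is_solution (T : R) (r : C -> R -> C) (b : nat -> nat -> C -> R -> C)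
    (fI : C -> C) (D : C -> R -> Prop) (f : C -> R -> C) : Prop :=
  (forall t, 0 <= t <= T -> analytic_on (fun y => D y t) (fun y => f y t)) /\
  (forall y, D y 0 -> f y 0 = fI y) /\
  exists f1 f2 f3 : C -> R -> C,
    (forall y t, D y t ->
       Cderiv (fun z => f z t) y (f1 y t) /\
       Cderiv (fun z => f1 z t) y (f2 y t) /\
       Cderiv (fun z => f2 z t) y (f3 y t)) /\
    (forall y t, D y t ->
       exists (ft : C) (B : nat -> C),
         tderiv_within T (fun s => f y s) t ft /\
         (forall j, (j < 4)%nat ->
            Cseries (fun k => Cmult (b j k y t) (pow_n (K := C_Ring) (f y t) k)) (B j)) /\
         Cminus ft (f3 y t) =
           Cplus (Cplus (Cplus (Cplus (Cmult (B 0%nat) (f y t)) (Cmult (B 1%nat) (f1 y t)))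
                  (Cmult (B 2%nat) (f2 y t))) (Cmult (B 3%nat) (f3 y t))) (r y t)).

Definition bigO_inv (a : R) (D : C -> R -> Prop) (f : C -> R -> C) : Prop :=
  exists K M : R, forall y t, D y t -> M < Cmod y ->
    Cmod (f y t) <= K / Rpower (Cmod y) a.

(* Main.v *)
Require Import Defs.
From Stdlib Require Import Reals Lra Lia ClassicalEpsilon.
From Coquelicot Require Import Coquelicot.
Open Scope R_scope.

(** The problem is solved directly in the [y]-plane. On a region [d > 0], where [d] is 1-Lipschitz and grows linearly along
    the rays [1, e^{i psi}, e^{-i psi}] with [PI/3 < psi < PI/2], the equation [u_t = u_yyy] is solved by integrating against
    an Airy-type kernel along these three rays; the kernel decays there because it is a difference of Laplace integrals
    [int_0^oo c e^{c q z - c^3 q^3} dq] taken over valleys of [e^{- q^3}].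
    The Duhamel operator of this evolution gains two [y]-derivatives with bounded weight and a third one at the price of
    the boundary singularity [d^{-1/2}], which is exactly the loss it tolerates in its argument. As the coefficients
    [b_j] are small far out, the nonlinear equation becomes a contraction, in the weight [vp^{- alpha_r}] for existence.
    For uniqueness the same contraction is run on a far half-plane, where Cauchy estimates bound the derivatives of any
    [O(1/y)] solution; the identity theorem then carries the equality to the whole domain. *)

(** * Derivatives and integrals of complex functions *)

Definition ccont (f : R -> C) (x : R) := forall eps, 0 < eps -> exists del, 0 < del /\
  forall x', Rabs (x' - x) < del -> Cmod (f x' - f x)%C < eps.
Definition rder (f : R -> C) (x : R) (l : C) := forall eps, 0 < eps -> exists del, 0 < del /\
  forall h, Rabs h < del -> Cmod (f (x + h)%R - f x - RtoC h * l)%C <= eps * Rabs h.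
Definition cder (g : C -> C) (z l : C) := forall eps, 0 < eps -> exists del, 0 < del /\
  forall k, Cmod k < del -> Cmod (g (z + k) - g z - k * l)%C <= eps * Cmod k.
Definition czcont (g : C -> C) (z : C) := forall eps, 0 < eps -> exists del, 0 < del /\
  forall z', Cmod (z' - z)%C < del -> Cmod (g z' - g z)%C < eps.

Lemma Cmod_minus_sym (a b : C) : Cmod (a - b)%C = Cmod (b - a)%C.
Proof. rewrite <- Cmod_opp. f_equal. ring. Qed.

Lemma Cmod_tri3 (a b c : C) : Cmod (a - c)%C <= Cmod (a - b)%C + Cmod (b - c)%C.
Proof. replace (a - c)%C with ((a - b) + (b - c))%C by ring. apply Cmod_triangle. Qed.

Lemma Cmod_rtri (a b : C) : Cmod a - Cmod b <= Cmod (a + b)%C.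
Proof.
  assert (H := Cmod_triangle (a + b)%C (- b)%C). rewrite Cmod_opp in H.
  replace (a + b + - b)%C with a in H by ring. lra.
Qed.

Lemma Cmod_triangle_minus (a b : C) : Cmod (a - b)%C <= Cmod a + Cmod b.
Proof. unfold Cminus. rewrite <- (Cmod_opp b). apply Cmod_triangle. Qed.

Lemma Cmod_RtoC_pos (x : R) : 0 <= x -> Cmod (RtoC x) = x.
Proof. intros H. rewrite Cmod_R. now apply Rabs_pos_eq. Qed.

Lemma im_le_Cmod (c : C) : Rabs (Im c) <= Cmod c.
Proof. eapply Rle_trans; [apply Rmax_r | apply Rmax_Cmod]. Qed.

Lemma Cmod_le_ReIm (c : C) : Cmod c <= Rabs (Re c) + Rabs (Im c).
Proof.
  unfold Cmod, Re, Im. apply Rsqr_incr_0_var.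
  - rewrite Rsqr_sqrt by nra.
    assert (H1 := Rabs_pos (fst c)). assert (H2 := Rabs_pos (snd c)).
    rewrite <- (pow2_abs (fst c)), <- (pow2_abs (snd c)). unfold Rsqr. nra.
  - assert (H1 := Rabs_pos (fst c)). assert (H2 := Rabs_pos (snd c)). lra.
Qed.

Lemma Re_minus (a b : C) : Re (a - b)%C = Re a - Re b.
Proof. reflexivity. Qed.
Lemma Im_minus (a b : C) : Im (a - b)%C = Im a - Im b.
Proof. reflexivity. Qed.

Lemma C_ext (a b : C) : Re a = Re b -> Im a = Im b -> a = b.
Proof. destruct a, b; simpl; intros; subst; reflexivity. Qed.

Lemma Cmod_eps_eq (a b : C) : (forall eps, 0 < eps -> Cmod (a - b)%C <= eps) -> a = b.
Proof.
  intros H. apply Ceq_minus. apply Cmod_eq_0. apply Rle_antisym; [|apply Cmod_ge_0].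
  apply le_epsilon. intros e He. rewrite Rplus_0_l. auto.
Qed.

Lemma locally_C_iff (z : C) (P : C -> Prop) :
  locally (T := C_UniformSpace) z P <-> exists del, 0 < del /\ forall z', Cmod (z' - z)%C < del -> P z'.
Proof.
  split.
  - intros [e He]. exists e. split; [apply e|]. intros z' Hz. apply He.
    apply C_NormedModule_mixin_compat1. exact Hz.
  - intros [d [Hd H]].
    assert (Hs : 0 < sqrt 2) by (apply sqrt_lt_R0; lra).
    assert (Hp : 0 < d / sqrt 2) by (apply Rdiv_lt_0_compat; lra).
    exists (mkposreal _ Hp). intros z' Hz. apply H.
    apply C_NormedModule_mixin_compat2 in Hz. simpl in Hz.
    replace (sqrt 2 * (d / sqrt 2)) with d in Hz by (field; lra). exact Hz.
Qed.

Lemma locally_R_iff (x : R) (P : R -> Prop) :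
  locally x P <-> exists del, 0 < del /\ forall x', Rabs (x' - x) < del -> P x'.
Proof.
  split.
  - intros [e He]. exists e. split; [apply e|]. intros z' Hz. apply He. exact Hz.
  - intros [d [Hd H]]. exists (mkposreal _ Hd). intros z' Hz. apply H. exact Hz.
Qed.

Lemma filterlim_C_iff {U} (F : (U -> Prop) -> Prop) {FF : Filter F} (f : U -> C) (l : C) :
  filterlim f F (locally (T := C_UniformSpace) l) <->
  forall eps, 0 < eps -> F (fun u => Cmod (f u - l)%C < eps).
Proof.
  split.
  - intros H e He. apply (H (fun z => Cmod (z - l)%C < e)). apply locally_C_iff. eauto.
  - intros H P HP. apply locally_C_iff in HP. destruct HP as [d [Hd HP]].
    unfold filtermap. apply filter_imp with (2 := H d Hd). auto.
Qed.

Lemma locally_Cn_iff (z : C) (P : C -> Prop) :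
  locally (T := AbsRing_UniformSpace C_AbsRing) z P <->
  exists del, 0 < del /\ forall z', Cmod (z' - z)%C < del -> P z'.
Proof.
  split.
  - intros [e He]. exists e. split; [apply e|]. intros z' Hz. apply He. exact Hz.
  - intros [d [Hd H]]. exists (mkposreal _ Hd). intros z' Hz. apply H. exact Hz.
Qed.

Lemma Cderiv_cder (g : C -> C) (z l : C) : Cderiv g z l <-> cder g z l.
Proof.
  unfold Cderiv. split.
  - intros [_ H] e He. specialize (H z (fun P H => H) (mkposreal _ He)).
    apply locally_Cn_iff in H. destruct H as [d [Hd H]]. exists d. split; [exact Hd|].
    intros k Hk. specialize (H (z + k)%C).
    replace (z + k - z)%C with k in H by ring. specialize (H Hk).
    change (Cmod (g (z + k) - g z - (z + k - z) * l)%C <= e * Cmod (z + k - z)%C) in H.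
    replace (z + k - z)%C with k in H by ring.
    exact H.
  - intros H. split.
    + apply is_linear_scal_l.
    + intros x Hx. assert (x = z) by (symmetry; exact (is_filter_lim_locally_unique _ _ Hx)). subst x.
      intros e. destruct (H e (cond_pos e)) as [d [Hd H']].
      apply locally_Cn_iff. exists d. split; [exact Hd|]. intros z' Hz.
      specialize (H' (z' - z)%C Hz).
      replace (z + (z' - z))%C with z' in H' by ring. exact H'.
Qed.

Lemma ccont_const (c : C) x : ccont (fun _ => c) x.
Proof. intros e He. exists 1. split; [lra|]. intros. replace (c - c)%C with (RtoC 0) by ring. rewrite Cmod_0; lra. Qed.

Lemma ccont_RtoC f x : continuous f x -> ccont (fun u => RtoC (f u)) x.
Proof.
  intros H e He.
  assert (HH : locally x (fun u => Rabs (f u - f x) < e)).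
  { apply (H (fun v => Rabs (v - f x) < e)). apply locally_R_iff. exists e. auto. }
  apply locally_R_iff in HH. destruct HH as [d [Hd HH]]. exists d. split; [exact Hd|].
  intros x' Hx. rewrite <- RtoC_minus, Cmod_R. auto.
Qed.

Lemma ccont_plus f g x : ccont f x -> ccont g x -> ccont (fun u => f u + g u)%C x.
Proof.
  intros Hf Hg e He. destruct (Hf (e/2)) as [d1 [Hd1 H1]]; [lra|]. destruct (Hg (e/2)) as [d2 [Hd2 H2]]; [lra|].
  exists (Rmin d1 d2). split; [apply Rmin_glb_lt; auto|]. intros x' Hx.
  assert (Rabs (x' - x) < d1) by (eapply Rlt_le_trans; [exact Hx|apply Rmin_l]).
  assert (Rabs (x' - x) < d2) by (eapply Rlt_le_trans; [exact Hx|apply Rmin_r]).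
  specialize (H1 x' H). specialize (H2 x' H0).
  replace (f x' + g x' - (f x + g x))%C with ((f x' - f x) + (g x' - g x))%C by ring.
  eapply Rle_lt_trans; [apply Cmod_triangle|]. lra.
Qed.

Lemma ccont_mult f g x : ccont f x -> ccont g x -> ccont (fun u => f u * g u)%C x.
Proof.
  intros Hf Hg e He.
  set (M := Cmod (f x) + 1). set (N := Cmod (g x) + 1).
  assert (HM : 0 < M) by (unfold M; assert (H := Cmod_ge_0 (f x)); lra).
  assert (HN : 0 < N) by (unfold N; assert (H := Cmod_ge_0 (g x)); lra).
  destruct (Hf (Rmin 1 (e/(2*N)))) as [d1 [Hd1 H1]].
  { apply Rmin_glb_lt; [lra|]. apply Rdiv_lt_0_compat; lra. }
  destruct (Hg (e/(2*M))) as [d2 [Hd2 H2]].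
  { apply Rdiv_lt_0_compat; lra. }
  exists (Rmin d1 d2). split; [apply Rmin_glb_lt; auto|]. intros x' Hx.
  assert (Ha : Rabs (x' - x) < d1) by (eapply Rlt_le_trans; [exact Hx|apply Rmin_l]).
  assert (Hb : Rabs (x' - x) < d2) by (eapply Rlt_le_trans; [exact Hx|apply Rmin_r]).
  specialize (H1 x' Ha). specialize (H2 x' Hb).
  assert (Hf1 : Cmod (f x') <= M).
  { unfold M. replace (f x') with (f x + (f x' - f x))%C by ring.
    eapply Rle_trans; [apply Cmod_triangle|].
    assert (Cmod (f x' - f x) < 1) by (eapply Rlt_le_trans; [exact H1|apply Rmin_l]). lra. }
  assert (H1' : Cmod (f x' - f x)%C < e/(2*N)) by (eapply Rlt_le_trans; [exact H1|apply Rmin_r]).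
  replace (f x' * g x' - f x * g x)%C with (f x' * (g x' - g x) + (f x' - f x) * g x)%C by ring.
  eapply Rle_lt_trans; [apply Cmod_triangle|]. rewrite !Cmod_mult.
  assert (Cmod (f x') * Cmod (g x' - g x)%C <= M * Cmod (g x' - g x)%C)
    by (apply Rmult_le_compat_r; [apply Cmod_ge_0|exact Hf1]).
  assert (M * Cmod (g x' - g x)%C < M * (e/(2*M))) by (apply Rmult_lt_compat_l; auto).
  replace (M * (e/(2*M))) with (e/2) in H0 by (field; lra).
  assert (Cmod (f x' - f x)%C * Cmod (g x) <= e/(2*N) * N).
  { apply Rmult_le_compat; [apply Cmod_ge_0|apply Cmod_ge_0|lra|unfold N; lra]. }
  replace (e/(2*N)*N) with (e/2) in H3 by (field; lra). lra.
Qed.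

Lemma ccont_ext f g x : (forall u, f u = g u) -> ccont f x -> ccont g x.
Proof. intros H Hf e He. destruct (Hf e He) as [d [Hd K]]. exists d. split; auto. intros. rewrite <- !H. auto. Qed.

Lemma ccont_opp f x : ccont f x -> ccont (fun u => - f u)%C x.
Proof.
  intros H. apply ccont_ext with (fun u => RtoC (-1) * f u)%C; [intros; ring|].
  apply ccont_mult; auto. apply ccont_const.
Qed.

Lemma ccont_minus f g x : ccont f x -> ccont g x -> ccont (fun u => f u - g u)%C x.
Proof. intros. apply ccont_plus; auto. now apply ccont_opp. Qed.

Lemma ccont_comp_z g f x : czcont g (f x) -> ccont f x -> ccont (fun u => g (f u)) x.
Proof.
  intros Hg Hf e He. destruct (Hg e He) as [d [Hd H]]. destruct (Hf d Hd) as [d' [Hd' H']].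
  exists d'. split; auto.
Qed.

Lemma ccont_comp_r f (u : R -> R) x : ccont f (u x) -> continuous u x -> ccont (fun v => f (u v)) x.
Proof.
  intros Hf Hu e He. destruct (Hf e He) as [d [Hd H]].
  assert (HH : locally x (fun v => Rabs (u v - u x) < d)).
  { apply (Hu (fun v => Rabs (v - u x) < d)). apply locally_R_iff. exists d. auto. }
  apply locally_R_iff in HH. destruct HH as [d' [Hd' HH]]. exists d'. auto.
Qed.

Lemma ccont_Re f x : ccont f x -> continuous (fun u => Re (f u)) x.
Proof.
  intros H P HP. apply locally_R_iff in HP. destruct HP as [e [He HP]].
  destruct (H e He) as [d [Hd K]]. apply locally_R_iff. exists d. split; auto. intros x' Hx. apply HP.
  rewrite <- Re_minus. eapply Rle_lt_trans; [apply re_le_Cmod|]. auto.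
Qed.
Lemma ccont_Im f x : ccont f x -> continuous (fun u => Im (f u)) x.
Proof.
  intros H P HP. apply locally_R_iff in HP. destruct HP as [e [He HP]].
  destruct (H e He) as [d [Hd K]]. apply locally_R_iff. exists d. split; auto. intros x' Hx. apply HP.
  rewrite <- Im_minus. eapply Rle_lt_trans; [apply im_le_Cmod|]. auto.
Qed.
Lemma ccont_Cmod f x : ccont f x -> continuous (fun u => Cmod (f u)) x.
Proof.
  intros H P HP. apply locally_R_iff in HP. destruct HP as [e [He HP]].
  destruct (H e He) as [d [Hd K]]. apply locally_R_iff. exists d. split; auto. intros x' Hx. apply HP.
  eapply Rle_lt_trans; [|apply (K x' Hx)].
  assert (A := Cmod_rtri (f x') (f x - f x')%C). assert (B := Cmod_rtri (f x) (f x' - f x)%C).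
  replace (f x' + (f x - f x'))%C with (f x) in A by ring.
  replace (f x + (f x' - f x))%C with (f x') in B by ring.
  rewrite (Cmod_minus_sym (f x)) in A. apply Rabs_le. lra.
Qed.

Lemma rder_ccont f x l : rder f x l -> ccont f x.
Proof.
  intros H e He. destruct (H 1 Rlt_0_1) as [d [Hd K]].
  set (M := Cmod l + 1). assert (HM : 0 < M) by (unfold M; assert (Q := Cmod_ge_0 l); lra).
  exists (Rmin d (e / M)). split.
  { apply Rmin_glb_lt; auto. apply Rdiv_lt_0_compat; auto. }
  intros x' Hx. specialize (K (x' - x)).
  assert (Ha : Rabs (x' - x) < d) by (eapply Rlt_le_trans; [exact Hx|apply Rmin_l]).
  assert (Hb : Rabs (x' - x) < e/M) by (eapply Rlt_le_trans; [exact Hx|apply Rmin_r]).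
  specialize (K Ha). replace (x + (x' - x)) with x' in K by ring.
  replace (f x' - f x)%C with ((f x' - f x - RtoC (x' - x) * l) + RtoC (x' - x) * l)%C by ring.
  eapply Rle_lt_trans; [apply Cmod_triangle|]. rewrite Cmod_mult, Cmod_R.
  assert (Rabs (x' - x) * M < e / M * M) by (apply Rmult_lt_compat_r; auto).
  replace (e / M * M) with e in H0 by (field; lra). unfold M in H0. lra.
Qed.

Lemma cder_czcont g z l : cder g z l -> czcont g z.
Proof.
  intros H e He. destruct (H 1 Rlt_0_1) as [d [Hd K]].
  set (M := Cmod l + 1). assert (HM : 0 < M) by (unfold M; assert (Q := Cmod_ge_0 l); lra).
  exists (Rmin d (e / M)). split.
  { apply Rmin_glb_lt; auto. apply Rdiv_lt_0_compat; auto. }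
  intros x' Hx. specialize (K (x' - z)%C).
  assert (Ha : Cmod (x' - z)%C < d) by (eapply Rlt_le_trans; [exact Hx|apply Rmin_l]).
  assert (Hb : Cmod (x' - z)%C < e/M) by (eapply Rlt_le_trans; [exact Hx|apply Rmin_r]).
  specialize (K Ha). replace (z + (x' - z))%C with x' in K by ring.
  replace (g x' - g z)%C with ((g x' - g z - (x' - z) * l) + (x' - z) * l)%C by ring.
  eapply Rle_lt_trans; [apply Cmod_triangle|]. rewrite Cmod_mult.
  assert (Cmod (x' - z)%C * M < e / M * M) by (apply Rmult_lt_compat_r; auto).
  replace (e / M * M) with e in H0 by (field; lra). unfold M in H0. lra.
Qed.

Lemma cder_rder g z e x l : cder g (z + RtoC x * e)%C l -> rder (fun u => g (z + RtoC u * e)%C) x (l * e)%C.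
Proof.
  intros H eps He.
  set (M := Cmod e + 1). assert (HM : 0 < M) by (unfold M; assert (Q := Cmod_ge_0 e); lra).
  destruct (H (eps / M)) as [d [Hd K]]. { apply Rdiv_lt_0_compat; auto. }
  exists (d / M). split. { apply Rdiv_lt_0_compat; auto. }
  intros h Hh. specialize (K (RtoC h * e)%C). rewrite Cmod_mult, Cmod_R in K.
  assert (Hlt : Rabs h * Cmod e < d).
  { apply Rle_lt_trans with (Rabs h * M).
    - apply Rmult_le_compat_l; [apply Rabs_pos|unfold M; lra].
    - apply (Rmult_lt_compat_r M) in Hh; auto. replace (d / M * M) with d in Hh by (field; lra). exact Hh. }
  specialize (K Hlt). replace (z + RtoC x * e + RtoC h * e)%C with (z + RtoC (x + h) * e)%C in K
    by (rewrite RtoC_plus; ring).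
  replace (RtoC h * (l * e))%C with (RtoC h * e * l)%C by ring.
  eapply Rle_trans; [exact K|].
  apply Rle_trans with (eps / M * (Rabs h * M)).
  - apply Rmult_le_compat_l; [apply Rlt_le, Rdiv_lt_0_compat; auto|].
    apply Rmult_le_compat_l; [apply Rabs_pos|unfold M; lra].
  - right. field. lra.
Qed.

Lemma rder_comps f x l : rder f x l <-> is_derive (fun u => Re (f u)) x (Re l) /\ is_derive (fun u => Im (f u)) x (Im l).
Proof.
  split.
  - intros H. split; apply is_derive_Reals; intros e He;
    destruct (H (e/2)) as [d [Hd K]]; try lra; exists (mkposreal _ Hd); intros h Hh0 Hh; simpl in Hh;
    specialize (K h Hh).
    + assert (Q := re_le_Cmod (f (x + h)%R - f x - RtoC h * l)%C).
      assert (E : Re (f (x + h)%R - f x - RtoC h * l)%C = (Re (f (x+h)) - Re (f x)) - h * Re l).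
      { rewrite !Re_minus, re_scal_l. ring. }
      rewrite E in Q.
      replace ((Re (f (x + h)) - Re (f x)) / h - Re l) with (((Re (f (x+h)) - Re (f x)) - h * Re l) / h) by (field; auto).
      unfold Rdiv. rewrite Rabs_mult, Rabs_inv.
      apply Rmult_lt_reg_r with (Rabs h); [now apply Rabs_pos_lt|].
      rewrite Rmult_assoc, Rinv_l by (now apply Rabs_no_R0).
      assert (0 < Rabs h) by now apply Rabs_pos_lt. nra.
    + assert (Q := im_le_Cmod (f (x + h)%R - f x - RtoC h * l)%C).
      assert (E : Im (f (x + h)%R - f x - RtoC h * l)%C = (Im (f (x+h)) - Im (f x)) - h * Im l).
      { rewrite !Im_minus, im_scal_l. ring. }
      rewrite E in Q.
      replace ((Im (f (x + h)) - Im (f x)) / h - Im l) with (((Im (f (x+h)) - Im (f x)) - h * Im l) / h) by (field; auto).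
      unfold Rdiv. rewrite Rabs_mult, Rabs_inv.
      apply Rmult_lt_reg_r with (Rabs h); [now apply Rabs_pos_lt|].
      rewrite Rmult_assoc, Rinv_l by (now apply Rabs_no_R0).
      assert (0 < Rabs h) by now apply Rabs_pos_lt. nra.
  - intros [H1 H2] e He. apply is_derive_Reals in H1, H2.
    destruct (H1 (e/2)) as [d1 K1]; [lra|]. destruct (H2 (e/2)) as [d2 K2]; [lra|].
    exists (Rmin d1 d2). split; [apply Rmin_glb_lt; apply cond_pos|]. intros h Hh.
    destruct (Req_dec h 0) as [->|Hh0].
    { rewrite Rplus_0_r. replace (f x - f x - 0 * l)%C with (RtoC 0) by ring. rewrite Cmod_0, Rabs_R0. lra. }
    assert (Rabs h < d1) by (eapply Rlt_le_trans; [exact Hh|apply Rmin_l]).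
    assert (Rabs h < d2) by (eapply Rlt_le_trans; [exact Hh|apply Rmin_r]).
    specialize (K1 h Hh0 H). specialize (K2 h Hh0 H0).
    eapply Rle_trans; [apply Cmod_le_ReIm|].
    rewrite !Re_minus, !Im_minus, re_scal_l, im_scal_l.
    assert (Hp : 0 < Rabs h) by now apply Rabs_pos_lt.
    replace (Re (f (x + h)) - Re (f x) - h * Re l) with (((Re (f (x + h)) - Re (f x)) / h - Re l) * h) by (field; auto).
    replace (Im (f (x + h)) - Im (f x) - h * Im l) with (((Im (f (x + h)) - Im (f x)) / h - Im l) * h) by (field; auto).
    rewrite !Rabs_mult. nra.
Qed.

Lemma rder_plus f g x a b : rder f x a -> rder g x b -> rder (fun u => f u + g u)%C x (a + b)%C.
Proof.
  intros Hf Hg. apply rder_comps in Hf, Hg. destruct Hf, Hg. apply rder_comps. split.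
  - apply (is_derive_ext (fun u => Re (f u) + Re (g u))); [reflexivity|].
    apply (is_derive_plus (V := R_NormedModule)); auto.
  - apply (is_derive_ext (fun u => Im (f u) + Im (g u))); [reflexivity|].
    apply (is_derive_plus (V := R_NormedModule)); auto.
Qed.

Lemma rder_mult f g x a b : rder f x a -> rder g x b -> rder (fun u => f u * g u)%C x (a * g x + f x * b)%C.
Proof.
  intros Hf Hg. apply rder_comps in Hf, Hg. destruct Hf as [F1 F2], Hg as [G1 G2]. apply rder_comps.
  apply is_derive_Reals in F1, F2, G1, G2.
  split; apply is_derive_Reals.
  - replace (Re (a * g x + f x * b)%C) with
     ((Re a * Re (g x) + Re (f x) * Re b) - (Im a * Im (g x) + Im (f x) * Im b)) by (rewrite re_plus, !re_mult; ring).
    apply (derivable_pt_lim_minus (fun u => Re (f u) * Re (g u)) (fun u => Im (f u) * Im (g u)));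
    apply (derivable_pt_lim_mult (fun u => _ (f u)) (fun u => _ (g u))); auto.
  - replace (Im (a * g x + f x * b)%C) with
     ((Re a * Im (g x) + Re (f x) * Im b) + (Im a * Re (g x) + Im (f x) * Re b)) by (rewrite im_plus, !im_mult; ring).
    apply (derivable_pt_lim_plus (fun u => Re (f u) * Im (g u)) (fun u => Im (f u) * Re (g u)));
    apply (derivable_pt_lim_mult (fun u => _ (f u)) (fun u => _ (g u))); auto.
Qed.

Lemma rder_const c x : rder (fun _ => c) x 0.
Proof.
  intros e He. exists 1. split; [lra|]. intros.
  replace (c - c - h * 0)%C with (RtoC 0) by ring. rewrite Cmod_0.
  apply Rmult_le_pos; [lra|apply Rabs_pos].
Qed.

Lemma rder_scal c f x l : rder f x l -> rder (fun u => c * f u)%C x (c * l)%C.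
Proof.
  intros H. replace (c * l)%C with (0 * f x + c * l)%C by ring.
  apply (rder_mult (fun _ => c) f); auto. apply rder_const.
Qed.

Lemma rder_minus f g x a b : rder f x a -> rder g x b -> rder (fun u => f u - g u)%C x (a - b)%C.
Proof.
  intros Hf Hg. apply rder_comps in Hf, Hg. destruct Hf, Hg. apply rder_comps. split.
  - apply (is_derive_ext (fun u => Re (f u) - Re (g u))); [reflexivity|].
    apply (is_derive_minus (V := R_NormedModule)); auto.
  - apply (is_derive_ext (fun u => Im (f u) - Im (g u))); [reflexivity|].
    apply (is_derive_minus (V := R_NormedModule)); auto.
Qed.

Lemma rder_ext f g x l : (forall u, f u = g u) -> rder f x l -> rder g x l.
Proof. intros H Hf e He. destruct (Hf e He) as [d [Hd K]]. exists d. split; auto. intros. rewrite <- !H. auto. Qed.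

Lemma rder_RtoC (f : R -> R) (x l : R) : is_derive f x l -> rder (fun u => RtoC (f u)) x (RtoC l).
Proof. intros H. apply rder_comps. split; [exact H|]. apply is_derive_ext with (fun _ => 0); [reflexivity|]. exact (is_derive_const (V := R_NormedModule) 0 x). Qed.

Definition CI (f : R -> C) (a b : R) : C := (RInt (fun u => Re (f u)) a b, RInt (fun u => Im (f u)) a b).

Definition con_on (f : R -> C) a b := forall x, a <= x <= b -> ccont f x.

Lemma con_on_Re f a b : a <= b -> con_on f a b -> ex_RInt (fun u => Re (f u)) a b.
Proof. intros Hab H. apply (ex_RInt_continuous (V := R_CompleteNormedModule)). rewrite Rmin_left, Rmax_right by lra. intros. now apply ccont_Re, H. Qed.
Lemma con_on_Im f a b : a <= b -> con_on f a b -> ex_RInt (fun u => Im (f u)) a b.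
Proof. intros Hab H. apply (ex_RInt_continuous (V := R_CompleteNormedModule)). rewrite Rmin_left, Rmax_right by lra. intros. now apply ccont_Im, H. Qed.

Lemma CI_ext f g a b : a <= b -> (forall x, a < x < b -> f x = g x) -> CI f a b = CI g a b.
Proof.
  intros Hab H. unfold CI. f_equal; apply (RInt_ext (V := R_CompleteNormedModule));
  rewrite Rmin_left, Rmax_right by lra; intros; now rewrite H.
Qed.

Lemma CI_plus f g a b : a <= b -> con_on f a b -> con_on g a b ->
  CI (fun u => f u + g u)%C a b = (CI f a b + CI g a b)%C.
Proof.
  intros Hab Hf Hg. apply C_ext; simpl;
  apply (RInt_plus (V := R_CompleteNormedModule));
  auto using con_on_Re, con_on_Im.
Qed.

Lemma CI_scal c f a b : a <= b -> con_on f a b -> CI (fun u => c * f u)%C a b = (c * CI f a b)%C.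
Proof.
  intros Hab Hf. assert (A := con_on_Re _ _ _ Hab Hf). assert (B := con_on_Im _ _ _ Hab Hf).
  assert (S : forall k (h : R -> R), ex_RInt h a b -> RInt (fun u => k * h u) a b = k * RInt h a b).
  { intros k h Hh. apply (RInt_scal (V := R_CompleteNormedModule)). exact Hh. }
  assert (S' : forall k (h : R -> R), ex_RInt h a b -> ex_RInt (fun u => k * h u) a b).
  { intros k h Hh. apply (ex_RInt_scal (V := R_NormedModule)). exact Hh. }
  apply C_ext; simpl.
  - rewrite <- !S by auto. apply (RInt_minus (V := R_CompleteNormedModule)); auto.
  - rewrite <- !S by auto. apply (RInt_plus (V := R_CompleteNormedModule)); auto.
Qed.

Lemma con_on_minus f g a b : con_on f a b -> con_on g a b -> con_on (fun u => f u - g u)%C a b.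
Proof. intros ? ? x Hx. apply ccont_minus; auto. Qed.
Lemma con_on_scal c f a b : con_on f a b -> con_on (fun u => c * f u)%C a b.
Proof. intros ? x Hx. apply ccont_mult; auto. apply ccont_const. Qed.

Lemma CI_minus f g a b : a <= b -> con_on f a b -> con_on g a b ->
  CI (fun u => f u - g u)%C a b = (CI f a b - CI g a b)%C.
Proof.
  intros Hab Hf Hg. apply C_ext; simpl;
  apply (RInt_minus (V := R_CompleteNormedModule)); auto using con_on_Re, con_on_Im.
Qed.

Lemma CI_Chasles f a b c : a <= b -> b <= c -> con_on f a c -> (CI f a b + CI f b c)%C = CI f a c.
Proof.
  intros Hab Hbc Hf.
  assert (con_on f a b) by (intros x Hx; apply Hf; lra).
  assert (con_on f b c) by (intros x Hx; apply Hf; lra).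
  apply C_ext; simpl; apply (RInt_Chasles (V := R_CompleteNormedModule)); auto using con_on_Re, con_on_Im.
Qed.

Lemma CI_point f a : CI f a a = 0.
Proof. unfold CI. rewrite !(RInt_point (V := R_CompleteNormedModule)). reflexivity. Qed.

Lemma CI_const c a b : CI (fun _ => c) a b = (RtoC (b - a) * c)%C.
Proof.
  unfold CI. rewrite !(RInt_const (V := R_CompleteNormedModule)).
  apply C_ext; [rewrite re_scal_l | rewrite im_scal_l]; reflexivity.
Qed.

Lemma CI_bound f g a b : a <= b -> con_on f a b -> ex_RInt g a b ->
  (forall x, a < x < b -> Cmod (f x) <= g x) -> Cmod (CI f a b) <= RInt g a b.
Proof.
  intros Hab Hf Hg H. set (z := CI f a b).
  destruct (Req_dec (Cmod z) 0) as [E|E].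
  { rewrite E. apply RInt_ge_0; auto. intros x Hx. eapply Rle_trans; [apply Cmod_ge_0|apply H; lra]. }
  assert (Hz : 0 < Cmod z) by (assert (Q := Cmod_ge_0 z); lra).
  assert (A : CI (fun u => Cconj z * f u)%C a b = (Cconj z * z)%C) by (apply CI_scal; auto).
  assert (B : Re (Cconj z * z)%C = Cmod z * Cmod z).
  { rewrite Cmult_comm, <- Cmod2_conj, re_RtoC. ring. }
  assert (Q : Re (CI (fun u => Cconj z * f u)%C a b) <= Cmod z * RInt g a b).
  { replace (Cmod z * RInt g a b) with (RInt (fun u => Cmod z * g u) a b)
      by (apply (RInt_scal (V := R_CompleteNormedModule)); auto).
    apply RInt_le; auto.
    - apply con_on_Re; auto. now apply con_on_scal.
    - apply (ex_RInt_scal (V := R_NormedModule)); auto.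
    - intros x Hx. eapply Rle_trans; [apply Rle_abs|].
      eapply Rle_trans; [apply (re_le_Cmod (Cconj z * f x)%C)|].
      rewrite Cmod_mult, Cmod_conj. apply Rmult_le_compat_l; [lra|]. auto. }
  rewrite A, B in Q. apply Rmult_le_reg_l with (Cmod z); auto.
Qed.

Lemma CI_bound_const f M a b : a <= b -> con_on f a b ->
  (forall x, a < x < b -> Cmod (f x) <= M) -> Cmod (CI f a b) <= (b - a) * M.
Proof.
  intros Hab Hf H. eapply Rle_trans.
  - apply CI_bound with (g := fun _ => M); auto. apply ex_RInt_const.
  - rewrite (RInt_const (V := R_CompleteNormedModule)). right. reflexivity.
Qed.

Lemma CI_FTC f df a b : a <= b -> (forall x, a <= x <= b -> rder f x (df x)) -> con_on df a b ->
  CI df a b = (f b - f a)%C.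
Proof.
  intros Hab H Hc. apply C_ext.
  - apply (is_RInt_unique (V := R_CompleteNormedModule)).
    apply (is_RInt_derive (V := R_CompleteNormedModule) (fun u => Re (f u)) (fun u => Re (df u)));
    rewrite Rmin_left, Rmax_right by lra; intros x Hx.
    + apply (proj1 (proj1 (rder_comps _ _ _) (H x Hx))).
    + apply ccont_Re; auto.
  - apply (is_RInt_unique (V := R_CompleteNormedModule)).
    apply (is_RInt_derive (V := R_CompleteNormedModule) (fun u => Im (f u)) (fun u => Im (df u)));
    rewrite Rmin_left, Rmax_right by lra; intros x Hx.
    + apply (proj2 (proj1 (rder_comps _ _ _) (H x Hx))).
    + apply ccont_Im; auto.
Qed.

Lemma nonpos_derive_le (f df : R -> R) a b : a <= b ->
  (forall x, a <= x <= b -> continuous f x) -> (forall x, a < x < b -> is_derive f x (df x)) ->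
  (forall x, a < x < b -> df x <= 0) -> f b <= f a.
Proof.
  intros Hab Hc Hd H.
  set (df' := fun x => if Rlt_dec a x then if Rlt_dec x b then df x else 0 else 0).
  destruct (MVT_gen f a b df') as [c [_ E]].
  - rewrite Rmin_left, Rmax_right by lra. intros x [Hx1 Hx2]. unfold df'.
    destruct (Rlt_dec a x); [|lra]. destruct (Rlt_dec x b); [|lra]. auto.
  - rewrite Rmin_left, Rmax_right by lra. intros x Hx. apply continuity_pt_filterlim. apply (Hc x Hx).
  - assert (df' c <= 0). { unfold df'. destruct (Rlt_dec a c); [|lra]. destruct (Rlt_dec c b); [|lra]. auto. }
    nra.
Qed.

Lemma MV_ineq (f df : R -> C) (P dP : R -> R) a b : a <= b ->
  (forall x, a <= x <= b -> ccont f x) -> (forall x, a <= x <= b -> continuous P x) ->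
  (forall x, a < x < b -> rder f x (df x)) -> (forall x, a < x < b -> is_derive P x (dP x)) ->
  (forall x, a < x < b -> Cmod (df x) <= dP x) -> Cmod (f b - f a)%C <= P b - P a.
Proof.
  intros Hab Hc HP Hd HdP H. set (z := (f b - f a)%C).
  assert (Hz0 := Cmod_ge_0 z).
  destruct (Req_dec (Cmod z) 0) as [E|E].
  { rewrite E. enough (- P b <= - P a) by lra.
    apply (nonpos_derive_le (fun x => - P x) (fun x => - dP x)); auto.
    - intros x Hx. apply (continuous_opp (V := R_NormedModule) P). auto.
    - intros x Hx. apply (is_derive_opp (V := R_NormedModule) P). auto.
    - intros x Hx. specialize (H x Hx). assert (Q := Cmod_ge_0 (df x)). lra. }
  set (psi := fun x => Re (Cconj z * f x)%C - Cmod z * P x).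
  assert (Hneg : psi b <= psi a).
  { apply (nonpos_derive_le psi (fun x => Re (Cconj z * df x)%C - Cmod z * dP x)); auto.
    - intros x Hx.
      apply (continuous_minus (V := R_NormedModule) (fun x => Re (Cconj z * f x)%C) (fun x => Cmod z * P x)).
      + apply ccont_Re. apply ccont_mult; auto. apply ccont_const.
      + apply (continuous_mult (K := R_AbsRing) (fun _ => Cmod z) P); auto. apply continuous_const.
    - intros x Hx.
      apply (is_derive_minus (V := R_NormedModule) (fun x => Re (Cconj z * f x)%C) (fun x => Cmod z * P x)).
      + apply (proj1 (rder_comps (fun x => (Cconj z * f x)%C) x (Cconj z * df x)%C)). apply rder_scal. auto.
      + apply is_derive_scal. auto.
    - intros x Hx. specialize (H x Hx).
      assert (Q := re_le_Cmod (Cconj z * df x)%C). rewrite Cmod_mult, Cmod_conj in Q.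
      assert (Q2 := Rle_abs (Re (Cconj z * df x)%C)). nra. }
  unfold psi in Hneg.
  assert (B : Re (Cconj z * f b)%C - Re (Cconj z * f a)%C = Cmod z * Cmod z).
  { rewrite <- Re_minus. replace (Cconj z * f b - Cconj z * f a)%C with (z * Cconj z)%C by (unfold z; ring).
    rewrite <- Cmod2_conj, re_RtoC. ring. }
  apply Rmult_le_reg_l with (Cmod z); nra.
Qed.

Lemma MV_lin (f df : R -> C) M a b : a <= b -> (forall x, a <= x <= b -> ccont f x) ->
  (forall x, a < x < b -> rder f x (df x)) ->
  (forall x, a < x < b -> Cmod (df x) <= M) -> Cmod (f b - f a)%C <= M * (b - a).
Proof.
  intros Hab Hc Hd H. replace (M * (b - a)) with (M * b - M * a) by ring.
  apply (MV_ineq f df (fun x => M * x) (fun _ => M)); auto.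
  - intros x Hx. apply (continuous_mult (K := R_AbsRing) (fun _ => M) (fun x => x)).
    apply continuous_const. apply continuous_id.
  - intros x Hx. auto_derive; auto. ring.
Qed.

Definition clamp a b x := Rmax a (Rmin b x).

Lemma clamp_in a b x : a <= b -> a <= clamp a b x <= b.
Proof. intros. unfold clamp. split; [apply Rmax_l|]. apply Rmax_lub; auto. apply Rmin_l. Qed.
Lemma clamp_id a b x : a <= x <= b -> clamp a b x = x.
Proof. intros. unfold clamp. rewrite Rmin_right by lra. apply Rmax_right. lra. Qed.
Lemma clamp_lip a b x y : Rabs (clamp a b x - clamp a b y) <= Rabs (x - y).
Proof.
  unfold clamp, Rmin.
  repeat (match goal with |- context [Rle_dec ?u ?v] => destruct (Rle_dec u v) end); unfold Rmax;
  repeat (match goal with |- context [Rle_dec ?u ?v] => destruct (Rle_dec u v) end);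
  unfold Rabs; repeat (match goal with |- context [Rcase_abs ?u] => destruct (Rcase_abs u) end); lra.
Qed.

Lemma clamp_continuous a b x : continuous (clamp a b) x.
Proof.
  intros P HP. apply locally_R_iff in HP. destruct HP as [e [He HP]].
  apply locally_R_iff. exists e. split; auto. intros x' Hx. apply HP.
  eapply Rle_lt_trans; [apply clamp_lip|auto].
Qed.

Lemma con_on_clamp f a b : a <= b -> con_on f a b -> forall x, ccont (fun u => f (clamp a b u)) x.
Proof.
  intros Hab H x. apply (ccont_comp_r f (clamp a b)); [|apply clamp_continuous].
  apply H. now apply clamp_in.
Qed.

Lemma CI_clamp f a b : a <= b -> CI (fun u => f (clamp a b u)) a b = CI f a b.
Proof. intros. apply CI_ext; auto. intros. rewrite clamp_id; auto; lra. Qed.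

Lemma rder_CI f a x : (forall u, ccont f u) -> rder (fun v => CI f a v) x (f x).
Proof.
  intros H. apply rder_comps. split.
  - apply (is_derive_RInt (V := R_NormedModule) (fun u => Re (f u)) _ a x).
    + apply filter_forall. intros y. apply (RInt_correct (V := R_CompleteNormedModule)).
      apply (ex_RInt_continuous (V := R_CompleteNormedModule)). intros. now apply ccont_Re.
    + now apply ccont_Re.
  - apply (is_derive_RInt (V := R_NormedModule) (fun u => Im (f u)) _ a x).
    + apply filter_forall. intros y. apply (RInt_correct (V := R_CompleteNormedModule)).
      apply (ex_RInt_continuous (V := R_CompleteNormedModule)). intros. now apply ccont_Im.
    + now apply ccont_Im.
Qed.

Lemma CI_prim_bound f (P dP : R -> R) a b : a <= b -> con_on f a b ->
  (forall x, a <= x <= b -> continuous P x) -> (forall x, a < x < b -> is_derive P x (dP x)) ->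
  (forall x, a < x < b -> Cmod (f x) <= dP x) -> Cmod (CI f a b) <= P b - P a.
Proof.
  intros Hab Hf HP HdP H. rewrite <- CI_clamp by auto.
  set (F := fun u => f (clamp a b u)).
  replace (CI F a b) with (CI F a b - CI F a a)%C by (rewrite CI_point; ring).
  assert (HF := con_on_clamp _ _ _ Hab Hf).
  apply (MV_ineq (fun v => CI F a v) F P dP); auto.
  - intros x _. eapply rder_ccont. apply rder_CI. exact HF.
  - intros x _. apply rder_CI. exact HF.
  - intros x Hx. unfold F. rewrite clamp_id by lra. auto.
Qed.

Lemma cder_quad g z l M d : 0 < d ->
  (forall k, Cmod k < d -> Cmod (g (z + k) - g z - k * l)%C <= M * Cmod k ^ 2) -> cder g z l.
Proof.
  intros Hd H e He. set (N := Rabs M + 1). assert (HN : 0 < N) by (unfold N; assert (Q := Rabs_pos M); lra).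
  exists (Rmin d (e / N)). split; [apply Rmin_glb_lt; auto; apply Rdiv_lt_0_compat; auto|].
  intros k Hk.
  assert (Ha : Cmod k < d) by (eapply Rlt_le_trans; [exact Hk|apply Rmin_l]).
  assert (Hb : Cmod k < e/N) by (eapply Rlt_le_trans; [exact Hk|apply Rmin_r]).
  eapply Rle_trans; [apply H; auto|]. assert (Q := Cmod_ge_0 k).
  assert (Cmod k * N <= e). { apply (Rmult_lt_compat_r N) in Hb; auto. replace (e / N * N) with e in Hb by (field; lra). lra. }
  assert (M <= N) by (unfold N; assert (Q1 := Rle_abs M); lra). nra.
Qed.

Lemma cder_const c z : cder (fun _ => c) z 0.
Proof.
  apply (cder_quad _ _ _ 0 1); [lra|]. intros. replace (c - c - k * 0)%C with (RtoC 0) by ring.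
  rewrite Cmod_0. lra.
Qed.
Lemma cder_id z : cder (fun u => u) z 1.
Proof.
  apply (cder_quad _ _ _ 0 1); [lra|]. intros. replace (z + k - z - k * 1)%C with (RtoC 0) by ring.
  rewrite Cmod_0. lra.
Qed.

Lemma cder_plus f g z a b : cder f z a -> cder g z b -> cder (fun u => f u + g u)%C z (a + b)%C.
Proof.
  intros Hf Hg e He. destruct (Hf (e/2)) as [d1 [Hd1 H1]]; [lra|]. destruct (Hg (e/2)) as [d2 [Hd2 H2]]; [lra|].
  exists (Rmin d1 d2). split; [apply Rmin_glb_lt; auto|]. intros k Hk.
  assert (Ha : Cmod k < d1) by (eapply Rlt_le_trans; [exact Hk|apply Rmin_l]).
  assert (Hb : Cmod k < d2) by (eapply Rlt_le_trans; [exact Hk|apply Rmin_r]).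
  specialize (H1 k Ha). specialize (H2 k Hb).
  replace (f (z + k) + g (z + k) - (f z + g z) - k * (a + b))%C with
    ((f (z + k) - f z - k * a) + (g (z + k) - g z - k * b))%C by ring.
  eapply Rle_trans; [apply Cmod_triangle|]. lra.
Qed.

Lemma cder_mult f g z a b : cder f z a -> cder g z b -> cder (fun u => f u * g u)%C z (a * g z + f z * b)%C.
Proof.
  intros Hf Hg e He.
  set (M := Cmod (g z) + 1). assert (HM : 0 < M) by (unfold M; assert (Q := Cmod_ge_0 (g z)); lra).
  set (N := Cmod (f z) + 1). assert (HN : 0 < N) by (unfold N; assert (Q := Cmod_ge_0 (f z)); lra).
  set (A := Cmod a + 1). assert (HA : 0 < A) by (unfold A; assert (Q := Cmod_ge_0 a); lra).
  destruct (Hf (e/(3*M))) as [d1 [Hd1 H1]]; [apply Rdiv_lt_0_compat; lra|].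
  destruct (Hg (e/(3*N))) as [d2 [Hd2 H2]]; [apply Rdiv_lt_0_compat; lra|].
  destruct (cder_czcont _ _ _ Hg (Rmin 1 (e/(3*A)))) as [d3 [Hd3 H3]].
  { apply Rmin_glb_lt; [lra|]. apply Rdiv_lt_0_compat; lra. }
  exists (Rmin d1 (Rmin d2 d3)). split; [repeat apply Rmin_glb_lt; auto|]. intros k Hk.
  assert (Ha : Cmod k < d1) by (eapply Rlt_le_trans; [exact Hk|apply Rmin_l]).
  assert (Hb : Cmod k < Rmin d2 d3) by (eapply Rlt_le_trans; [exact Hk|apply Rmin_r]).
  assert (Hb2 : Cmod k < d2) by (eapply Rlt_le_trans; [exact Hb|apply Rmin_l]).
  assert (Hb3 : Cmod k < d3) by (eapply Rlt_le_trans; [exact Hb|apply Rmin_r]).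
  specialize (H1 k Ha). specialize (H2 k Hb2). specialize (H3 (z + k)%C).
  replace (z + k - z)%C with k in H3 by ring. specialize (H3 Hb3).
  assert (H31 : Cmod (g (z + k) - g z)%C <= 1) by (apply Rlt_le; eapply Rlt_le_trans; [exact H3|apply Rmin_l]).
  assert (H32 : Cmod (g (z + k) - g z)%C <= e/(3*A)) by (apply Rlt_le; eapply Rlt_le_trans; [exact H3|apply Rmin_r]).
  assert (Hgk : Cmod (g (z + k)%C) <= M).
  { replace (g (z + k)%C) with (g z + (g (z + k) - g z))%C by ring.
    eapply Rle_trans; [apply Cmod_triangle|]. unfold M. lra. }
  replace (f (z + k) * g (z + k) - f z * g z - k * (a * g z + f z * b))%C with
    ((f (z + k) - f z - k * a) * g (z + k) + (k * a * (g (z + k) - g z) + f z * (g (z + k) - g z - k * b)))%C by ring.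
  eapply Rle_trans; [apply Cmod_triangle|].
  eapply Rle_trans; [apply Rplus_le_compat_l, Cmod_triangle|]. rewrite !Cmod_mult.
  assert (Qk := Cmod_ge_0 k).
  assert (T1 : Cmod (f (z + k) - f z - k * a)%C * Cmod (g (z + k)%C) <= (e / (3 * M) * Cmod k) * M).
  { apply Rmult_le_compat; auto using Cmod_ge_0. }
  assert (T2 : Cmod k * Cmod a * Cmod (g (z + k) - g z)%C <= (Cmod k * A) * (e/(3*A))).
  { apply Rmult_le_compat; auto using Cmod_ge_0.
    - apply Rmult_le_pos; auto using Cmod_ge_0.
    - apply Rmult_le_compat_l; auto. unfold A. lra. }
  assert (T3 : Cmod (f z) * Cmod (g (z + k) - g z - k * b)%C <= N * (e / (3 * N) * Cmod k)).
  { apply Rmult_le_compat; auto using Cmod_ge_0. unfold N; lra. }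
  replace (e / (3 * M) * Cmod k * M) with (e/3*Cmod k) in T1 by (field; lra).
  replace (Cmod k * A * (e/(3*A))) with (e/3*Cmod k) in T2 by (field; lra).
  replace (N * (e / (3 * N) * Cmod k)) with (e/3*Cmod k) in T3 by (field; lra).
  lra.
Qed.

Lemma cder_scal c g z l : cder g z l -> cder (fun u => c * g u)%C z (c * l)%C.
Proof.
  intros H. replace (c * l)%C with (0 * g z + c * l)%C by ring.
  apply (cder_mult (fun _ => c) g); auto. apply cder_const.
Qed.
Lemma cder_minus f g z a b : cder f z a -> cder g z b -> cder (fun u => f u - g u)%C z (a - b)%C.
Proof.
  intros Hf Hg. replace (a - b)%C with (a + RtoC (-1) * b)%C by ring.
  intros e He. destruct (cder_plus _ _ _ _ _ Hf (cder_scal (RtoC (-1)) _ _ _ Hg) e He) as [d [Hd H]].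
  exists d. split; auto. intros k Hk. specialize (H k Hk). cbv beta in H.
  replace (f (z + k) - g (z + k) - (f z - g z) - k * (a + RtoC (-1) * b))%C with
   (f (z + k) + RtoC (-1) * g (z + k) - (f z + RtoC (-1) * g z) - k * (a + RtoC (-1) * b))%C by ring. exact H.
Qed.

Lemma cder_ext_loc f g z l d : 0 < d -> (forall u, Cmod (u - z)%C < d -> f u = g u) -> cder f z l -> cder g z l.
Proof.
  intros Hd E H e He. destruct (H e He) as [d' [Hd' K]]. exists (Rmin d d'). split; [apply Rmin_glb_lt; auto|].
  intros k Hk. rewrite <- !E.
  - apply K. eapply Rlt_le_trans; [exact Hk|apply Rmin_r].
  - replace (z - z)%C with (RtoC 0) by ring. rewrite Cmod_0; auto.
  - replace (z + k - z)%C with k by ring. eapply Rlt_le_trans; [exact Hk|apply Rmin_l].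
Qed.

Lemma cder_comp g f z a b : cder f z a -> cder g (f z) b -> cder (fun u => g (f u)) z (a * b)%C.
Proof.
  intros Hf Hg e He.
  set (A := Cmod a + 1). assert (HA : 0 < A) by (unfold A; assert (Q := Cmod_ge_0 a); lra).
  set (B := Cmod b + 1). assert (HB : 0 < B) by (unfold B; assert (Q := Cmod_ge_0 b); lra).
  destruct (Hg (e/(2*A))) as [d1 [Hd1 H1]]; [apply Rdiv_lt_0_compat; lra|].
  destruct (Hf (Rmin 1 (e/(2*B)))) as [d2 [Hd2 H2]].
  { apply Rmin_glb_lt; [lra|]. apply Rdiv_lt_0_compat; lra. }
  exists (Rmin d2 (d1 / A)). split; [apply Rmin_glb_lt; auto; apply Rdiv_lt_0_compat; auto|]. intros k Hk.
  assert (Ha : Cmod k < d2) by (eapply Rlt_le_trans; [exact Hk|apply Rmin_l]).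
  assert (Hb : Cmod k < d1/A) by (eapply Rlt_le_trans; [exact Hk|apply Rmin_r]).
  specialize (H2 k Ha). assert (Qk := Cmod_ge_0 k).
  assert (H21 : Cmod (f (z + k) - f z - k * a)%C <= 1 * Cmod k).
  { eapply Rle_trans; [exact H2|]. apply Rmult_le_compat_r; auto. apply Rmin_l. }
  assert (H22 : Cmod (f (z + k) - f z - k * a)%C <= e/(2*B) * Cmod k).
  { eapply Rle_trans; [exact H2|]. apply Rmult_le_compat_r; auto. apply Rmin_r. }
  set (w := (f (z + k) - f z)%C).
  assert (Hw : Cmod w <= A * Cmod k).
  { unfold w. replace (f (z + k) - f z)%C with ((f (z + k) - f z - k * a) + k * a)%C by ring.
    eapply Rle_trans; [apply Cmod_triangle|]. rewrite Cmod_mult. unfold A. lra. }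
  assert (Hw1 : Cmod w < d1).
  { eapply Rle_lt_trans; [exact Hw|]. apply (Rmult_lt_compat_l A) in Hb; auto.
    replace (A * (d1 / A)) with d1 in Hb by (field; lra). auto. }
  specialize (H1 w Hw1). replace (f z + w)%C with (f (z + k)%C) in H1 by (unfold w; ring).
  replace (g (f (z + k)) - g (f z) - k * (a * b))%C with
   ((g (f (z + k)) - g (f z) - w * b) + b * (f (z + k) - f z - k * a))%C by (unfold w; ring).
  eapply Rle_trans; [apply Cmod_triangle|]. rewrite Cmod_mult.
  assert (T1 : e/(2*A) * Cmod w <= e / (2*A) * (A * Cmod k)).
  { apply Rmult_le_compat_l; auto. apply Rlt_le, Rdiv_lt_0_compat; lra. }
  replace (e / (2*A) * (A * Cmod k)) with (e/2 * Cmod k) in T1 by (field; lra).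
  assert (T2 : Cmod b * Cmod (f (z + k) - f z - k * a)%C <= B * (e/(2*B) * Cmod k)).
  { apply Rmult_le_compat; auto using Cmod_ge_0. unfold B; lra. }
  replace (B * (e/(2*B) * Cmod k)) with (e/2 * Cmod k) in T2 by (field; lra). lra.
Qed.

Definition Cexp (z : C) : C := (exp (Re z) * cos (Im z), exp (Re z) * sin (Im z)).

Lemma Cexp_plus a b : Cexp (a + b)%C = (Cexp a * Cexp b)%C.
Proof.
  unfold Cexp. rewrite re_plus, im_plus, exp_plus, cos_plus, sin_plus.
  apply C_ext; simpl; ring.
Qed.
Lemma Cexp_0 : Cexp 0 = 1.
Proof. unfold Cexp. simpl. rewrite exp_0, cos_0, sin_0. apply C_ext; simpl; ring. Qed.
Lemma Cmod_Cexp z : Cmod (Cexp z) = exp (Re z).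
Proof.
  unfold Cexp, Cmod. simpl.
  replace (exp (Re z) * cos (Im z) * (exp (Re z) * cos (Im z) * 1) +
           exp (Re z) * sin (Im z) * (exp (Re z) * sin (Im z) * 1))
    with ((exp (Re z))² * ((sin (Im z))² + (cos (Im z))²)) by (unfold Rsqr; ring).
  rewrite sin2_cos2, Rmult_1_r, sqrt_Rsqr; auto. apply Rlt_le, exp_pos.
Qed.

Lemma rder_Cexp_lin c k x : rder (fun u => Cexp (c + RtoC u * k)%C) x (k * Cexp (c + RtoC x * k))%C.
Proof.
  destruct c as [c1 c2], k as [k1 k2]. apply rder_comps. unfold Cexp, Re, Im. simpl.
  split; auto_derive; auto; unfold Rminus; ring.
Qed.

Lemma Cexp_lip1 k : Cmod (Cexp k - 1)%C <= Cmod k * exp (Cmod k).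
Proof.
  assert (H := MV_lin (fun u => Cexp (0 + RtoC u * k)%C) (fun x => k * Cexp (0 + RtoC x * k))%C (Cmod k * exp (Cmod k)) 0 1).
  cbv beta in H. replace (0 + 1 * k)%C with k in H by ring. replace (0 + 0 * k)%C with (RtoC 0) in H by ring.
  rewrite Cexp_0 in H. rewrite Rminus_0_r, Rmult_1_r in H. apply H; try lra; intros.
  - eapply rder_ccont, rder_Cexp_lin.
  - apply rder_Cexp_lin.
  - rewrite Cmod_mult, Cmod_Cexp. apply Rmult_le_compat_l; [apply Cmod_ge_0|].
    assert (Re (0 + RtoC x * k)%C <= Cmod k).
    { rewrite Cplus_0_l, re_scal_l. assert (A := re_le_Cmod k). assert (B := Rle_abs (Re k)). assert (D := Cmod_ge_0 k). nra. }
    destruct H1 as [H1|H1]; [left; now apply exp_increasing|right; now rewrite H1].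
Qed.

Lemma exp_le_compat x y : x <= y -> exp x <= exp y.
Proof. intros [H|H]; [left; now apply exp_increasing|right; now rewrite H]. Qed.

Lemma Cexp_quad k : Cmod (Cexp k - 1 - k)%C <= Cmod k ^ 2 * exp (Cmod k).
Proof.
  assert (H := MV_lin (fun u => Cexp (0 + RtoC u * k) - RtoC u * k)%C (fun x => k * Cexp (0 + RtoC x * k) - k)%C (Cmod k ^2 * exp (Cmod k)) 0 1).
  cbv beta in H. replace (0 + 1 * k)%C with k in H by ring. replace (0 + 0 * k)%C with (RtoC 0) in H by ring.
  rewrite Cexp_0 in H. rewrite Rminus_0_r, Rmult_1_r in H.
  replace (Cexp k - 1 * k - (1 - 0 * k))%C with (Cexp k - 1 - k)%C in H by ring.
  assert (D : forall x, rder (fun u : R => (Cexp (0 + RtoC u * k) - RtoC u * k)%C) x (k * Cexp (0 + RtoC x * k) - k)%C).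
  { intros x. apply rder_minus; [apply rder_Cexp_lin|].
    assert (Q := rder_mult (fun u => RtoC u) (fun _ => k) x 1 0). cbv beta in Q.
    replace (1 * k + x * 0)%C with k in Q by ring. apply Q; [|apply rder_const].
    apply (rder_RtoC (fun u => u)). exact (is_derive_id (K := R_AbsRing) x). }
  apply H; try lra; intros.
  - eapply rder_ccont, D.
  - apply D.
  - replace (k * Cexp (0 + RtoC x * k) - k)%C with (k * (Cexp (RtoC x * k) - 1))%C by (rewrite Cplus_0_l; ring).
    rewrite Cmod_mult. assert (Q := Cexp_lip1 (RtoC x * k)%C). rewrite Cmod_mult, Cmod_RtoC_pos in Q by lra.
    assert (Hk := Cmod_ge_0 k). simpl. rewrite Rmult_1_r, !Rmult_assoc. apply Rmult_le_compat_l; auto.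
    eapply Rle_trans; [exact Q|]. apply Rmult_le_compat; try nra.
    + apply Rlt_le, exp_pos.
    + apply exp_le_compat. nra.
Qed.

Lemma cder_Cexp z : cder Cexp z (Cexp z).
Proof.
  apply (cder_quad _ _ _ (Cmod (Cexp z) * exp 1) 1); [lra|]. intros k Hk.
  rewrite Cexp_plus. replace (Cexp z * Cexp k - Cexp z - k * Cexp z)%C with (Cexp z * (Cexp k - 1 - k))%C by ring.
  rewrite Cmod_mult, Rmult_assoc. apply Rmult_le_compat_l; [apply Cmod_ge_0|].
  eapply Rle_trans; [apply Cexp_quad|]. rewrite Rmult_comm. apply Rmult_le_compat_r; [nra|].
  apply exp_le_compat. lra.
Qed.

(** * Cauchy's theorem and the Cauchy estimates *)

Definition in_rect (x y p q : R) (z : C) := x <= Re z <= x + p /\ y <= Im z <= y + q.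

Definition rectI (G : C -> C) (x y p q : R) : C :=
  (CI (fun u => G (u, y)) x (x + p) + Ci * CI (fun v => G ((x + p)%R, v)) y (y + q)
   - CI (fun u => G (u, (y + q)%R)) x (x + p) - Ci * CI (fun v => G (x, v)) y (y + q))%C.

Lemma horiz_line (v u : R) : ((u, v) : C) = ((RtoC 0 + Ci * RtoC v) + RtoC u * 1)%C.
Proof. apply C_ext; simpl; ring. Qed.
Lemma vert_line (v u : R) : ((u, v) : C) = (RtoC u + RtoC v * Ci)%C.
Proof. apply C_ext; simpl; ring. Qed.

Lemma ccont_horiz G u v : czcont G (u, v) -> ccont (fun w => G (w, v)) u.
Proof.
  intros H. apply (ccont_comp_z G (fun w => (w, v))); auto.
  intros e He. exists e. split; auto. intros x' Hx.
  replace ((x', v) - (u, v))%C with (RtoC (x' - u)) by (apply C_ext; simpl; ring). now rewrite Cmod_R.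
Qed.
Lemma ccont_vert G u v : czcont G (u, v) -> ccont (fun w => G (u, w)) v.
Proof.
  intros H. apply (ccont_comp_z G (fun w => (u, w))); auto.
  intros e He. exists e. split; auto. intros x' Hx.
  replace ((u, x') - (u, v))%C with (RtoC (x' - v) * Ci)%C by (apply C_ext; simpl; ring).
  rewrite Cmod_mult, Cmod_Ci, Rmult_1_r. now rewrite Cmod_R.
Qed.

Lemma rectI_minus G H x y p q : 0 <= p -> 0 <= q ->
  (forall z, in_rect x y p q z -> czcont G z) -> (forall z, in_rect x y p q z -> czcont H z) ->
  rectI (fun z => G z - H z)%C x y p q = (rectI G x y p q - rectI H x y p q)%C.
Proof.
  intros Hp Hq HG HH. unfold rectI.
  rewrite !CI_minus; try lra; try ring; intros u Hu;
  (apply ccont_horiz || apply ccont_vert); (apply HG || apply HH); split; simpl; lra.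
Qed.

Lemma rectI_prim F G x y p q : 0 <= p -> 0 <= q ->
  (forall z, in_rect x y p q z -> cder F z (G z)) -> (forall z, in_rect x y p q z -> czcont G z) ->
  rectI G x y p q = 0.
Proof.
  intros Hp Hq HF HG.
  assert (Hh : forall v, y <= v <= y + q -> CI (fun u => G (u, v)) x (x + p) = (F ((x + p)%R, v) - F (x, v))%C).
  { intros v Hv. apply (CI_FTC (fun u => F (u, v))); try lra.
    - intros u Hu. specialize (HF (u, v)). rewrite horiz_line in HF.
      apply (rder_ext (fun u => F ((RtoC 0 + Ci * RtoC v) + RtoC u * 1)%C)).
      { intros w. now rewrite <- horiz_line. }
      replace (G (u, v)) with (G (RtoC 0 + Ci * RtoC v + RtoC u * 1)%C * 1)%C by (rewrite <- horiz_line; ring).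
      apply cder_rder. apply HF. rewrite <- horiz_line. split; simpl; lra.
    - intros u Hu. apply ccont_horiz. apply HG. split; simpl; lra. }
  assert (Hv : forall u, x <= u <= x + p -> (Ci * CI (fun v => G (u, v)) y (y + q))%C = (F (u, (y + q)%R) - F (u, y))%C).
  { intros u Hu. rewrite <- CI_scal; try lra.
    2:{ intros v Hv. apply ccont_vert. apply HG. split; simpl; lra. }
    apply (CI_FTC (fun v => F (u, v))); try lra.
    - intros v Hv. specialize (HF (u, v)). rewrite vert_line in HF.
      apply (rder_ext (fun v => F (RtoC u + RtoC v * Ci)%C)).
      { intros w. now rewrite <- vert_line. }
      replace (Ci * G (u, v))%C with (G (RtoC u + RtoC v * Ci)%C * Ci)%C by (rewrite <- vert_line; ring).
      apply cder_rder. apply HF. rewrite <- vert_line. split; simpl; lra.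
    - intros v Hv. apply ccont_mult; [apply ccont_const|]. apply ccont_vert. apply HG. split; simpl; lra. }
  unfold rectI. rewrite !Hh, !Hv by lra. ring.
Qed.

Lemma rectI_bound G x y p q M : 0 <= p -> 0 <= q ->
  (forall z, in_rect x y p q z -> czcont G z) -> (forall z, in_rect x y p q z -> Cmod (G z) <= M) ->
  Cmod (rectI G x y p q) <= 2 * (p + q) * M.
Proof.
  intros Hp Hq HG HM. unfold rectI.
  assert (H1 : Cmod (CI (fun u => G (u, y)) x (x + p)) <= (x + p - x) * M).
  { apply CI_bound_const; try lra; intros u Hu; [apply ccont_horiz, HG|apply HM]; split; simpl; lra. }
  assert (H2 : Cmod (CI (fun v => G ((x + p)%R, v)) y (y + q)) <= (y + q - y) * M).
  { apply CI_bound_const; try lra; intros u Hu; [apply ccont_vert, HG|apply HM]; split; simpl; lra. }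
  assert (H3 : Cmod (CI (fun u => G (u, (y + q)%R)) x (x + p)) <= (x + p - x) * M).
  { apply CI_bound_const; try lra; intros u Hu; [apply ccont_horiz, HG|apply HM]; split; simpl; lra. }
  assert (H4 : Cmod (CI (fun v => G (x, v)) y (y + q)) <= (y + q - y) * M).
  { apply CI_bound_const; try lra; intros u Hu; [apply ccont_vert, HG|apply HM]; split; simpl; lra. }
  eapply Rle_trans; [apply Cmod_triangle_minus|]. rewrite Cmod_mult, Cmod_Ci, Rmult_1_l.
  eapply Rle_trans; [apply Rplus_le_compat_r, Cmod_triangle_minus|].
  eapply Rle_trans; [apply Rplus_le_compat_r, Rplus_le_compat_r, Cmod_triangle|].
  rewrite Cmod_mult, Cmod_Ci, Rmult_1_l. nra.
Qed.

Lemma rectI_quarter G x y p q : 0 <= p -> 0 <= q -> (forall z, in_rect x y (2*p) (2*q) z -> czcont G z) ->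
  rectI G x y (2*p) (2*q) =
  (rectI G x y p q + rectI G (x + p) y p q + rectI G x (y + q) p q + rectI G (x + p) (y + q) p q)%C.
Proof.
  intros Hp Hq HG. unfold rectI.
  replace (x + p + p) with (x + 2 * p) by ring. replace (y + q + q) with (y + 2 * q) by ring.
  assert (Hh : forall v, y <= v <= y + 2*q ->
    CI (fun u => G (u, v)) x (x + 2*p) = (CI (fun u => G (u, v)) x (x + p) + CI (fun u => G (u, v)) (x + p) (x + 2*p))%C).
  { intros v Hv. symmetry. apply CI_Chasles; try lra. intros u Hu. apply ccont_horiz, HG. split; simpl; lra. }
  assert (Hv : forall u, x <= u <= x + 2*p ->
    CI (fun v => G (u, v)) y (y + 2*q) = (CI (fun v => G (u, v)) y (y + q) + CI (fun v => G (u, v)) (y + q) (y + 2*q))%C).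
  { intros u Hu. symmetry. apply CI_Chasles; try lra. intros v Hv. apply ccont_vert, HG. split; simpl; lra. }
  rewrite (Hh y), (Hh (y + 2*q)), (Hv x), (Hv (x + 2*p)) by lra. ring.
Qed.

Lemma nested_point (x w : nat -> R) : (forall n, x n <= x (S n)) -> (forall n, x (S n) + w (S n) <= x n + w n) ->
  (forall n, 0 <= w n) -> exists l, forall n, x n <= l <= x n + w n.
Proof.
  intros H1 H2 H3.
  assert (Hm : forall n m, x n <= x (n + m)%nat).
  { intros n m. induction m. rewrite Nat.add_0_r; lra. rewrite Nat.add_succ_r. eapply Rle_trans; [exact IHm|apply H1]. }
  assert (Hm2 : forall n m, x (n + m)%nat + w (n + m)%nat <= x n + w n).
  { intros n m. induction m. rewrite Nat.add_0_r; lra. rewrite Nat.add_succ_r. eapply Rle_trans; [apply H2|exact IHm]. }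
  assert (Hx : forall n m, x n <= x m + w m).
  { intros n m. destruct (Nat.le_ge_cases n m) as [L|L].
    - replace m with (n + (m - n))%nat by lia. specialize (Hm n (m - n)%nat). specialize (H3 (n + (m - n))%nat). lra.
    - replace n with (m + (n - m))%nat by lia. specialize (Hm2 m (n - m)%nat). specialize (H3 (m + (n - m))%nat). lra. }
  destruct (completeness (fun r => exists n, r = x n)) as [l [Hl1 Hl2]].
  - exists (x 0%nat + w 0%nat). intros r [n ->]. apply Hx.
  - exists (x 0%nat). eauto.
  - exists l. intros n. split; [apply Hl1; eauto|]. apply Hl2. intros r [m ->]. apply Hx.
Qed.

Lemma half_pow_small (A e : R) : 0 < e -> exists n, A * (/2) ^ n < e.
Proof.
  intros He. destruct (pow_lt_1_zero (/2)) with (y := e / (Rabs A + 1)) as [N HN].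
  - rewrite Rabs_pos_eq; lra.
  - apply Rdiv_lt_0_compat; auto. assert (Q := Rabs_pos A). lra.
  - exists N. specialize (HN N (Nat.le_refl N)). rewrite Rabs_pos_eq in HN by (apply pow_le; lra).
    assert (Q := Rabs_pos A). assert (Q2 := Rle_abs A).
    assert (Hp : 0 <= (/2)^N) by (apply pow_le; lra).
    apply (Rmult_lt_compat_l (Rabs A + 1)) in HN; [|lra].
    replace ((Rabs A + 1) * (e / (Rabs A + 1))) with e in HN by (field; lra). nra.
Qed.

Theorem goursat_rect G x0 y0 p q : 0 <= p -> 0 <= q ->
  (forall z, in_rect x0 y0 p q z -> exists l, cder G z l) -> rectI G x0 y0 p q = 0.
Proof.
  intros Hp Hq HG.
  assert (Hc : forall z, in_rect x0 y0 p q z -> czcont G z).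
  { intros z Hz. destruct (HG z Hz) as [l Hl]. eapply cder_czcont; eauto. }
  destruct (Req_dec (Cmod (rectI G x0 y0 p q)) 0) as [E|E]; [now apply Cmod_eq_0|exfalso].
  set (e0 := Cmod (rectI G x0 y0 p q)).
  assert (He0 : 0 < e0) by (assert (Q := Cmod_ge_0 (rectI G x0 y0 p q)); unfold e0; lra).
  set (P := fun n => p * (/2)^n). set (Q := fun n => q * (/2)^n).
  assert (HP : forall n, 0 <= P n) by (intros; apply Rmult_le_pos; auto; apply pow_le; lra).
  assert (HQ : forall n, 0 <= Q n) by (intros; apply Rmult_le_pos; auto; apply pow_le; lra).
  assert (HPS : forall n, P n = 2 * P (S n)) by (intros; unfold P; simpl; field).
  assert (HQS : forall n, Q n = 2 * Q (S n)) by (intros; unfold Q; simpl; field).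
  set (ok := fun n (a : R * R) => (x0 <= fst a /\ fst a + P n <= x0 + p /\ y0 <= snd a /\ snd a + Q n <= y0 + q) /\
     e0 * (/4)^n <= Cmod (rectI G (fst a) (snd a) (P n) (Q n))).
  assert (step : forall n a, ok n a -> exists b, ok (S n) b /\ fst a <= fst b /\ fst b + P (S n) <= fst a + P n /\
     snd a <= snd b /\ snd b + Q (S n) <= snd a + Q n).
  { intros n [x y] [[B1 [B2 [B3 B4]]] Hb]. simpl in *.
    assert (HP' := HPS n). assert (HQ' := HQS n). assert (HP1 := HP (S n)). assert (HQ1 := HQ (S n)).
    rewrite HP', HQ' in Hb. rewrite rectI_quarter in Hb; auto.
    2:{ intros z [Hz1 Hz2]. apply Hc. split; lra. }
    set (e1 := e0 * (/4)^(S n)).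
    assert (Ee : e0 * (/4)^n = 4 * e1) by (unfold e1; simpl; field). rewrite Ee in Hb.
    destruct (Rle_dec e1 (Cmod (rectI G x y (P (S n)) (Q (S n))))) as [D1|D1].
    { exists (x, y). simpl. unfold ok. simpl. repeat split; auto; lra. }
    destruct (Rle_dec e1 (Cmod (rectI G (x + P (S n)) y (P (S n)) (Q (S n))))) as [D2|D2].
    { exists (x + P (S n), y). simpl. unfold ok. simpl. repeat split; auto; lra. }
    destruct (Rle_dec e1 (Cmod (rectI G x (y + Q (S n)) (P (S n)) (Q (S n))))) as [D3|D3].
    { exists (x, y + Q (S n)). simpl. unfold ok. simpl. repeat split; auto; lra. }
    destruct (Rle_dec e1 (Cmod (rectI G (x + P (S n)) (y + Q (S n)) (P (S n)) (Q (S n))))) as [D4|D4].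
    { exists (x + P (S n), y + Q (S n)). simpl. unfold ok. simpl. repeat split; auto; lra. }
    exfalso. revert Hb. apply Rlt_not_le.
    eapply Rle_lt_trans; [apply Cmod_triangle|].
    eapply Rle_lt_trans; [apply Rplus_le_compat_r, Cmod_triangle|].
    eapply Rle_lt_trans; [apply Rplus_le_compat_r, Rplus_le_compat_r, Cmod_triangle|]. lra. }
  assert (ok0 : ok 0%nat (x0, y0)).
  { unfold ok, P, Q. simpl. rewrite !Rmult_1_r. repeat split; try lra. unfold e0. lra. }
  set (nxt := fun n (a : {a | ok n a}) =>
     let s := constructive_indefinite_description _ (step n (proj1_sig a) (proj2_sig a)) in
     exist (ok (S n)) (proj1_sig s) (proj1 (proj2_sig s))).
  set (sq := fix sq n : {a | ok n a} := match n with O => exist (ok O) (x0, y0) ok0 | S m => nxt m (sq m) end).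
  set (a := fun n => proj1_sig (sq n)).
  assert (Hok : forall n, ok n (a n)) by (intros; exact (proj2_sig (sq n))).
  assert (Hst : forall n, fst (a n) <= fst (a (S n)) /\ fst (a (S n)) + P (S n) <= fst (a n) + P n /\
     snd (a n) <= snd (a (S n)) /\ snd (a (S n)) + Q (S n) <= snd (a n) + Q n).
  { intros n.
    assert (Hs : a (S n) = proj1_sig (constructive_indefinite_description _ (step n (proj1_sig (sq n)) (proj2_sig (sq n))))) by reflexivity.
    rewrite Hs. destruct (constructive_indefinite_description _ _) as [b [Hb1 Hb2]]. exact Hb2. }
  destruct (nested_point (fun n => fst (a n)) P) as [xs Hxs]; [apply Hst|apply Hst|exact HP|].
  destruct (nested_point (fun n => snd (a n)) Q) as [ys Hys]; [apply Hst|apply Hst|exact HQ|].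
  assert (Hin : in_rect x0 y0 p q (xs, ys)).
  { specialize (Hxs 0%nat). specialize (Hys 0%nat). unfold a, P, Q in *. simpl in *. rewrite Rmult_1_r in *. split; simpl; lra. }
  destruct (HG _ Hin) as [l Hl].
  set (S := p + q).
  assert (HS : 0 < S).
  { unfold S. destruct (Req_dec p 0) as [->|]; [|lra]. destruct (Req_dec q 0) as [->|]; [|lra].
    exfalso. apply E. unfold rectI. rewrite !Rplus_0_r, !CI_point. replace (0 + Ci * 0 - 0 - Ci * 0)%C with (RtoC 0) by ring. apply Cmod_0. }
  destruct (Hl (e0 / (4 * S * S))) as [d [Hd Hd']].
  { apply Rdiv_lt_0_compat; auto. nra. }
  destruct (half_pow_small S d Hd) as [n Hn].
  destruct (Hok n) as [[B1 [B2 [B3 B4]]] Hbad].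
  set (A := fun z : C => (G (xs, ys) + (z - (xs, ys)) * l)%C).
  assert (HA : rectI A (fst (a n)) (snd (a n)) (P n) (Q n) = 0).
  { apply (rectI_prim (fun z => (G (xs,ys) * z + (z - (xs,ys)) * (z - (xs,ys)) * (/2 * l)))%C); auto.
    - intros z _. unfold A.
      replace (G (xs, ys) + (z - (xs, ys)) * l)%C with
        (G (xs, ys) * 1 + (((1 - 0) * (z - (xs,ys)) + (z - (xs,ys)) * (1 - 0)) * (/2*l) + (z - (xs,ys)) * (z - (xs,ys)) * 0))%C.
      2:{ field. }
      assert (D : cder (fun z => z - (xs,ys))%C z (1 - 0)%C) by (apply (cder_minus (fun z => z) (fun _ => (xs,ys) : C)); [apply cder_id|apply cder_const]).
      apply (cder_plus (fun z => G (xs,ys) * z)%C (fun z => (z - (xs,ys)) * (z - (xs,ys)) * (/2 * l))%C).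
      + apply cder_scal, cder_id.
      + apply (cder_mult (fun z => (z - (xs,ys)) * (z - (xs,ys)))%C (fun _ => (/2 * l)%C)); [|apply cder_const].
        apply (cder_mult (fun z => z - (xs,ys))%C (fun z => z - (xs,ys))%C); auto.
    - intros z _. apply cder_czcont with (0 + ((1 - 0) * l + (z - (xs,ys)) * 0))%C. unfold A.
      apply (cder_plus (fun _ => G (xs,ys)) (fun z => (z - (xs,ys)) * l)%C); [apply cder_const|].
      apply (cder_mult (fun z => z - (xs,ys))%C (fun _ => l)); [|apply cder_const].
      apply (cder_minus (fun z => z) (fun _ => (xs,ys) : C)); [apply cder_id|apply cder_const]. }
  assert (HcA : forall z, czcont A z).
  { intros z. apply cder_czcont with (0 + ((1 - 0) * l + (z - (xs,ys)) * 0))%C. unfold A.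
      apply (cder_plus (fun _ => G (xs,ys)) (fun z => (z - (xs,ys)) * l)%C); [apply cder_const|].
      apply (cder_mult (fun z => z - (xs,ys))%C (fun _ => l)); [|apply cder_const].
      apply (cder_minus (fun z => z) (fun _ => (xs,ys) : C)); [apply cder_id|apply cder_const]. }
  assert (Hcn : forall z, in_rect (fst (a n)) (snd (a n)) (P n) (Q n) z -> czcont G z).
  { intros z [Hz1 Hz2]. apply Hc. split; lra. }
  assert (Hfin : Cmod (rectI (fun z => G z - A z)%C (fst (a n)) (snd (a n)) (P n) (Q n)) <=
     2 * (P n + Q n) * (e0 / (4 * S * S) * (P n + Q n))).
  { apply rectI_bound; auto.
    - intros z Hz e He.
      destruct (Hcn z Hz (e/2)) as [d1 [Hd1 K1]]; [lra|]. destruct (HcA z (e/2)) as [d2 [Hd2 K2]]; [lra|].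
      exists (Rmin d1 d2). split; [apply Rmin_glb_lt; auto|]. intros z' Hz'.
      specialize (K1 z'). specialize (K2 z').
      replace (G z' - A z' - (G z - A z))%C with ((G z' - G z) - (A z' - A z))%C by ring.
      eapply Rle_lt_trans; [apply Cmod_triangle_minus|].
      assert (Cmod (z' - z)%C < d1) by (eapply Rlt_le_trans; [exact Hz'|apply Rmin_l]).
      assert (Cmod (z' - z)%C < d2) by (eapply Rlt_le_trans; [exact Hz'|apply Rmin_r]).
      specialize (K1 H). specialize (K2 H0). lra.
    - intros z [Hz1 Hz2]. specialize (Hxs n). specialize (Hys n). cbv beta in Hxs, Hys.
      assert (Hk : Cmod (z - (xs,ys))%C <= P n + Q n).
      { eapply Rle_trans; [apply Cmod_le_ReIm|]. rewrite Re_minus, Im_minus. simpl (Re (xs, ys)). simpl (Im (xs,ys)).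
        apply Rplus_le_compat; apply Rabs_le; lra. }
      specialize (Hd' (z - (xs,ys))%C). replace ((xs,ys) + (z - (xs,ys)))%C with z in Hd' by ring.
      unfold A. replace (G z - (G (xs, ys) + (z - (xs, ys)) * l))%C with (G z - G (xs, ys) - (z - (xs, ys)) * l)%C by ring.
      assert (He4 : 0 < e0 / (4 * S * S)) by (apply Rdiv_lt_0_compat; auto; nra).
      eapply Rle_trans; [apply Hd'|].
      + eapply Rle_lt_trans; [exact Hk|]. replace (P n + Q n) with (S * (/2)^n) by (unfold S, P, Q; ring). exact Hn.
      + apply Rmult_le_compat_l; lra. }
  rewrite rectI_minus in Hfin; auto. rewrite HA in Hfin.
  replace (rectI G (fst (a n)) (snd (a n)) (P n) (Q n) - 0)%C with (rectI G (fst (a n)) (snd (a n)) (P n) (Q n)) in Hfin by ring.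
  assert (Hpq : P n + Q n = S * (/2)^n) by (unfold S, P, Q; ring). rewrite Hpq in Hfin.
  replace (2 * (S * (/ 2) ^ n) * (e0 / (4 * S * S) * (S * (/ 2) ^ n))) with (e0 / 2 * ((/2)^n * (/2)^n)) in Hfin by (field; lra).
  rewrite <- Rpow_mult_distr in Hfin. replace (/2 * /2) with (/4) in Hfin by field.
  assert (0 < (/4)^n) by (apply pow_lt; lra). nra.
Qed.

Definition D (g : C -> C) : C -> C := C_derive g.
Definition hball (c : C) (R : R) (g : C -> C) := forall z, Cmod (z - c)%C <= R -> exists l, cder g z l.

Lemma cder_D g z : (exists l, cder g z l) -> cder g z (D g z).
Proof.
  intros [l H]. assert (H' := H). apply Cderiv_cder in H. unfold D.
  now rewrite (is_C_derive_unique _ _ _ H).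
Qed.
Lemma D_unique g z l : cder g z l -> D g z = l.
Proof. intros H. apply Cderiv_cder in H. exact (is_C_derive_unique _ _ _ H). Qed.

Lemma hball_sub c R c' R' g : hball c R g -> Cmod (c' - c)%C + R' <= R -> hball c' R' g.
Proof.
  intros H HR z Hz. apply H. assert (Q := Cmod_tri3 z c' c). lra.
Qed.

Lemma cder_oppid z : cder (fun w => - w)%C z (RtoC (-1)).
Proof.
  apply (cder_quad _ _ _ 0 1); [lra|]. intros k _.
  replace (- (z + k) - - z - k * RtoC (-1))%C with (RtoC 0) by ring. rewrite Cmod_0. lra.
Qed.

Definition circ (r v : R) : C := Cexp (ln r, v).
Lemma Cmod_circ r v : 0 < r -> Cmod (circ r v) = r.
Proof. intros. unfold circ. rewrite Cmod_Cexp. simpl. now apply exp_ln. Qed.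

Lemma ccont_circ r v : ccont (fun v => circ r v) v.
Proof. unfold circ. apply (ccont_vert Cexp). eapply cder_czcont, cder_Cexp. Qed.

Lemma ccont_circ_inv r v : ccont (fun v => Cexp (- (ln r, v))%C) v.
Proof.
  apply (ccont_vert (fun w => Cexp (- w)%C)). apply cder_czcont with (RtoC (-1) * Cexp (- (ln r, v)))%C.
  apply (cder_comp Cexp (fun w => (- w)%C)); [apply cder_oppid|apply cder_Cexp].
Qed.

(* [2 PI] times the Cauchy integral for [g'(c)]: in the coordinate [w = ln (z - c)] the circle is a vertical side of a rectangle. *)
Definition circI (g : C -> C) (c : C) (r : R) : C :=
  CI (fun v => g (c + circ r v) * Cexp (- (ln r, v)))%C 0 (2 * PI).

Lemma circI_indep g c r R : 0 < r -> r <= R -> hball c R g -> circI g c r = circI g c R.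
Proof.
  intros Hr HrR H. assert (HPI := PI_RGT_0).
  assert (HR : 0 < R) by lra.
  assert (Hln : ln r <= ln R). { destruct HrR as [L|L]; [left; now apply ln_increasing|right; now rewrite L]. }
  set (G := fun w => (g (c + Cexp w) * Cexp (- w))%C).
  assert (Q := goursat_rect G (ln r) 0 (ln R - ln r) (2 * PI)).
  assert (Q0 : rectI G (ln r) 0 (ln R - ln r) (2 * PI) = 0).
  { apply Q; try lra. intros z [Hz _].
    destruct (H (c + Cexp z)%C) as [l Hl].
    { replace (c + Cexp z - c)%C with (Cexp z) by ring. rewrite Cmod_Cexp.
      rewrite <- (exp_ln R) by auto. apply exp_le_compat. lra. }
    eexists. unfold G. apply (cder_mult (fun w => g (c + Cexp w)%C) (fun w => Cexp (- w)%C)).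
    - apply (cder_comp g (fun w => (c + Cexp w)%C)).
      + apply (cder_plus (fun _ => c) Cexp); [apply cder_const|apply cder_Cexp].
      + exact Hl.
    - apply (cder_comp Cexp (fun w => (- w)%C)); [apply cder_oppid|apply cder_Cexp]. }
  unfold rectI in Q0. rewrite !Rplus_0_l in Q0. replace (ln r + (ln R - ln r)) with (ln R) in Q0 by ring.
  rewrite (CI_ext (fun u => G (u, 2 * PI)) (fun u => G (u, 0)) (ln r) (ln R)) in Q0; auto.
  2:{ intros u _. unfold G, Cexp. simpl.
      rewrite cos_2PI, sin_2PI, cos_0, sin_0.
      rewrite cos_neg, sin_neg, cos_2PI, sin_2PI. rewrite Ropp_0, cos_0, sin_0.
      reflexivity. }
  change (circI g c r) with (CI (fun v => G (ln r, v)) 0 (2 * PI)).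
  change (circI g c R) with (CI (fun v => G (ln R, v)) 0 (2 * PI)).
  set (A := CI (fun u => G (u, 0)) (ln r) (ln R)) in *.
  set (B := CI (fun v => G (ln R, v)) 0 (2 * PI)) in *.
  set (B' := CI (fun v => G (ln r, v)) 0 (2 * PI)) in *.
  assert (E : (Ci * (B - B'))%C = 0).
  { rewrite <- Q0. ring. }
  apply (f_equal (Cmult (- Ci)%C)) in E.
  replace (- Ci * (Ci * (B - B')))%C with (B - B')%C in E.
  2:{ replace (- Ci * (Ci * (B - B')))%C with (- (Ci * Ci) * (B - B'))%C by ring.
      replace (Ci * Ci)%C with (RtoC (-1)) by (apply C_ext; simpl; ring). ring. }
  symmetry. apply Ceq_minus. rewrite E. ring.
Qed.

Lemma CI_circ_inv r : CI (fun v => Cexp (- (ln r, v)))%C 0 (2 * PI) = 0.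
Proof.
  assert (HPI := PI_RGT_0).
  rewrite (CI_FTC (fun v => (Ci * Cexp (- (ln r, v)))%C) (fun v => Cexp (- (ln r, v)))%C); try lra.
  - unfold Cexp. simpl. rewrite cos_neg, sin_neg, cos_2PI, sin_2PI, Ropp_0, cos_0, sin_0. ring.
  - intros x _.
    replace (Cexp (- (ln r, x)))%C with (Ci * (- Ci * Cexp (RtoC (- ln r) + RtoC x * (- Ci))))%C.
    2:{ replace (- (ln r, x))%C with (RtoC (- ln r) + RtoC x * (- Ci))%C by (apply C_ext; simpl; ring).
        replace (Ci * (- Ci * Cexp (RtoC (- ln r) + RtoC x * - Ci)))%C with (- (Ci * Ci) * Cexp (RtoC (- ln r) + RtoC x * - Ci))%C by ring.
        replace (Ci * Ci)%C with (RtoC (-1)) by (apply C_ext; simpl; ring). ring. }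
    apply rder_scal.
    apply rder_ext with (fun u => Cexp (RtoC (- ln r) + RtoC u * (- Ci))%C).
    { intros u. f_equal. apply C_ext; simpl; ring. }
    apply rder_Cexp_lin.
  - intros x _. apply ccont_circ_inv.
Qed.

Lemma hball_circ_cont g c r R : 0 < r -> r <= R -> hball c R g ->
  con_on (fun v => g (c + circ r v) * Cexp (- (ln r, v)))%C 0 (2 * PI).
Proof.
  intros Hr HrR H v _. apply ccont_mult; [|apply ccont_circ_inv].
  apply (ccont_comp_z g (fun v => (c + circ r v)%C)).
  - destruct (H (c + circ r v)%C) as [l Hl].
    { replace (c + circ r v - c)%C with (circ r v) by ring. rewrite Cmod_circ; auto. }
    eapply cder_czcont; eauto.
  - apply ccont_plus; [apply ccont_const|apply ccont_circ].
Qed.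

Lemma Cmod_circ_inv r v : 0 < r -> Cmod (Cexp (- (ln r, v)))%C = / r.
Proof. intros. rewrite Cmod_Cexp. simpl. rewrite exp_Ropp, exp_ln; auto. Qed.

Lemma circ_mult_inv r v : (circ r v * Cexp (- (ln r, v)))%C = 1.
Proof. unfold circ. rewrite <- Cexp_plus, Cplus_opp_r. apply Cexp_0. Qed.

Theorem cauchy_deriv g c R l : 0 < R -> hball c R g -> cder g c l -> circI g c R = (RtoC (2 * PI) * l)%C.
Proof.
  intros HR H Hl. assert (HPI := PI_RGT_0). apply Cmod_eps_eq. intros e He.
  destruct (Hl (e / (2 * PI))) as [d [Hd K]]; [apply Rdiv_lt_0_compat; lra|].
  set (r := Rmin R (d / 2)).
  assert (Hr : 0 < r) by (apply Rmin_glb_lt; lra).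
  assert (HrR : r <= R) by apply Rmin_l. assert (Hrd : r < d) by (assert (Q := Rmin_r R (d/2)); unfold r; lra).
  rewrite <- (circI_indep g c r R) by auto.
  assert (E : (RtoC (2 * PI) * l)%C = CI (fun v => g c * Cexp (- (ln r, v)) + l)%C 0 (2 * PI)).
  { rewrite CI_plus; try lra.
    - rewrite CI_scal, CI_circ_inv, CI_const; try lra.
      + rewrite Rminus_0_r. ring.
      + intros v _. apply ccont_circ_inv.
    - intros v _. apply ccont_mult; [apply ccont_const|apply ccont_circ_inv].
    - intros v _. apply ccont_const. }
  rewrite E. unfold circI. rewrite <- CI_minus; try lra.
  - replace e with ((2 * PI - 0) * (e / (2 * PI))) by (field; lra).
    apply CI_bound_const; try lra.
    + apply con_on_minus; [eapply hball_circ_cont; eauto|].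
      intros v _. apply ccont_plus; [|apply ccont_const]. apply ccont_mult; [apply ccont_const|apply ccont_circ_inv].
    + intros v _. specialize (K (circ r v)). rewrite Cmod_circ in K by auto. specialize (K Hrd).
      replace (g (c + circ r v) * Cexp (- (ln r, v)) - (g c * Cexp (- (ln r, v)) + l))%C with
        ((g (c + circ r v) - g c - circ r v * l) * Cexp (- (ln r, v)))%C.
      2:{ transitivity (g (c + circ r v) * Cexp (- (ln r, v)) - g c * Cexp (- (ln r, v)) - (circ r v * Cexp (- (ln r, v))) * l)%C; [ring|].
          rewrite circ_mult_inv. ring. }
      rewrite Cmod_mult, Cmod_circ_inv by auto.
      replace (e / (2 * PI)) with (e / (2 * PI) * r * / r) by (field; split; lra).
      apply Rmult_le_compat_r; auto. apply Rlt_le, Rinv_0_lt_compat; auto.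
  - eapply hball_circ_cont; eauto.
  - intros v _. apply ccont_plus; [|apply ccont_const]. apply ccont_mult; [apply ccont_const|apply ccont_circ_inv].
Qed.

Lemma cauchy_bound_circle g c R l M : 0 < R -> hball c R g -> cder g c l ->
  (forall v, 0 <= v <= 2 * PI -> Cmod (g (c + circ R v)%C) <= M) -> Cmod l <= M / R.
Proof.
  intros HR H Hl HM. assert (HPI := PI_RGT_0). assert (E := cauchy_deriv g c R l HR H Hl).
  assert (B : Cmod (circI g c R) <= (2 * PI - 0) * (M / R)).
  { unfold circI. apply CI_bound_const; try lra.
    - eapply hball_circ_cont; eauto. lra.
    - intros v Hv. rewrite Cmod_mult, Cmod_circ_inv by auto.
      apply Rmult_le_compat_r; [apply Rlt_le, Rinv_0_lt_compat; auto|]. apply HM. lra. }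
  rewrite E, Cmod_mult, Cmod_RtoC_pos, Rminus_0_r in B by lra.
  apply Rmult_le_reg_l with (2 * PI); lra.
Qed.

Lemma cauchy_bound g c R l M : 0 < R -> hball c R g -> cder g c l ->
  (forall z, Cmod (z - c)%C <= R -> Cmod (g z) <= M) -> Cmod l <= M / R.
Proof.
  intros HR H Hl HM. apply (cauchy_bound_circle g c R l M); auto. intros v _.
  apply HM. replace (c + circ R v - c)%C with (circ R v) by ring. rewrite Cmod_circ; lra.
Qed.

Lemma seg_ball c R z w t : Cmod (z - c)%C <= R -> Cmod (w - c)%C <= R -> 0 <= t <= 1 ->
  Cmod (z + RtoC t * (w - z) - c)%C <= R.
Proof.
  intros Hz Hw Ht.
  replace (z + RtoC t * (w - z) - c)%C with (RtoC (1 - t) * (z - c) + RtoC t * (w - c))%C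
    by (rewrite RtoC_minus; ring).
  eapply Rle_trans; [apply Cmod_triangle|]. rewrite !Cmod_mult, !Cmod_RtoC_pos by lra. nra.
Qed.

Lemma lip_of_bound g c R M : hball c R g -> (forall z, Cmod (z - c)%C <= R -> Cmod (D g z) <= M) ->
  forall z w, Cmod (z - c)%C <= R -> Cmod (w - c)%C <= R -> Cmod (g w - g z)%C <= M * Cmod (w - z)%C.
Proof.
  intros H HM z w Hz Hw.
  assert (Dr : forall x, 0 <= x <= 1 -> rder (fun u => g (z + RtoC u * (w - z))%C) x (D g (z + RtoC x * (w - z)) * (w - z))%C).
  { intros x Hx. apply cder_rder. apply cder_D, H. apply seg_ball; auto. }
  assert (Q := MV_lin (fun u => g (z + RtoC u * (w - z))%C) (fun x => D g (z + RtoC x * (w - z)) * (w - z))%C (M * Cmod (w - z)%C) 0 1).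
  cbv beta in Q. replace (z + 1 * (w - z))%C with w in Q by ring. replace (z + 0 * (w - z))%C with z in Q by ring.
  rewrite Rminus_0_r, Rmult_1_r in Q. apply Q; try lra.
  - intros x Hx. eapply rder_ccont, Dr. lra.
  - intros x Hx. apply Dr; lra.
  - intros x Hx. rewrite Cmod_mult. apply Rmult_le_compat_r; [apply Cmod_ge_0|]. apply HM. apply seg_ball; auto; lra.
Qed.

Lemma cder_shift g k z l : cder g (z + k)%C l -> cder (fun u => g (u + k)%C) z l.
Proof.
  intros H. replace l with ((1 + 0) * l)%C by ring.
  apply (cder_comp g (fun u => (u + k)%C)); auto.
  apply (cder_plus (fun u => u) (fun _ => k)); [apply cder_id|apply cder_const].
Qed.

Section Quad.
Variables (g : C -> C) (c : C) (R M : R).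
Hypothesis (HR : 0 < R) (H : hball c R g) (HM : forall z, Cmod (z - c)%C <= R -> Cmod (g z) <= M).

Lemma D_bound z r : 0 < r -> Cmod (z - c)%C + r <= R -> Cmod (D g z) <= M / r.
Proof using HM H.
  intros Hr Hz. apply (cauchy_bound g z r); auto.
  - eapply hball_sub; eauto.
  - apply cder_D, H. lra.
  - intros w Hw. apply HM. assert (Q := Cmod_tri3 w z c). lra.
Qed.

Lemma g_lip z w : Cmod (z - c)%C <= R/2 -> Cmod (w - c)%C <= R/2 -> Cmod (g w - g z)%C <= 2 * M / R * Cmod (w - z)%C.
Proof using HR HM H.
  intros. apply (lip_of_bound g c (R/2)); auto.
  - eapply hball_sub; eauto. replace (c - c)%C with (RtoC 0) by ring. rewrite Cmod_0. lra.
  - intros u Hu. replace (2 * M / R) with (M / (R/2)) by (field; lra). apply D_bound; lra.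
Qed.

Lemma D_lip z w : Cmod (z - c)%C <= R/4 -> Cmod (w - c)%C <= R/4 -> Cmod (D g w - D g z)%C <= 8 * M / R^2 * Cmod (w - z)%C.
Proof using HR HM H.
  intros Hz Hw.
  replace (8 * M / R^2 * Cmod (w - z)%C) with ((2 * M / R * Cmod (w - z)%C) / (R/4)) by (field; lra).
  set (h := fun u => (g (u + (w - z)) - g u)%C).
  assert (Hin : forall u, Cmod (u - z)%C <= R/4 -> Cmod (u - c)%C <= R/2).
  { intros u Hu. assert (Q := Cmod_tri3 u z c). lra. }
  assert (Hin2 : forall u, Cmod (u - z)%C <= R/4 -> Cmod (u + (w - z) - c)%C <= R/2).
  { intros u Hu. replace (u + (w - z) - c)%C with ((u - z) + (w - c))%C by ring. eapply Rle_trans; [apply Cmod_triangle|]. lra. }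
  assert (Dh : forall u, Cmod (u - z)%C <= R/4 -> cder h u (D g (u + (w - z)) - D g u)%C).
  { intros u Hu. apply (cder_minus (fun u => g (u + (w - z))%C) g).
    - apply cder_shift. apply cder_D, H. specialize (Hin2 u Hu). lra.
    - apply cder_D, H. specialize (Hin u Hu). lra. }
  apply (cauchy_bound h z (R/4)); try lra.
  - intros u Hu. eexists. apply Dh; auto.
  - replace w with (z + (w - z))%C at 1 by ring. apply Dh.
    replace (z - z)%C with (RtoC 0) by ring. rewrite Cmod_0. lra.
  - intros u Hu. unfold h. eapply Rle_trans; [apply g_lip; auto|].
    replace (u + (w - z) - u)%C with (w - z)%C by ring. lra.
Qed.

Theorem quad_lemma k : Cmod k <= R/4 -> Cmod (g (c + k) - g c - k * D g c)%C <= 8 * M / R^2 * Cmod k ^ 2.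
Proof using HR HM H.
  intros Hk. assert (Hk0 := Cmod_ge_0 k).
  assert (Hin : forall x, 0 <= x <= 1 -> Cmod (c + RtoC x * k - c)%C <= R/4).
  { intros x Hx. replace (c + RtoC x * k - c)%C with (RtoC x * k)%C by ring.
    rewrite Cmod_mult, Cmod_RtoC_pos by lra. nra. }
  set (f := fun u : Rdefinitions.R => (g (c + RtoC u * k) - RtoC u * (k * D g c))%C).
  set (df := fun u : Rdefinitions.R => (D g (c + RtoC u * k) * k - k * D g c)%C).
  assert (Dr : forall x, 0 <= x <= 1 -> rder f x (df x)).
  { intros x Hx. apply rder_minus.
    - apply cder_rder. apply cder_D, H. specialize (Hin x Hx). lra.
    - assert (Q := rder_mult (fun u => RtoC u) (fun _ => (k * D g c)%C) x 1 0). cbv beta in Q.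
      replace (1 * (k * D g c) + x * 0)%C with (k * D g c)%C in Q by ring. apply Q; [|apply rder_const].
      apply (rder_RtoC (fun u => u)). exact (is_derive_id (K := R_AbsRing) x). }
  assert (Q := MV_lin f df (8 * M / R^2 * Cmod k ^ 2) 0 1).
  unfold f in Q. rewrite Rminus_0_r, Rmult_1_r in Q.
  replace (c + 1 * k)%C with (c + k)%C in Q by ring. replace (c + 0 * k)%C with c in Q by ring.
  replace (g (c + k) - g c - k * D g c)%C with (g (c + k) - 1 * (k * D g c) - (g c - 0 * (k * D g c)))%C by ring.
  apply Q; try lra; fold f.
  - intros x Hx. eapply rder_ccont, Dr; lra.
  - intros x Hx. apply Dr; lra.
  - intros x Hx. unfold df.
    replace (D g (c + RtoC x * k) * k - k * D g c)%C with ((D g (c + RtoC x * k) - D g c) * k)%C by ring.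
    rewrite Cmod_mult.
    assert (L : Cmod (D g (c + RtoC x * k) - D g c)%C <= 8 * M / R^2 * Cmod (c + RtoC x * k - c)%C).
    { apply D_lip; [|apply Hin; lra]. replace (c - c)%C with (RtoC 0) by ring. rewrite Cmod_0. lra. }
    replace (c + RtoC x * k - c)%C with (RtoC x * k)%C in L by ring. rewrite Cmod_mult, Cmod_RtoC_pos in L by lra.
    assert (HM0 : 0 <= M). { eapply Rle_trans; [apply Cmod_ge_0|apply (HM c)]. replace (c - c)%C with (RtoC 0) by ring. rewrite Cmod_0. lra. }
    assert (HC : 0 <= 8 * M / R^2). { apply Rle_div_r; [apply pow_lt; auto|]. lra. }
    apply Rle_trans with (8 * M / R^2 * (x * Cmod k) * Cmod k); [apply Rmult_le_compat_r; auto|].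
    replace (8 * M / R ^ 2 * Cmod k ^ 2) with (8 * M / R^2 * (1 * Cmod k) * Cmod k) by ring.
    apply Rmult_le_compat_r; auto. apply Rmult_le_compat_l; auto. apply Rmult_le_compat_r; lra.
Qed.
End Quad.

Lemma hball_bounded g c R : 0 < R -> hball c R g -> exists r M, 0 < r /\ r <= R /\ forall z, Cmod (z - c)%C <= r -> Cmod (g z) <= M.
Proof.
  intros HR H. destruct (H c) as [l Hl]. { replace (c - c)%C with (RtoC 0) by ring. rewrite Cmod_0. lra. }
  destruct (cder_czcont _ _ _ Hl 1) as [d [Hd K]]; [lra|].
  exists (Rmin R (d/2)), (Cmod (g c) + 1). repeat split.
  - apply Rmin_glb_lt; lra.
  - apply Rmin_l.
  - intros z Hz. assert (Cmod (z - c)%C < d) by (assert (Q := Rmin_r R (d/2)); lra). specialize (K z H0).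
    replace (g z) with (g c + (g z - g c))%C by ring. eapply Rle_trans; [apply Cmod_triangle|]. lra.
Qed.

Theorem D_holo g c R : 0 < R -> hball c R g -> exists l, cder (D g) c l.
Proof.
  intros HR0 H0. destruct (hball_bounded g c R HR0 H0) as [r [M [Hr [HrR HM]]]].
  assert (H : hball c r g). { eapply hball_sub; eauto. replace (c - c)%C with (RtoC 0) by ring. rewrite Cmod_0. lra. }
  clear R HR0 H0 HrR. assert (HPI := PI_RGT_0).
  assert (HM0 : 0 <= M). { eapply Rle_trans; [apply Cmod_ge_0|apply (HM c)]. replace (c - c)%C with (RtoC 0) by ring. rewrite Cmod_0. lra. }
  set (R := r / 4). assert (HR : 0 < R) by (unfold R; lra).
  assert (HDc : forall v, czcont (D g) (c + circ R v)%C).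
  { intros v e He.
    assert (Hc0 : Cmod (c + circ R v - c)%C = R).
    { replace (c + circ R v - c)%C with (circ R v) by ring. now apply Cmod_circ. }
    set (L := 8 * M / (r/2)^2 + 1).
    assert (HL : 0 < L). { unfold L. assert (0 <= 8 * M / (r/2)^2) by (apply Rle_div_r; [apply pow_lt; lra|lra]). lra. }
    exists (Rmin (r/8) (e / L)). split; [apply Rmin_glb_lt; [lra|]; apply Rdiv_lt_0_compat; auto|].
    intros z' Hz'.
    assert (Ha : Cmod (z' - (c + circ R v))%C < r/8) by (eapply Rlt_le_trans; [exact Hz'|apply Rmin_l]).
    assert (Hb : Cmod (z' - (c + circ R v))%C < e/L) by (eapply Rlt_le_trans; [exact Hz'|apply Rmin_r]).
    eapply Rle_lt_trans.
    - apply (D_lip g (c + circ R v)%C (r/2) M); try lra.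
      + eapply hball_sub; [exact H|]. rewrite Hc0. unfold R. lra.
      + intros z Hz. apply HM. assert (Q := Cmod_tri3 z (c + circ R v)%C c). rewrite Hc0 in Q. unfold R in Q. unfold R in Hz. lra.
      + replace (c + circ R v - (c + circ R v))%C with (RtoC 0) by ring. rewrite Cmod_0. lra.
    - assert (Hp := Cmod_ge_0 (z' - (c + circ R v))%C).
      apply Rle_lt_trans with (L * Cmod (z' - (c + circ R v))%C).
      + apply Rmult_le_compat_r; auto. unfold L. lra.
      + apply (Rmult_lt_compat_l L) in Hb; auto. replace (L * (e / L)) with e in Hb by (field; lra). exact Hb. }
  exists (/ RtoC (2 * PI) * circI (D g) c R)%C.
  assert (HN : RtoC (2 * PI) <> 0). { intros E. apply RtoC_inj in E. lra. }
  apply (cder_quad _ _ _ (128 * M / r^3) (r/8)); [lra|]. intros k Hk. assert (Hk0 := Cmod_ge_0 k).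
  assert (E1 : D g (c + k)%C = (/ RtoC (2 * PI) * circI g (c + k) R)%C).
  { rewrite (cauchy_deriv g (c + k)%C R (D g (c + k)%C)); auto.
    - field. auto.
    - eapply hball_sub; [exact H|]. replace (c + k - c)%C with k by ring. unfold R. lra.
    - apply cder_D, H. replace (c + k - c)%C with k by ring. lra. }
  assert (E0 : D g c = (/ RtoC (2 * PI) * circI g c R)%C).
  { rewrite (cauchy_deriv g c R (D g c)); auto.
    - field. auto.
    - eapply hball_sub; [exact H|]. replace (c - c)%C with (RtoC 0) by ring. rewrite Cmod_0. unfold R. lra.
    - apply cder_D, H. replace (c - c)%C with (RtoC 0) by ring. rewrite Cmod_0. lra. }
  rewrite E1, E0.
  replace (/ RtoC (2 * PI) * circI g (c + k) R - / RtoC (2 * PI) * circI g c R - k * (/ RtoC (2 * PI) * circI (D g) c R))%C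
    with (/ RtoC (2 * PI) * (circI g (c + k) R - circI g c R - k * circI (D g) c R))%C by ring.
  assert (C1 : con_on (fun v => g (c + k + circ R v) * Cexp (- (ln R, v)))%C 0 (2 * PI)).
  { apply (hball_circ_cont g (c + k)%C R R); try lra. eapply hball_sub; [exact H|]. replace (c + k - c)%C with k by ring. unfold R. lra. }
  assert (C2 : con_on (fun v => g (c + circ R v) * Cexp (- (ln R, v)))%C 0 (2 * PI)).
  { apply (hball_circ_cont g c R R); try lra. eapply hball_sub; [exact H|]. replace (c - c)%C with (RtoC 0) by ring. rewrite Cmod_0. unfold R. lra. }
  assert (C3 : con_on (fun v => D g (c + circ R v) * Cexp (- (ln R, v)))%C 0 (2 * PI)).
  { intros v _. apply ccont_mult; [|apply ccont_circ_inv]. apply (ccont_comp_z (D g) (fun v => (c + circ R v)%C)); auto.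
    apply ccont_plus; [apply ccont_const|apply ccont_circ]. }
  unfold circI. rewrite <- (CI_scal k), <- !CI_minus; try lra; auto.
  2: apply con_on_minus; auto. 2: apply con_on_scal; auto.
  rewrite Cmod_mult, Cmod_inv, Cmod_RtoC_pos by (auto; lra).
  apply Rmult_le_reg_l with (2 * PI); [lra|]. rewrite <- Rmult_assoc, Rinv_r, Rmult_1_l by lra.
  rewrite <- (Rminus_0_r (2 * PI)) at 2.
  apply CI_bound_const; try lra.
  - apply con_on_minus; [apply con_on_minus; auto|apply con_on_scal; auto].
  - intros v _.
    replace (g (c + k + circ R v) * Cexp (- (ln R, v)) - g (c + circ R v) * Cexp (- (ln R, v)) - k * (D g (c + circ R v) * Cexp (- (ln R, v))))%C
     with ((g ((c + circ R v) + k) - g (c + circ R v) - k * D g (c + circ R v)) * Cexp (- (ln R, v)))%C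
     by (replace (c + circ R v + k)%C with (c + k + circ R v)%C by ring; ring).
    rewrite Cmod_mult, Cmod_circ_inv by auto.
    assert (Hc0 : Cmod (c + circ R v - c)%C = R).
    { replace (c + circ R v - c)%C with (circ R v) by ring. now apply Cmod_circ. }
    assert (Q := quad_lemma g (c + circ R v)%C (r/2) M).
    replace (128 * M / r ^ 3 * Cmod k ^ 2) with ((8 * M / (r/2)^2 * Cmod k ^ 2) * / R) by (unfold R; field; lra).
    apply Rmult_le_compat_r; [apply Rlt_le, Rinv_0_lt_compat; auto|].
    apply Q; try lra.
    + eapply hball_sub; [exact H|]. rewrite Hc0. unfold R. lra.
    + intros z Hz. apply HM. assert (Q2 := Cmod_tri3 z (c + circ R v)%C c). rewrite Hc0 in Q2. unfold R in *. lra.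
Qed.

(** * Limits and improper integrals *)

Definition Ccv (u : nat -> C) (l : C) := forall eps, 0 < eps -> exists N, forall n, (N <= n)%nat -> Cmod (u n - l)%C < eps.
(* Unspecified when the sequence diverges. *)
Definition Clim (u : nat -> C) : C := epsilon (inhabits (RtoC 0)) (fun l => Ccv u l).

Lemma Ccv_unique u a b : Ccv u a -> Ccv u b -> a = b.
Proof.
  intros Ha Hb. apply Cmod_eps_eq. intros e He.
  destruct (Ha (e/2)) as [N1 H1]; [lra|]. destruct (Hb (e/2)) as [N2 H2]; [lra|].
  specialize (H1 (max N1 N2) (Nat.le_max_l _ _)). specialize (H2 (max N1 N2) (Nat.le_max_r _ _)).
  assert (Q := Cmod_tri3 a (u (max N1 N2)) b). rewrite (Cmod_minus_sym a (u _)) in Q. lra.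
Qed.

Lemma Ccv_Clim u l : Ccv u l -> Clim u = l.
Proof.
  intros H. apply (Ccv_unique u); auto. unfold Clim. apply epsilon_spec. eauto.
Qed.

Lemma Ccauchy_cv u : (forall eps, 0 < eps -> exists N, forall n m, (N <= n)%nat -> (N <= m)%nat -> Cmod (u n - u m)%C < eps) ->
  Ccv u (Clim u).
Proof.
  intros H. unfold Clim. apply epsilon_spec.
  destruct (Stdlib.Reals.Rcomplete.R_complete (fun n => Re (u n))) as [a Ha].
  { intros e He. destruct (H e He) as [N HN]. exists N. intros n m Hn Hm. unfold Rdist.
    rewrite <- Re_minus. eapply Rle_lt_trans; [apply re_le_Cmod|]. auto. }
  destruct (Stdlib.Reals.Rcomplete.R_complete (fun n => Im (u n))) as [b Hb].
  { intros e He. destruct (H e He) as [N HN]. exists N. intros n m Hn Hm. unfold Rdist.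
    rewrite <- Im_minus. eapply Rle_lt_trans; [apply im_le_Cmod|]. auto. }
  exists (a, b). intros e He. destruct (Ha (e/2)) as [N1 H1]; [lra|]. destruct (Hb (e/2)) as [N2 H2]; [lra|].
  exists (max N1 N2). intros n Hn. specialize (H1 n ltac:(lia)). specialize (H2 n ltac:(lia)).
  unfold Rdist in *. eapply Rle_lt_trans; [apply Cmod_le_ReIm|]. rewrite Re_minus, Im_minus. simpl (Re (a,b)). simpl (Im (a, b)). lra.
Qed.

Lemma Ccv_bound u l M a : Ccv u l -> (exists N, forall n, (N <= n)%nat -> Cmod (u n - a)%C <= M) -> Cmod (l - a)%C <= M.
Proof.
  intros H [N HN]. apply le_epsilon. intros e He. destruct (H e He) as [N' H'].
  specialize (HN (max N N') (Nat.le_max_l _ _)). specialize (H' (max N N') (Nat.le_max_r _ _)).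
  assert (Q := Cmod_tri3 l (u (max N N')) a). rewrite (Cmod_minus_sym l (u _)) in Q. lra.
Qed.

Lemma Ccv_bound0 u l M : Ccv u l -> (exists N, forall n, (N <= n)%nat -> Cmod (u n) <= M) -> Cmod l <= M.
Proof.
  intros H [N HN]. replace l with (l - 0)%C by ring. eapply Ccv_bound; eauto. exists N. intros.
  replace (u n - 0)%C with (u n) by ring. auto.
Qed.

Lemma Ccv_plus u v a b : Ccv u a -> Ccv v b -> Ccv (fun n => u n + v n)%C (a + b)%C.
Proof.
  intros Ha Hb e He. destruct (Ha (e/2)) as [N1 H1]; [lra|]. destruct (Hb (e/2)) as [N2 H2]; [lra|].
  exists (max N1 N2). intros n Hn. specialize (H1 n ltac:(lia)). specialize (H2 n ltac:(lia)).
  replace (u n + v n - (a + b))%C with ((u n - a) + (v n - b))%C by ring.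
  eapply Rle_lt_trans; [apply Cmod_triangle|]. lra.
Qed.

Lemma Ccv_scal c u a : Ccv u a -> Ccv (fun n => c * u n)%C (c * a)%C.
Proof.
  intros Ha e He. set (M := Cmod c + 1). assert (HM : 0 < M) by (unfold M; assert (Q := Cmod_ge_0 c); lra).
  destruct (Ha (e/M)) as [N H]; [apply Rdiv_lt_0_compat; auto|]. exists N. intros n Hn. specialize (H n Hn).
  replace (c * u n - c * a)%C with (c * (u n - a))%C by ring. rewrite Cmod_mult.
  assert (Q := Cmod_ge_0 (u n - a)%C). apply (Rmult_lt_compat_l M) in H; auto. replace (M * (e / M)) with e in H by (field; lra).
  unfold M in H. nra.
Qed.

Lemma Ccv_ext u v l : (forall n, u n = v n) -> Ccv u l -> Ccv v l.
Proof. intros E H e He. destruct (H e He) as [N HN]. exists N. intros. rewrite <- E. auto. Qed.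

Lemma Ccv_filterlim u l : Ccv u l <-> filterlim u eventually (locally (T := C_UniformSpace) l).
Proof.
  split.
  - intros H. apply filterlim_C_iff; [apply eventually_filter|]. exact H.
  - intros H e He. apply (proj1 (filterlim_C_iff eventually u l) H e He).
Qed.

Section LimHolo.
Context {U : Type} (F : (U -> Prop) -> Prop) {FF : ProperFilter F}.
Variables (G : U -> C -> C) (g : C -> C) (c : C) (R M : R).
Hypothesis (HR : 0 < R) (HG : forall u, hball c R (G u)) (HM : forall u z, Cmod (z - c)%C <= R -> Cmod (G u z) <= M).
Hypothesis (Hlim : forall z, Cmod (z - c)%C <= R -> forall eps, 0 < eps -> F (fun u => Cmod (G u z - g z)%C < eps)).

Lemma limit_holo : exists l, cder g c l /\ forall eps, 0 < eps -> F (fun u => Cmod (D (G u) c - l)%C < eps).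
Proof using All.
  assert (Hcc : Cmod (c - c)%C <= R) by (replace (c - c)%C with (RtoC 0) by ring; rewrite Cmod_0; lra).
  set (K := 8 * M / R^2).
  assert (HM0 : 0 <= M). { destruct (filter_ex _ (Hlim c Hcc 1 Rlt_0_1)) as [u _]. eapply Rle_trans; [apply Cmod_ge_0|apply (HM u c Hcc)]. }
  assert (HK : 0 <= K). { unfold K. apply Rle_div_r; [apply pow_lt; auto|]. lra. }
  assert (HQ : forall u k, Cmod k <= R/4 -> Cmod (G u (c + k) - G u c - k * D (G u) c)%C <= K * Cmod k ^ 2).
  { intros u k Hk. apply (quad_lemma (G u) c R M); auto. }
  assert (HC : exists l : C_CompleteNormedModule, filterlim (fun u => D (G u) c : C_CompleteNormedModule) F (locally l)).
  { apply (proj1 (filterlim_locally_cauchy (U := C_CompleteNormedModule) (F := F) (fun u => D (G u) c))). intros eps.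
    set (e := pos eps). assert (He : 0 < e) by apply cond_pos.
    set (d := Rmin (R/4) (e / (8 * (K + 1)))).
    assert (Hd : 0 < d) by (apply Rmin_glb_lt; [lra|]; apply Rdiv_lt_0_compat; lra).
    assert (HdR : d <= R/4) by apply Rmin_l.
    assert (HdK : K * d <= e / 8).
    { assert (d <= e / (8 * (K + 1))) by apply Rmin_r. apply Rle_trans with ((K + 1) * (e / (8 * (K+1)))); [nra|right; field; lra]. }
    assert (Hcd : Cmod (c + RtoC d - c)%C <= R).
    { replace (c + RtoC d - c)%C with (RtoC d) by ring. rewrite Cmod_RtoC_pos; lra. }
    exists (fun u => Cmod (G u (c + RtoC d)%C - g (c + RtoC d)%C)%C < e * d / 8 /\ Cmod (G u c - g c)%C < e * d / 8). split.
    - apply filter_and; apply Hlim; auto; nra.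
    - intros u v [Hu1 Hu2] [Hv1 Hv2]. apply C_NormedModule_mixin_compat1.
      change (Cmod (D (G v) c - D (G u) c)%C < e).
      assert (Qu := HQ u (RtoC d)). assert (Qv := HQ v (RtoC d)). rewrite Cmod_RtoC_pos in Qu, Qv by lra.
      specialize (Qu HdR). specialize (Qv HdR).
      apply Rmult_lt_reg_l with d; auto. rewrite <- (Cmod_RtoC_pos d) at 1 by lra. rewrite <- Cmod_mult.
      replace (RtoC d * (D (G v) c - D (G u) c))%C with
       ((G u (c + RtoC d) - G u c - RtoC d * D (G u) c) - (G v (c + RtoC d) - G v c - RtoC d * D (G v) c)
        + ((G v (c + RtoC d) - g (c + RtoC d)) - (G u (c + RtoC d) - g (c + RtoC d)))
        + ((G u c - g c) - (G v c - g c)))%C by ring.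
      eapply Rle_lt_trans; [apply Cmod_triangle|].
      eapply Rle_lt_trans; [apply Rplus_le_compat_r, Cmod_triangle|].
      eapply Rle_lt_trans.
      { apply Rplus_le_compat; [apply Rplus_le_compat|]; apply Cmod_triangle_minus. }
      assert (K * d^2 <= e * d / 8) by (simpl; nra). assert (0 < e * d) by nra. lra. }
  destruct HC as [l Hl].
  assert (Hl' : forall eps, 0 < eps -> F (fun u => Cmod (D (G u) c - l)%C < eps)).
  { apply (filterlim_C_iff F (fun u => D (G u) c) l). exact Hl. }
  exists l. split; auto.
  apply (cder_quad _ _ _ K (R/4)); [lra|]. intros k Hk. apply le_epsilon. intros e He.
  assert (Hck : Cmod (c + k - c)%C <= R) by (replace (c + k - c)%C with k by ring; lra).
  set (e' := e / (4 * (1 + Cmod k))). assert (Hk0 := Cmod_ge_0 k).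
  assert (He' : 0 < e') by (apply Rdiv_lt_0_compat; lra).
  destruct (filter_ex _ (filter_and _ _ (Hlim _ Hck e' He') (filter_and _ _ (Hlim _ Hcc e' He') (Hl' e' He')))) as [u [H1 [H2 H3]]].
  assert (Q := HQ u k (Rlt_le _ _ Hk)).
  replace (g (c + k) - g c - k * l)%C with
   ((G u (c + k) - G u c - k * D (G u) c) - (G u (c + k) - g (c + k)) + (G u c - g c) + k * (D (G u) c - l))%C by ring.
  eapply Rle_trans; [apply Cmod_triangle|].
  eapply Rle_trans; [apply Rplus_le_compat_r, Cmod_triangle|].
  eapply Rle_trans; [apply Rplus_le_compat_r, Rplus_le_compat_r, Cmod_triangle_minus|].
  rewrite Cmod_mult.
  assert (Cmod k * Cmod (D (G u) c - l)%C <= Cmod k * e') by (apply Rmult_le_compat_l; lra).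
  assert (E : 4 * (1 + Cmod k) * e' = e) by (unfold e'; field; lra). nra.
Qed.
End LimHolo.

Definition dom (f : R -> C) (M : R) := (forall x, 0 <= x -> ccont f x) /\ (forall x, 0 <= x -> Cmod (f x) <= M / (1 + x)^2).

Definition Iinf (f : R -> C) : C := Clim (fun n => CI f 0 (INR n)).

Lemma dom_con f M a b : 0 <= a -> dom f M -> con_on f a b.
Proof. intros Ha [H _] x Hx. apply H. lra. Qed.

Lemma dom_M f M : dom f M -> 0 <= M.
Proof.
  intros [_ H]. specialize (H 0 (Rle_refl 0)). replace (M / (1 + 0)^2) with M in H by field.
  eapply Rle_trans; [apply Cmod_ge_0|eauto].
Qed.

Lemma CI_tail f M a b : 0 <= a <= b -> dom f M -> Cmod (CI f a b) <= M / (1 + a).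
Proof.
  intros Hab H. assert (HM := dom_M _ _ H).
  apply Rle_trans with ((- M / (1 + b)) - (- M / (1 + a))).
  - apply (CI_prim_bound f (fun x => - M / (1 + x)) (fun x => M / (1 + x)^2)); try lra.
    + eapply dom_con; eauto; lra.
    + intros x Hx. apply (ex_derive_continuous (V := R_NormedModule)). auto_derive. lra.
    + intros x Hx. auto_derive; [lra|]. field. lra.
    + intros x Hx. apply H. lra.
  - assert (0 <= M / (1 + b)). { apply Rle_div_r; lra. } unfold Rdiv in *. lra.
Qed.

Lemma Iinf_cv f M : dom f M -> Ccv (fun n => CI f 0 (INR n)) (Iinf f).
Proof.
  intros H. assert (HM := dom_M _ _ H). apply Ccauchy_cv. intros e He.
  destruct (INR_unbounded (M / e)) as [N HN]. exists N.
  assert (W : forall n m, (N <= n)%nat -> (n <= m)%nat -> Cmod (CI f 0 (INR n) - CI f 0 (INR m))%C < e).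
  { intros n m Hn Hm. assert (Hn' := le_INR _ _ Hn). assert (Hm' := le_INR _ _ Hm). assert (HN0 := pos_INR N).
    rewrite <- (CI_Chasles f 0 (INR n) (INR m)); try lra. 2: eapply dom_con; eauto; lra.
    replace (CI f 0 (INR n) - (CI f 0 (INR n) + CI f (INR n) (INR m)))%C with (- CI f (INR n) (INR m))%C by ring.
    rewrite Cmod_opp. eapply Rle_lt_trans; [apply (CI_tail f M); auto; lra|].
    apply Rlt_div_l; [lra|]. assert (E : M / e * e = M) by (field; lra). nra. }
  intros n m Hn Hm. destruct (Nat.le_ge_cases n m); [auto|]. rewrite Cmod_minus_sym. auto.
Qed.

Lemma Iinf_tail f M X : 0 <= X -> dom f M -> Cmod (Iinf f - CI f 0 X)%C <= M / (1 + X).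
Proof.
  intros HX H. eapply Ccv_bound; [eapply Iinf_cv; eauto|].
  destruct (INR_unbounded X) as [N HN]. exists N. intros n Hn. apply le_INR in Hn.
  rewrite <- (CI_Chasles f 0 X (INR n)); try lra. 2: eapply dom_con; eauto; lra.
  replace (CI f 0 X + CI f X (INR n) - CI f 0 X)%C with (CI f X (INR n)) by ring.
  apply CI_tail; auto. lra.
Qed.

Lemma dom_plus f g M N : dom f M -> dom g N -> dom (fun x => f x + g x)%C (M + N).
Proof.
  intros [F1 F2] [G1 G2]. split; intros x Hx.
  - apply ccont_plus; auto.
  - eapply Rle_trans; [apply Cmod_triangle|]. specialize (F2 x Hx). specialize (G2 x Hx).
    unfold Rdiv in *. lra.
Qed.
Lemma dom_scal c f M : dom f M -> dom (fun x => c * f x)%C (Cmod c * M).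
Proof.
  intros [F1 F2]. split; intros x Hx.
  - apply ccont_mult; auto. apply ccont_const.
  - rewrite Cmod_mult. unfold Rdiv. rewrite Rmult_assoc. apply Rmult_le_compat_l; [apply Cmod_ge_0|]. apply F2; auto.
Qed.
Lemma dom_minus f g M N : dom f M -> dom g N -> dom (fun x => f x - g x)%C (M + N).
Proof.
  intros [F1 F2] [G1 G2]. split; intros x Hx.
  - apply ccont_minus; auto.
  - eapply Rle_trans; [apply Cmod_triangle_minus|]. specialize (F2 x Hx). specialize (G2 x Hx).
    unfold Rdiv in *. lra.
Qed.

Lemma Iinf_plus f g M N : dom f M -> dom g N -> Iinf (fun x => f x + g x)%C = (Iinf f + Iinf g)%C.
Proof.
  intros Hf Hg. apply Ccv_Clim. eapply Ccv_ext; [|apply Ccv_plus; eapply Iinf_cv; eauto].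
  intros n. simpl. symmetry. apply CI_plus; [apply pos_INR| |]; eapply dom_con; eauto; lra.
Qed.
Lemma Iinf_scal c f M : dom f M -> Iinf (fun x => c * f x)%C = (c * Iinf f)%C.
Proof.
  intros Hf. apply Ccv_Clim. eapply Ccv_ext; [|apply Ccv_scal; eapply Iinf_cv; eauto].
  intros n. simpl. symmetry. apply CI_scal; [apply pos_INR|]; eapply dom_con; eauto; lra.
Qed.
Lemma Iinf_ext f g : (forall x, 0 <= x -> f x = g x) -> Iinf f = Iinf g.
Proof.
  intros H. unfold Iinf. f_equal. apply FunctionalExtensionality.functional_extensionality. intros n.
  apply CI_ext; [apply pos_INR|]. intros; apply H; lra.
Qed.
Lemma Iinf_minus f g M N : dom f M -> dom g N -> Iinf (fun x => f x - g x)%C = (Iinf f - Iinf g)%C.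
Proof.
  intros Hf Hg. transitivity (Iinf (fun x => f x + RtoC (-1) * g x)%C); [apply Iinf_ext; intros; ring|].
  erewrite Iinf_plus; eauto; [|eapply dom_scal; eauto]. erewrite Iinf_scal; eauto. ring.
Qed.

Lemma Iinf_prim_bound f M (P dP : R -> R) B : dom f M ->
  (forall x, 0 <= x -> continuous P x) -> (forall x, 0 < x -> is_derive P x (dP x)) ->
  (forall x, 0 < x -> Cmod (f x) <= dP x) -> (forall x, 0 <= x -> P x - P 0 <= B) -> Cmod (Iinf f) <= B.
Proof.
  intros Hf HP HdP H HB. eapply Ccv_bound0; [eapply Iinf_cv; eauto|]. exists 0%nat. intros n _.
  assert (Hn := pos_INR n). eapply Rle_trans; [|apply (HB (INR n) Hn)].
  apply (CI_prim_bound f P dP); auto.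
  - eapply dom_con; eauto; lra.
  - intros; apply HP; lra.
  - intros; apply HdP; lra.
  - intros; apply H; lra.
Qed.

Lemma Iinf_bound f M : dom f M -> Cmod (Iinf f) <= M.
Proof.
  intros H. assert (Q := Iinf_tail f M 0 (Rle_refl 0) H). rewrite CI_point in Q.
  replace (Iinf f - 0)%C with (Iinf f) in Q by ring. replace (M / (1 + 0)) with M in Q by field. exact Q.
Qed.

Lemma Iinf_FTC F f M K : dom f M -> (forall x, 0 <= x -> rder F x (f x)) -> (forall x, 0 <= x -> Cmod (F x) <= K / (1 + x)) ->
  Iinf f = (- F 0)%C.
Proof.
  intros Hf HF HK. apply Ccv_Clim. intros e He.
  destruct (INR_unbounded (Rabs K / e)) as [N HN]. exists N. intros n Hn. apply le_INR in Hn. assert (Hn0 := pos_INR n). assert (HN0 := pos_INR N).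
  rewrite (CI_FTC F f 0 (INR n)); auto.
  - replace (F (INR n) - F 0 - - F 0)%C with (F (INR n)) by ring.
    eapply Rle_lt_trans; [apply HK; auto|]. apply Rlt_div_l; [lra|].
    assert (Q := Rle_abs K). assert (E : Rabs K / e * e = Rabs K) by (field; lra). nra.
  - intros x Hx. apply HF; lra.
  - eapply dom_con; eauto; lra.
Qed.

(** * Laplace integrals and the Airy kernel *)

Lemma rder_comp_c g f x d l : rder f x d -> cder g (f x) l -> rder (fun u => g (f u)) x (d * l)%C.
Proof.
  intros Hf Hg e He.
  set (A := Cmod d + 1). assert (HA : 0 < A) by (unfold A; assert (Q := Cmod_ge_0 d); lra).
  set (B := Cmod l + 1). assert (HB : 0 < B) by (unfold B; assert (Q := Cmod_ge_0 l); lra).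
  destruct (Hg (e/(2*A))) as [d1 [Hd1 H1]]; [apply Rdiv_lt_0_compat; lra|].
  destruct (Hf (Rmin 1 (e/(2*B)))) as [d2 [Hd2 H2]].
  { apply Rmin_glb_lt; [lra|]. apply Rdiv_lt_0_compat; lra. }
  exists (Rmin d2 (d1 / A)). split; [apply Rmin_glb_lt; auto; apply Rdiv_lt_0_compat; auto|]. intros k Hk.
  assert (Ha : Rabs k < d2) by (eapply Rlt_le_trans; [exact Hk|apply Rmin_l]).
  assert (Hb : Rabs k < d1/A) by (eapply Rlt_le_trans; [exact Hk|apply Rmin_r]).
  specialize (H2 k Ha). assert (Qk := Rabs_pos k).
  assert (H21 : Cmod (f (x + k)%R - f x - k * d)%C <= 1 * Rabs k).
  { eapply Rle_trans; [exact H2|]. apply Rmult_le_compat_r; auto. apply Rmin_l. }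
  assert (H22 : Cmod (f (x + k)%R - f x - k * d)%C <= e/(2*B) * Rabs k).
  { eapply Rle_trans; [exact H2|]. apply Rmult_le_compat_r; auto. apply Rmin_r. }
  set (w := (f (x + k)%R - f x)%C).
  assert (Hw : Cmod w <= A * Rabs k).
  { unfold w. replace (f (x + k)%R - f x)%C with ((f (x + k)%R - f x - RtoC k * d) + RtoC k * d)%C by ring.
    eapply Rle_trans; [apply Cmod_triangle|]. rewrite Cmod_mult, Cmod_R. unfold A. lra. }
  assert (Hw1 : Cmod w < d1).
  { eapply Rle_lt_trans; [exact Hw|]. apply (Rmult_lt_compat_l A) in Hb; auto.
    replace (A * (d1 / A)) with d1 in Hb by (field; lra). auto. }
  specialize (H1 w Hw1). replace (f x + w)%C with (f (x + k)%R) in H1 by (unfold w; ring).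
  replace (g (f (x + k)%R) - g (f x) - RtoC k * (d * l))%C with
   ((g (f (x + k)%R) - g (f x) - w * l) + l * (f (x + k)%R - f x - RtoC k * d))%C by (unfold w; ring).
  eapply Rle_trans; [apply Cmod_triangle|]. rewrite Cmod_mult.
  assert (T1 : e/(2*A) * Cmod w <= e / (2*A) * (A * Rabs k)).
  { apply Rmult_le_compat_l; auto. apply Rlt_le, Rdiv_lt_0_compat; lra. }
  replace (e / (2*A) * (A * Rabs k)) with (e/2 * Rabs k) in T1 by (field; lra).
  assert (T2 : Cmod l * Cmod (f (x + k)%R - f x - k * d)%C <= B * (e/(2*B) * Rabs k)).
  { apply Rmult_le_compat; auto using Cmod_ge_0. unfold B; lra. }
  replace (B * (e/(2*B) * Rabs k)) with (e/2 * Rabs k) in T2 by (field; lra). lra.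
Qed.

Lemma rder_quad f x l M d : 0 < d ->
  (forall h, Rabs h < d -> Cmod (f (x + h)%R - f x - RtoC h * l)%C <= M * h ^ 2) -> rder f x l.
Proof.
  intros Hd H e He. set (N := Rabs M + 1). assert (HN : 0 < N) by (unfold N; assert (Q := Rabs_pos M); lra).
  exists (Rmin d (e / N)). split; [apply Rmin_glb_lt; auto; apply Rdiv_lt_0_compat; auto|].
  intros k Hk.
  assert (Ha : Rabs k < d) by (eapply Rlt_le_trans; [exact Hk|apply Rmin_l]).
  assert (Hb : Rabs k < e/N) by (eapply Rlt_le_trans; [exact Hk|apply Rmin_r]).
  eapply Rle_trans; [apply H; auto|]. assert (Q := Rabs_pos k).
  assert (Rabs k * N <= e). { apply (Rmult_lt_compat_r N) in Hb; auto. replace (e / N * N) with e in Hb by (field; lra). lra. }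
  assert (M <= N) by (unfold N; assert (Q1 := Rle_abs M); lra). rewrite <- (pow2_abs k). nra.
Qed.

Lemma rder_id x : rder (fun u => RtoC u) x 1.
Proof. apply (rder_RtoC (fun u => u)). exact (is_derive_id (K := R_AbsRing) x). Qed.

Lemma le_div_intro a b c : 0 < c -> a * c <= b -> a <= b / c.
Proof. intros Hc H. now apply (Rle_div_r a b c Hc). Qed.

Lemma exp_mult_INR n x : exp x ^ n = exp (INR n * x).
Proof.
  induction n; [simpl; now rewrite Rmult_0_l, exp_0|].
  rewrite S_INR. replace ((INR n + 1) * x) with (x + INR n * x) by ring. rewrite exp_plus, <- IHn. reflexivity.
Qed.

Lemma pow_le_exp n y : 0 <= y -> y ^ n <= INR n ^ n * exp y.
Proof.
  intros Hy. destruct n.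
  { simpl. rewrite Rmult_1_l. rewrite <- exp_0. now apply exp_le_compat. }
  set (N := INR (S n)). assert (HN : 0 < N) by (apply lt_0_INR; lia).
  assert (E : exp y = exp (y / N) ^ (S n)).
  { rewrite exp_mult_INR. f_equal. fold N. field. lra. }
  rewrite E, <- Rpow_mult_distr. apply pow_incr. split; auto.
  assert (Q := exp_ineq1_le (y / N)). assert (N * (1 + y / N) <= N * exp (y / N)) by (apply Rmult_le_compat_l; lra).
  replace (N * (1 + y / N)) with (N + y) in H by (field; lra). lra.
Qed.

Lemma poly_cubic_bound n A th : 0 < th -> exists K, 0 <= K /\ forall q, 0 <= q -> (1 + q) ^ n * exp (A * q - th * q ^ 3) <= K.
Proof.
  intros Hth. set (A' := Rabs (A + 1)). assert (HA : 0 <= A') by apply Rabs_pos.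
  exists (INR n ^ n * exp (1 + A' * (1 + A' / th))). split.
  { apply Rmult_le_pos; [apply pow_le, pos_INR|apply Rlt_le, exp_pos]. }
  intros q Hq. apply Rle_trans with (INR n ^ n * exp (1 + q) * exp (A * q - th * q ^ 3)).
  { apply Rmult_le_compat_r; [apply Rlt_le, exp_pos|]. apply pow_le_exp. lra. }
  rewrite Rmult_assoc, <- exp_plus. apply Rmult_le_compat_l; [apply pow_le, pos_INR|].
  apply exp_le_compat.
  assert (H1 : (A + 1) * q <= A' * q) by (apply Rmult_le_compat_r; auto; apply Rle_abs).
  enough (A' * q - th * q^3 <= A' * (1 + A' / th)) by lra.
  assert (Hd : 0 <= A' / th) by (apply le_div_intro; lra).
  assert (E : A' / th * th = A') by (field; lra).
  destruct (Rle_dec q (1 + A' / th)) as [L|L].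
  - assert (0 <= th * q^3) by (apply Rmult_le_pos; [lra|apply pow_le; auto]). nra.
  - assert (q^2 >= 1 + A'/th) by nra. assert (th * q^2 >= A') by nra.
    assert (th * q^3 >= A' * q). { replace (th * q^3) with (th * q^2 * q) by ring. nra. }
    assert (0 <= A' * (1 + A'/th)) by nra. lra.
Qed.

Lemma RtoC_pow_mod (q : R) n : 0 <= q -> Cmod (RtoC (q ^ n)) = q ^ n.
Proof. intros. apply Cmod_RtoC_pos. now apply pow_le. Qed.

Lemma Re_le_mod (z : C) : Re z <= Cmod z.
Proof. eapply Rle_trans; [apply Rle_abs|apply re_le_Cmod]. Qed.
Lemma Re_ge_mod (z : C) : - Cmod z <= Re z.
Proof. assert (Q := re_le_Cmod z). assert (Q2 := Rabs_maj2 (Re z)). lra. Qed.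

Section Moments.
Variables (lam w : C) (gam th : R).
Hypothesis (Hgam : 0 < gam) (Hlam : Re lam <= - gam) (Hth : 0 < th) (Hw : th <= Re w).

Definition ki (n : nat) (x q : R) : C := (RtoC (q ^ n) * Cexp (lam * RtoC (q * x) - w * RtoC (q ^ 3)))%C.
Definition mom (n : nat) (x : R) : C := Iinf (ki n x).

Lemma rder_exponent x q : rder (fun q => lam * RtoC (q * x) - w * RtoC (q ^ 3))%C q (lam * RtoC x - w * RtoC (3 * q ^ 2))%C.
Proof using.
  apply rder_minus; apply rder_scal.
  - apply (rder_RtoC (fun q => q * x)). auto_derive; auto. ring.
  - apply (rder_RtoC (fun q => q ^ 3)). auto_derive; auto. ring.
Qed.

Lemma rder_expo x q : rder (fun q => Cexp (lam * RtoC (q * x) - w * RtoC (q ^ 3)))%C q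
  ((lam * RtoC x - w * RtoC (3 * q ^ 2)) * Cexp (lam * RtoC (q * x) - w * RtoC (q ^ 3)))%C.
Proof using.
  apply (rder_comp_c Cexp (fun q => lam * RtoC (q * x) - w * RtoC (q ^ 3))%C); [apply rder_exponent|apply cder_Cexp].
Qed.

Lemma ki_ccont n x q : ccont (ki n x) q.
Proof using.
  apply ccont_mult.
  - apply (ccont_RtoC (fun q => q ^ n)). apply (ex_derive_continuous (V := R_NormedModule)). auto_derive. auto.
  - eapply rder_ccont, rder_expo.
Qed.

Lemma ki_mod n x q : 0 <= q -> Cmod (ki n x q) <= q ^ n * exp (Re lam * (q * x) - th * q ^ 3).
Proof using Hw.
  intros Hq. unfold ki. rewrite Cmod_mult, RtoC_pow_mod, Cmod_Cexp by auto.
  apply Rmult_le_compat_l; [now apply pow_le|]. apply exp_le_compat.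
  rewrite Re_minus, !re_scal_r. assert (0 <= q^3) by now apply pow_le. nra.
Qed.

Lemma ki_dom n : exists K, forall x, -1 <= x -> dom (ki n x) K.
Proof using Hlam Hgam Hth Hw.
  destruct (poly_cubic_bound (n + 2) (Cmod lam) th Hth) as [K [HK0 HK]].
  exists K. intros x Hx. split; [intros; apply ki_ccont|].
  intros q Hq. eapply Rle_trans; [apply ki_mod; auto|].
  apply le_div_intro; [apply pow_lt; lra|].
  eapply Rle_trans; [|apply (HK q Hq)]. rewrite pow_add.
  assert (q ^ n <= (1 + q)^n) by (apply pow_incr; lra).
  assert (He : exp (Re lam * (q * x) - th * q ^ 3) <= exp (Cmod lam * q - th * q ^ 3)).
  { apply exp_le_compat. assert (Q := Re_ge_mod lam). assert (Re lam * (q * x) <= Cmod lam * q).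
    { apply Rle_trans with (- Re lam * q); [|nra]. assert (0 <= q * (1 + x)) by nra. nra. }
    lra. }
  assert (0 <= q^n) by now apply pow_le. assert (P1 := exp_pos (Re lam * (q * x) - th * q ^ 3)).
  assert (0 <= (1 + q)^2) by (apply pow_le; lra).
  apply Rle_trans with ((1 + q) ^ n * exp (Cmod lam * q - th * q ^ 3) * (1 + q)^2); [|right; ring].
  apply Rmult_le_compat_r; auto. apply Rmult_le_compat; auto. lra.
Qed.

Lemma mom_rder n x : 0 <= x -> rder (mom n) x (lam * mom (S n) x)%C.
Proof using Hlam Hgam Hth Hw.
  intros Hx. destruct (ki_dom n) as [K0 HK0]. destruct (ki_dom (S n)) as [K1 HK1].
  destruct (poly_cubic_bound (n + 4) (Cmod lam) th Hth) as [K [HKp HK]].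
  set (M := Cmod lam ^ 2 * K).
  apply (rder_quad _ _ _ M 1); [lra|]. intros h Hh. apply Rabs_def2 in Hh.
  unfold mom. rewrite <- (Iinf_scal lam _ K1) by (apply HK1; lra).
  rewrite <- (Iinf_scal (RtoC h) _ (Cmod lam * K1)) by (apply dom_scal, HK1; lra).
  rewrite <- (Iinf_minus _ _ K0 K0) by (apply HK0; lra).
  rewrite <- (Iinf_minus _ _ (K0 + K0) (Cmod (RtoC h) * (Cmod lam * K1))).
  2:{ apply dom_minus; apply HK0; lra. }
  2:{ apply dom_scal, dom_scal, HK1; lra. }
  apply Iinf_bound. split.
  { intros q Hq. apply ccont_minus; [apply ccont_minus; apply ki_ccont|].
    apply ccont_mult; [apply ccont_const|]. apply ccont_mult; [apply ccont_const|apply ki_ccont]. }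
  intros q Hq.
  replace (ki n (x + h) q - ki n x q - RtoC h * (lam * ki (S n) x q))%C with
    (ki n x q * (Cexp (lam * RtoC (q * h)) - 1 - lam * RtoC (q * h)))%C.
  2:{ unfold ki. replace (lam * RtoC (q * (x + h)) - w * RtoC (q ^ 3))%C with
       ((lam * RtoC (q * x) - w * RtoC (q ^ 3)) + lam * RtoC (q * h))%C by (rewrite !RtoC_mult, RtoC_plus; ring).
      rewrite Cexp_plus. replace (q ^ S n) with (q * q ^ n) by reflexivity. rewrite !RtoC_mult. ring. }
  rewrite Cmod_mult. assert (Q := Cexp_quad (lam * RtoC (q * h))%C).
  rewrite Cmod_mult, Cmod_R, Rabs_mult, (Rabs_pos_eq q Hq) in Q.
  assert (Hl0 := Cmod_ge_0 lam). assert (Hh0 := Rabs_pos h). assert (Hh1 : Rabs h <= 1) by (apply Rabs_le; lra).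
  assert (Hex : exp (Cmod lam * (q * Rabs h)) <= exp (Cmod lam * q)) by (apply exp_le_compat; apply Rmult_le_compat_l; nra).
  assert (Hki : Cmod (ki n x q) <= q ^ n * exp (- th * q^3)).
  { eapply Rle_trans; [apply ki_mod; auto|]. apply Rmult_le_compat_l; [now apply pow_le|].
    apply exp_le_compat. assert (0 <= q * x) by nra. nra. }
  apply Rle_trans with ((q ^ n * exp (- th * q^3)) * ((Cmod lam * (q * Rabs h))^2 * exp (Cmod lam * q))).
  { apply Rmult_le_compat; auto using Cmod_ge_0. eapply Rle_trans; [exact Q|].
    apply Rmult_le_compat_l; auto. apply pow2_ge_0. }
  apply le_div_intro; [apply pow_lt; lra|].
  replace (q ^ n * exp (- th * q ^ 3) * ((Cmod lam * (q * Rabs h)) ^ 2 * exp (Cmod lam * q)) * (1 + q) ^ 2)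
    with (Cmod lam ^ 2 * (Rabs h)^2 * ((q ^ n * q ^ 2) * (1 + q)^2 * (exp (Cmod lam * q) * exp (- th * q ^ 3)))) by ring.
  rewrite pow2_abs, <- exp_plus.
  replace (Cmod lam * q + - th * q ^ 3) with (Cmod lam * q - th * q^3) by ring.
  unfold M. replace (Cmod lam ^ 2 * K * h ^ 2) with (Cmod lam ^ 2 * h^2 * K) by ring.
  apply Rmult_le_compat_l; [apply Rmult_le_pos; apply pow2_ge_0|].
  eapply Rle_trans; [|apply (HK q Hq)]. apply Rmult_le_compat_r; [apply Rlt_le, exp_pos|].
  replace (n + 4)%nat with (n + 2 + 2)%nat by lia. rewrite !pow_add.
  apply Rmult_le_compat_r; [apply pow2_ge_0|].
  apply Rmult_le_compat; try apply pow_incr; try (apply pow_le); lra.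
Qed.

Lemma mom_parts0 x : 0 <= x -> (RtoC 3 * w * mom 2 x = 1 + lam * RtoC x * mom 0 x)%C.
Proof using Hlam Hgam Hth Hw.
  intros Hx. destruct (ki_dom 0) as [K0 HK0]. destruct (ki_dom 2) as [K2 HK2].
  assert (H0 := HK0 x ltac:(lra)). assert (H2 := HK2 x ltac:(lra)).
  assert (E : Iinf (fun q => lam * RtoC x * ki 0 x q - RtoC 3 * w * ki 2 x q)%C = (- (ki 0 x 0))%C).
  { eapply (Iinf_FTC (ki 0 x) _ _ K0).
    - eapply dom_minus; apply dom_scal; eauto.
    - intros q Hq. unfold ki. simpl (q ^ 0).
      apply rder_ext with (fun q => Cexp (lam * RtoC (q * x) - w * RtoC (q ^ 3)))%C; [intros; simpl; ring|].
      replace (lam * RtoC x * (1 * Cexp (lam * RtoC (q * x) - w * RtoC (q ^ 3))) - RtoC 3 * w * (RtoC (q ^ 2) * Cexp (lam * RtoC (q * x) - w * RtoC (q ^ 3))))%C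
      with ((lam * RtoC x - w * RtoC (3 * q ^ 2)) * Cexp (lam * RtoC (q * x) - w * RtoC (q ^ 3)))%C by (rewrite (RtoC_mult 3); ring).
      apply rder_expo.
    - intros q Hq. eapply Rle_trans; [apply H0; auto|]. assert (HK := dom_M _ _ H0).
      unfold Rdiv. apply Rmult_le_compat_l; auto. apply Rinv_le_contravar; nra. }
  rewrite (Iinf_minus _ _ _ _ (dom_scal _ _ _ H0) (dom_scal _ _ _ H2)) in E.
  rewrite (Iinf_scal _ _ _ H0), (Iinf_scal _ _ _ H2) in E. fold (mom 0 x) (mom 2 x) in E.
  assert (E0 : ki 0 x 0 = 1).
  { unfold ki. replace (lam * RtoC (0 * x) - w * RtoC (0 ^ 3))%C with (RtoC 0).
    - rewrite Cexp_0. simpl. ring.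
    - rewrite Rmult_0_l. replace (0 ^ 3) with 0 by ring. ring. }
  rewrite E0 in E. replace (1 + lam * RtoC x * mom 0 x)%C with (1 + (lam * RtoC x * mom 0 x - RtoC 3 * w * mom 2 x) + RtoC 3 * w * mom 2 x)%C by ring.
  rewrite E. ring.
Qed.

Lemma mom_parts1 x : 0 <= x -> (RtoC 3 * w * mom 3 x = mom 0 x + lam * RtoC x * mom 1 x)%C.
Proof using Hlam Hgam Hth Hw.
  intros Hx. destruct (ki_dom 0) as [K0 HK0]. destruct (ki_dom 1) as [K1 HK1]. destruct (ki_dom 3) as [K3 HK3].
  assert (H0 := HK0 x ltac:(lra)). assert (H1 := HK1 x ltac:(lra)). assert (H3 := HK3 x ltac:(lra)).
  assert (E : Iinf (fun q => (ki 0 x q + lam * RtoC x * ki 1 x q) - RtoC 3 * w * ki 3 x q)%C = (- (ki 1 x 0))%C).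
  { eapply (Iinf_FTC (ki 1 x) _ _ K1).
    - eapply dom_minus; [apply dom_plus; [eauto|]|]; apply dom_scal; eauto.
    - intros q Hq. unfold ki.
      apply rder_ext with (fun q => RtoC q * Cexp (lam * RtoC (q * x) - w * RtoC (q ^ 3)))%C; [intros; now rewrite pow_1|].
      match goal with |- rder _ _ ?t => replace t with
       (1 * Cexp (lam * RtoC (q * x) - w * RtoC (q ^ 3)) + RtoC q * ((lam * RtoC x - w * RtoC (3 * q ^ 2)) * Cexp (lam * RtoC (q * x) - w * RtoC (q ^ 3))))%C end.
      2:{ set (E := Cexp (lam * RtoC (q * x) - w * RtoC (q ^ 3))%C).
          replace (RtoC (q ^ 3)) with (RtoC q * RtoC (q^2))%C by (rewrite <- RtoC_mult; f_equal; ring).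
          rewrite pow_1, (RtoC_mult 3). simpl (q ^ 0). ring. }
      apply (rder_mult (fun q => RtoC q)); [apply rder_id|apply rder_expo].
    - intros q Hq. eapply Rle_trans; [apply H1; auto|]. assert (HK := dom_M _ _ H1).
      unfold Rdiv. apply Rmult_le_compat_l; auto. apply Rinv_le_contravar; nra. }
  rewrite (Iinf_minus _ _ _ _ (dom_plus _ _ _ _ H0 (dom_scal _ _ _ H1)) (dom_scal _ _ _ H3)) in E.
  rewrite (Iinf_plus _ _ _ _ H0 (dom_scal _ _ _ H1)) in E.
  rewrite (Iinf_scal _ _ _ H1), (Iinf_scal _ _ _ H3) in E. fold (mom 0 x) (mom 1 x) (mom 3 x) in E.
  assert (E0 : ki 1 x 0 = 0). { unfold ki. simpl. rewrite Rmult_0_l. ring. }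
  rewrite E0 in E.
  replace (mom 0 x + lam * RtoC x * mom 1 x)%C with ((mom 0 x + lam * RtoC x * mom 1 x - RtoC 3 * w * mom 3 x) + RtoC 3 * w * mom 3 x)%C by ring.
  rewrite E. ring.
Qed.

Lemma mom_bound n : exists K, 0 <= K /\ forall x, 0 <= x -> Cmod (mom n x) <= K / (1 + x) ^ (S n).
Proof using Hlam Hgam Hth Hw.
  destruct (ki_dom n) as [K0 HK0].
  destruct (poly_cubic_bound 0 gam th Hth) as [K [HKp HK]].
  set (N := INR n ^ n). assert (HN : 0 <= N) by (apply pow_le, pos_INR).
  exists (K * N * (2 / gam) ^ (S n)). split.
  { apply Rmult_le_pos; [nra|]. apply pow_le. apply Rlt_le, Rdiv_lt_0_compat; lra. }
  intros x Hx. set (X := 1 + x). assert (HX : 0 < X) by (unfold X; lra).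
  set (s := gam * X / 2). assert (Hs : 0 < s) by (unfold s; nra).
  assert (Hp : 0 < / s ^ n) by (apply Rinv_0_lt_compat, pow_lt; auto).
  set (A := K * N * / s ^ n). assert (HA : 0 <= A) by (unfold A; apply Rmult_le_pos; nra).
  replace (K * N * (2 / gam) ^ S n / X ^ S n) with (A / s).
  2:{ unfold A. replace (2 / gam) with (X / s) by (unfold s; field; lra).
      unfold Rdiv. rewrite Rpow_mult_distr, pow_inv. simpl. field. repeat split; try lra; apply pow_nonzero; lra. }
  apply (Iinf_prim_bound (ki n x) K0 (fun q => - (A / s) * exp (- s * q)) (fun q => A * exp (- s * q))).
  - apply HK0. lra.
  - intros q Hq. apply (ex_derive_continuous (V := R_NormedModule)). auto_derive. auto.
  - intros q Hq. auto_derive; auto. field. lra.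
  - intros q Hq. eapply Rle_trans; [apply ki_mod; lra|].
    assert (Q1 := pow_le_exp n (s * q) ltac:(nra)). fold N in Q1.
    assert (Hqn : q ^ n <= N * / s ^ n * exp (s * q)).
    { rewrite Rpow_mult_distr in Q1. assert (0 < s ^ n) by now apply pow_lt.
      apply Rmult_le_reg_l with (s ^ n); auto.
      replace (s ^ n * (N * / s ^ n * exp (s * q))) with (N * exp (s * q)) by (field; lra). exact Q1. }
    assert (He : exp (Re lam * (q * x) - th * q ^ 3) <= K * exp (- (2 * s) * q)).
    { specialize (HK q ltac:(lra)). simpl (_ ^ 0) in HK. rewrite Rmult_1_l in HK.
      apply Rle_trans with (exp (gam * q - th * q ^ 3) * exp (- (2 * s) * q)).
      - rewrite <- exp_plus. apply exp_le_compat. assert (0 <= q * x) by nra. unfold s, X. nra.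
      - apply Rmult_le_compat_r; auto. apply Rlt_le, exp_pos. }
    apply Rle_trans with ((N * / s ^ n * exp (s * q)) * (K * exp (- (2 * s) * q))).
    + apply Rmult_le_compat; auto. apply pow_le; lra. apply Rlt_le, exp_pos.
    + unfold A. replace (N * / s ^ n * exp (s * q) * (K * exp (- (2 * s) * q))) with (K * N * / s ^ n * (exp (s * q) * exp (- (2 * s) * q))) by ring.
      rewrite <- exp_plus. right. f_equal. f_equal. ring.
  - intros q Hq. rewrite Rmult_0_r, exp_0. assert (0 < exp (- s * q)) by apply exp_pos.
    assert (0 <= A / s) by (apply le_div_intro; lra). nra.
Qed.
End Moments.

Lemma rder_lin c x : rder (fun u => RtoC u * c)%C x c.
Proof.
  assert (Q := rder_mult (fun u => RtoC u) (fun _ => c) x 1 0 (rder_id x) (rder_const c x)). cbv beta in Q.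
  replace (1 * c + RtoC x * 0)%C with c in Q by ring. exact Q.
Qed.

Lemma MV_abs (f df : R -> C) M a b : (forall x, a <= x <= b -> ccont f x) ->
  (forall x, a < x < b -> rder f x (df x)) -> (forall x, a < x < b -> Cmod (df x) <= M) ->
  forall x y, a <= x <= b -> a <= y <= b -> Cmod (f y - f x)%C <= M * Rabs (y - x).
Proof.
  intros Hc Hd HM.
  assert (W : forall x y, a <= x -> x <= y -> y <= b -> Cmod (f y - f x)%C <= M * (y - x)).
  { intros x y Hx Hxy Hy. apply (MV_lin f df); auto; intros; [apply Hc|apply Hd|apply HM]; lra. }
  intros x y Hx Hy. destruct (Rle_dec x y).
  - rewrite Rabs_pos_eq by lra. apply W; lra.
  - rewrite Rabs_left1, Cmod_minus_sym by lra. replace (- (y - x)) with (x - y) by ring. apply W; lra.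
Qed.

Lemma taylor_lip (f f1 : R -> C) K a b : (forall x, a <= x <= b -> ccont f x) ->
  (forall x, a < x < b -> rder f x (f1 x)) ->
  (forall x y, a <= x <= b -> a <= y <= b -> Cmod (f1 y - f1 x)%C <= K * Rabs (y - x)) ->
  forall x y, a <= x <= b -> a <= y <= b -> Cmod (f y - f x - RtoC (y - x) * f1 x)%C <= K * (y - x)^2.
Proof.
  intros Hc Hd HK x y Hx Hy.
  assert (Hab : a <= b) by lra.
  set (g := fun u => (f u - RtoC u * f1 x)%C).
  assert (Hg : Cmod (g y - g x)%C <= (K * Rabs (y - x)) * Rabs (y - x)).
  { apply (MV_abs g (fun u => (f1 u - f1 x)%C) _ (Rmin x y) (Rmax x y)).
    - intros u Hu. assert (Q1 := Rmin_glb x y a ltac:(lra) ltac:(lra)). assert (Q2 := Rmax_lub x y b ltac:(lra) ltac:(lra)).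
      apply ccont_minus; [apply Hc; lra|]. apply ccont_mult; [|apply ccont_const]. eapply rder_ccont, rder_id.
    - intros u Hu. assert (Q1 := Rmin_glb x y a ltac:(lra) ltac:(lra)). assert (Q2 := Rmax_lub x y b ltac:(lra) ltac:(lra)).
      apply rder_minus; [apply Hd; lra|].
      apply rder_lin.
    - intros u Hu. assert (Q1 := Rmin_glb x y a ltac:(lra) ltac:(lra)). assert (Q2 := Rmax_lub x y b ltac:(lra) ltac:(lra)).
      eapply Rle_trans; [apply HK; lra|].
      assert (HK0 : 0 <= K \/ K < 0) by lra. destruct HK0 as [HK0|HK0].
      + apply Rmult_le_compat_l; auto. unfold Rmin, Rmax in Hu. destruct (Rle_dec x y); unfold Rabs; destruct (Rcase_abs (u - x)), (Rcase_abs (y - x)); lra.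
      + exfalso. assert (Hxy : x <> y). { unfold Rmin, Rmax in Hu. destruct (Rle_dec x y); lra. }
        specialize (HK x y Hx Hy). assert (Q := Cmod_ge_0 (f1 y - f1 x)%C). assert (0 < Rabs (y - x)) by (apply Rabs_pos_lt; lra). nra.
    - split; [apply Rmin_l|apply Rmax_l].
    - split; [apply Rmin_r|apply Rmax_r]. }
  unfold g in Hg. replace (f y - RtoC y * f1 x - (f x - RtoC x * f1 x))%C with (f y - f x - RtoC (y - x) * f1 x)%C in Hg by (rewrite RtoC_minus; ring).
  replace (K * (y - x)^2) with (K * Rabs (y - x) * Rabs (y - x)); auto.
  rewrite <- (pow2_abs (y - x)). ring.
Qed.

Lemma quad_const (f : R -> C) K a b : a <= b ->
  (forall x y, a <= x <= b -> a <= y <= b -> Cmod (f y - f x)%C <= K * (y - x)^2) -> f b = f a.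
Proof.
  intros Hab H. apply Cmod_eps_eq. intros e He.
  set (L := Rabs K * (b - a)^2). assert (HL : 0 <= L) by (apply Rmult_le_pos; [apply Rabs_pos|apply pow2_ge_0]).
  destruct (INR_unbounded (L / e)) as [N HN]. set (n := S N).
  assert (Hn : 0 < INR n) by (apply lt_0_INR; unfold n; lia).
  assert (Hn2 : L / e < INR n) by (unfold n; rewrite S_INR; lra).
  set (h := (b - a) / INR n). assert (Hh : 0 <= h) by (unfold h; apply le_div_intro; lra).
  assert (Ehn : INR n * h = b - a) by (unfold h; field; lra).
  assert (W : forall i, (i <= n)%nat -> Cmod (f (a + INR i * h)%R - f a)%C <= INR i * (Rabs K * h^2)).
  { induction i; intros Hi.
    - simpl (INR 0). rewrite !Rmult_0_l, Rplus_0_r. replace (f a - f a)%C with (RtoC 0) by ring. rewrite Cmod_0. lra.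
    - assert (Hi1 : INR (S i) <= INR n) by now apply le_INR. rewrite S_INR in Hi1.
      assert (Hi0 := pos_INR i).
      eapply Rle_trans; [apply (Cmod_tri3 _ (f (a + INR i * h)))|]. rewrite S_INR.
      assert (Q : Cmod (f (a + (INR i + 1) * h)%R - f (a + INR i * h)%R)%C <= K * (a + (INR i + 1) * h - (a + INR i * h))^2).
      { apply H; nra. }
      replace (a + (INR i + 1) * h - (a + INR i * h)) with h in Q by ring.
      assert (K * h^2 <= Rabs K * h^2) by (apply Rmult_le_compat_r; [apply pow2_ge_0|apply Rle_abs]).
      specialize (IHi ltac:(lia)). lra. }
  specialize (W n (Nat.le_refl n)). rewrite Ehn in W. replace (a + (b - a)) with b in W by ring.
  eapply Rle_trans; [exact W|].
  replace (INR n * (Rabs K * h ^ 2)) with (L / INR n) by (unfold L, h; field; lra).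
  apply Rlt_le. apply Rlt_div_l; auto. apply (Rmult_lt_compat_r e) in Hn2; auto.
  replace (L / e * e) with L in Hn2 by (field; lra). lra.
Qed.

Definition cis (t : R) : C := (cos t, sin t).
Lemma cis_plus a b : cis (a + b) = (cis a * cis b)%C.
Proof. unfold cis. rewrite cos_plus, sin_plus. apply C_ext; simpl; ring. Qed.
Lemma cis_exp t : cis t = Cexp (RtoC t * Ci)%C.
Proof.
  unfold cis, Cexp. replace (Re (RtoC t * Ci)%C) with 0 by (simpl; ring). replace (Im (RtoC t * Ci)%C) with t by (simpl; ring).
  rewrite exp_0. apply C_ext; simpl; ring.
Qed.
Lemma Cmod_cis t : Cmod (cis t) = 1.
Proof. rewrite cis_exp, Cmod_Cexp. replace (Re (RtoC t * Ci)%C) with 0 by (simpl; ring). apply exp_0. Qed.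
Lemma cis_0 : cis 0 = 1.
Proof. unfold cis. now rewrite cos_0, sin_0. Qed.
Lemma cis_nz t : cis t <> 0.
Proof. intros E. assert (Q := Cmod_cis t). rewrite E, Cmod_0 in Q. lra. Qed.

Definition Amom (n : nat) (w : C) : C := Iinf (fun q => RtoC (q ^ n) * Cexp (- (w * RtoC (q ^ 3))))%C.

Lemma mom_at_0 lam w n : mom lam w n 0 = Amom n w.
Proof.
  apply Iinf_ext. intros q _. unfold ki. rewrite Rmult_0_r. f_equal. f_equal. ring.
Qed.

Lemma rotation n d t : 0 <= d < PI / 6 -> - d <= t <= d -> (cis (INR (S n) * t) * Amom n (cis (3 * t)))%C = Amom n 1.
Proof.
  intros Hd Ht. assert (HPI := PI_RGT_0).
  set (th := cos (3 * d)).
  assert (Hth : 0 < th) by (apply cos_gt_0; lra).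
  assert (Hct : forall t, - d <= t <= d -> th <= cos (3 * t)).
  { intros u Hu. unfold th. destruct (Rle_dec 0 u).
    - apply cos_decr_1; lra.
    - rewrite <- (cos_neg (3 * u)). apply cos_decr_1; lra. }
  set (S0 := fun (q t : R) => (RtoC (INR (S n) * t) * Ci - RtoC (q ^ 3) * Cexp (RtoC (3 * t) * Ci))%C).
  set (S1 := fun (q t : R) => (RtoC (INR (S n)) * Ci - RtoC (q ^ 3) * ((RtoC 3 * Ci) * Cexp (RtoC (3 * t) * Ci)))%C).
  set (S2 := fun (q t : R) => (- (RtoC (q ^ 3) * ((RtoC 3 * Ci) * ((RtoC 3 * Ci) * Cexp (RtoC (3 * t) * Ci)))))%C).
  assert (De : forall t, rder (fun t => Cexp (RtoC (3 * t) * Ci)%C) t ((RtoC 3 * Ci) * Cexp (RtoC (3 * t) * Ci))%C).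
  { intros u. apply (rder_comp_c Cexp (fun t => RtoC (3 * t) * Ci)%C); [|apply cder_Cexp].
    replace (RtoC 3 * Ci)%C with (RtoC 3 * Ci + RtoC (3 * u) * 0)%C by ring.
    apply (rder_mult (fun t => RtoC (3 * t)) (fun _ => Ci)); [|apply rder_const].
    apply (rder_RtoC (fun t => 3 * t)). auto_derive; auto. ring. }
  assert (DS0 : forall q t, rder (S0 q) t (S1 q t)).
  { intros q u. apply rder_minus; [|apply rder_scal; apply De].
    replace (RtoC (INR (S n)) * Ci)%C with (RtoC (INR (S n)) * Ci + RtoC (INR (S n) * u) * 0)%C by ring.
    apply (rder_mult (fun t => RtoC (INR (S n) * t)) (fun _ => Ci)); [|apply rder_const].
    apply (rder_RtoC (fun t => INR (S n) * t)). generalize (INR (S n)). intros c. auto_derive; auto. ring. }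
  assert (DS1 : forall q t, rder (S1 q) t (S2 q t)).
  { intros q u. unfold S2. replace (- (RtoC (q ^ 3) * (RtoC 3 * Ci * (RtoC 3 * Ci * Cexp (RtoC (3 * u) * Ci)))))%C with
     (0 - (RtoC (q ^ 3) * (RtoC 3 * Ci * (RtoC 3 * Ci * Cexp (RtoC (3 * u) * Ci)))))%C by ring.
    apply rder_minus; [apply rder_const|]. apply rder_scal, rder_scal, De. }
  set (f := fun (q t : R) => (RtoC (q ^ n) * Cexp (S0 q t))%C).
  set (f1 := fun (q t : R) => (S1 q t * f q t)%C).
  set (f2 := fun (q t : R) => (S2 q t * f q t + S1 q t * f1 q t)%C).
  assert (Df : forall q t, rder (f q) t (f1 q t)).
  { intros q u. unfold f1, f. replace (S1 q u * (RtoC (q ^ n) * Cexp (S0 q u)))%C with (RtoC (q ^ n) * (S1 q u * Cexp (S0 q u)))%C by ring.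
    apply rder_scal. apply (rder_comp_c Cexp (S0 q)); [apply DS0|apply cder_Cexp]. }
  assert (Df1 : forall q t, rder (f1 q) t (f2 q t)).
  { intros q u. apply rder_mult; [apply DS1|apply Df]. }
  assert (Hmf : forall q t, 0 <= q -> - d <= t <= d -> Cmod (f q t) <= q ^ n * exp (0 * q - th * q ^ 3)).
  { intros q u Hq Hu. unfold f. rewrite Cmod_mult, RtoC_pow_mod, Cmod_Cexp by auto. apply Rmult_le_compat_l; [now apply pow_le|].
    apply exp_le_compat. unfold S0. rewrite Re_minus, re_scal_l, <- cis_exp.
    replace (Re (RtoC (INR (S n) * u) * Ci)%C) with 0 by (rewrite re_mult_Ci, im_RtoC; ring). unfold cis, Re. simpl fst.
    specialize (Hct u Hu). assert (0 <= q^3) by now apply pow_le. nra. }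
  assert (Hm1 : forall q t, 0 <= q -> Cmod (S1 q t) <= (INR n + 4) * (1 + q) ^ 3).
  { intros q u Hq. unfold S1. eapply Rle_trans; [apply Cmod_triangle_minus|].
    rewrite !Cmod_mult, Cmod_Ci, <- cis_exp, Cmod_cis, RtoC_pow_mod, !Cmod_RtoC_pos by (auto using pos_INR; lra).
    rewrite S_INR. assert (Hn := pos_INR n). assert (q ^ 3 <= (1 + q)^3) by (apply pow_incr; lra).
    assert (1 <= (1 + q)^3) by (apply pow_R1_Rle; lra). nra. }
  assert (Hm2 : forall q t, 0 <= q -> Cmod (S2 q t) <= 9 * (1 + q) ^ 6).
  { intros q u Hq. unfold S2. rewrite Cmod_opp, !Cmod_mult, Cmod_Ci, <- cis_exp, Cmod_cis, RtoC_pow_mod, !Cmod_RtoC_pos by (auto; lra).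
    assert (q ^ 3 <= (1 + q)^3) by (apply pow_incr; lra). assert ((1 + q)^3 <= (1 + q)^6) by (apply Rle_pow; [lra|lia]). lra. }
  destruct (poly_cubic_bound (n + 2) 0 th Hth) as [K0 [HK0p HK0]].
  destruct (poly_cubic_bound (n + 5) 0 th Hth) as [K1 [HK1p HK1]].
  destruct (poly_cubic_bound (n + 8) 0 th Hth) as [K2 [HK2p HK2]].
  assert (Hpw : forall q m, 0 <= q -> (1 + q) ^ m * (q ^ n * exp (0 * q - th * q ^ 3)) <= (1 + q) ^ (n + m) * exp (0 * q - th * q^3)).
  { intros q m Hq. rewrite pow_add. assert (q ^ n <= (1 + q)^n) by (apply pow_incr; lra).
    assert (0 < exp (0 * q - th * q ^ 3)) by apply exp_pos. assert (0 <= (1 + q)^m) by (apply pow_le; lra).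
    replace ((1 + q) ^ n * (1 + q) ^ m * exp (0 * q - th * q ^ 3)) with ((1 + q) ^ m * ((1 + q) ^ n * exp (0 * q - th * q ^ 3))) by ring.
    apply Rmult_le_compat_l; auto. apply Rmult_le_compat_r; lra. }
  assert (Hq2 : forall q, 0 <= q -> 0 < (1 + q)^2) by (intros; apply pow_lt; lra).
  assert (Hcq : forall t q, ccont (fun q => f q t) q).
  { intros u q. apply ccont_mult.
    - apply (ccont_RtoC (fun q => q ^ n)). apply (ex_derive_continuous (V := R_NormedModule)). auto_derive. auto.
    - apply (ccont_comp_z Cexp (fun q => S0 q u)); [eapply cder_czcont, cder_Cexp|].
      apply ccont_minus; [apply ccont_const|]. apply ccont_mult; [|apply ccont_const].
      apply (ccont_RtoC (fun q => q ^ 3)). apply (ex_derive_continuous (V := R_NormedModule)). auto_derive. auto. }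
  assert (Hcq1 : forall t q, ccont (fun q => f1 q t) q).
  { intros u q. apply ccont_mult; [|apply Hcq]. apply ccont_minus; [apply ccont_const|]. apply ccont_mult; [|apply ccont_const].
      apply (ccont_RtoC (fun q => q ^ 3)). apply (ex_derive_continuous (V := R_NormedModule)). auto_derive. auto. }
  assert (Dom0 : forall t, - d <= t <= d -> dom (fun q => f q t) K0).
  { intros u Hu. split; [intros; apply Hcq|]. intros q Hq. apply le_div_intro; auto.
    specialize (Hmf q u Hq Hu). specialize (HK0 q Hq). specialize (Hpw q 2%nat Hq). specialize (Hq2 q Hq). nra. }
  assert (Dom1 : forall t, - d <= t <= d -> dom (fun q => f1 q t) ((INR n + 4) * K1)).
  { intros u Hu. split; [intros; apply Hcq1|]. intros q Hq. apply le_div_intro; auto. unfold f1. rewrite Cmod_mult.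
    specialize (Hmf q u Hq Hu). specialize (HK1 q Hq). specialize (Hpw q 5%nat Hq). specialize (Hm1 q u Hq). specialize (Hq2 q Hq).
    assert (Hn := pos_INR n).
    apply Rle_trans with ((INR n + 4) * (1 + q) ^ 3 * (q ^ n * exp (0 * q - th * q ^ 3)) * (1 + q)^2).
    - apply Rmult_le_compat_r; [lra|]. apply Rmult_le_compat; auto using Cmod_ge_0.
    - replace ((INR n + 4) * (1 + q) ^ 3 * (q ^ n * exp (0 * q - th * q ^ 3)) * (1 + q)^2) with
        ((INR n + 4) * ((1 + q) ^ 5 * (q ^ n * exp (0 * q - th * q ^ 3)))) by ring.
      apply Rmult_le_compat_l; lra. }
  set (KK := (9 + (INR n + 4)^2) * K2).
  assert (Hf2 : forall q t, 0 <= q -> - d <= t <= d -> Cmod (f2 q t) <= KK / (1 + q)^2).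
  { intros q u Hq Hu. apply le_div_intro; auto. unfold f2, f1.
    replace (S2 q u * f q u + S1 q u * (S1 q u * f q u))%C with ((S2 q u + S1 q u * S1 q u) * f q u)%C by ring.
    rewrite Cmod_mult. specialize (Hmf q u Hq Hu). specialize (HK2 q Hq). specialize (Hpw q 8%nat Hq). specialize (Hm1 q u Hq).
    specialize (Hm2 q u Hq). specialize (Hq2 q Hq). assert (Hn := pos_INR n). assert (HS := Cmod_ge_0 (S1 q u)).
    assert (H3 : 0 < (1 + q)^3) by (apply pow_lt; lra).
    assert (HA : Cmod (S2 q u + S1 q u * S1 q u)%C <= (9 + (INR n + 4)^2) * (1 + q)^6).
    { eapply Rle_trans; [apply Cmod_triangle|]. rewrite Cmod_mult.
      assert (Cmod (S1 q u) * Cmod (S1 q u) <= ((INR n + 4) * (1 + q) ^ 3) * ((INR n + 4) * (1 + q) ^ 3)) by (apply Rmult_le_compat; auto).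
      replace (((INR n + 4) * (1 + q) ^ 3) * ((INR n + 4) * (1 + q) ^ 3)) with ((INR n + 4)^2 * (1 + q)^6) in H by ring. lra. }
    apply Rle_trans with ((9 + (INR n + 4)^2) * (1 + q)^6 * (q ^ n * exp (0 * q - th * q ^ 3)) * (1 + q)^2).
    - apply Rmult_le_compat_r; [lra|]. apply Rmult_le_compat; auto using Cmod_ge_0.
    - replace ((9 + (INR n + 4)^2) * (1 + q)^6 * (q ^ n * exp (0 * q - th * q ^ 3)) * (1 + q)^2) with
        ((9 + (INR n + 4)^2) * ((1 + q) ^ 8 * (q ^ n * exp (0 * q - th * q ^ 3)))) by ring.
      unfold KK. apply Rmult_le_compat_l; [nra|lra]. }
  assert (Hzero : forall t, - d <= t <= d -> Iinf (fun q => f1 q t) = 0).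
  { intros u Hu. transitivity (- (RtoC (0 ^ (S n)) * (Ci * Cexp (S0 0%R u))))%C; [|rewrite pow_i by lia; ring].
    apply (Iinf_FTC (fun q => RtoC (q ^ (S n)) * (Ci * Cexp (S0 q u)))%C (fun q => f1 q u) _ K0 (Dom1 u Hu)).
    - intros q Hq.
      assert (Q := rder_mult (fun q => RtoC (q ^ (S n))) (fun q => Ci * Cexp (S0 q u))%C q
         (RtoC (INR (S n) * q ^ n)) (Ci * ((0 - RtoC (3 * q ^ 2) * Cexp (RtoC (3 * u) * Ci)) * Cexp (S0 q u)))%C).
      cbv beta in Q. unfold f1, f, S1.
      match type of Q with _ -> _ -> rder _ _ ?t => match goal with |- rder _ _ ?t' => replace t' with t end end.
      + apply Q.
        * apply (rder_RtoC (fun q => q ^ (S n))). replace (INR (S n) * q ^ n) with (INR (S n) * 1 * q ^ (Init.Nat.pred (S n))) by (simpl Init.Nat.pred; ring). apply is_derive_pow. exact (is_derive_id (K := R_AbsRing) q).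
        * apply rder_scal. apply (rder_comp_c Cexp (fun q => S0 q u)); [|apply cder_Cexp].
          apply rder_minus; [apply rder_const|].
          replace (RtoC (3 * q ^ 2) * Cexp (RtoC (3 * u) * Ci))%C with (RtoC (3 * q ^ 2) * Cexp (RtoC (3 * u) * Ci) + RtoC (q^3) * 0)%C by ring.
          apply (rder_mult (fun q => RtoC (q ^ 3)) (fun _ => Cexp (RtoC (3 * u) * Ci))); [|apply rder_const].
          apply (rder_RtoC (fun q => q ^ 3)). auto_derive; auto. ring.
      + set (E := Cexp (S0 q u)). set (E3 := Cexp (RtoC (3 * u) * Ci)%C).
        replace (RtoC (q ^ S n)) with (RtoC q * RtoC (q ^ n))%C by (rewrite <- RtoC_mult; reflexivity).
        replace (RtoC (q ^ 3)) with (RtoC q * RtoC (q^2))%C by (rewrite <- RtoC_mult; f_equal; ring).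
        rewrite (RtoC_mult 3), (RtoC_mult (INR (S n))). ring.
    - intros q Hq. rewrite !Cmod_mult, Cmod_Ci.
      assert (H0 := proj2 (Dom0 u Hu) q Hq). unfold f in H0. rewrite Cmod_mult in H0.
      replace (q ^ S n) with (q * q ^ n) by reflexivity. rewrite RtoC_mult, Cmod_mult, (Cmod_RtoC_pos q) by auto.
      set (X := Cmod (RtoC (q ^ n)) * Cmod (Cexp (S0 q u))) in *.
      replace (q * Cmod (RtoC (q ^ n)) * (1 * Cmod (Cexp (S0 q u)))) with (q * X) by (unfold X; ring).
      assert (0 <= X) by (apply Rmult_le_pos; apply Cmod_ge_0).
      apply Rle_trans with ((1 + q) * (K0 / (1 + q)^2)); [apply Rmult_le_compat; lra|].
      right. field. lra. }
  set (Psi := fun t => Iinf (fun q => f q t)).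
  assert (HPsi : forall t, Psi t = (cis (INR (S n) * t) * Amom n (cis (3 * t)))%C \/ ~ (- d <= t <= d)).
  { intros u. destruct (classic (- d <= u <= d)) as [Hu|Hu]; [left|now right].
    assert (E : forall q, f q u = (cis (INR (S n) * u) * (RtoC (q ^ n) * Cexp (- (cis (3 * u) * RtoC (q ^ 3)))))%C).
    { intros q. unfold f, S0. rewrite <- cis_exp. unfold Cminus. rewrite Cexp_plus, <- cis_exp.
      rewrite (Cmult_comm (RtoC (q ^ 3))). ring. }
    unfold Psi, Amom. rewrite <- (Iinf_scal _ _ K0).
    - apply Iinf_ext. intros; apply E.
    - replace (fun q => RtoC (q ^ n) * Cexp (- (cis (3 * u) * RtoC (q ^ 3))))%C with (fun q => (cis (- (INR (S n) * u)) * f q u)%C).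
      + destruct (Dom0 u Hu) as [D1 D2]. split; intros q Hq.
        * apply ccont_mult; auto. apply ccont_const.
        * rewrite Cmod_mult, Cmod_cis, Rmult_1_l. auto.
      + apply FunctionalExtensionality.functional_extensionality. intros q. rewrite E, Cmult_assoc, <- cis_plus.
        rewrite Rplus_opp_l, cis_0. ring. }
  assert (Hconst : forall a b, - d <= a -> a <= b -> b <= d -> Psi b = Psi a).
  { intros a b Ha Hab Hb. apply (quad_const Psi KK); auto. intros x y Hx Hy.
    assert (E : (Psi y - Psi x)%C = Iinf (fun q => f q y - f q x - RtoC (y - x) * f1 q x)%C).
    { rewrite (Iinf_minus _ _ (K0 + K0) (Cmod (RtoC (y - x)) * ((INR n + 4) * K1))).
      - rewrite (Iinf_minus _ _ K0 K0) by (apply Dom0; lra).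
        rewrite (Iinf_scal _ _ ((INR n + 4) * K1)) by (apply Dom1; lra). rewrite Hzero by lra. unfold Psi. ring.
      - apply dom_minus; apply Dom0; lra.
      - apply dom_scal, Dom1; lra. }
    rewrite E. apply Iinf_bound. split.
    - intros q Hq. apply ccont_minus; [apply ccont_minus; apply Hcq|]. apply ccont_mult; [apply ccont_const|apply Hcq1].
    - intros q Hq. replace (KK * (y - x) ^ 2 / (1 + q) ^ 2) with (KK / (1 + q)^2 * (y - x)^2) by (field; lra).
      apply (taylor_lip (f q) (f1 q) (KK / (1 + q)^2) a b); auto.
      + intros; eapply rder_ccont, Df.
      + apply (MV_abs (f1 q) (f2 q)).
        * intros; eapply rder_ccont, Df1.
        * intros; apply Df1.
        * intros; apply Hf2; auto; lra. }
  destruct (HPsi t) as [E|E]; [|tauto]. rewrite <- E.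
  destruct (HPsi 0) as [E0|E0]; [|exfalso; apply E0; lra].
  rewrite !Rmult_0_r, cis_0, Cmult_1_l in E0. rewrite <- E0.
  destruct (Rle_dec 0 t); [apply Hconst; lra|]. symmetry. apply Hconst; lra.
Qed.

Lemma Iinf_pos_nz (r : R -> R) M : dom (fun q => RtoC (r q)) M -> (forall q, 0 <= q -> 0 <= r q) ->
  (forall q, / 2 <= q <= 1 -> 0 < r q) -> Iinf (fun q => RtoC (r q)) <> 0.
Proof.
  intros Hd H0 H1 E. set (f := fun q => RtoC (r q)) in *.
  assert (Hc : forall q, 0 <= q -> continuous r q).
  { intros q Hq. apply (ccont_Re f q). apply Hd; auto. }
  assert (Hex : forall a b, 0 <= a <= b -> ex_RInt r a b).
  { intros a b Hab. apply (ex_RInt_continuous (V := R_CompleteNormedModule)). rewrite Rmin_left, Rmax_right by lra. intros; apply Hc; lra. }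
  set (I := RInt r (/2) 1).
  assert (HI : 0 < I). { apply RInt_gt_0; try lra. intros; apply H1; lra. intros; apply Hc; lra. }
  assert (Hcv := Iinf_cv f M Hd I HI). destruct Hcv as [N HN]. specialize (HN (S N) ltac:(lia)). rewrite E in HN.
  assert (HN1 : 1 <= INR (S N)). { rewrite S_INR. assert (Q := pos_INR N). lra. }
  revert HN. apply Rle_not_lt. eapply Rle_trans; [|apply Re_le_mod].
  replace (Re (CI f 0 (INR (S N)) - 0)%C) with (RInt r 0 (INR (S N))).
  2:{ unfold CI. simpl. rewrite Ropp_0, Rplus_0_r. reflexivity. }
  rewrite <- (RInt_Chasles (V := R_CompleteNormedModule) r 0 (/2) (INR (S N))) by (apply Hex; lra).
  rewrite <- (RInt_Chasles (V := R_CompleteNormedModule) r (/2) 1 (INR (S N))) by (apply Hex; lra).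
  assert (A1 : 0 <= RInt r 0 (/2)) by (apply RInt_ge_0; [lra|apply Hex; lra|intros; apply H0; lra]).
  assert (A2 : 0 <= RInt r 1 (INR (S N))) by (apply RInt_ge_0; [lra|apply Hex; lra|intros; apply H0; lra]).
  fold I. change (I <= RInt r 0 (/ 2) + (I + RInt r 1 (INR (S N)))). lra.
Qed.

Lemma Amom_nz n : Amom n 1 <> 0.
Proof.
  unfold Amom.
  assert (E : forall q, (RtoC (q ^ n) * Cexp (- (1 * RtoC (q ^ 3))))%C = RtoC (q ^ n * exp (- q ^ 3))).
  { intros q. rewrite RtoC_mult. f_equal. unfold Cexp.
    replace (Re (- (1 * RtoC (q ^ 3)))%C) with (- q ^ 3) by (simpl; ring).
    replace (Im (- (1 * RtoC (q ^ 3)))%C) with 0 by (simpl; ring). rewrite cos_0, sin_0. apply C_ext; simpl; ring. }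
  rewrite (Iinf_ext _ (fun q => RtoC (q ^ n * exp (- q ^ 3)))) by (intros; apply E).
  destruct (poly_cubic_bound (n + 2) 0 1 Rlt_0_1) as [K [HKp HK]].
  apply (Iinf_pos_nz _ K).
  - split.
    + intros q Hq. apply (ccont_RtoC (fun q => q ^ n * exp (- q ^ 3))). apply (ex_derive_continuous (V := R_NormedModule)). auto_derive. auto.
    + intros q Hq. apply le_div_intro; [apply pow_lt; lra|]. specialize (HK q Hq).
      assert (Hp : 0 < exp (- q^3)) by apply exp_pos. assert (0 <= q^n) by now apply pow_le.
      rewrite Cmod_RtoC_pos by nra. rewrite pow_add in HK.
      replace (0 * q - 1 * q^3) with (- q^3) in HK by ring.
      assert (q ^ n <= (1 + q)^n) by (apply pow_incr; lra). assert (0 < (1 + q)^2) by (apply pow_lt; lra).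
      eapply Rle_trans; [|exact HK].
      replace ((1 + q) ^ n * (1 + q) ^ 2 * exp (- q ^ 3)) with ((1 + q)^n * exp (- q^3) * (1 + q)^2) by ring.
      apply Rmult_le_compat_r; [lra|]. apply Rmult_le_compat_r; lra.
  - intros q Hq. apply Rmult_le_pos; [now apply pow_le|apply Rlt_le, exp_pos].
  - intros q Hq. apply Rmult_lt_0_compat; [apply pow_lt; lra|apply exp_pos].
Qed.

(* The Laplace integral [J_c(z) = int_0^oo c e^{c q z - c^3 q^3} dq] converges and decays along [z = x e]. Below, [j0 .. j3]
   are [J_c] and its first three derivatives on that ray, up to powers of [e], and [jA], [jB] are [J_c(0)] and [J_c'(0)]. *)
Definition valley (c e : C) := Re (c * e)%C < 0 /\ 0 < Re (c * c * c)%C /\ c <> 0.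

Definition jA (c : C) : C := (c * Amom 0 (c * c * c))%C.
Definition jB (c : C) : C := (c * c * Amom 1 (c * c * c))%C.
Definition j0 (c e : C) (x : R) : C := (c * mom (c * e) (c * c * c) 0 x)%C.
Definition j1 (c e : C) (x : R) : C := (c * ((c * e) * mom (c * e) (c * c * c) 1 x))%C.
Definition j2 (c e : C) (x : R) : C := (c * ((c * e) * ((c * e) * mom (c * e) (c * c * c) 2 x)))%C.
Definition j3 (c e : C) (x : R) : C := (c * ((c * e) * ((c * e) * ((c * e) * mom (c * e) (c * c * c) 3 x))))%C.

Section J.
Variables (c e : C).
Hypothesis (H : valley c e).

Let gam := - Re (c * e)%C.
Let th := Re (c * c * c)%C.
Let Hg : 0 < gam. Proof. destruct H. unfold gam. lra. Qed.
Let Hl : Re (c * e)%C <= - gam. Proof. unfold gam. lra. Qed.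
Let Ht : 0 < th. Proof. apply H. Qed.
Let Hw : th <= Re (c * c * c)%C. Proof. unfold th. lra. Qed.

Lemma j0_rder x : 0 <= x -> rder (j0 c e) x (j1 c e x).
Proof using All. intros Hx. apply rder_scal. apply (mom_rder _ _ gam th); auto. Qed.
Lemma j1_rder x : 0 <= x -> rder (j1 c e) x (j2 c e x).
Proof using All. intros Hx. apply rder_scal, rder_scal. apply (mom_rder _ _ gam th); auto. Qed.

Lemma j2_eq x : 0 <= x -> (RtoC 3 * j2 c e x = e * e * e * RtoC x * j0 c e x + e * e)%C.
Proof using All.
  intros Hx. assert (Q := mom_parts0 (c * e)%C (c * c * c)%C gam th Hg Hl Ht Hw x Hx).
  assert (Hc : c <> 0) by apply H. unfold j2, j0.
  replace (RtoC 3 * (c * (c * e * (c * e * mom (c * e) (c * c * c) 2 x))))%C with (e * e * (RtoC 3 * (c * c * c) * mom (c * e) (c * c * c) 2 x))%C by ring.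
  rewrite Q. ring.
Qed.
Lemma j3_eq x : 0 <= x -> (RtoC 3 * j3 c e x = e * e * e * (j0 c e x + RtoC x * j1 c e x))%C.
Proof using All.
  intros Hx. assert (Q := mom_parts1 (c * e)%C (c * c * c)%C gam th Hg Hl Ht Hw x Hx).
  unfold j3, j0, j1.
  replace (RtoC 3 * (c * (c * e * (c * e * (c * e * mom (c * e) (c * c * c) 3 x)))))%C with (e * e * e * c * (RtoC 3 * (c * c * c) * mom (c * e) (c * c * c) 3 x))%C by ring.
  rewrite Q. ring.
Qed.
Lemma j_bounds : exists K, 0 <= K /\ forall x, 0 <= x -> Cmod (j0 c e x) <= K / (1 + x) /\ Cmod (j1 c e x) <= K / (1 + x)^2 /\
  Cmod (j2 c e x) <= K / (1 + x)^3 /\ Cmod (j3 c e x) <= K / (1 + x)^4.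
Proof using All.
  destruct (mom_bound (c * e)%C (c * c * c)%C gam th Hg Hl Ht Hw 0) as [K0 [P0 B0]].
  destruct (mom_bound (c * e)%C (c * c * c)%C gam th Hg Hl Ht Hw 1) as [K1 [P1 B1]].
  destruct (mom_bound (c * e)%C (c * c * c)%C gam th Hg Hl Ht Hw 2) as [K2 [P2 B2]].
  destruct (mom_bound (c * e)%C (c * c * c)%C gam th Hg Hl Ht Hw 3) as [K3 [P3 B3]].
  set (a := Cmod c). set (b := Cmod (c * e)%C). assert (Ha : 0 <= a) by apply Cmod_ge_0. assert (Hb : 0 <= b) by apply Cmod_ge_0.
  exists (a * K0 + a * (b * K1) + a * (b * (b * K2)) + a * (b * (b * (b * K3)))).
  assert (Q0 : 0 <= a * K0) by (repeat apply Rmult_le_pos; auto).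
  assert (Q1 : 0 <= a * (b * K1)) by (repeat apply Rmult_le_pos; auto).
  assert (Q2 : 0 <= a * (b * (b * K2))) by (repeat apply Rmult_le_pos; auto).
  assert (Q3 : 0 <= a * (b * (b * (b * K3)))) by (repeat apply Rmult_le_pos; auto).
  split; [lra|]. intros x Hx.
  assert (S : forall n X Y, X <= Y -> X / (1 + x)^n <= Y / (1 + x)^n).
  { intros n X Y HXY. apply Rmult_le_compat_r; auto. apply Rlt_le, Rinv_0_lt_compat, pow_lt. lra. }
  unfold j0, j1, j2, j3. unfold b in *. clearbody gam th. clear Hg Hl Ht Hw.
  set (l := (c * e)%C) in *. clearbody l. rewrite !Cmod_mult. fold a. set (b' := Cmod l) in *.
  repeat split.
  - rewrite <- (pow_1 (1 + x)). eapply Rle_trans; [|apply (S 1%nat (a * K0)); lra].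
    unfold Rdiv. rewrite Rmult_assoc. apply Rmult_le_compat_l; [auto|apply B0; auto].
  - eapply Rle_trans; [|apply (S 2%nat (a * (b' * K1))); lra].
    unfold Rdiv. rewrite !Rmult_assoc. do 2 (apply Rmult_le_compat_l; [auto|]). apply B1; auto.
  - eapply Rle_trans; [|apply (S 3%nat (a * (b' * (b' * K2)))); lra].
    unfold Rdiv. rewrite !Rmult_assoc. do 3 (apply Rmult_le_compat_l; [auto|]). apply B2; auto.
  - eapply Rle_trans; [|apply (S 4%nat (a * (b' * (b' * (b' * K3))))); lra].
    unfold Rdiv. rewrite !Rmult_assoc. do 4 (apply Rmult_le_compat_l; [auto|]). apply B3; auto.
Qed.
Lemma j0_0 : j0 c e 0 = jA c.
Proof using. unfold j0, jA. now rewrite mom_at_0. Qed.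
Lemma j1_0 : j1 c e 0 = (e * jB c)%C.
Proof using. unfold j1, jB. rewrite mom_at_0. ring. Qed.
End J.

(* [k] is the restriction to the ray [x e] of a solution of [3 k'' = z k]. *)
Definition ray_ok (e : C) (k kp : R -> C) (K : R) :=
  (forall x, 0 <= x -> rder k x (kp x)) /\ (forall x, 0 <= x -> rder kp x (e * e * e / RtoC 3 * RtoC x * k x)%C) /\
  (forall x, 0 <= x -> Cmod (k x) <= K / (1 + x)^4) /\ (forall x, 0 <= x -> Cmod (kp x) <= K / (1 + x)^4).

Lemma C3_nz : RtoC 3 <> 0.
Proof. intros E. apply RtoC_inj in E. lra. Qed.

Lemma ray_kernel e c1 c2 : Cmod e = 1 -> valley c1 e -> valley c2 e ->
  exists K, ray_ok e (fun x => j0 c1 e x - j0 c2 e x)%C (fun x => j1 c1 e x - j1 c2 e x)%C K /\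
   (e * Iinf (fun x => j0 c1 e x - j0 c2 e x)%C = RtoC 3 * (jA c2 * jB c1 - jA c1 * jB c2))%C.
Proof.
  intros He V1 V2. destruct (j_bounds c1 e V1) as [K1 [P1 B1]]. destruct (j_bounds c2 e V2) as [K2 [P2 B2]].
  set (K := K1 + K2). set (k := fun x => (j0 c1 e x - j0 c2 e x)%C). set (kp := fun x => (j1 c1 e x - j1 c2 e x)%C).
  assert (Hsum : forall n x, 0 <= x -> K1 / (1 + x)^n + K2 / (1 + x)^n = K / (1 + x)^n).
  { intros n x Hx. unfold K. field. apply pow_nonzero. lra. }
  assert (Hen : e <> 0). { intros E. rewrite E, Cmod_0 in He. lra. }
  assert (E2 : forall x, 0 <= x -> (RtoC 3 * (j2 c1 e x - j2 c2 e x) = e * e * e * RtoC x * k x)%C).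
  { intros x Hx. replace (RtoC 3 * (j2 c1 e x - j2 c2 e x))%C with (RtoC 3 * j2 c1 e x - RtoC 3 * j2 c2 e x)%C by ring.
    rewrite (j2_eq c1 e V1), (j2_eq c2 e V2) by auto. unfold k. ring. }
  assert (E3 : forall x, 0 <= x -> (RtoC 3 * (j3 c1 e x - j3 c2 e x) = e * e * e * (k x + RtoC x * kp x))%C).
  { intros x Hx. replace (RtoC 3 * (j3 c1 e x - j3 c2 e x))%C with (RtoC 3 * j3 c1 e x - RtoC 3 * j3 c2 e x)%C by ring.
    rewrite (j3_eq c1 e V1), (j3_eq c2 e V2) by auto. unfold k, kp. ring. }
  assert (HK : 0 <= K) by (unfold K; lra).
  assert (Bk : forall x, 0 <= x -> Cmod (k x) <= K).
  { intros x Hx. eapply Rle_trans; [apply Cmod_triangle_minus|]. destruct (B1 x Hx) as [b1 _]. destruct (B2 x Hx) as [b2 _].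
    assert (forall X, 0 <= X -> X / (1 + x) <= X). { intros X HX. apply Rle_div_l; nra. }
    assert (Q1 := H K1 P1). assert (Q2 := H K2 P2). unfold K. lra. }
  assert (Bkp : forall x, 0 <= x -> Cmod (kp x) <= K).
  { intros x Hx. eapply Rle_trans; [apply Cmod_triangle_minus|]. destruct (B1 x Hx) as [_ [b1 _]]. destruct (B2 x Hx) as [_ [b2 _]].
    assert (forall X, 0 <= X -> X / (1 + x)^2 <= X). { intros X HX. apply Rle_div_l; [apply pow_lt; lra|]. assert (1 <= (1 + x)^2) by (apply pow_R1_Rle; lra). nra. }
    assert (Q1 := H K1 P1). assert (Q2 := H K2 P2). unfold K. lra. }
  assert (B2' : forall x, 0 <= x -> Cmod (j2 c1 e x - j2 c2 e x)%C <= K / (1 + x)^3).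
  { intros x Hx. eapply Rle_trans; [apply Cmod_triangle_minus|]. rewrite <- Hsum by auto.
    destruct (B1 x Hx) as [_ [_ [b1 _]]]. destruct (B2 x Hx) as [_ [_ [b2 _]]]. lra. }
  assert (B3' : forall x, 0 <= x -> Cmod (j3 c1 e x - j3 c2 e x)%C <= K / (1 + x)^4).
  { intros x Hx. eapply Rle_trans; [apply Cmod_triangle_minus|]. rewrite <- Hsum by auto.
    destruct (B1 x Hx) as [_ [_ [_ b1]]]. destruct (B2 x Hx) as [_ [_ [_ b2]]]. lra. }
  assert (Me : Cmod (e * e * e)%C = 1) by (rewrite !Cmod_mult, He; ring).
  assert (Bk4 : forall x, 0 <= x -> Cmod (k x) <= 16 * K / (1 + x)^4).
  { intros x Hx. assert (H4 : 0 < (1 + x)^4) by (apply pow_lt; lra). apply le_div_intro; auto.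
    destruct (Rle_dec x 1) as [L|L].
    - specialize (Bk x Hx). assert ((1 + x)^4 <= 16) by (replace 16 with (2^4) by ring; apply pow_incr; lra).
      assert (Q := Cmod_ge_0 (k x)). nra.
    - assert (Q := f_equal Cmod (E2 x Hx)). rewrite !(Cmod_mult (RtoC 3)), (Cmod_mult (e * e * e * RtoC x)%C), (Cmod_mult (e * e * e)%C), Me, !Cmod_RtoC_pos in Q by lra.
      specialize (B2' x Hx). assert (H3 : 0 < (1 + x)^3) by (apply pow_lt; lra).
      apply (Rmult_le_compat_r ((1 + x)^3)) in B2'; [|lra].
      replace (K / (1 + x) ^ 3 * (1 + x) ^ 3) with K in B2' by (field; lra).
      assert (Q0 := Cmod_ge_0 (k x)).
      assert (x * Cmod (k x) * (1 + x)^3 <= 3 * K) by nra.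
      replace (Cmod (k x) * (1 + x)^4) with ((1 + x) * Cmod (k x) * (1 + x)^3) by ring.
      assert ((1 + x) * Cmod (k x) * (1 + x)^3 <= 2 * x * Cmod (k x) * (1 + x)^3).
      { apply Rmult_le_compat_r; [lra|]. nra. }
      nra. }
  assert (Bkp4 : forall x, 0 <= x -> Cmod (kp x) <= 19 * K / (1 + x)^4).
  { intros x Hx. assert (H4 : 0 < (1 + x)^4) by (apply pow_lt; lra). apply le_div_intro; auto.
    destruct (Rle_dec x 1) as [L|L].
    - specialize (Bkp x Hx). assert ((1 + x)^4 <= 16) by (replace 16 with (2^4) by ring; apply pow_incr; lra).
      assert (Q := Cmod_ge_0 (kp x)). nra.
    - assert (E : (e * e * e * (RtoC x * kp x) = RtoC 3 * (j3 c1 e x - j3 c2 e x) - e * e * e * k x)%C).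
      { rewrite E3 by auto. ring. }
      apply (f_equal Cmod) in E. rewrite (Cmod_mult (e * e * e)%C), Me, Cmod_mult, Cmod_RtoC_pos, Rmult_1_l in E by lra.
      assert (Q : x * Cmod (kp x) <= 3 * (K / (1 + x)^4) + 16 * K / (1 + x)^4).
      { rewrite E. eapply Rle_trans; [apply Cmod_triangle_minus|]. rewrite (Cmod_mult (RtoC 3)), (Cmod_mult (e * e * e)%C), Me, Cmod_RtoC_pos, Rmult_1_l by lra.
        specialize (B3' x Hx). specialize (Bk4 x Hx). lra. }
      apply (Rmult_le_compat_r ((1 + x)^4)) in Q; [|lra].
      replace ((3 * (K / (1 + x) ^ 4) + 16 * K / (1 + x) ^ 4) * (1 + x) ^ 4) with (19 * K) in Q by (field; lra).
      assert (Q0 := Cmod_ge_0 (kp x)). assert (Cmod (kp x) <= x * Cmod (kp x)) by nra. nra. }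
  assert (Rk : forall x, 0 <= x -> rder k x (kp x)).
  { intros x Hx. apply rder_minus; apply j0_rder; auto. }
  assert (Rkp : forall x, 0 <= x -> rder kp x (e * e * e / RtoC 3 * RtoC x * k x)%C).
  { intros x Hx. replace (e * e * e / RtoC 3 * RtoC x * k x)%C with (j2 c1 e x - j2 c2 e x)%C.
    - apply rder_minus; apply j1_rder; auto.
    - transitivity (/ RtoC 3 * (e * e * e * RtoC x * k x))%C; [|field; try apply C3_nz].
      rewrite <- E2 by auto. field; try apply C3_nz. }
  exists (19 * K). split.
  - repeat split; auto. intros x Hx. eapply Rle_trans; [apply Bk4; auto|].
    apply Rmult_le_compat_r; [apply Rlt_le, Rinv_0_lt_compat, pow_lt; lra|lra].
  - assert (Dk : dom k (16 * K)).
    { split; [intros x Hx; eapply rder_ccont, Rk; auto|]. intros x Hx. eapply Rle_trans; [apply Bk4; auto|].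
      apply Rmult_le_compat_l; [lra|]. apply Rinv_le_contravar; [apply pow_lt; lra|]. apply Rle_pow; [lra|lia]. }
    assert (E : Iinf (fun x => e * e / RtoC 3 * k x)%C = (- (k 0 * j1 c1 e 0 - kp 0 * j0 c1 e 0))%C).
    { eapply (Iinf_FTC (fun x => k x * j1 c1 e x - kp x * j0 c1 e x)%C _ _ (38 * K * K1)).
      - apply dom_scal. exact Dk.
      - intros x Hx.
        replace (e * e / RtoC 3 * k x)%C with ((kp x * j1 c1 e x + k x * j2 c1 e x) - ((e * e * e / RtoC 3 * RtoC x * k x) * j0 c1 e x + kp x * j1 c1 e x))%C.
        + apply rder_minus; apply rder_mult; auto. apply j1_rder; auto. apply j0_rder; auto.
        + assert (Q := j2_eq c1 e V1 x Hx).
          replace (j2 c1 e x) with (/ RtoC 3 * (RtoC 3 * j2 c1 e x))%C by (field; try apply C3_nz). rewrite Q. field; try apply C3_nz.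
      - intros x Hx. eapply Rle_trans; [apply Cmod_triangle_minus|]. rewrite !Cmod_mult.
        destruct (B1 x Hx) as [b0 [b1 _]]. specialize (Bk4 x Hx). specialize (Bkp4 x Hx).
        assert (A : forall X n, 0 <= X -> (1 <= n)%nat -> X / (1 + x)^n <= X / (1 + x)).
        { intros X n HX Hn. apply Rmult_le_compat_l; auto. apply Rinv_le_contravar; [lra|]. rewrite <- (pow_1 (1 + x)) at 1. apply Rle_pow; [lra|lia]. }
        assert (Aone : forall X, 0 <= X -> X / (1 + x) <= X). { intros X HX. apply Rle_div_l; nra. }
        assert (Q1 := A (16 * K) 4%nat ltac:(lra) ltac:(lia)). assert (Q2 := A (19 * K) 4%nat ltac:(lra) ltac:(lia)).
        assert (Q3 := A K1 2%nat P1 ltac:(lia)). assert (Q4 := Aone K1 P1).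
        assert (T1 : Cmod (k x) * Cmod (j1 c1 e x) <= (16 * K / (1 + x)) * K1) by (apply Rmult_le_compat; auto using Cmod_ge_0; lra).
        assert (T2 : Cmod (kp x) * Cmod (j0 c1 e x) <= (19 * K / (1 + x)) * K1) by (apply Rmult_le_compat; auto using Cmod_ge_0; lra).
        assert (Hi : 0 <= K / (1 + x)) by (apply le_div_intro; lra).
        replace (38 * K * K1 / (1 + x)) with (38 * (K / (1 + x)) * K1) by (field; lra).
        replace (16 * K / (1 + x) * K1) with (16 * (K / (1 + x)) * K1) in T1 by (field; lra).
        replace (19 * K / (1 + x) * K1) with (19 * (K / (1 + x)) * K1) in T2 by (field; lra). nra. }
    rewrite (Iinf_scal _ _ _ Dk) in E.
    transitivity (RtoC 3 / e * (e * e / RtoC 3 * Iinf k))%C.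
    + unfold k. field; auto using C3_nz.
    + rewrite E. unfold k, kp. rewrite !j0_0, !j1_0. field. auto.
Qed.

Lemma valley_cis a b : cos (a + b) < 0 -> 0 < cos (3 * a) -> valley (cis a) (cis b).
Proof.
  intros H1 H2. repeat split.
  - rewrite <- cis_plus. exact H1.
  - rewrite <- !cis_plus. replace (a + a + a) with (3 * a) by ring. exact H2.
  - apply cis_nz.
Qed.

Lemma jA_cis t d : 0 <= d < PI / 6 -> - d <= t <= d -> jA (cis t) = Amom 0 1.
Proof.
  intros Hd Ht. unfold jA. rewrite <- !cis_plus. replace (t + t + t) with (3 * t) by ring.
  rewrite <- (rotation 0 d t Hd Ht). simpl INR. now rewrite Rmult_1_l.
Qed.
Lemma jB_cis t d : 0 <= d < PI / 6 -> - d <= t <= d -> jB (cis t) = Amom 1 1.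
Proof.
  intros Hd Ht. unfold jB. rewrite <- !cis_plus. replace (t + t + t) with (3 * t) by ring.
  rewrite <- (rotation 1 d t Hd Ht). simpl INR. replace ((1 + 1) * t) with (t + t) by ring. reflexivity.
Qed.

Lemma cis_2PI3_cube : (cis (2 * PI / 3) * cis (2 * PI / 3) * cis (2 * PI / 3))%C = 1.
Proof. rewrite <- !cis_plus. replace (2 * PI / 3 + 2 * PI / 3 + 2 * PI / 3) with (2 * PI) by field. unfold cis. now rewrite cos_2PI, sin_2PI. Qed.
Lemma cis_m2PI3_cube : (cis (- (2 * PI / 3)) * cis (- (2 * PI / 3)) * cis (- (2 * PI / 3)))%C = 1.
Proof. rewrite <- !cis_plus. replace (- (2 * PI / 3) + - (2 * PI / 3) + - (2 * PI / 3)) with (- (2 * PI)) by field. unfold cis. rewrite cos_neg, sin_neg, cos_2PI, sin_2PI. now rewrite Ropp_0. Qed.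

Definition edir (psi : R) (i : nat) : C := match i with O => cis psi | S O => 1 | _ => cis (- psi) end.

(* The three identities make the boundary terms of the integrations by parts cancel at the vertex of
   the three rays, and normalise the evolution to the identity at time [0]. *)
Definition kernel_ok (psi K : R) (k kp : nat -> R -> C) :=
  (forall i, (i < 3)%nat -> ray_ok (edir psi i) (k i) (kp i) K) /\
  (k 0%nat 0 + k 1%nat 0 + k 2%nat 0 = 0)%C /\
  (kp 0%nat 0 / edir psi 0 + kp 1%nat 0 / edir psi 1 + kp 2%nat 0 / edir psi 2 = 0)%C /\
  (edir psi 0 * Iinf (k 0%nat) + edir psi 1 * Iinf (k 1%nat) + edir psi 2 * Iinf (k 2%nat) = 1)%C.

Lemma ray_ok_scal e k kp K a K' : Cmod a * K <= K' -> ray_ok e k kp K -> ray_ok e (fun x => a * k x)%C (fun x => a * kp x)%C K'.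
Proof.
  intros HK' [H1 [H2 [H3 H4]]].
  assert (Ha := Cmod_ge_0 a).
  assert (M : forall x X, 0 <= x -> X <= K / (1 + x)^4 -> Cmod a * X <= K' / (1 + x)^4).
  { intros x X Hx HX. apply Rle_trans with (Cmod a * (K / (1 + x)^4)); [now apply Rmult_le_compat_l|].
    unfold Rdiv. rewrite <- Rmult_assoc. apply Rmult_le_compat_r; auto. apply Rlt_le, Rinv_0_lt_compat, pow_lt; lra. }
  repeat split; intros x Hx.
  - apply rder_scal; auto.
  - replace (e * e * e / RtoC 3 * RtoC x * (a * k x))%C with (a * (e * e * e / RtoC 3 * RtoC x * k x))%C by (field; try apply C3_nz).
    apply rder_scal; auto.
  - rewrite Cmod_mult. auto.
  - rewrite Cmod_mult. auto.
Qed.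

Theorem airy_kernels psi : PI / 3 < psi < PI / 2 -> exists K k kp, kernel_ok psi K k kp.
Proof.
  intros Hpsi. assert (HPI := PI_RGT_0).
  set (d := PI / 3 - psi / 2). assert (Hd : 0 < d < PI / 6) by (unfold d; lra).
  set (om := 2 * PI / 3).
  assert (V1 : valley (cis d) (cis psi)).
  { apply valley_cis; [apply cos_lt_0; unfold d; lra|apply cos_gt_0; unfold d; lra]. }
  assert (Cth : cos (3 * om) = 1). { unfold om. replace (3 * (2 * PI / 3)) with (2 * PI) by field. apply cos_2PI. }
  assert (V2 : valley (cis om) (cis psi)).
  { apply valley_cis; [apply cos_lt_0; unfold om; lra|rewrite Cth; lra]. }
  assert (V3 : valley (cis om) 1).
  { rewrite <- cis_0. apply valley_cis; [apply cos_lt_0; unfold om; lra|rewrite Cth; lra]. }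
  assert (Cth' : cos (3 * - om) = 1). { replace (3 * - om) with (- (3 * om)) by ring. now rewrite cos_neg. }
  assert (V4 : valley (cis (- om)) 1).
  { rewrite <- cis_0. apply valley_cis; [|rewrite Cth'; lra]. replace (- om + 0) with (- om) by ring. rewrite cos_neg. apply cos_lt_0; unfold om; lra. }
  assert (V5 : valley (cis (- om)) (cis (- psi))).
  { apply valley_cis; [|rewrite Cth'; lra]. replace (- om + - psi) with (- (om + psi)) by ring. rewrite cos_neg. apply cos_lt_0; unfold om; lra. }
  assert (V6 : valley (cis (- d)) (cis (- psi))).
  { apply valley_cis.
    - replace (- d + - psi) with (- (d + psi)) by ring. rewrite cos_neg. apply cos_lt_0; unfold d; lra.
    - replace (3 * - d) with (- (3 * d)) by ring. rewrite cos_neg. apply cos_gt_0; unfold d; lra. }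
  destruct (ray_kernel (cis psi) (cis d) (cis om) (Cmod_cis _) V1 V2) as [K1 [R1 N1]].
  destruct (ray_kernel 1 (cis om) (cis (- om)) Cmod_1 V3 V4) as [K2 [R2 N2]].
  destruct (ray_kernel (cis (- psi)) (cis (- om)) (cis (- d)) (Cmod_cis _) V5 V6) as [K3 [R3 N3]].
  set (A := Amom 0 1) in *. set (B := Amom 1 1) in *.
  assert (A1 : jA (cis d) = A) by (apply (jA_cis d d); lra).
  assert (A2 : jA (cis (- d)) = A) by (apply (jA_cis (- d) d); lra).
  assert (B1 : jB (cis d) = B) by (apply (jB_cis d d); lra).
  assert (B2 : jB (cis (- d)) = B) by (apply (jB_cis (- d) d); lra).
  assert (A3 : jA (cis om) = (cis om * A)%C) by (unfold jA, om; now rewrite cis_2PI3_cube).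
  assert (A4 : jA (cis (- om)) = (cis (- om) * A)%C) by (unfold jA, om; now rewrite cis_m2PI3_cube).
  assert (Eoo : (cis om * cis om)%C = cis (- om)).
  { rewrite <- cis_plus. replace (om + om) with (- om + 2 * PI) by (unfold om; field).
    rewrite cis_plus. replace (cis (2 * PI)) with (RtoC 1) by (unfold cis; now rewrite cos_2PI, sin_2PI). ring. }
  assert (Einv : (cis om * cis (- om))%C = 1).
  { rewrite <- cis_plus, Rplus_opp_r. apply cis_0. }
  assert (Eoo' : (cis (- om) * cis (- om))%C = cis om).
  { rewrite <- Eoo at 1. rewrite <- Cmult_assoc, Einv. ring. }
  assert (B3 : jB (cis om) = (cis (- om) * B)%C) by (unfold jB; rewrite Eoo at 1; unfold om; now rewrite cis_2PI3_cube).
  assert (B4 : jB (cis (- om)) = (cis om * B)%C) by (unfold jB; rewrite Eoo' at 1; unfold om; now rewrite cis_m2PI3_cube).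
  set (N := (RtoC 9 * A * B * (cis om - cis (- om)))%C).
  assert (HN : N <> 0).
  { unfold N. assert (R9 : RtoC 9 <> 0) by (intros E; apply RtoC_inj in E; lra).
    repeat apply Cmult_neq_0; auto; try apply Amom_nz.
    intros E. apply (f_equal Im) in E. rewrite Im_minus in E. unfold cis, Im, om in E. simpl in E. rewrite sin_neg in E.
    assert (0 < sin (2 * PI / 3)) by (apply sin_gt_0; lra). lra. }
  set (kk := fun i : nat => match i with O => (fun x => j0 (cis d) (cis psi) x - j0 (cis om) (cis psi) x)%C
    | S O => (fun x => j0 (cis om) 1 x - j0 (cis (- om)) 1 x)%C | _ => (fun x => j0 (cis (- om)) (cis (- psi)) x - j0 (cis (- d)) (cis (- psi)) x)%C end).
  set (kkp := fun i : nat => match i with O => (fun x => j1 (cis d) (cis psi) x - j1 (cis om) (cis psi) x)%C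
    | S O => (fun x => j1 (cis om) 1 x - j1 (cis (- om)) 1 x)%C | _ => (fun x => j1 (cis (- om)) (cis (- psi)) x - j1 (cis (- d)) (cis (- psi)) x)%C end).
  set (Kn := fun i : nat => match i with O => K1 | S O => K2 | _ => K3 end).
  assert (Hray : forall i, (i < 3)%nat -> ray_ok (edir psi i) (kk i) (kkp i) (Kn i)).
  { intros i Hi. destruct i as [|[|[|i]]]; simpl; auto; lia. }
  assert (HI : forall i, (i < 3)%nat -> Iinf (fun x => / N * kk i x)%C = (/ N * Iinf (kk i))%C).
  { intros i Hi. destruct (Hray i Hi) as [Q1 [_ [Q3 _]]]. apply (Iinf_scal _ _ (Kn i)). split.
    - intros x Hx. eapply rder_ccont, Q1; auto.
    - intros x Hx. eapply Rle_trans; [apply Q3; auto|].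
      assert (HK : 0 <= Kn i). { specialize (Q3 0 (Rle_refl 0)). replace (Kn i / (1 + 0)^4) with (Kn i) in Q3 by field. eapply Rle_trans; [apply Cmod_ge_0|eauto]. }
      apply Rmult_le_compat_l; auto. apply Rinv_le_contravar; [apply pow_lt; lra|]. apply Rle_pow; [lra|lia]. }
  set (K := Cmod (/ N)%C * Rmax K1 (Rmax K2 K3)).
  exists K, (fun i x => / N * kk i x)%C, (fun i x => / N * kkp i x)%C. repeat split.
  1,2,3,4: destruct (ray_ok_scal (edir psi i) (kk i) (kkp i) (Kn i) (/ N)%C K) as [Q1 [Q2 [Q3 Q4]]]; auto.
  1,2,3,4: unfold K; apply Rmult_le_compat_l; [apply Cmod_ge_0|]; destruct i as [|[|i]]; simpl;
    [apply Rmax_l|eapply Rle_trans; [apply Rmax_l|apply Rmax_r]|eapply Rle_trans; [apply Rmax_r|apply Rmax_r]].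
  - simpl. rewrite !j0_0, A1, A2. ring.
  - simpl. rewrite !j1_0, B1, B2. field; repeat split; auto; try apply cis_nz.
  - rewrite !HI by lia. simpl.
    replace (cis psi * (/ N * Iinf (fun x => j0 (cis d) (cis psi) x - j0 (cis om) (cis psi) x)) +
      1 * (/ N * Iinf (fun x => j0 (cis om) 1 x - j0 (cis (- om)) 1 x)) +
      cis (- psi) * (/ N * Iinf (fun x => j0 (cis (- om)) (cis (- psi)) x - j0 (cis (- d)) (cis (- psi)) x)))%C with
     (/ N * ((cis psi * Iinf (fun x => j0 (cis d) (cis psi) x - j0 (cis om) (cis psi) x)) +
      (1 * Iinf (fun x => j0 (cis om) 1 x - j0 (cis (- om)) 1 x)) +
      (cis (- psi) * Iinf (fun x => j0 (cis (- om)) (cis (- psi)) x - j0 (cis (- d)) (cis (- psi)) x))))%C by ring.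
    rewrite N1, N2, N3, A1, A2, A3, A4, B1, B2, B3, B4.
    transitivity (/ N * N)%C; [f_equal|field; auto]. unfold N.
    transitivity (RtoC 3 * A * B * ((cis om - cis (- om)) + ((cis (- om) * cis (- om)) - (cis om * cis om)) + (cis om - cis (- om))))%C; [ring|].
    rewrite Eoo, Eoo'. ring.
Qed.

(** * The Airy evolution operator *)

Definition sum3 (F : nat -> C) : C := (F 0%nat + F 1%nat + F 2%nat)%C.
Lemma sum3_ext F G : (forall i, (i < 3)%nat -> F i = G i) -> sum3 F = sum3 G.
Proof. intros H. unfold sum3. now rewrite !H by lia. Qed.
Lemma sum3_bound F M : (forall i, (i < 3)%nat -> Cmod (F i) <= M) -> Cmod (sum3 F) <= 3 * M.
Proof.
  intros H. unfold sum3. eapply Rle_trans; [apply Cmod_triangle|]. eapply Rle_trans; [apply Rplus_le_compat_r, Cmod_triangle|].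
  assert (H0 := H 0%nat ltac:(lia)). assert (H1 := H 1%nat ltac:(lia)). assert (H2 := H 2%nat ltac:(lia)). lra.
Qed.
Lemma sum3_scal c F : (c * sum3 F = sum3 (fun i => c * F i))%C.
Proof. unfold sum3. ring. Qed.
Lemma sum3_minus F G : (sum3 F - sum3 G = sum3 (fun i => F i - G i))%C.
Proof. unfold sum3. ring. Qed.

Section Operator.
Variables (psi K : R) (k kp : nat -> R -> C).
Hypothesis HK : kernel_ok psi K k kp.
Variables (d : C -> R) (c0 : R).
Hypothesis Hc0 : 0 < c0.
Hypothesis d_lip : forall y z, Rabs (d y - d z) <= Cmod (y - z)%C.
Hypothesis d_cone : forall y i s, (i < 3)%nat -> 0 <= s -> d y + c0 * s <= d (y + RtoC s * edir psi i)%C.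

Definition nice (g : C -> C) := (forall z, 0 < d z -> exists l, cder g z l) /\
  (forall del, 0 < del -> exists M, forall z, del <= d z -> Cmod (g z) <= M).

Lemma nice_hball g z r : nice g -> r < d z -> hball z r g.
Proof using d_lip.
  intros [H _] Hr u Hu. apply H. assert (Q := d_lip u z). apply Rabs_le_between in Q. lra.
Qed.
Lemma d_ball z u r : Cmod (u - z)%C <= r -> d z - r <= d u.
Proof using d_lip. intros H. assert (Q := d_lip u z). apply Rabs_le_between in Q. lra. Qed.

Lemma nice_cder g z : nice g -> 0 < d z -> cder g z (D g z).
Proof using. intros [H _] Hz. apply cder_D. auto. Qed.

Lemma D_bound_d g z del M : nice g -> 0 < del -> del < d z -> (forall u, d z - del <= d u -> Cmod (g u) <= M) -> Cmod (D g z) <= M / del.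
Proof using d_lip.
  intros Hg Hdel Hz HM. apply (cauchy_bound g z del); auto.
  - now apply nice_hball.
  - apply nice_cder; auto; lra.
  - intros u Hu. apply HM. now apply d_ball.
Qed.

Lemma nice_D g : nice g -> nice (D g).
Proof using d_lip.
  intros Hg. split.
  - intros z Hz. apply (D_holo g z (d z / 2)); [lra|]. apply nice_hball; auto. lra.
  - intros del Hdel. destruct (proj2 Hg (del/2)) as [M HM]; [lra|]. exists (M / (del/2)). intros z Hz.
    apply D_bound_d; auto; try lra. intros u Hu. apply HM. lra.
Qed.

Lemma cone_d y i s : (i < 3)%nat -> 0 <= s -> d y <= d (y + RtoC s * edir psi i)%C.
Proof using d_cone Hc0. intros Hi Hs. assert (Q := d_cone y i s Hi Hs). nra. Qed.

Definition kern (q : nat -> R -> C) (Q : R) := forall i, (i < 3)%nat ->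
  (forall x, 0 <= x -> ccont (q i) x) /\ (forall x, 0 <= x -> Cmod (q i x) <= Q / (1 + x)^2).

Definition EK (q : nat -> R -> C) (s : R) (g : C -> C) (y : C) : C :=
  sum3 (fun i => Iinf (fun x => q i x * g (y + RtoC (x * s) * edir psi i)%C)%C).

Lemma ray_rder g y i s x : nice g -> 0 < d y -> (i < 3)%nat -> 0 <= s -> 0 <= x ->
  rder (fun x => g (y + RtoC (x * s) * edir psi i)%C) x (RtoC s * edir psi i * D g (y + RtoC (x * s) * edir psi i))%C.
Proof using d_cone Hc0.
  intros Hg Hy Hi Hs Hx.
  apply (rder_comp_c g (fun x => y + RtoC (x * s) * edir psi i)%C).
  - replace (RtoC s * edir psi i)%C with (0 + RtoC s * edir psi i)%C by ring.
    apply (rder_plus (fun _ => y)); [apply rder_const|].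
    apply rder_ext with (fun u => RtoC u * (RtoC s * edir psi i))%C; [intros; rewrite RtoC_mult; ring|]. apply rder_lin.
  - apply nice_cder; auto. assert (Q := cone_d y i (x * s) Hi ltac:(nra)). lra.
Qed.

Lemma ray_dom q Q g y s i M : kern q Q -> nice g -> 0 < d y -> (i < 3)%nat -> 0 <= s ->
  (forall x, 0 <= x -> Cmod (g (y + RtoC (x * s) * edir psi i)%C) <= M) ->
  dom (fun x => q i x * g (y + RtoC (x * s) * edir psi i)%C)%C (Q * M).
Proof using d_cone Hc0.
  intros Hq Hg Hy Hi Hs HM. destruct (Hq i Hi) as [q1 q2]. split; intros x Hx.
  - apply ccont_mult; auto. eapply rder_ccont, ray_rder; auto.
  - rewrite Cmod_mult. replace (Q * M / (1 + x)^2) with ((Q / (1 + x)^2) * M) by (field; lra).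
    apply Rmult_le_compat; auto using Cmod_ge_0.
Qed.

Lemma ray_bd g y : nice g -> 0 < d y -> exists M, forall i s x, (i < 3)%nat -> 0 <= s -> 0 <= x -> Cmod (g (y + RtoC (x * s) * edir psi i)%C) <= M.
Proof using d_cone Hc0.
  intros Hg Hy. destruct (proj2 Hg (d y) Hy) as [M HM]. exists M. intros. apply HM. apply cone_d; auto. nra.
Qed.

Lemma EK_bound q Q g y s M : kern q Q -> nice g -> 0 < d y -> 0 <= s ->
  (forall i x, (i < 3)%nat -> 0 <= x -> Cmod (g (y + RtoC (x * s) * edir psi i)%C) <= M) -> Cmod (EK q s g y) <= 3 * (Q * M).
Proof using d_cone Hc0.
  intros Hq Hg Hy Hs HM. apply sum3_bound. intros i Hi. apply Iinf_bound. apply ray_dom; auto.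
Qed.

Lemma kern_Q q Q : kern q Q -> 0 <= Q.
Proof.
  intros H. destruct (H 0%nat ltac:(lia)) as [_ H2]. specialize (H2 0 (Rle_refl 0)).
  replace (Q / (1 + 0)^2) with Q in H2 by field. eapply Rle_trans; [apply Cmod_ge_0|eauto].
Qed.

Lemma EK_sing_bound q Q g y s A B : kern q Q -> nice g -> 0 < d y -> 0 <= s -> 0 <= A -> 0 <= B ->
  (forall i x, (i < 3)%nat -> 0 < x -> Cmod (g (y + RtoC (x * s) * edir psi i)%C) <= A + B / sqrt x) ->
  Cmod (EK q s g y) <= 3 * (Q * (A + 4 * B)).
Proof using d_cone Hc0.
  intros Hq Hg Hy Hs HA HB HM. assert (HQ := kern_Q q Q Hq).
  destruct (ray_bd g y Hg Hy) as [M HMM]. apply sum3_bound. intros i Hi.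
  apply (Iinf_prim_bound _ (Q * M) (fun x => Q * (- A / (1 + x) + 2 * B * atan (sqrt x)))
     (fun x => Q * (A / (1 + x)^2 + B / (sqrt x * (1 + x))))).
  - apply ray_dom; auto.
  - intros x Hx.
    apply (continuous_mult (K := R_AbsRing) (fun _ => Q) (fun x => - A / (1 + x) + 2 * B * atan (sqrt x))); [apply continuous_const|].
    apply (continuous_plus (V := R_NormedModule) (fun x => - A / (1 + x)) (fun x => 2 * B * atan (sqrt x))).
    + apply (ex_derive_continuous (V := R_NormedModule)). auto_derive. lra.
    + apply (continuous_mult (K := R_AbsRing) (fun _ => 2 * B) (fun x => atan (sqrt x))); [apply continuous_const|].
      apply (continuous_comp sqrt atan); [apply continuity_pt_filterlim, continuity_pt_sqrt; auto|].
      apply (ex_derive_continuous (V := R_NormedModule)). auto_derive. auto.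
  - intros x Hx. assert (Hsx : 0 < sqrt x) by now apply sqrt_lt_R0.
    auto_derive; [repeat split; auto; lra|]. replace (sqrt x * (sqrt x * 1)) with x by (rewrite Rmult_1_r; symmetry; apply sqrt_sqrt; lra).
    field. repeat split; lra.
  - intros x Hx. rewrite Cmod_mult. destruct (Hq i Hi) as [_ q2].
    assert (Hsx : 0 < sqrt x) by now apply sqrt_lt_R0.
    apply Rle_trans with (Q / (1 + x)^2 * (A + B / sqrt x)).
    + apply Rmult_le_compat; auto using Cmod_ge_0. apply q2; lra.
    + unfold Rdiv. rewrite Rmult_assoc. apply Rmult_le_compat_l; auto.
      replace (/ (1 + x) ^ 2 * (A + B * / sqrt x)) with (A * / (1 + x)^2 + (B * / sqrt x) * / (1 + x)^2) by ring.
      apply Rplus_le_compat_l. rewrite Rinv_mult, <- Rmult_assoc. apply Rmult_le_compat_l.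
      * apply Rmult_le_pos; auto. apply Rlt_le, Rinv_0_lt_compat; auto.
      * apply Rinv_le_contravar; nra.
  - intros x Hx. rewrite <- Rmult_minus_distr_l. apply Rmult_le_compat_l; auto.
    rewrite sqrt_0, atan_0. assert (Ha := atan_bound (sqrt x)). assert (HP := PI_4).
    assert (0 <= A / (1 + x)) by (apply le_div_intro; lra).
    replace (- A / (1 + x)) with (- (A / (1 + x))) by (field; lra). replace (- A / (1 + 0)) with (- A) by field.
    assert (B * atan (sqrt x) <= B * 2) by (apply Rmult_le_compat_l; lra). lra.
Qed.

Lemma EK_minus q Q s f g y : kern q Q -> nice f -> nice g -> 0 < d y -> 0 <= s ->
  EK q s (fun z => f z - g z)%C y = (EK q s f y - EK q s g y)%C.
Proof using d_cone Hc0.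
  intros Hq Hf Hg Hy Hs. destruct (ray_bd f y Hf Hy) as [M HM]. destruct (ray_bd g y Hg Hy) as [N HN].
  unfold EK. rewrite sum3_minus. apply sum3_ext. intros i Hi.
  rewrite <- (Iinf_minus _ _ (Q * M) (Q * N)).
  - apply Iinf_ext. intros; ring.
  - apply ray_dom; auto.
  - apply ray_dom; auto.
Qed.

Lemma EK_scal q Q s c g y : kern q Q -> nice g -> 0 < d y -> 0 <= s ->
  EK q s (fun z => c * g z)%C y = (c * EK q s g y)%C.
Proof using d_cone Hc0.
  intros Hq Hg Hy Hs. destruct (ray_bd g y Hg Hy) as [N HN].
  unfold EK. rewrite sum3_scal. apply sum3_ext. intros i Hi.
  rewrite <- (Iinf_scal c _ (Q * N)).
  - apply Iinf_ext. intros; ring.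
  - apply ray_dom; auto.
Qed.

Lemma EK_quad q Q s g y M h : kern q Q -> nice g -> 0 < d y -> 0 <= s ->
  (forall z, d y / 2 <= d z -> Cmod (g z) <= M) -> Cmod h <= d y / 12 ->
  Cmod (EK q s g (y + h) - EK q s g y - h * EK q s (D g) y)%C <= 3 * (Q * (72 * M / (d y)^2 * Cmod h ^ 2)).
Proof using d_cone Hc0 d_lip.
  intros Hq Hg Hy Hs HM Hh.
  assert (Hyh : d y / 2 <= d (y + h)%C). { assert (W := d_ball y (y + h)%C (d y / 12)). replace (y + h - y)%C with h in W by ring. specialize (W Hh). lra. }
  destruct (ray_bd (D g) y (nice_D g Hg) Hy) as [N HN].
  destruct (ray_bd g y Hg Hy) as [N1 HN1]. destruct (ray_bd g (y + h)%C Hg ltac:(lra)) as [N2 HN2].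
  unfold EK. rewrite sum3_scal, !sum3_minus. apply sum3_bound. intros i Hi.
  rewrite <- (Iinf_scal h _ (Q * N)) by (apply ray_dom; auto using nice_D).
  rewrite <- (Iinf_minus _ _ (Q * N2) (Q * N1)) by (apply ray_dom; auto; lra).
  rewrite <- (Iinf_minus _ _ (Q * N2 + Q * N1) (Cmod h * (Q * N))).
  2:{ apply dom_minus; apply ray_dom; auto; lra. }
  2:{ apply dom_scal. apply ray_dom; auto using nice_D. }
  apply Iinf_bound.
  assert (D1 : dom (fun x => q i x * g (y + h + RtoC (x * s) * edir psi i))%C (Q * N2)) by (apply ray_dom; auto; lra).
  assert (D2 : dom (fun x => q i x * g (y + RtoC (x * s) * edir psi i))%C (Q * N1)) by (apply ray_dom; auto; lra).
  assert (D3 : dom (fun x => q i x * D g (y + RtoC (x * s) * edir psi i))%C (Q * N)) by (apply ray_dom; auto using nice_D; lra).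
  split; intros x Hx.
  - apply ccont_minus; [apply ccont_minus; [apply D1|apply D2]|]; auto. apply ccont_mult; [apply ccont_const|]. apply D3; auto.
  - set (z := (y + RtoC (x * s) * edir psi i)%C).
    replace (y + h + RtoC (x * s) * edir psi i)%C with (z + h)%C by (unfold z; ring).
    replace (q i x * g (z + h) - q i x * g z - h * (q i x * D g z))%C with (q i x * (g (z + h) - g z - h * D g z))%C by ring.
    rewrite Cmod_mult. assert (Hz : d y <= d z) by (apply cone_d; auto; nra).
    assert (L := quad_lemma g z (d y / 3) M).
    replace (Q * (72 * M / d y ^ 2 * Cmod h ^ 2) / (1 + x) ^ 2) with (Q / (1 + x)^2 * (8 * M / (d y / 3)^2 * Cmod h ^ 2)) by (field; split; lra).
    apply Rmult_le_compat; auto using Cmod_ge_0.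
    + destruct (Hq i Hi) as [_ q2]. auto.
    + apply L; try lra.
      * apply nice_hball; auto. lra.
      * intros u Hu. apply HM. assert (W := d_ball z u (d y / 3) Hu). lra.
Qed.

Lemma EK_parts q q' Q s g y i : kern q Q -> (forall x, 0 <= x -> rder (q i) x (q' i x)) -> kern q' Q ->
  nice g -> 0 < d y -> 0 <= s -> (i < 3)%nat ->
  Iinf (fun x => q i x * (RtoC s * edir psi i * D g (y + RtoC (x * s) * edir psi i)))%C =
  (- (q i 0%R * g y) - Iinf (fun x => q' i x * g (y + RtoC (x * s) * edir psi i)))%C.
Proof using d_cone Hc0 d_lip.
  intros Hq Hr Hq' Hg Hy Hs Hi.
  destruct (ray_bd (D g) y (nice_D g Hg) Hy) as [N HN]. destruct (ray_bd g y Hg Hy) as [M HM].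
  assert (D2 : dom (fun x => q' i x * g (y + RtoC (x * s) * edir psi i))%C (Q * M)) by (apply ray_dom; auto).
  assert (D1 : dom (fun x => q i x * g (y + RtoC (x * s) * edir psi i))%C (Q * M)) by (apply ray_dom; auto).
  assert (D3 : dom (fun x => q i x * (RtoC s * edir psi i * D g (y + RtoC (x * s) * edir psi i)))%C (Cmod (RtoC s * edir psi i)%C * (Q * N))).
  { assert (D3' := ray_dom q Q (D g) y s i N Hq (nice_D g Hg) Hy Hi Hs ltac:(auto)).
    apply (dom_scal (RtoC s * edir psi i)%C) in D3'. destruct D3' as [a b]. split; intros x Hx.
    - eapply ccont_ext; [|apply a; auto]. intros; simpl; ring.
    - eapply Rle_trans; [|apply b; auto]. right. f_equal. ring. }
  assert (E := Iinf_FTC (fun x => q i x * g (y + RtoC (x * s) * edir psi i))%C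
     (fun x => q' i x * g (y + RtoC (x * s) * edir psi i) + q i x * (RtoC s * edir psi i * D g (y + RtoC (x * s) * edir psi i)))%C
     _ (Q * M) (dom_plus _ _ _ _ D2 D3)).
  rewrite (Iinf_plus _ _ _ _ D2 D3) in E.
  set (I1 := Iinf (fun x => q' i x * g (y + RtoC (x * s) * edir psi i))%C) in *.
  set (I2 := Iinf (fun x => q i x * (RtoC s * edir psi i * D g (y + RtoC (x * s) * edir psi i)))%C) in *.
  replace I2 with (I1 + I2 - I1)%C by ring. rewrite E.
  - replace (y + RtoC (0 * s) * edir psi i)%C with y by (rewrite Rmult_0_l; ring). ring.
  - intros x Hx. apply rder_mult; auto. apply ray_rder; auto.
  - intros x Hx. eapply Rle_trans; [apply D1; auto|]. assert (W := dom_M _ _ D1).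
    apply Rmult_le_compat_l; auto. apply Rinv_le_contravar; nra.
Qed.

(* Each integration by parts trades a derivative of [g] for a factor [-1/s] and moves from [q0] to [q1], [q2], [q3]. *)
Definition q0 (i : nat) (x : R) : C := (edir psi i * k i x)%C.
Definition q1 (i : nat) (x : R) : C := kp i x.
Definition q2 (i : nat) (x : R) : C := (edir psi i * edir psi i / RtoC 3 * (RtoC x * k i x))%C.
Definition q3 (i : nat) (x : R) : C := (edir psi i / RtoC 3 * (k i x + RtoC x * kp i x))%C.

Lemma Cmod_edir i : Cmod (edir psi i) = 1.
Proof using. destruct i as [|[|i]]; simpl; try apply Cmod_cis. apply Cmod_1. Qed.
Lemma edir_nz i : edir psi i <> 0.
Proof using. intros E. assert (W := Cmod_edir i). rewrite E, Cmod_0 in W. lra. Qed.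

Lemma kbd i x : (i < 3)%nat -> 0 <= x -> Cmod (k i x) <= K / (1 + x)^4 /\ Cmod (kp i x) <= K / (1 + x)^4.
Proof using HK. intros Hi Hx. destruct HK as [H _]. destruct (H i Hi) as [_ [_ [a b]]]. auto. Qed.
Lemma K_pos : 0 <= K.
Proof using HK. destruct (kbd 0 0 ltac:(lia) (Rle_refl 0)) as [H _]. replace (K / (1 + 0)^4) with K in H by field. eapply Rle_trans; [apply Cmod_ge_0|eauto]. Qed.

Lemma K_pow_mono n m x : (n <= m)%nat -> 0 <= x -> K / (1 + x)^m <= K / (1 + x)^n.
Proof using HK. intros Hn Hx. apply Rmult_le_compat_l; [apply K_pos|]. apply Rinv_le_contravar; [apply pow_lt; lra|]. apply Rle_pow; [lra|auto]. Qed.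

Lemma k_rder i x : (i < 3)%nat -> 0 <= x -> rder (k i) x (kp i x).
Proof using HK. intros Hi Hx. destruct HK as [H _]. destruct (H i Hi) as [a _]. auto. Qed.
Lemma kp_rder i x : (i < 3)%nat -> 0 <= x -> rder (kp i) x (edir psi i * edir psi i * edir psi i / RtoC 3 * RtoC x * k i x)%C.
Proof using HK. intros Hi Hx. destruct HK as [H _]. destruct (H i Hi) as [_ [a _]]. auto. Qed.

Lemma xk_bd i x : (i < 3)%nat -> 0 <= x -> x * Cmod (k i x) <= K / (1 + x)^3 /\ x * Cmod (kp i x) <= K / (1 + x)^3.
Proof using HK.
  intros Hi Hx. destruct (kbd i x Hi Hx) as [a b]. assert (HKp := K_pos).
  assert (E : K / (1 + x)^3 = (1 + x) * (K / (1 + x)^4)) by (field; lra).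
  assert (0 <= K / (1 + x)^4) by (apply le_div_intro; [apply pow_lt; lra|lra]).
  rewrite E. split; apply Rmult_le_compat; auto using Cmod_ge_0; lra.
Qed.

Lemma Cmod_third (z : C) : Cmod (z / RtoC 3)%C = Cmod z / 3.
Proof. rewrite Cmod_div by apply C3_nz. rewrite Cmod_RtoC_pos by lra. reflexivity. Qed.

Lemma kern0 : kern q0 K.
Proof using HK.
  intros i Hi. split; intros x Hx.
  - apply ccont_mult; [apply ccont_const|]. eapply rder_ccont, k_rder; auto.
  - unfold q0. rewrite Cmod_mult, Cmod_edir, Rmult_1_l. eapply Rle_trans; [apply kbd; auto|apply K_pow_mono; auto].
Qed.
Lemma kern_k : kern k K.
Proof using HK.
  intros i Hi. split; intros x Hx.
  - eapply rder_ccont, k_rder; auto.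
  - eapply Rle_trans; [apply kbd; auto|apply K_pow_mono; auto].
Qed.
Lemma kern1 : kern q1 K.
Proof using HK.
  intros i Hi. split; intros x Hx.
  - eapply rder_ccont, kp_rder; auto.
  - eapply Rle_trans; [apply kbd; auto|apply K_pow_mono; auto].
Qed.
Lemma kern2 : kern q2 K.
Proof using HK.
  intros i Hi. split; intros x Hx.
  - apply ccont_mult; [apply ccont_const|]. apply ccont_mult; [eapply rder_ccont, rder_id|]. eapply rder_ccont, k_rder; auto.
  - unfold q2. rewrite Cmod_mult, Cmod_third, Cmod_mult, Cmod_edir, Cmod_mult, Cmod_RtoC_pos by auto.
    destruct (xk_bd i x Hi Hx) as [a _]. assert (W := K_pow_mono 2 3 x ltac:(lia) Hx). assert (0 <= x * Cmod (k i x)) by (apply Rmult_le_pos; auto; apply Cmod_ge_0). lra.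
Qed.
Lemma kern_xk e3 : Cmod e3 <= 1 -> kern (fun i x => e3 * (RtoC x * k i x))%C K.
Proof using HK.
  intros He i Hi. split; intros x Hx.
  - apply ccont_mult; [apply ccont_const|]. apply ccont_mult; [eapply rder_ccont, rder_id|]. eapply rder_ccont, k_rder; auto.
  - rewrite !Cmod_mult, Cmod_RtoC_pos by auto.
    destruct (xk_bd i x Hi Hx) as [a _]. assert (W := K_pow_mono 2 3 x ltac:(lia) Hx). assert (0 <= x * Cmod (k i x)) by (apply Rmult_le_pos; auto; apply Cmod_ge_0).
    assert (0 <= Cmod e3) by apply Cmod_ge_0. nra.
Qed.
Lemma kern3 : kern q3 K.
Proof using HK.
  intros i Hi. split; intros x Hx.
  - apply ccont_mult; [apply ccont_const|]. apply ccont_plus; [eapply rder_ccont, k_rder; auto|].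
    apply ccont_mult; [eapply rder_ccont, rder_id|]. eapply rder_ccont, kp_rder; auto.
  - unfold q3. rewrite Cmod_mult, Cmod_third, Cmod_edir.
    assert (Cmod (k i x + RtoC x * kp i x)%C <= 2 * (K / (1 + x)^2)).
    { eapply Rle_trans; [apply Cmod_triangle|]. rewrite Cmod_mult, Cmod_RtoC_pos by auto.
      destruct (xk_bd i x Hi Hx) as [_ b]. destruct (kbd i x Hi Hx) as [a _].
      assert (W := K_pow_mono 2 3 x ltac:(lia) Hx). assert (W' := K_pow_mono 2 4 x ltac:(lia) Hx). lra. }
    assert (0 <= Cmod (k i x + RtoC x * kp i x)%C) by apply Cmod_ge_0. lra.
Qed.

Definition E (s : R) (g : C -> C) (y : C) : C := EK q0 s g y.

Lemma E_parts1 s g y : nice g -> 0 < d y -> 0 <= s -> (RtoC s * E s (D g) y = - EK q1 s g y)%C.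
Proof using HK d_cone Hc0 d_lip.
  intros Hg Hy Hs. unfold E, EK. rewrite sum3_scal.
  destruct (ray_bd (D g) y (nice_D g Hg) Hy) as [N HN].
  transitivity (sum3 (fun i => - (k i 0%R * g y) - Iinf (fun x => q1 i x * g (y + RtoC (x * s) * edir psi i))))%C.
  - apply sum3_ext. intros i Hi.
    rewrite <- (EK_parts k q1 K) by (auto using kern_k, kern1; intros; apply k_rder; auto).
    rewrite <- (Iinf_scal (RtoC s) _ (K * N)) by (apply ray_dom; auto using nice_D, kern0).
    apply Iinf_ext. intros x Hx. unfold q0. ring.
  - unfold sum3. destruct HK as [_ [H0 _]].
    match goal with |- ?a = _ => transitivity (a + (k 0%nat 0%R + k 1%nat 0%R + k 2%nat 0%R) * g y)%C end.
    + rewrite H0. ring.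
    + ring.
Qed.

Lemma E_parts2 s g y : nice g -> 0 < d y -> 0 <= s -> (RtoC s * EK q1 s (D g) y = - EK q2 s g y)%C.
Proof using HK d_cone Hc0 d_lip.
  intros Hg Hy Hs. unfold EK. rewrite sum3_scal.
  destruct (ray_bd (D g) y (nice_D g Hg) Hy) as [N HN]. destruct (ray_bd g y Hg Hy) as [M HM].
  transitivity (sum3 (fun i => - (kp i 0%R / edir psi i * g y) - Iinf (fun x => q2 i x * g (y + RtoC (x * s) * edir psi i))))%C.
  - apply sum3_ext. intros i Hi. assert (He := edir_nz i).
    set (q' := fun (j : nat) (x : R) => (edir psi i * edir psi i * edir psi i / RtoC 3 * (RtoC x * k j x))%C).
    assert (Kq' : kern q' K). { apply kern_xk. rewrite Cmod_third, !Cmod_mult, Cmod_edir. lra. }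
    assert (P := EK_parts q1 q' K s g y i kern1).
    assert (P' : Iinf (fun x => q1 i x * (RtoC s * edir psi i * D g (y + RtoC (x * s) * edir psi i)))%C =
      (- (q1 i 0%R * g y) - Iinf (fun x => q' i x * g (y + RtoC (x * s) * edir psi i)))%C).
    { apply P; auto. intros x Hx. unfold q1, q'.
      replace (edir psi i * edir psi i * edir psi i / RtoC 3 * (RtoC x * k i x))%C with (edir psi i * edir psi i * edir psi i / RtoC 3 * RtoC x * k i x)%C by ring.
      apply kp_rder; auto. }
    assert (L : Iinf (fun x => q1 i x * (RtoC s * edir psi i * D g (y + RtoC (x * s) * edir psi i)))%C =
      (RtoC s * edir psi i * Iinf (fun x => q1 i x * D g (y + RtoC (x * s) * edir psi i)))%C).
    { rewrite <- (Iinf_scal _ _ (K * N)) by (apply ray_dom; auto using nice_D, kern1). apply Iinf_ext. intros; ring. }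
    assert (L2 : Iinf (fun x => q' i x * g (y + RtoC (x * s) * edir psi i))%C = (edir psi i * Iinf (fun x => q2 i x * g (y + RtoC (x * s) * edir psi i)))%C).
    { rewrite <- (Iinf_scal _ _ (K * M)) by (apply ray_dom; auto using kern2). apply Iinf_ext. intros. unfold q', q2. field; try apply C3_nz. }
    rewrite L, L2 in P'. unfold q1 in P' at 2.
    transitivity (/ edir psi i * (RtoC s * edir psi i * Iinf (fun x => q1 i x * D g (y + RtoC (x * s) * edir psi i))))%C; [field; auto|].
    rewrite P'. field. auto.
  - unfold sum3. destruct HK as [_ [_ [H0 _]]].
    match goal with |- ?a = _ => transitivity (a + (kp 0%nat 0%R / edir psi 0 + kp 1%nat 0%R / edir psi 1 + kp 2%nat 0%R / edir psi 2) * g y)%C end.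
    + rewrite H0. ring.
    + ring.
Qed.

Lemma E_parts3 s g y : nice g -> 0 < d y -> 0 <= s -> (RtoC s * EK q2 s (D g) y = - EK q3 s g y)%C.
Proof using HK d_cone Hc0 d_lip.
  intros Hg Hy Hs. unfold EK. rewrite sum3_scal.
  destruct (ray_bd (D g) y (nice_D g Hg) Hy) as [N HN]. destruct (ray_bd g y Hg Hy) as [M HM].
  transitivity (sum3 (fun i => - Iinf (fun x => q3 i x * g (y + RtoC (x * s) * edir psi i))))%C; [|unfold sum3; ring].
  apply sum3_ext. intros i Hi. assert (He := edir_nz i).
  set (q' := fun (j : nat) (x : R) => (edir psi i / RtoC 3 * (RtoC x * k j x))%C).
  assert (Kq' : kern q' K). { apply kern_xk. rewrite Cmod_third, Cmod_edir. lra. }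
  set (q'' := fun (j : nat) (x : R) => (edir psi i / RtoC 3 * (k j x + RtoC x * kp j x))%C).
  assert (Kq'' : kern q'' K).
  { intros j Hj. destruct (kern3 j Hj) as [a b]. split; intros x Hx.
    - apply ccont_mult; [apply ccont_const|]. apply ccont_plus; [eapply rder_ccont, k_rder; auto|].
      apply ccont_mult; [eapply rder_ccont, rder_id|]. eapply rder_ccont, kp_rder; auto.
    - specialize (b x Hx). unfold q3 in b. unfold q''. rewrite Cmod_mult, Cmod_third, Cmod_edir in *. exact b. }
  rewrite <- (Iinf_scal _ _ (K * N)) by (apply ray_dom; auto using nice_D, kern2).
  transitivity (Iinf (fun x => q' i x * (RtoC s * edir psi i * D g (y + RtoC (x * s) * edir psi i)))%C).
  { apply Iinf_ext. intros x Hx. unfold q2, q'. field; try apply C3_nz. }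
  assert (Rq : forall x, 0 <= x -> rder (q' i) x (q'' i x)).
  { intros x Hx. apply rder_scal. replace (k i x + RtoC x * kp i x)%C with (1 * k i x + RtoC x * kp i x)%C by ring.
    apply (rder_mult (fun x => RtoC x)); [apply rder_id|apply k_rder; auto]. }
  rewrite (EK_parts q' q'' K) by auto.
  unfold q' at 1. replace (edir psi i / RtoC 3 * (0 * k i 0%R) * g y)%C with (RtoC 0) by (field; try apply C3_nz).
  unfold q'', q3. ring.
Qed.

Lemma E_D3_eq2 s g y : nice g -> 0 < d y -> 0 <= s -> (RtoC (s^2) * E s (D (D (D g))) y = EK q2 s (D g) y)%C.
Proof using HK d_cone Hc0 d_lip.
  intros Hg Hy Hs. assert (N1 := nice_D g Hg). assert (N2 := nice_D _ N1).
  replace (RtoC (s^2) * E s (D (D (D g))) y)%C with (RtoC s * (RtoC s * E s (D (D (D g))) y))%C.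
  2:{ replace (s^2) with (s * s) by ring. rewrite RtoC_mult. ring. }
  rewrite E_parts1 by auto. replace (RtoC s * - EK q1 s (D (D g)) y)%C with (- (RtoC s * EK q1 s (D (D g)) y))%C by ring.
  rewrite E_parts2 by auto. ring.
Qed.

Lemma E_D2_eq s g y : nice g -> 0 < d y -> 0 <= s -> (RtoC (s^2) * E s (D (D g)) y = EK q2 s g y)%C.
Proof using HK d_cone Hc0 d_lip.
  intros Hg Hy Hs. assert (N1 := nice_D g Hg).
  replace (RtoC (s^2) * E s (D (D g)) y)%C with (RtoC s * (RtoC s * E s (D (D g)) y))%C.
  2:{ replace (s^2) with (s * s) by ring. rewrite RtoC_mult. ring. }
  rewrite E_parts1 by auto. replace (RtoC s * - EK q1 s (D g) y)%C with (- (RtoC s * EK q1 s (D g) y))%C by ring.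
  rewrite E_parts2 by auto. ring.
Qed.

Lemma E_D3_eq3 s g y : nice g -> 0 < d y -> 0 <= s -> (RtoC (s^3) * E s (D (D (D g))) y = - EK q3 s g y)%C.
Proof using HK d_cone Hc0 d_lip.
  intros Hg Hy Hs. replace (s^3) with (s * s^2) by ring. rewrite RtoC_mult.
  replace (RtoC s * RtoC (s ^ 2) * E s (D (D (D g))) y)%C with (RtoC s * (RtoC (s ^ 2) * E s (D (D (D g))) y))%C by ring.
  rewrite E_D3_eq2 by auto. now apply E_parts3.
Qed.

Lemma E_zero g y : nice g -> 0 < d y -> E 0 g y = g y.
Proof using HK d_cone Hc0.
  intros Hg Hy. destruct HK as [_ [_ [_ H0]]].
  transitivity ((edir psi 0 * Iinf (k 0%nat) + edir psi 1 * Iinf (k 1%nat) + edir psi 2 * Iinf (k 2%nat)) * g y)%C; [|rewrite H0; ring].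
  unfold E, EK. transitivity (sum3 (fun i => edir psi i * g y * Iinf (k i)))%C; [|unfold sum3; ring].
  apply sum3_ext. intros i Hi. rewrite <- (Iinf_scal _ _ K).
  - apply Iinf_ext. intros x Hx. unfold q0. rewrite Rmult_0_r. replace (y + RtoC 0 * edir psi i)%C with y by ring. ring.
  - destruct (kern_k i Hi). split; auto.
Qed.

Lemma E_s_quad g y M s s' : nice g -> 0 < d y -> 0 <= s -> 0 <= s' ->
  (forall z, d y <= d z -> Cmod (D (D g) z) <= M) ->
  Cmod (E s' g y - E s g y - RtoC (s' - s) * (RtoC 3 * (RtoC (s^2) * E s (D (D (D g))) y)))%C <= 3 * (K * M) * (s' - s)^2.
Proof using HK d_cone Hc0 d_lip.
  intros Hg Hy Hs Hs' HM. assert (N1 := nice_D g Hg). assert (N2 := nice_D _ N1).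
  rewrite E_D3_eq2 by auto. unfold E, EK.
  destruct (ray_bd g y Hg Hy) as [B0 HB0]. destruct (ray_bd (D g) y N1 Hy) as [B1 HB1].
  assert (HKp := K_pos).
  rewrite !sum3_scal, !sum3_minus. rewrite Rmult_assoc. apply sum3_bound. intros i Hi.
  assert (D0 : dom (fun x => q0 i x * g (y + RtoC (x * s) * edir psi i))%C (K * B0)) by (apply ray_dom; auto using kern0).
  assert (D0' : dom (fun x => q0 i x * g (y + RtoC (x * s') * edir psi i))%C (K * B0)) by (apply ray_dom; auto using kern0).
  assert (D2 : dom (fun x => q2 i x * D g (y + RtoC (x * s) * edir psi i))%C (K * B1)) by (apply ray_dom; auto using kern2).
  rewrite <- (Iinf_scal (RtoC 3) _ _ D2), <- (Iinf_scal _ _ _ (dom_scal (RtoC 3) _ _ D2)).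
  rewrite <- (Iinf_minus _ _ _ _ D0' D0).
  rewrite <- (Iinf_minus _ _ _ _ (dom_minus _ _ _ _ D0' D0) (dom_scal _ _ _ (dom_scal (RtoC 3) _ _ D2))).
  apply Iinf_bound. split; intros x Hx.
  - apply ccont_minus; [apply ccont_minus; [apply D0'|apply D0]; auto|].
    apply ccont_mult; [apply ccont_const|]. apply ccont_mult; [apply ccont_const|]. apply D2; auto.
  - replace (q0 i x * g (y + RtoC (x * s') * edir psi i) - q0 i x * g (y + RtoC (x * s) * edir psi i) -
       RtoC (s' - s) * (RtoC 3 * (q2 i x * D g (y + RtoC (x * s) * edir psi i))))%C with
      (q0 i x * (g (y + RtoC (x * s') * edir psi i) - g (y + RtoC (x * s) * edir psi i) -
        RtoC (x * s' - x * s) * (RtoC 1 * edir psi i * D g (y + RtoC (x * s) * edir psi i))))%C.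
    2:{ unfold q0, q2. rewrite !RtoC_minus, !RtoC_mult. field; try apply C3_nz. }
    rewrite Cmod_mult.
    set (f := fun r => g (y + RtoC (r * 1) * edir psi i)%C).
    set (f1 := fun r => (RtoC 1 * edir psi i * D g (y + RtoC (r * 1) * edir psi i))%C).
    assert (R0 : forall r, 0 <= r -> rder f r (f1 r)) by (intros r Hr; apply ray_rder; auto; lra).
    assert (R1 : forall r, 0 <= r -> rder f1 r (RtoC 1 * edir psi i * (RtoC 1 * edir psi i * D (D g) (y + RtoC (r * 1) * edir psi i)))%C).
    { intros r Hr. apply rder_scal. apply ray_rder; auto; lra. }
    assert (T := taylor_lip f f1 M 0 (Rmax (x * s) (x * s'))).
    assert (T' : Cmod (f (x * s')%R - f (x * s)%R - RtoC (x * s' - x * s) * f1 (x * s)%R)%C <= M * (x * s' - x * s)^2).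
    { apply T.
      - intros u Hu. eapply rder_ccont, R0; lra.
      - intros u Hu. apply R0; lra.
      - apply (MV_abs f1 (fun r => RtoC 1 * edir psi i * (RtoC 1 * edir psi i * D (D g) (y + RtoC (r * 1) * edir psi i)))%C).
        + intros u Hu. eapply rder_ccont, R1; lra.
        + intros u Hu. apply R1; lra.
        + intros u Hu. rewrite !Cmod_mult, Cmod_edir, Cmod_1, !Rmult_1_l. apply HM. apply cone_d; auto; lra.
      - split; [nra|apply Rmax_l].
      - split; [nra|apply Rmax_r]. }
    unfold f, f1 in T'. rewrite !Rmult_1_r in T'.
    apply Rle_trans with (K / (1 + x)^4 * (M * (x * s' - x * s)^2)).
    + apply Rmult_le_compat; auto using Cmod_ge_0. unfold q0. rewrite Cmod_mult, Cmod_edir, Rmult_1_l. apply kbd; auto.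
    + assert (HM0 : 0 <= M). { eapply Rle_trans; [apply Cmod_ge_0|apply (HM y); lra]. }
      replace (K / (1 + x)^4 * (M * (x * s' - x * s)^2)) with (K * M * (s' - s)^2 * (x^2 * / (1 + x)^4)) by (field; lra).
      replace (K * M * (s' - s) ^ 2 / (1 + x) ^ 2) with (K * M * (s' - s)^2 * ((1 + x)^2 * / (1 + x)^4)) by (field; lra).
      apply Rmult_le_compat_l; [apply Rmult_le_pos; [nra|apply pow2_ge_0]|].
      apply Rmult_le_compat_r; [apply Rlt_le, Rinv_0_lt_compat, pow_lt; lra|]. nra.
Qed.

Lemma E_rder g y s : nice g -> 0 < d y -> 0 < s -> rder (fun s => E (Rmax 0 s) g y) s (RtoC (3 * s^2) * E s (D (D (D g))) y)%C.
Proof using HK d_cone Hc0 d_lip.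
  intros Hg Hy Hs. assert (N1 := nice_D g Hg). assert (N2 := nice_D _ N1).
  destruct (proj2 N2 (d y) Hy) as [M HM].
  apply (rder_quad _ _ _ (3 * (K * M)) s); auto. intros h Hh. apply Rabs_def2 in Hh.
  rewrite (Rmax_right 0 (s + h)), (Rmax_right 0 s) by lra.
  assert (Q := E_s_quad g y M s (s + h) Hg Hy ltac:(lra) ltac:(lra) HM). replace (s + h - s) with h in Q by ring.
  replace (RtoC (3 * s^2) * E s (D (D (D g))) y)%C with (RtoC 3 * (RtoC (s ^ 2) * E s (D (D (D g))) y))%C by (rewrite RtoC_mult; ring).
  exact Q.
Qed.

Lemma E_ccont g y s : nice g -> 0 < d y -> ccont (fun s => E (Rmax 0 s) g y) s.
Proof using HK d_cone Hc0 d_lip.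
  intros Hg Hy. assert (N1 := nice_D g Hg). assert (N2 := nice_D _ N1).
  destruct (proj2 N2 (d y) Hy) as [M HM]. set (s0 := Rmax 0 s).
  assert (Hs0 : 0 <= s0) by apply Rmax_l.
  set (A := (RtoC 3 * (RtoC (s0 ^ 2) * E s0 (D (D (D g))) y))%C).
  intros e He. set (L := Cmod A + 3 * Rabs (K * M) + 1).
  assert (HL : 0 < L) by (unfold L; assert (W := Cmod_ge_0 A); assert (W' := Rabs_pos (K * M)); lra).
  exists (Rmin 1 (e / L)). split; [apply Rmin_glb_lt; [lra|apply Rdiv_lt_0_compat; auto]|].
  intros s' Hs'. set (s1 := Rmax 0 s').
  assert (H1 : Rabs (s1 - s0) <= Rabs (s' - s)).
  { unfold s1, s0, Rmax. destruct (Rle_dec 0 s'), (Rle_dec 0 s); unfold Rabs; repeat destruct (Rcase_abs _); lra. }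
  assert (Q := E_s_quad g y M s0 s1 Hg Hy Hs0 (Rmax_l _ _) HM). fold A in Q.
  assert (Ha : Rabs (s' - s) < 1) by (eapply Rlt_le_trans; [exact Hs'|apply Rmin_l]).
  assert (Hb : Rabs (s' - s) < e / L) by (eapply Rlt_le_trans; [exact Hs'|apply Rmin_r]).
  change (Cmod (E s1 g y - E s0 g y)%C < e).
  replace (E s1 g y - E s0 g y)%C with ((E s1 g y - E s0 g y - RtoC (s1 - s0) * A) + RtoC (s1 - s0) * A)%C by ring.
  eapply Rle_lt_trans; [apply Cmod_triangle|]. rewrite Cmod_mult, Cmod_R.
  assert (Hp := Rabs_pos (s1 - s0)). rewrite <- (pow2_abs (s1 - s0)) in Q.
  assert (W := Rle_abs (K * M)). assert (HA := Cmod_ge_0 A).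
  assert (3 * (K * M) * Rabs (s1 - s0)^2 <= 3 * Rabs (K * M) * Rabs (s1 - s0)).
  { assert (0 <= Rabs (K * M)) by apply Rabs_pos. assert (Rabs (s1 - s0)^2 <= Rabs (s1 - s0)) by nra. nra. }
  assert (L * Rabs (s1 - s0) < e).
  { apply Rle_lt_trans with (L * Rabs (s' - s)); [apply Rmult_le_compat_l; lra|].
    apply (Rmult_lt_compat_l L) in Hb; auto. replace (L * (e / L)) with e in Hb by (field; lra). exact Hb. }
  unfold L in H0. nra.
Qed.

Lemma E_lip g y M s s' : nice g -> 0 < d y -> 0 <= s -> 0 <= s' ->
  (forall z, d y <= d z -> Cmod (D (D (D g)) z) <= M) ->
  Cmod (E s' g y - E s g y)%C <= 3 * (K * M) * Rabs (s'^3 - s^3).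
Proof using HK d_cone Hc0 d_lip.
  intros Hg Hy Hs Hs' HM. assert (N3 := nice_D _ (nice_D _ (nice_D g Hg))).
  assert (W : forall s s', 0 <= s -> s <= s' -> Cmod (E s' g y - E s g y)%C <= 3 * (K * M) * (s'^3 - s^3)).
  { clear s s' Hs Hs'. intros s s' Hs Hss.
    assert (Q := MV_ineq (fun s => E (Rmax 0 s) g y) (fun s => RtoC (3 * s^2) * E s (D (D (D g))) y)%C
      (fun s => 3 * (K * M) * s^3) (fun s => 3 * (K * M) * (3 * s^2)) s s' Hss).
    cbv beta in Q. rewrite !Rmax_right in Q by lra. rewrite Rmult_minus_distr_l. apply Q.
    - intros; apply E_ccont; auto.
    - intros; apply (ex_derive_continuous (V := R_NormedModule)); auto_derive; auto.
    - intros; apply E_rder; auto; lra.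
    - intros; auto_derive; auto. ring.
    - intros x Hx. cbv beta. rewrite Cmod_mult, Cmod_RtoC_pos by nra. rewrite (Rmult_comm (3 * (K * M))). apply Rmult_le_compat_l; [nra|].
      apply EK_bound; auto using kern0; try lra. intros i u Hi Hu. apply HM. apply cone_d; auto; nra. }
  destruct (Rle_dec s s').
  - rewrite Rabs_pos_eq; auto. assert (s^3 <= s'^3) by (apply pow_incr; lra). lra.
  - rewrite Rabs_left1, Cmod_minus_sym. replace (- (s'^3 - s^3)) with (s^3 - s'^3) by ring. apply W; lra.
    assert (s'^3 <= s^3) by (apply pow_incr; lra). lra.
Qed.

Lemma E_taylor g y M s s' : nice g -> 0 < d y -> 0 <= s -> 0 <= s' ->
  (forall z, d y <= d z -> Cmod (D (D (D (D (D (D g))))) z) <= M) ->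
  Cmod (E s' g y - E s g y - RtoC (s'^3 - s^3) * E s (D (D (D g))) y)%C <= 3 * (K * M) * (s'^3 - s^3)^2.
Proof using HK d_cone Hc0 d_lip.
  intros Hg Hy Hs Hs' HM. assert (N3 := nice_D _ (nice_D _ (nice_D g Hg))).
  assert (HM0 : 0 <= M). { eapply Rle_trans; [apply Cmod_ge_0|apply (HM y); lra]. }
  assert (HKp := K_pos).
  set (A := E s (D (D (D g))) y). set (De := Rabs (s'^3 - s^3)).
  set (f := fun u => (E (Rmax 0 u) g y - RtoC (u^3) * A)%C).
  set (df := fun u => (RtoC (3 * u^2) * E u (D (D (D g))) y - RtoC (3 * u^2) * A)%C).
  assert (Cf : forall u, ccont f u).
  { intros u. apply ccont_minus; [apply E_ccont; auto|]. apply ccont_mult; [|apply ccont_const].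
    apply (ccont_RtoC (fun u => u^3)). apply (ex_derive_continuous (V := R_NormedModule)). auto_derive. auto. }
  assert (Rf : forall u, 0 < u -> rder f u (df u)).
  { intros u Hu. apply rder_minus; [apply E_rder; auto|].
    replace (RtoC (3 * u^2) * A)%C with (RtoC (3 * u^2) * A + RtoC (u^3) * 0)%C by ring.
    apply (rder_mult (fun u => RtoC (u^3)) (fun _ => A)); [|apply rder_const].
    apply (rder_RtoC (fun u => u^3)). auto_derive; auto. ring. }
  assert (Bf : forall u, 0 <= u -> Rabs (u^3 - s^3) <= De -> Cmod (df u) <= (3 * (K * M) * De) * (3 * u^2)).
  { intros u Hu HuD. unfold df. replace (RtoC (3 * u^2) * E u (D (D (D g))) y - RtoC (3 * u^2) * A)%C with (RtoC (3 * u^2) * (E u (D (D (D g))) y - A))%C by ring.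
    rewrite Cmod_mult, Cmod_RtoC_pos by nra. rewrite (Rmult_comm (3 * (K * M) * De)). apply Rmult_le_compat_l; [nra|].
    eapply Rle_trans; [apply (E_lip (D (D (D g))) y M s u); auto|]. apply Rmult_le_compat_l; [|auto]. nra. }
  assert (W : forall a b, 0 <= a -> a <= b -> (forall u, a < u < b -> Rabs (u^3 - s^3) <= De) ->
     Cmod (f b - f a)%C <= (3 * (K * M) * De) * (b^3 - a^3)).
  { intros a b Ha Hab HD. rewrite Rmult_minus_distr_l.
    apply (MV_ineq f df (fun u => (3 * (K * M) * De) * u^3) (fun u => (3 * (K * M) * De) * (3 * u^2))); auto.
    - intros; apply (ex_derive_continuous (V := R_NormedModule)); auto_derive; auto.
    - intros; apply Rf; lra.
    - intros; auto_derive; auto. ring.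
    - intros x Hx. apply Bf; auto; lra. }
  assert (Ef : forall u, 0 <= u -> f u = (E u g y - RtoC (u^3) * A)%C) by (intros u Hu; unfold f; now rewrite Rmax_right by lra).
  replace (E s' g y - E s g y - RtoC (s'^3 - s^3) * A)%C with (f s' - f s)%C by (rewrite !Ef, RtoC_minus by auto; ring).
  replace ((s'^3 - s^3)^2) with (De * De) by (unfold De; rewrite <- pow2_abs; ring). rewrite <- Rmult_assoc.
  destruct (Rle_dec s s').
  - assert (s^3 <= s'^3) by (apply pow_incr; lra). unfold De at 2. rewrite (Rabs_pos_eq (s'^3 - s^3)) by lra. apply W; auto.
    intros u Hu. unfold De. assert (s^3 <= u^3) by (apply pow_incr; lra). assert (u^3 <= s'^3) by (apply pow_incr; lra). rewrite !Rabs_pos_eq; lra.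
  - assert (s'^3 <= s^3) by (apply pow_incr; lra). unfold De at 2. rewrite (Rabs_left1 (s'^3 - s^3)), Cmod_minus_sym by lra.
    replace (- (s'^3 - s^3)) with (s^3 - s'^3) by ring. apply W; auto; [lra|].
    intros u Hu. unfold De. assert (s'^3 <= u^3) by (apply pow_incr; lra). assert (u^3 <= s^3) by (apply pow_incr; lra). rewrite !Rabs_left1; lra.
Qed.
End Operator.

(** * The Duhamel operator *)

Definition cbrt (t : R) : R := if Rle_dec t 0 then 0 else Rpower t (/3).

Lemma cbrt_pos t : 0 <= cbrt t.
Proof. unfold cbrt. destruct (Rle_dec t 0); [lra|]. apply Rlt_le, exp_pos. Qed.
Lemma cbrt_neg t : t <= 0 -> cbrt t = 0.
Proof. intros H. unfold cbrt. destruct (Rle_dec t 0); lra. Qed.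
Lemma cbrt_cube t : 0 <= t -> cbrt t ^ 3 = t.
Proof.
  intros H. unfold cbrt. destruct (Rle_dec t 0); [replace t with 0 by lra; ring|].
  rewrite <- Rpower_pow by apply exp_pos. rewrite Rpower_mult. replace (/3 * INR 3) with 1 by (simpl; field).
  apply Rpower_1. lra.
Qed.
Lemma cbrt_gt t : 0 < t -> 0 < cbrt t.
Proof. intros H. unfold cbrt. destruct (Rle_dec t 0); [lra|]. apply exp_pos. Qed.
Lemma cube_lt_inv a b : 0 <= a -> 0 <= b -> a ^ 3 < b ^ 3 -> a < b.
Proof. intros Ha Hb H. destruct (Rlt_dec a b); auto. assert (b^3 <= a^3) by (apply pow_incr; lra). lra. Qed.
Lemma cbrt_le a b : a <= b -> cbrt a <= cbrt b.
Proof.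
  intros H. destruct (Rle_dec a 0). { rewrite cbrt_neg by lra. apply cbrt_pos. }
  destruct (Rle_dec (cbrt a) (cbrt b)) as [L|L]; auto. exfalso.
  assert (cbrt b ^ 3 < cbrt a ^ 3).
  { apply Rnot_le_lt in L. assert (P := cbrt_pos b).
    assert (Q : cbrt a ^ 3 - cbrt b ^ 3 = (cbrt a - cbrt b) * (cbrt a ^ 2 + cbrt a * cbrt b + cbrt b ^ 2)) by ring.
    assert (0 < (cbrt a - cbrt b) * (cbrt a ^ 2 + cbrt a * cbrt b + cbrt b ^ 2)) by (apply Rmult_lt_0_compat; [lra|nra]). lra. }
  rewrite !cbrt_cube in H0 by lra. lra.
Qed.
Lemma cbrt_derive t : 0 < t -> is_derive cbrt t (/ (3 * cbrt t ^ 2)).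
Proof.
  intros H. apply (is_derive_ext_loc (fun u => Rpower u (/3))).
  - apply locally_R_iff. exists t. split; auto. intros u Hu. apply Rabs_def2 in Hu. unfold cbrt. destruct (Rle_dec u 0); [lra|reflexivity].
  - unfold Rpower. auto_derive; [auto|].
    assert (E : cbrt t = exp (/3 * ln t)). { unfold cbrt. destruct (Rle_dec t 0); [lra|reflexivity]. }
    rewrite <- E. assert (P := cbrt_gt t H). replace (/ t) with (/ (cbrt t ^ 3)) by (rewrite cbrt_cube; lra).
    field. lra.
Qed.
Lemma cbrt_continuous t : continuous cbrt t.
Proof.
  destruct (Rlt_dec 0 t) as [H|H].
  { apply (ex_derive_continuous (V := R_NormedModule)). eexists. now apply cbrt_derive. }
  intros P HP. apply locally_R_iff in HP. destruct HP as [e [He HP]].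
  apply locally_R_iff. exists (e^3). split; [now apply pow_lt|]. intros u Hu. apply HP.
  rewrite (cbrt_neg t) by lra. rewrite Rminus_0_r, Rabs_pos_eq by apply cbrt_pos.
  apply cube_lt_inv; [apply cbrt_pos|lra|]. destruct (Rle_dec u 0).
  - rewrite cbrt_neg by auto. rewrite pow_i by lia. now apply pow_lt.
  - rewrite cbrt_cube by lra. apply Rabs_def2 in Hu. lra.
Qed.

Section Duhamel.
Variables (psi K : R) (k kp : nat -> R -> C).
Hypothesis HK : kernel_ok psi K k kp.
Variables (d : C -> R) (c0 : R).
Hypothesis Hc0 : 0 < c0.
Hypothesis d_lip : forall y z, Rabs (d y - d z) <= Cmod (y - z)%C.
Hypothesis d_cone : forall y i s, (i < 3)%nat -> 0 <= s -> d y + c0 * s <= d (y + RtoC s * edir psi i)%C.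

Notation nice := (nice d).
Notation kern := kern.
Notation E := (E psi k).
Notation EK := (EK psi).

Lemma niceD g : nice g -> nice (D g).
Proof using d_lip. exact (nice_D d d_lip g). Qed.

Definition slice (h : C -> R -> C) (t : R) : C -> C := fun z => h z t.
Definition tD (h : C -> R -> C) : C -> R -> C := fun z t => D (slice h t) z.
Definition tnice (h : C -> R -> C) := (forall z t, 0 < d z -> exists l, cder (slice h t) z l) /\
  (forall del, 0 < del -> exists M, forall z t, del <= d z -> Cmod (h z t) <= M) /\
  (forall z t, 0 < d z -> ccont (h z) t).

Lemma tnice_nice h t : tnice h -> nice (slice h t).
Proof using. intros [H1 [H2 _]]. split; [auto|]. intros del Hd. destruct (H2 del Hd) as [M HM]. exists M. intros; apply HM; auto. Qed.

Lemma tnice_tD h : tnice h -> tnice (tD h).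
Proof using d_lip.
  intros Hh. destruct Hh as [H1 [H2 H3]]. assert (Hh : tnice h) by (repeat split; auto). repeat split.
  - intros z t Hz. apply (niceD (slice h t) (tnice_nice h t Hh)). auto.
  - intros del Hd. destruct (H2 (del/2)) as [M HM]; [lra|]. exists (M / (del/2)). intros z t Hz.
    apply (D_bound_d d d_lip (slice h t) z (del/2) M); try lra. now apply tnice_nice. intros u Hu. apply HM. lra.
  - intros z t Hz.
    destruct (H2 (d z / 2)) as [M HM]; [lra|].
    assert (Hb : forall s, hball z (d z / 2) (slice h s)) by (intros s; apply (nice_hball d d_lip); [now apply tnice_nice|lra]).
    destruct (limit_holo (locally t) (fun s => slice h s) (slice h t) z (d z / 2) M ltac:(lra) Hb) as [l [Hl HL]].
    + intros s u Hu. apply HM. assert (W := d_ball d d_lip z u (d z / 2) Hu). lra.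
    + intros u Hu e He. assert (W := d_ball d d_lip z u (d z / 2) Hu).
      destruct (H3 u t ltac:(lra) e He) as [del [Hdel HH]]. apply locally_R_iff. exists del. split; auto.
    + intros e He. assert (Q := HL e He). apply locally_R_iff in Q. destruct Q as [del [Hdel Q]]. exists del. split; auto.
      intros s Hs. unfold tD. rewrite (D_unique _ _ _ Hl). auto.
Qed.

Lemma finite_net (P : nat -> R -> Prop) t : (forall j, exists del, 0 < del /\ forall s, Rabs (s - t) < del -> P j s) ->
  forall n, exists del, 0 < del /\ forall s, Rabs (s - t) < del -> forall j, (j <= n)%nat -> P j s.
Proof using.
  intros H. induction n.
  - destruct (H 0%nat) as [del [Hd HH]]. exists del. split; auto. intros s Hs j Hj. replace j with 0%nat by lia. auto.
  - destruct IHn as [d1 [Hd1 H1]]. destruct (H (S n)) as [d2 [Hd2 H2]]. exists (Rmin d1 d2). split; [now apply Rmin_glb_lt|].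
    intros s Hs j Hj.
    assert (Rabs (s - t) < d1) by (eapply Rlt_le_trans; [exact Hs|apply Rmin_l]).
    assert (Rabs (s - t) < d2) by (eapply Rlt_le_trans; [exact Hs|apply Rmin_r]).
    destruct (Nat.eq_dec j (S n)) as [->|]; auto. apply H1; auto. lia.
Qed.

Lemma equilip_uniform (f : R -> R -> C) (X L t : R) : 0 <= X ->
  (forall x y s, 0 <= x -> 0 <= y -> Cmod (f x s - f y s)%C <= L * Rabs (x - y)) ->
  (forall x, 0 <= x -> ccont (f x) t) ->
  forall e, 0 < e -> exists del, 0 < del /\ forall s, Rabs (s - t) < del -> forall x, 0 <= x <= X -> Cmod (f x s - f x t)%C <= e.
Proof using.
  intros HX HL Hc e He.
  set (L' := Rabs L + 1). assert (HL' : 0 < L') by (unfold L'; assert (W := Rabs_pos L); lra).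
  set (r := e / (4 * L')). assert (Hr : 0 < r) by (apply Rdiv_lt_0_compat; lra).
  destruct (INR_unbounded (X / r)) as [n Hn].
  destruct (finite_net (fun j s => Cmod (f (INR j * r)%R s - f (INR j * r)%R t)%C < e / 4) t) with (n := n) as [del [Hdel HH]].
  { intros j. destruct (Hc (INR j * r)) with (eps := e/4) as [del [Hdel HH]].
    - apply Rmult_le_pos; [apply pos_INR|lra].
    - lra.
    - exists del. split; auto. }
  exists del. split; auto. intros s Hs x Hx.
  destruct (nfloor_ex (x / r)) as [j [Hj1 Hj2]]. { apply le_div_intro; lra. }
  assert (Hxr : x = x / r * r) by (field; lra).
  assert (Hjn : (j <= n)%nat).
  { apply INR_le. apply Rle_trans with (x / r); auto. apply Rle_trans with (X / r); [|lra].
    apply Rmult_le_compat_r; [apply Rlt_le, Rinv_0_lt_compat; auto|lra]. }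
  specialize (HH s Hs j Hjn). cbv beta in HH.
  set (xj := INR j * r) in *. assert (Hxj : 0 <= xj) by (apply Rmult_le_pos; [apply pos_INR|lra]).
  assert (Hd : Rabs (x - xj) <= r). { rewrite Hxr. unfold xj. rewrite <- Rmult_minus_distr_r, Rabs_mult, (Rabs_pos_eq r) by lra.
    rewrite Rabs_pos_eq by lra. nra. }
  assert (B : forall u, Cmod (f x u - f xj u)%C <= e / 4).
  { intros u. eapply Rle_trans; [apply HL; lra|]. apply Rle_trans with (L' * r).
    - assert (W := Rle_abs L). assert (0 <= Rabs (x - xj)) by apply Rabs_pos. unfold L'. assert (W2 := Rabs_pos L). nra.
    - right. unfold r. field. lra. }
  assert (T1 := Cmod_tri3 (f x s) (f xj s) (f x t)). assert (T2 := Cmod_tri3 (f xj s) (f xj t) (f x t)).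
  assert (B1 := B s). assert (B2 := B t). rewrite (Cmod_minus_sym (f x t) (f xj t)) in B2. lra.
Qed.

Lemma EK_tcont q Q s h y t : kern q Q -> tnice h -> 0 < d y -> 0 <= s -> ccont (fun u => EK q s (slice h u) y) t.
Proof using d_lip d_cone Hc0.
  intros Hq Hh Hy Hs e He. assert (HQ := kern_Q q Q Hq).
  destruct (proj1 (proj2 Hh) (d y) Hy) as [M HM]. destruct (proj1 (proj2 (tnice_tD h Hh)) (d y) Hy) as [M1 HM1].
  assert (HM0 : 0 <= M). { eapply Rle_trans; [apply Cmod_ge_0|apply (HM y 0); lra]. }
  set (e' := e / 12).
  set (X := 2 * (Q * M) / e').
  assert (HX : 0 <= X). { unfold X. apply le_div_intro; unfold e'; [lra|]. assert (0 <= Q * M) by nra. lra. }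
  assert (HeX : 2 * (Q * M / (1 + X)) <= e').
  { replace (2 * (Q * M / (1 + X))) with ((2 * (Q * M)) / (1 + X)) by (field; lra). apply Rle_div_l; [lra|].
    assert (E0 : X * e' = 2 * (Q * M)) by (unfold X, e'; field; lra). unfold e' in *. nra. }
  set (eta := e' / (X * Q + 1)). assert (HXQ : 0 <= X * Q) by nra. assert (Heta : 0 < eta) by (apply Rdiv_lt_0_compat; unfold e'; lra).
  assert (U : forall i, (i < 3)%nat -> exists del, 0 < del /\ forall u, Rabs (u - t) < del -> forall x, 0 <= x <= X ->
     Cmod (h (y + RtoC (x * s) * edir psi i)%C u - h (y + RtoC (x * s) * edir psi i)%C t)%C <= eta).
  { intros i Hi. apply (equilip_uniform (fun x u => h (y + RtoC (x * s) * edir psi i)%C u) X (s * M1) t); auto.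
    - intros a b u Ha Hb.
      assert (W := MV_abs (fun x => h (y + RtoC (x * s) * edir psi i)%C u) (fun x => RtoC s * edir psi i * D (slice h u) (y + RtoC (x * s) * edir psi i))%C (s * M1) 0 (Rmax a b)).
      apply W.
      + intros x Hx. eapply rder_ccont. apply (ray_rder psi d c0 Hc0 d_cone (slice h u)); auto; try lra. now apply tnice_nice.
      + intros x Hx. apply (ray_rder psi d c0 Hc0 d_cone (slice h u)); auto; try lra. now apply tnice_nice.
      + intros x Hx. rewrite !Cmod_mult, Cmod_edir, Rmult_1_r, Cmod_RtoC_pos by auto. apply Rmult_le_compat_l; auto.
        apply (HM1 _ u). apply (cone_d psi d c0 Hc0 d_cone); auto; nra.
      + split; [auto|apply Rmax_r].
      + split; [auto|apply Rmax_l].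
    - intros x Hx. apply Hh. assert (W := cone_d psi d c0 Hc0 d_cone y i (x * s) Hi ltac:(nra)). lra. }
  destruct (U 0%nat ltac:(lia)) as [d0 [Hd0 U0]]. destruct (U 1%nat ltac:(lia)) as [d1 [Hd1 U1]]. destruct (U 2%nat ltac:(lia)) as [d2 [Hd2 U2]].
  exists (Rmin d0 (Rmin d1 d2)). split; [repeat apply Rmin_glb_lt; auto|]. intros u Hu.
  assert (Hu0 : Rabs (u - t) < d0) by (eapply Rlt_le_trans; [exact Hu|apply Rmin_l]).
  assert (Hu' : Rabs (u - t) < Rmin d1 d2) by (eapply Rlt_le_trans; [exact Hu|apply Rmin_r]).
  assert (Hu1 : Rabs (u - t) < d1) by (eapply Rlt_le_trans; [exact Hu'|apply Rmin_l]).
  assert (Hu2 : Rabs (u - t) < d2) by (eapply Rlt_le_trans; [exact Hu'|apply Rmin_r]).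
  assert (UU : forall i, (i < 3)%nat -> forall x, 0 <= x <= X ->
     Cmod (h (y + RtoC (x * s) * edir psi i)%C u - h (y + RtoC (x * s) * edir psi i)%C t)%C <= eta).
  { intros i Hi. destruct i as [|[|[|i]]]; [apply U0|apply U1|apply U2|lia]; auto. }
  clear U U0 U1 U2. unfold EK. rewrite sum3_minus.
  apply Rle_lt_trans with (3 * (3 * e')); [|unfold e'; lra]. apply sum3_bound. intros i Hi.
  set (fu := fun x => (q i x * slice h u (y + RtoC (x * s) * edir psi i))%C).
  set (ft := fun x => (q i x * slice h t (y + RtoC (x * s) * edir psi i))%C).
  assert (Du : dom fu (Q * M)). { apply (ray_dom psi d c0 Hc0 d_cone); auto. now apply tnice_nice. intros; apply HM; apply (cone_d psi d c0 Hc0 d_cone); auto; nra. }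
  assert (Dt : dom ft (Q * M)). { apply (ray_dom psi d c0 Hc0 d_cone); auto. now apply tnice_nice. intros; apply HM; apply (cone_d psi d c0 Hc0 d_cone); auto; nra. }
  assert (T1 := Iinf_tail fu (Q * M) X HX Du). assert (T2 := Iinf_tail ft (Q * M) X HX Dt).
  assert (T3 : Cmod (CI fu 0 X - CI ft 0 X)%C <= (X - 0) * (Q * eta)).
  { rewrite <- CI_minus; auto. 2: eapply dom_con; eauto; lra. 2: eapply dom_con; eauto; lra.
    apply CI_bound_const; auto.
    - apply con_on_minus; eapply dom_con; eauto; lra.
    - intros x Hx. unfold fu, ft.
      replace (q i x * slice h u (y + RtoC (x * s) * edir psi i) - q i x * slice h t (y + RtoC (x * s) * edir psi i))%C with
       (q i x * (slice h u (y + RtoC (x * s) * edir psi i) - slice h t (y + RtoC (x * s) * edir psi i)))%C by ring.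
      rewrite Cmod_mult. apply Rmult_le_compat; auto using Cmod_ge_0.
      + destruct (Hq i Hi) as [_ q2]. eapply Rle_trans; [apply q2; lra|]. apply Rle_div_l; [apply pow_lt; lra|].
        assert (1 <= (1 + x)^2) by (apply pow_R1_Rle; lra). nra.
      + apply UU; auto; lra. }
  rewrite Rminus_0_r in T3.
  assert (T4 : X * (Q * eta) <= e').
  { replace (X * (Q * eta)) with (X * Q * eta) by ring. unfold eta. replace (X * Q * (e' / (X * Q + 1))) with (e' * (X * Q) / (X * Q + 1)) by (field; lra).
    apply Rle_div_l; [lra|]. assert (0 < e') by (unfold e'; lra). nra. }
  replace (Iinf fu - Iinf ft)%C with ((Iinf fu - CI fu 0 X) + (CI fu 0 X - CI ft 0 X) - (Iinf ft - CI ft 0 X))%C by ring.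
  eapply Rle_trans; [apply Cmod_triangle_minus|]. eapply Rle_trans; [apply Rplus_le_compat_r, Cmod_triangle|]. unfold e' in *; lra.
Qed.

Definition Lint (h : C -> R -> C) (y : C) (t sg : R) : C := E (cbrt (t - sg)) (slice h sg) y.
Definition L (h : C -> R -> C) (y : C) (t : R) : C := CI (Lint h y t) 0 t.

Lemma Lint_cont h y t : tnice h -> 0 < d y -> forall sg, ccont (Lint h y t) sg.
Proof using HK d_lip d_cone Hc0.
  intros Hh Hy sg e He. set (s := cbrt (t - sg)). assert (Hs : 0 <= s) by apply cbrt_pos.
  destruct (proj1 (proj2 (tnice_tD _ (tnice_tD _ (tnice_tD h Hh)))) (d y) Hy) as [M HM].
  set (C3 := Rabs (3 * (K * M)) + 1). assert (HC3 : 0 < C3) by (unfold C3; assert (W := Rabs_pos (3 * (K * M))); lra).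
  destruct (EK_tcont (q0 psi k) K s h y sg (kern0 _ _ _ _ HK) Hh Hy Hs (e/2)) as [del [Hdel HH]]; [lra|].
  exists (Rmin del (e / (2 * C3))). split; [apply Rmin_glb_lt; auto; apply Rdiv_lt_0_compat; lra|]. intros u Hu.
  assert (Ha : Rabs (u - sg) < del) by (eapply Rlt_le_trans; [exact Hu|apply Rmin_l]).
  assert (Hb : Rabs (u - sg) < e / (2 * C3)) by (eapply Rlt_le_trans; [exact Hu|apply Rmin_r]).
  specialize (HH u Ha). unfold Lint. fold s.
  eapply Rle_lt_trans; [apply (Cmod_tri3 _ (E s (slice h u) y))|].
  assert (Q := E_lip psi K k kp HK d c0 Hc0 d_lip d_cone (slice h u) y M s (cbrt (t - u)) (tnice_nice _ _ Hh) Hy Hs (cbrt_pos _)).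
  assert (Q' : Cmod (E (cbrt (t - u)) (slice h u) y - E s (slice h u) y)%C <= 3 * (K * M) * Rabs (cbrt (t - u) ^ 3 - s ^ 3)).
  { apply Q. intros z Hz. apply (HM z u Hz). }
  assert (Hcub : Rabs (cbrt (t - u) ^ 3 - s ^ 3) <= Rabs (u - sg)).
  { assert (Z : forall v, cbrt v ^ 3 = Rmax 0 v). { intros v. destruct (Rle_dec 0 v). rewrite Rmax_right, cbrt_cube; auto. rewrite Rmax_left, cbrt_neg by lra. ring. }
    unfold s. rewrite !Z. unfold Rmax. destruct (Rle_dec 0 (t - u)), (Rle_dec 0 (t - sg)); unfold Rabs; repeat destruct (Rcase_abs _); lra. }
  assert (Hfin : 3 * (K * M) * Rabs (cbrt (t - u) ^ 3 - s ^ 3) < e / 2).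
  { assert (W := Rle_abs (3 * (K * M))). assert (Hp := Rabs_pos (cbrt (t - u) ^ 3 - s ^ 3)). assert (Hp' := Rabs_pos (3 * (K * M))).
    apply Rle_lt_trans with (C3 * Rabs (u - sg)).
    - apply Rle_trans with (C3 * Rabs (cbrt (t - u) ^ 3 - s ^ 3)); [apply Rmult_le_compat_r; auto; unfold C3; lra|]. apply Rmult_le_compat_l; lra.
    - apply (Rmult_lt_compat_l C3) in Hb; auto. replace (C3 * (e / (2 * C3))) with (e/2) in Hb by (field; lra). exact Hb. }
  change (Cmod (E s (slice h u) y - E s (slice h sg) y)%C < e / 2) in HH. lra.
Qed.

Lemma Lint_con h y t a b : tnice h -> 0 < d y -> con_on (Lint h y t) a b.
Proof using HK d_lip d_cone Hc0. intros Hh Hy x _. now apply Lint_cont. Qed.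

Lemma K_p : 0 <= K.
Proof using HK. exact (K_pos psi K k kp HK). Qed.

Lemma Lint_bound h y t sg M : tnice h -> 0 < d y -> (forall z u, d y <= d z -> Cmod (h z u) <= M) -> Cmod (Lint h y t sg) <= 3 * (K * M).
Proof using HK d_lip d_cone Hc0.
  intros Hh Hy HM. apply (EK_bound psi d c0 Hc0 d_cone); auto.
  - exact (kern0 _ _ _ _ HK).
  - now apply tnice_nice.
  - apply cbrt_pos.
  - intros i x Hi Hx. apply HM. apply (cone_d psi d c0 Hc0 d_cone); auto. apply Rmult_le_pos; auto. apply cbrt_pos.
Qed.

Lemma L_bound h y t M : tnice h -> 0 < d y -> 0 <= t -> (forall z u, d y <= d z -> Cmod (h z u) <= M) -> Cmod (L h y t) <= t * (3 * (K * M)).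
Proof using HK d_lip d_cone Hc0.
  intros Hh Hy Ht HM. rewrite <- (Rminus_0_r t) at 2. apply CI_bound_const; auto.
  - now apply Lint_con.
  - intros. now apply Lint_bound.
Qed.

Lemma L_cder h y t : tnice h -> 0 < d y -> 0 <= t -> cder (fun z => L h z t) y (L (tD h) y t).
Proof using HK d_lip d_cone Hc0.
  intros Hh Hy Ht. destruct (proj1 (proj2 Hh) (d y / 2)) as [M HM]; [lra|].
  apply (cder_quad _ _ _ (t * (3 * (K * (72 * M / (d y)^2)))) (d y / 12)); [lra|]. intros v Hv.
  assert (Hyv : 0 < d (y + v)%C). { assert (W := d_ball d d_lip y (y + v)%C (d y / 12)). replace (y + v - y)%C with v in W by ring. specialize (W ltac:(lra)). lra. }
  unfold L. rewrite <- CI_scal by (auto; apply Lint_con; auto using tnice_tD).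
  rewrite <- !CI_minus; auto; try (apply Lint_con; auto using tnice_tD).
  2: apply con_on_minus; apply Lint_con; auto.
  2: apply con_on_scal; apply Lint_con; auto using tnice_tD.
  replace (t * (3 * (K * (72 * M / d y ^ 2))) * Cmod v ^ 2) with ((t - 0) * (3 * (K * (72 * M / d y ^ 2 * Cmod v ^ 2)))) by ring.
  apply CI_bound_const; auto.
  - apply con_on_minus; [apply con_on_minus; apply Lint_con; auto|]. apply con_on_scal; apply Lint_con; auto using tnice_tD.
  - intros sg _. unfold Lint. apply (EK_quad psi d c0 Hc0 d_lip d_cone); auto.
    + exact (kern0 _ _ _ _ HK).
    + now apply tnice_nice.
    + apply cbrt_pos.
    + intros z Hz. apply HM; auto.
    + lra.
Qed.

Notation tD3 h := (tD (tD (tD h))).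

Lemma L_fwd h y T : tnice h -> 0 < d y -> 0 <= T -> exists C0, forall t t', 0 <= t -> t <= t' -> t' <= T ->
  Cmod (L h y t' - L h y t - RtoC (t' - t) * L (tD3 h) y t - CI (h y) t t')%C <= C0 * (t' - t)^2.
Proof using HK d_lip d_cone Hc0.
  intros Hh Hy HT. assert (N3 := tnice_tD _ (tnice_tD _ (tnice_tD h Hh))). assert (N6 := tnice_tD _ (tnice_tD _ (tnice_tD _ N3))).
  destruct (proj1 (proj2 N3) (d y) Hy) as [M3 HM3]. destruct (proj1 (proj2 N6) (d y) Hy) as [M6 HM6].
  assert (HM3p : 0 <= M3). { eapply Rle_trans; [apply Cmod_ge_0|apply (HM3 y 0); lra]. }
  assert (HM6p : 0 <= M6). { eapply Rle_trans; [apply Cmod_ge_0|apply (HM6 y 0); lra]. }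
  assert (HKp := K_p).
  assert (KM3 : 0 <= K * M3) by (apply Rmult_le_pos; auto). assert (KM6 : 0 <= K * M6) by (apply Rmult_le_pos; auto).
  exists (3 * (K * M3) + T * (3 * (K * M6))). intros t t' Ht Htt HtT.
  assert (Hhc : con_on (h y) t t') by (intros x _; apply Hh; auto).
  set (A := CI (Lint h y t') t t'). set (B := CI (Lint h y t') 0 t).
  assert (EA : L h y t' = (B + A)%C). { unfold L, A, B. symmetry. apply CI_Chasles; auto. apply Lint_con; auto. }
  assert (HA : Cmod (A - CI (h y) t t')%C <= (t' - t) * (3 * (K * M3) * (t' - t))).
  { unfold A. rewrite <- CI_minus; auto; [|apply Lint_con; auto]. apply CI_bound_const; auto.
    - apply con_on_minus; auto. apply Lint_con; auto.
    - intros sg Hsg. unfold Lint. rewrite <- (E_zero psi K k kp HK d c0 Hc0 d_cone (slice h sg) y (tnice_nice _ _ Hh) Hy : _ = h y sg).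
      eapply Rle_trans; [apply (E_lip psi K k kp HK d c0 Hc0 d_lip d_cone (slice h sg) y M3 0); auto using cbrt_pos; try lra|].
      + now apply tnice_nice.
      + intros z Hz. apply (HM3 z sg Hz).
      + rewrite cbrt_cube by lra. replace (t' - sg - 0 ^ 3) with (t' - sg) by ring. rewrite Rabs_pos_eq by lra.
        apply Rmult_le_compat_l; lra. }
  assert (HB : Cmod (B - L h y t - RtoC (t' - t) * L (tD3 h) y t)%C <= (t - 0) * (3 * (K * M6) * (t' - t)^2)).
  { unfold B, L. rewrite <- CI_scal by (auto; apply Lint_con; auto).
    rewrite <- !CI_minus; auto; try (apply Lint_con; auto).
    2: apply con_on_minus; apply Lint_con; auto.
    2: apply con_on_scal; apply Lint_con; auto.
    apply CI_bound_const; auto.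
    - apply con_on_minus; [apply con_on_minus; apply Lint_con; auto|]. apply con_on_scal; apply Lint_con; auto.
    - intros sg Hsg. unfold Lint.
      assert (Q := E_taylor psi K k kp HK d c0 Hc0 d_lip d_cone (slice h sg) y M6 (cbrt (t - sg)) (cbrt (t' - sg)) (tnice_nice _ _ Hh) Hy (cbrt_pos _) (cbrt_pos _)).
      rewrite !cbrt_cube in Q by lra. replace (t' - sg - (t - sg)) with (t' - t) in Q by ring.
      apply Q. intros z Hz. apply (HM6 z sg Hz). }
  rewrite EA. replace (B + A - L h y t - RtoC (t' - t) * L (tD3 h) y t - CI (h y) t t')%C with
    ((A - CI (h y) t t') + (B - L h y t - RtoC (t' - t) * L (tD3 h) y t))%C by ring.
  eapply Rle_trans; [apply Cmod_triangle|].
  assert ((t - 0) * (3 * (K * M6) * (t' - t) ^ 2) <= T * (3 * (K * M6) * (t' - t)^2)).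
  { apply Rmult_le_compat_r; [|lra]. apply Rmult_le_pos; [lra|apply pow2_ge_0]. }
  replace ((3 * (K * M3) + T * (3 * (K * M6))) * (t' - t)^2) with ((t' - t) * (3 * (K * M3) * (t' - t)) + T * (3 * (K * M6) * (t' - t)^2)) by ring. lra.
Qed.

Lemma L_lip h y T : tnice h -> 0 < d y -> 0 <= T -> exists C0, 0 <= C0 /\ forall t t', 0 <= t <= T -> 0 <= t' <= T ->
  Cmod (L h y t' - L h y t)%C <= C0 * Rabs (t' - t).
Proof using HK d_lip d_cone Hc0.
  intros Hh Hy HT. assert (N3 := tnice_tD _ (tnice_tD _ (tnice_tD h Hh))).
  destruct (L_fwd h y T Hh Hy HT) as [C1 HC1].
  destruct (proj1 (proj2 N3) (d y) Hy) as [M3 HM3]. destruct (proj1 (proj2 Hh) (d y) Hy) as [M0 HM0].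
  assert (HM3p : 0 <= M3). { eapply Rle_trans; [apply Cmod_ge_0|apply (HM3 y 0); lra]. }
  assert (HM0p : 0 <= M0). { eapply Rle_trans; [apply Cmod_ge_0|apply (HM0 y 0); lra]. }
  assert (HKp := K_p). assert (KM3 : 0 <= K * M3) by (apply Rmult_le_pos; auto).
  set (C0 := Rabs C1 * T + T * (3 * (K * M3)) + M0). exists C0.
  assert (HC1p := Rabs_pos C1).
  split; [unfold C0; nra|].
  assert (W : forall t t', 0 <= t -> t <= t' -> t' <= T -> Cmod (L h y t' - L h y t)%C <= C0 * (t' - t)).
  { intros t t' Ht Htt HtT. specialize (HC1 t t' Ht Htt HtT).
    assert (B1 := L_bound (tD3 h) y t M3 N3 Hy Ht HM3).
    assert (B2 : Cmod (CI (h y) t t') <= (t' - t) * M0).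
    { apply CI_bound_const; auto. intros x _; apply Hh; auto. intros; apply HM0; lra. }
    replace (L h y t' - L h y t)%C with ((L h y t' - L h y t - RtoC (t' - t) * L (tD3 h) y t - CI (h y) t t') + RtoC (t' - t) * L (tD3 h) y t + CI (h y) t t')%C by ring.
    eapply Rle_trans; [apply Cmod_triangle|]. eapply Rle_trans; [apply Rplus_le_compat_r, Cmod_triangle|].
    rewrite Cmod_mult, Cmod_RtoC_pos by lra.
    assert (C1 * (t' - t)^2 <= Rabs C1 * T * (t' - t)).
    { assert (V := Rle_abs C1). assert (0 <= (t' - t)^2) by apply pow2_ge_0.
      apply Rle_trans with (Rabs C1 * (t' - t)^2); [apply Rmult_le_compat_r; auto|]. rewrite Rmult_assoc. apply Rmult_le_compat_l; auto. nra. }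
    assert ((t' - t) * Cmod (L (tD3 h) y t) <= (t' - t) * (T * (3 * (K * M3)))).
    { apply Rmult_le_compat_l; [lra|]. eapply Rle_trans; [exact B1|]. apply Rmult_le_compat_r; lra. }
    unfold C0. nra. }
  intros t t' Ht Ht'. destruct (Rle_dec t t').
  - rewrite Rabs_pos_eq by lra. apply W; lra.
  - rewrite Rabs_left1, Cmod_minus_sym by lra. replace (- (t' - t)) with (t - t') by ring. apply W; lra.
Qed.

Lemma L_time h y T : tnice h -> 0 < d y -> 0 <= T -> exists C0, forall t t', 0 <= t <= T -> 0 <= t' <= T ->
  Cmod ((L h y t' - CI (h y) 0 t') - (L h y t - CI (h y) 0 t) - RtoC (t' - t) * L (tD3 h) y t)%C <= C0 * (t' - t)^2.
Proof using HK d_lip d_cone Hc0.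
  intros Hh Hy HT. assert (N3 := tnice_tD _ (tnice_tD _ (tnice_tD h Hh))).
  destruct (L_fwd h y T Hh Hy HT) as [C1 HC1]. destruct (L_lip _ y T N3 Hy HT) as [C2 [HC2p HC2]].
  exists (Rabs C1 + C2). assert (HC1p := Rabs_pos C1). assert (V := Rle_abs C1).
  assert (CH : forall t t', 0 <= t -> t <= t' -> (CI (h y) 0 t' - CI (h y) 0 t)%C = CI (h y) t t').
  { intros t t' Ht Htt. rewrite <- (CI_Chasles (h y) 0 t t'); auto. ring. intros x _; apply Hh; auto. }
  intros t t' Ht Ht'. destruct (Rle_dec t t').
  - specialize (HC1 t t' ltac:(lra) ltac:(lra) ltac:(lra)). rewrite <- (CH t t') in HC1 by lra.
    replace (L h y t' - CI (h y) 0 t' - (L h y t - CI (h y) 0 t) - RtoC (t' - t) * L (tD3 h) y t)%C with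
      (L h y t' - L h y t - RtoC (t' - t) * L (tD3 h) y t - (CI (h y) 0 t' - CI (h y) 0 t))%C by ring.
    eapply Rle_trans; [exact HC1|]. assert (0 <= (t' - t)^2) by apply pow2_ge_0. nra.
  - specialize (HC1 t' t ltac:(lra) ltac:(lra) ltac:(lra)). rewrite <- (CH t' t) in HC1 by lra.
    specialize (HC2 t t' Ht Ht').
    replace (L h y t' - CI (h y) 0 t' - (L h y t - CI (h y) 0 t) - RtoC (t' - t) * L (tD3 h) y t)%C with
      (- (L h y t - L h y t' - RtoC (t - t') * L (tD3 h) y t' - (CI (h y) 0 t - CI (h y) 0 t')) + RtoC (t' - t) * (L (tD3 h) y t' - L (tD3 h) y t))%C
      by (rewrite !RtoC_minus; ring).
    eapply Rle_trans; [apply Cmod_triangle|]. rewrite Cmod_opp, Cmod_mult, Cmod_R.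
    assert (0 <= (t' - t)^2) by apply pow2_ge_0.
    assert (Rabs (t' - t) * Cmod (L (tD3 h) y t' - L (tD3 h) y t)%C <= C2 * (t' - t)^2).
    { rewrite <- (pow2_abs (t' - t)). apply Rle_trans with (Rabs (t' - t) * (C2 * Rabs (t' - t))); [apply Rmult_le_compat_l; auto using Rabs_pos|]. right; ring. }
    replace ((t - t')^2) with ((t' - t)^2) in HC1 by ring. nra.
Qed.

(* Times are clamped to [0, T], so that functions of time are defined and continuous on the whole line. *)
Definition Lc (T : R) (h : C -> R -> C) : C -> R -> C := fun y t => L h y (clamp 0 T t).

Lemma Lc_tnice T h : 0 <= T -> tnice h -> tnice (Lc T h).
Proof using HK d_lip d_cone Hc0.
  intros HT Hh. repeat split.
  - intros z t Hz. eexists. unfold slice, Lc. apply L_cder; auto. apply clamp_in; auto.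
  - intros del Hd. destruct (proj1 (proj2 Hh) del Hd) as [M HM]. exists (T * (3 * (K * M))). intros z t Hz.
    assert (Hcl := clamp_in 0 T t HT). assert (HKp := K_p).
    assert (HMp : 0 <= M). { eapply Rle_trans; [apply Cmod_ge_0|apply (HM z 0); lra]. }
    assert (0 <= K * M) by (apply Rmult_le_pos; auto).
    eapply Rle_trans; [apply (L_bound h z (clamp 0 T t) M); auto; try lra|].
    + intros u v Hu. apply HM. lra.
    + apply Rmult_le_compat_r; lra.
  - intros z t Hz. destruct (L_lip h z T Hh Hz HT) as [C0 [HC0 H]].
    intros e He. exists (e / (C0 + 1)). split; [apply Rdiv_lt_0_compat; lra|]. intros u Hu. unfold Lc.
    eapply Rle_lt_trans; [apply H; apply clamp_in; auto|].
    assert (W := clamp_lip 0 T u t). apply Rle_lt_trans with ((C0 + 1) * Rabs (u - t)).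
    + assert (0 <= Rabs (clamp 0 T u - clamp 0 T t)) by apply Rabs_pos. nra.
    + apply (Rmult_lt_compat_l (C0 + 1)) in Hu; [|lra]. replace ((C0 + 1) * (e / (C0 + 1))) with e in Hu by (field; lra). exact Hu.
Qed.

Lemma Lc_cder T h y t : 0 <= T -> tnice h -> 0 < d y -> cder (slice (Lc T h) t) y (Lc T (tD h) y t).
Proof using HK d_lip d_cone Hc0. intros HT Hh Hy. apply L_cder; auto. now apply clamp_in. Qed.

Lemma Lc_zero T h y : 0 <= T -> Lc T h y 0 = 0.
Proof using. intros HT. unfold Lc. rewrite clamp_id by lra. unfold L. apply CI_point. Qed.

Lemma D3_bound g z del M : nice g -> 0 < del -> 3 * del < d z -> (forall u, d z - 3 * del <= d u -> Cmod (g u) <= M) ->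
  Cmod (D (D (D g)) z) <= M / del / del / del.
Proof using d_lip.
  intros Hg Hd Hz HM. apply (D_bound_d d d_lip); auto using niceD; try lra. intros u Hu.
  apply (D_bound_d d d_lip); auto using niceD; try lra. intros v Hv.
  apply (D_bound_d d d_lip); auto; try lra. intros w Hw. apply HM. lra.
Qed.

Lemma D_minus f g z : nice f -> nice g -> 0 < d z -> D (fun u => f u - g u)%C z = (D f z - D g z)%C.
Proof using. intros Hf Hg Hz. apply D_unique. apply cder_minus; apply (nice_cder d); auto. Qed.

Lemma d_open z : 0 < d z -> forall u, Cmod (u - z)%C < d z -> 0 < d u.
Proof using d_lip. intros Hz u Hu. assert (W := d_lip u z). apply Rabs_le_between in W. lra. Qed.

Lemma D_ext f g : (forall z, 0 < d z -> f z = g z) -> nice f -> forall z, 0 < d z -> D f z = D g z.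
Proof using d_lip.
  intros H Hf z Hz. symmetry. apply D_unique. apply (cder_ext_loc f) with (d := d z); auto.
  - intros u Hu. apply H. now apply (d_open z).
  - now apply (nice_cder d).
Qed.

Lemma nice_minus f g : nice f -> nice g -> nice (fun z => f z - g z)%C.
Proof using.
  intros [f1 f2] [g1 g2]. split.
  - intros z Hz. destruct (f1 z Hz) as [a Ha]. destruct (g1 z Hz) as [b Hb]. eexists. apply cder_minus; eauto.
  - intros del Hd. destruct (f2 del Hd) as [M HM]. destruct (g2 del Hd) as [N HN]. exists (M + N). intros z Hz.
    eapply Rle_trans; [apply Cmod_triangle_minus|]. specialize (HM z Hz). specialize (HN z Hz). lra.
Qed.
Lemma nice_scal c g : nice g -> nice (fun z => c * g z)%C.
Proof using.
  intros [g1 g2]. split.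
  - intros z Hz. destruct (g1 z Hz) as [b Hb]. eexists. apply cder_scal; eauto.
  - intros del Hd. destruct (g2 del Hd) as [N HN]. exists (Cmod c * N). intros z Hz.
    rewrite Cmod_mult. apply Rmult_le_compat_l; auto using Cmod_ge_0.
Qed.

Lemma D3_minus f g z : nice f -> nice g -> 0 < d z -> D (D (D (fun u => f u - g u)%C)) z = (D (D (D f)) z - D (D (D g)) z)%C.
Proof using d_lip.
  intros Hf Hg Hz.
  assert (E1 : forall u, 0 < d u -> D (fun u => f u - g u)%C u = (D f u - D g u)%C) by (intros; now apply D_minus).
  assert (N1 := niceD _ (nice_minus _ _ Hf Hg)).
  assert (E2 : forall u, 0 < d u -> D (D (fun u => f u - g u)%C) u = (D (D f) u - D (D g) u)%C).
  { intros u Hu. rewrite (D_ext _ _ E1 N1 u Hu). apply D_minus; auto using niceD. }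
  rewrite (D_ext _ _ E2 (niceD _ N1) z Hz). apply D_minus; auto using niceD.
Qed.

Theorem linear_uniqueness T w : 0 <= T -> tnice w ->
  (forall y t, 0 < d y -> 0 < t < T -> rder (w y) t (tD3 w y t)) -> (forall y, 0 < d y -> w y 0 = 0) ->
  forall y t, 0 < d y -> 0 <= t <= T -> w y t = 0.
Proof using HK d_lip d_cone Hc0.
  intros HT Hw Hder H0 y t Hy Ht.
  assert (N3 := tnice_tD _ (tnice_tD _ (tnice_tD w Hw))). assert (N6 := tnice_tD _ (tnice_tD _ (tnice_tD _ N3))).
  destruct (proj1 (proj2 N3) (d y / 2) ltac:(lra)) as [M3 HM3]. destruct (proj1 (proj2 N6) (d y) Hy) as [M6 HM6].
  assert (HM3p : 0 <= M3). { eapply Rle_trans; [apply Cmod_ge_0|apply (HM3 y 0); lra]. }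
  assert (HKp := K_p).
  assert (Lw : forall z a b, d y / 2 <= d z -> 0 <= a <= T -> 0 <= b <= T -> Cmod (w z b - w z a)%C <= M3 * Rabs (b - a)).
  { intros z a b Hz Ha Hb. apply (MV_abs (w z) (tD3 w z) M3 0 T); auto.
    - intros x _. apply Hw. lra.
    - intros x Hx. apply Hder; auto. lra. }
  set (del := d y / 12). assert (Hdel : 0 < del) by (unfold del; lra).
  set (L3 := M3 / del / del / del).
  assert (LD : forall z a b, d y <= d z -> 0 <= a <= T -> 0 <= b <= T -> Cmod (tD3 w z b - tD3 w z a)%C <= L3 * Rabs (b - a)).
  { intros z a b Hz Ha Hb. assert (Na := tnice_nice w a Hw). assert (Nb := tnice_nice w b Hw).
    change (tD3 w z b) with (D (D (D (slice w b))) z). change (tD3 w z a) with (D (D (D (slice w a))) z).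
    rewrite <- D3_minus by (auto; lra).
    replace (L3 * Rabs (b - a)) with (M3 * Rabs (b - a) / del / del / del) by (unfold L3; field; lra).
    apply D3_bound; auto.
    - now apply nice_minus.
    - unfold del. lra.
    - intros u Hu. unfold slice. apply Lw; auto. unfold del in Hu. lra. }
  assert (TQ : forall z a b, d y <= d z -> 0 <= a <= T -> 0 <= b <= T -> Cmod (w z b - w z a - RtoC (b - a) * tD3 w z a)%C <= L3 * (b - a)^2).
  { intros z a b Hz Ha Hb. apply (taylor_lip (w z) (tD3 w z) L3 0 T); auto.
    - intros x _. apply Hw. lra.
    - intros x Hx. apply Hder; auto; lra. }
  set (Phi := fun sg => E (cbrt (t - sg)) (slice w sg) y).
  assert (HPhi : Phi t = Phi 0).
  { apply (quad_const Phi (3 * (K * L3) + 3 * (K * M6)) 0 t); [lra|]. intros a b Ha Hb.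
    set (s := cbrt (t - a)). set (s' := cbrt (t - b)).
    assert (Hs : 0 <= s) by apply cbrt_pos. assert (Hs' : 0 <= s') by apply cbrt_pos.
    assert (Na := tnice_nice w a Hw). assert (Nb := tnice_nice w b Hw).
    assert (Na3 : nice (D (D (D (slice w a))))) by auto using niceD.
    set (rr := fun z => ((slice w b z - slice w a z) - RtoC (b - a) * D (D (D (slice w a))) z)%C).
    assert (Nr : nice rr). { apply nice_minus; [apply nice_minus; auto|]. apply nice_scal; auto. }
    assert (K0 := kern0 psi K k kp HK).
    assert (ER : E s' rr y = (E s' (slice w b) y - E s' (slice w a) y - RtoC (b - a) * E s' (D (D (D (slice w a)))) y)%C).
    { unfold E, rr. rewrite (EK_minus psi d c0 Hc0 d_cone _ K) by (auto using nice_minus, nice_scal).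
      rewrite (EK_minus psi d c0 Hc0 d_cone _ K) by auto.
      rewrite (EK_scal psi d c0 Hc0 d_cone _ K) by auto. reflexivity. }
    assert (BR : Cmod (E s' rr y) <= 3 * (K * (L3 * (b - a)^2))).
    { apply (EK_bound psi d c0 Hc0 d_cone); auto. intros i x Hi Hx. unfold rr. apply (TQ _ a b); try lra.
      apply (cone_d psi d c0 Hc0 d_cone); auto. now apply Rmult_le_pos. }
    assert (BT := E_taylor psi K k kp HK d c0 Hc0 d_lip d_cone (slice w a) y M6 s' s Na Hy Hs' Hs (fun z Hz => HM6 z a Hz)).
    unfold s, s' in BT. rewrite !cbrt_cube in BT by lra. fold s s' in BT. replace (t - a - (t - b)) with (b - a) in BT by ring.
    unfold Phi. fold s s'.
    replace (E s' (slice w b) y - E s (slice w a) y)%C with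
      (E s' rr y - (E s (slice w a) y - E s' (slice w a) y - RtoC (b - a) * E s' (D (D (D (slice w a)))) y))%C by (rewrite ER; ring).
    eapply Rle_trans; [apply Cmod_triangle_minus|]. lra. }
  unfold Phi in HPhi. rewrite Rminus_diag, (cbrt_neg 0) in HPhi by lra.
  rewrite (E_zero psi K k kp HK d c0 Hc0 d_cone) in HPhi by (auto; now apply tnice_nice).
  change (slice w t y) with (w y t) in HPhi. rewrite HPhi.
  apply Cmod_eq_0. apply Rle_antisym; [|apply Cmod_ge_0].
  apply Rle_trans with (3 * (K * 0)); [|lra].
  apply (EK_bound psi d c0 Hc0 d_cone); auto.
  - exact (kern0 psi K k kp HK).
  - now apply tnice_nice.
  - apply cbrt_pos.
  - intros i x Hi Hx. unfold slice. rewrite H0; [rewrite Cmod_0; lra|].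
    assert (W := cone_d psi d c0 Hc0 d_cone y i (x * cbrt (t - 0)) Hi). specialize (W (Rmult_le_pos _ _ Hx (cbrt_pos _))). lra.
Qed.
End Duhamel.

(** * Weighted estimates *)

Lemma eta_derive t sg : sg < t ->
  is_derive (fun u => sqrt (cbrt (t - u))) sg (- / (6 * cbrt (t - sg) ^ 2 * sqrt (cbrt (t - sg)))).
Proof.
  intros H. assert (Hs := cbrt_gt (t - sg) ltac:(lra)). assert (Hq : 0 < sqrt (cbrt (t - sg))) by now apply sqrt_lt_R0.
  assert (D1 : is_derive (fun u => t - u) sg (-1)) by (auto_derive; auto; ring).
  assert (D2 := is_derive_comp cbrt (fun u => t - u) sg _ _ (cbrt_derive (t - sg) ltac:(lra)) D1).
  assert (D0 : is_derive sqrt (cbrt (t - sg)) (/ (2 * sqrt (cbrt (t - sg))))).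
  { auto_derive; auto. field. lra. }
  assert (D3 := is_derive_comp sqrt (fun u => cbrt (t - u)) sg _ _ D0 D2).
  unfold scal in D3. simpl in D3. unfold mult in D3. simpl in D3.
  match type of D3 with is_derive _ _ ?v => replace (- / (6 * cbrt (t - sg) ^ 2 * sqrt (cbrt (t - sg)))) with v end; auto.
  field. lra.
Qed.

Lemma eta_cont t sg : continuous (fun u => sqrt (cbrt (t - u))) sg.
Proof.
  apply (continuous_comp (fun u => cbrt (t - u)) sqrt).
  - apply (continuous_comp (fun u => t - u) cbrt); [|apply cbrt_continuous].
    apply (ex_derive_continuous (V := R_NormedModule)). auto_derive. auto.
  - apply continuity_pt_filterlim, continuity_pt_sqrt, cbrt_pos.
Qed.

Definition Cest1 (K c0 T : R) := 3 * K * (sqrt (cbrt T) + 4 / sqrt c0).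
Definition Cest (K c0 T CW : R) := Cest1 K c0 T * (1 + cbrt T)^2 * 6 * sqrt (cbrt T) + 24 * (Cest1 K c0 T + 12 * K * CW).

Section Weighted.
Variables (psi K : R) (k kp : nat -> R -> C).
Hypothesis HK : kernel_ok psi K k kp.
Variables (d : C -> R) (c0 : R).
Hypothesis Hc0 : 0 < c0.
Hypothesis d_lip : forall y z, Rabs (d y - d z) <= Cmod (y - z)%C.
Hypothesis d_cone : forall y i s, (i < 3)%nat -> 0 <= s -> d y + c0 * s <= d (y + RtoC s * edir psi i)%C.
Variables (W : C -> R) (CW T : R).
Hypothesis HT : 0 <= T.
Hypothesis W_pos : forall z, 0 < d z -> 0 <= W z.
Hypothesis HCW : 0 <= CW.
Hypothesis W_cone : forall y i s, (i < 3)%nat -> 0 <= s -> 0 < d y -> W (y + RtoC s * edir psi i)%C <= W y.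
Hypothesis W_loc : forall z u, 0 < d z -> Cmod (u - z)%C <= d z / 2 -> Cmod (u - z)%C <= / 2 -> W u <= CW * W z.

Notation E := (E psi k).
Notation L := (L psi k).
Notation tnice := (tnice d).

Definition mu (z : C) : R := sqrt (Rmin (d z) 1).

Lemma mu_pos z : 0 < d z -> 0 < mu z.
Proof using. intros H. apply sqrt_lt_R0. apply Rmin_glb_lt; lra. Qed.
Lemma mu_le1 z : mu z <= 1.
Proof using. unfold mu. rewrite <- sqrt_1 at 2. apply sqrt_le_1_alt. apply Rmin_r. Qed.
Lemma mu_sq z : 0 < d z -> mu z * mu z = Rmin (d z) 1.
Proof using. intros H. apply sqrt_sqrt. apply Rmin_glb; lra. Qed.
Lemma mu_mono y z : d y <= d z -> mu y <= mu z.
Proof using. intros H. apply sqrt_le_1_alt. apply Rle_min_compat_r; auto. Qed.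
Lemma mu_inv_ray z r : 0 < r -> r <= d z -> / mu z <= 1 + / sqrt r.
Proof using.
  intros Hr Hz. assert (Hs : 0 < sqrt r) by now apply sqrt_lt_R0. assert (Hi : 0 < / sqrt r) by now apply Rinv_0_lt_compat.
  destruct (Rle_dec 1 (d z)) as [H|H].
  - unfold mu. rewrite Rmin_right by lra. rewrite sqrt_1, Rinv_1. lra.
  - unfold mu. rewrite Rmin_left by lra. assert (sqrt r <= sqrt (d z)) by now apply sqrt_le_1_alt.
    assert (/ sqrt (d z) <= / sqrt r) by (apply Rinv_le_contravar; auto). lra.
Qed.

Variables (h : C -> R -> C) (B : R).
Hypothesis Hh : tnice h.
Hypothesis HB : 0 <= B.
Hypothesis Hbd : forall z t, 0 < d z -> Cmod (h z t) <= B * W z / mu z.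

Let C1 := Cest1 K c0 T.
Let Kp : 0 <= K := K_pos psi K k kp HK.
Let Hs0 : 0 < sqrt c0. Proof. now apply sqrt_lt_R0. Qed.
Let C1p : 0 <= C1.
Proof.
  unfold C1, Cest1. apply Rmult_le_pos; [lra|]. assert (0 <= 4 / sqrt c0) by (apply le_div_intro; lra).
  assert (0 <= sqrt (cbrt T)) by apply sqrt_pos. lra.
Qed.

Lemma EK_h_bound q y s t : kern q K -> 0 < d y -> 0 < s -> s <= cbrt T -> Cmod (EK psi q s (slice h t) y) <= B * W y * C1 / sqrt s.
Proof using All.
  intros Hq Hy Hs HsT. assert (Hss : 0 < sqrt s) by now apply sqrt_lt_R0.
  assert (HBW : 0 <= B * W y) by (apply Rmult_le_pos; auto).
  set (A := B * W y) in *. set (B' := A / (sqrt c0 * sqrt s)).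
  assert (Hcs : 0 < sqrt c0 * sqrt s) by now apply Rmult_lt_0_compat.
  assert (HB' : 0 <= B') by (apply le_div_intro; lra).
  eapply Rle_trans; [apply (EK_sing_bound psi d c0 Hc0 d_cone q K (slice h t) y s A B'); auto; try lra|].
  - now apply tnice_nice.
  - intros i x Hi Hx. set (z := (y + RtoC (x * s) * edir psi i)%C). assert (Hxs : 0 < x * s) by now apply Rmult_lt_0_compat.
    assert (Hdz := d_cone y i (x * s) Hi (Rlt_le _ _ Hxs)). fold z in Hdz. assert (Hcx : 0 < c0 * (x * s)) by now apply Rmult_lt_0_compat.
    assert (Hz : 0 < d z) by lra.
    assert (Hsx : 0 < sqrt x) by now apply sqrt_lt_R0.
    eapply Rle_trans; [apply (Hbd z t Hz)|].
    assert (HWz : W z <= W y) by (apply W_cone; auto; lra).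
    apply Rle_trans with (A * (1 + / sqrt (c0 * (x * s)))).
    + unfold Rdiv. apply Rmult_le_compat.
      * apply Rmult_le_pos; auto.
      * apply Rlt_le, Rinv_0_lt_compat, mu_pos; auto.
      * unfold A. apply Rmult_le_compat_l; auto.
      * apply mu_inv_ray; auto. lra.
    + right. unfold B'. rewrite !sqrt_mult by lra. field. repeat split; lra.
  - unfold B', C1, Cest1.
    replace (3 * (K * (A + 4 * (A / (sqrt c0 * sqrt s))))) with (A * (3 * K * (sqrt s + 4 / sqrt c0)) / sqrt s) by (field; lra).
    apply Rmult_le_compat_r; [apply Rlt_le, Rinv_0_lt_compat; auto|]. apply Rmult_le_compat_l; auto.
    apply Rmult_le_compat_l; [lra|]. apply Rplus_le_compat_r. apply sqrt_le_1_alt; auto.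
Qed.

Lemma Dh_bound z t : 0 < d z -> Cmod (tD h z t) <= 4 * CW * (B * W z) / (mu z ^ 3).
Proof using All.
  intros Hz. assert (Hm := mu_pos z Hz). assert (Hm1 := mu_le1 z). assert (Hmm := mu_sq z Hz).
  set (del := mu z * mu z / 2). assert (Hdel : 0 < del) by (unfold del; nra).
  assert (Hd1 : del <= d z / 2) by (unfold del; rewrite Hmm; assert (Q := Rmin_l (d z) 1); lra).
  assert (Hd2 : del <= / 2) by (unfold del; rewrite Hmm; assert (Q := Rmin_r (d z) 1); lra).
  replace (4 * CW * (B * W z) / mu z ^ 3) with ((B * (CW * W z) * (2 / mu z)) / del) by (unfold del; field; lra).
  apply (cauchy_bound (slice h t) z del); auto.
  - apply (nice_hball d d_lip); [now apply tnice_nice|lra].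
  - apply (nice_cder d); auto. now apply tnice_nice.
  - intros u Hu. assert (Hu' := d_ball d d_lip z u del Hu). assert (Hdu : 0 < d u) by lra.
    eapply Rle_trans; [apply (Hbd u t Hdu)|]. unfold Rdiv at 1. apply Rmult_le_compat.
    + apply Rmult_le_pos; auto.
    + apply Rlt_le, Rinv_0_lt_compat, mu_pos; auto.
    + apply Rmult_le_compat_l; auto. apply W_loc; auto; lra.
    + replace (2 / mu z) with (/ (mu z / 2)) by (field; lra). apply Rinv_le_contravar; [lra|].
      apply Rsqr_incr_0_var; [|apply Rlt_le, mu_pos; auto]. unfold Rsqr. rewrite (mu_sq u Hdu).
      replace (mu z / 2 * (mu z / 2)) with (mu z * mu z / 4) by field. rewrite Hmm.
      assert (Q1 := Rmin_l (d z) 1). assert (Q2 := Rmin_r (d z) 1). assert (Q0 : 0 < Rmin (d z) 1) by (apply Rmin_glb_lt; lra).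
      apply Rmin_glb; lra.
Qed.

Section AtPoint.
Variables (y : C) (t : R).
Hypothesis (Hy : 0 < d y) (Ht : 0 <= t <= T).
Let BW := B * W y.
Let HBW : 0 <= BW. Proof. apply Rmult_le_pos; auto. Qed.

Let s_facts sg : 0 < sg < t -> 0 < cbrt (t - sg) <= cbrt T.
Proof. intros H. split; [apply cbrt_gt; lra|apply cbrt_le; lra]. Qed.

Lemma time_int_sing (hh : C -> R -> C) Q : tnice hh -> 0 <= Q ->
  (forall sg, 0 < sg < t -> Cmod (Lint psi k hh y t sg) <= Q / (cbrt (t - sg) ^ 2 * sqrt (cbrt (t - sg)))) ->
  Cmod (L hh y t) <= Q * 6 * sqrt (cbrt T).
Proof using All.
  intros Hhh HQ Hb.
  apply Rle_trans with ((- (Q * 6)) * sqrt (cbrt (t - t)) - (- (Q * 6)) * sqrt (cbrt (t - 0))).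
  - apply (CI_prim_bound (Lint psi k hh y t) (fun u => (- (Q * 6)) * sqrt (cbrt (t - u)))
      (fun u => (- (Q * 6)) * (- / (6 * cbrt (t - u) ^ 2 * sqrt (cbrt (t - u)))))); [lra| | | |].
    + apply (Lint_con psi K k kp HK d c0 Hc0 d_lip d_cone); auto.
    + intros x _. apply (continuous_mult (K := R_AbsRing) (fun _ => - (Q * 6)) (fun u => sqrt (cbrt (t - u)))); [apply continuous_const|apply eta_cont].
    + intros x Hx. apply is_derive_scal. apply eta_derive. lra.
    + intros x Hx. destruct (s_facts x Hx) as [Hs _]. assert (Hq : 0 < sqrt (cbrt (t - x))) by now apply sqrt_lt_R0.
      eapply Rle_trans; [apply Hb; auto|]. right. field. lra.
  - rewrite Rminus_diag, (cbrt_neg 0), sqrt_0, Rminus_0_r by lra.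
    assert (sqrt (cbrt t) <= sqrt (cbrt T)) by (apply sqrt_le_1_alt, cbrt_le; lra). nra.
Qed.

Let S := cbrt T.
Let HS : 0 <= S := cbrt_pos T.

Lemma L_est_low j (hh : C -> R -> C) : (j <= 2)%nat -> tnice hh ->
  (forall s sg, 0 < s -> s <= S -> s ^ j * Cmod (E s (slice hh sg) y) <= BW * C1 / sqrt s) ->
  Cmod (L hh y t) <= BW * (C1 * (1 + S)^2 * 6 * sqrt S).
Proof using All.
  intros Hj Hhh Hb.
  assert (HQ : 0 <= BW * C1 * (1 + S)^2) by (apply Rmult_le_pos; [apply Rmult_le_pos; auto|apply pow2_ge_0]).
  replace (BW * (C1 * (1 + S)^2 * 6 * sqrt S)) with (BW * C1 * (1 + S)^2 * 6 * sqrt S) by ring.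
  apply time_int_sing; auto. intros sg Hsg. destruct (s_facts sg Hsg) as [Hs HsS]. unfold Lint.
  set (s := cbrt (t - sg)) in *. specialize (Hb s sg Hs HsS). assert (Hq : 0 < sqrt s) by now apply sqrt_lt_R0.
  set (X := Cmod (E s (slice hh sg) y)) in *. assert (HX : 0 <= X) by apply Cmod_ge_0.
  apply le_div_intro. { apply Rmult_lt_0_compat; auto. now apply pow_lt. }
  assert (Hb' : s ^ j * X * sqrt s <= BW * C1).
  { apply (Rmult_le_compat_r (sqrt s)) in Hb; [|lra]. replace (BW * C1 / sqrt s * sqrt s) with (BW * C1) in Hb by (field; lra). exact Hb. }
  change (s <= S) in HsS. assert (HS' : 0 <= S) by apply cbrt_pos.
  assert (Hp : s ^ 2 <= (1 + S)^2 * s ^ j).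
  { replace (s ^ 2) with (s ^ (2 - j) * s ^ j) by (rewrite <- pow_add; f_equal; lia).
    apply Rmult_le_compat_r; [apply pow_le; lra|]. apply Rle_trans with ((1 + S)^(2 - j)); [apply pow_incr; lra|]. apply Rle_pow; [lra|lia]. }
  apply Rle_trans with (X * ((1 + S)^2 * s ^ j * sqrt s)).
  - apply Rmult_le_compat_l; auto. apply Rmult_le_compat_r; lra.
  - replace (X * ((1 + S) ^ 2 * s ^ j * sqrt s)) with ((1 + S)^2 * (s ^ j * X * sqrt s)) by ring.
    replace (BW * C1 * (1 + S)^2) with ((1 + S)^2 * (BW * C1)) by ring. apply Rmult_le_compat_l; auto. apply pow2_ge_0.
Qed.

(* Interpolates between two bounds for [E (D^3 h)]: [s^{-7/2}] from three integrations by parts, and [s^{-2} mu^{-3}] from two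
   of them together with the Cauchy estimate for [h']; the primitive of the minimum is an arctangent of [sqrt s / mu]. *)
Lemma L_est_top : Cmod (L (tD (tD (tD h))) y t) <= 24 * (C1 + 12 * K * CW) * BW / mu y.
Proof using All.
  assert (Hm := mu_pos y Hy). set (m := mu y) in *.
  assert (H12 : 0 <= 12 * K * CW) by (apply Rmult_le_pos; nra).
  set (c := 12 * (C1 + 12 * K * CW)). assert (Hc : 0 <= c) by (unfold c; lra).
  assert (N3 : tnice (tD (tD (tD h)))) by (repeat apply (tnice_tD d d_lip); auto).
  set (P := fun u => (- (c * BW / m)) * atan (sqrt (cbrt (t - u)) / m)).
  set (dP := fun u => (- (c * BW / m)) * ((- / (6 * cbrt (t - u) ^ 2 * sqrt (cbrt (t - u))) / m) * / (1 + (sqrt (cbrt (t - u)) / m)^2))).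
  apply Rle_trans with (P t - P 0).
  - apply (CI_prim_bound (Lint psi k (tD (tD (tD h))) y t) P dP); [lra| | | |].
    + apply (Lint_con psi K k kp HK d c0 Hc0 d_lip d_cone); auto.
    + intros x _. apply (continuous_mult (K := R_AbsRing) (fun _ => - (c * BW / m)) (fun u => atan (sqrt (cbrt (t - u)) / m))); [apply continuous_const|].
      apply (continuous_comp (fun u => sqrt (cbrt (t - u)) / m) atan).
      * apply (continuous_mult (K := R_AbsRing) (fun u => sqrt (cbrt (t - u))) (fun _ => / m)); [apply eta_cont|apply continuous_const].
      * apply (ex_derive_continuous (V := R_NormedModule)). auto_derive. auto.
    + intros x Hx. apply is_derive_scal.
      assert (D1 := eta_derive t x ltac:(lra)).
      assert (D2 : is_derive (fun u => sqrt (cbrt (t - u)) / m) x (- / (6 * cbrt (t - x) ^ 2 * sqrt (cbrt (t - x))) / m)).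
      { apply (is_derive_ext (fun u => / m * sqrt (cbrt (t - u)))); [intros; unfold Rdiv; apply Rmult_comm|].
        replace (- / (6 * cbrt (t - x) ^ 2 * sqrt (cbrt (t - x))) / m) with (/ m * - / (6 * cbrt (t - x) ^ 2 * sqrt (cbrt (t - x)))) by (unfold Rdiv; apply Rmult_comm).
        apply is_derive_scal. exact D1. }
      assert (D0 : is_derive atan (sqrt (cbrt (t - x)) / m) (/ (1 + (sqrt (cbrt (t - x)) / m)^2))).
      { generalize (sqrt (cbrt (t - x)) / m). intros v. auto_derive; [auto|]. field. nra. }
      exact (is_derive_comp atan (fun u => sqrt (cbrt (t - u)) / m) x _ _ D0 D2).
    + intros sg Hsg. destruct (s_facts sg Hsg) as [Hs HsS]. unfold Lint, dP.
      set (s := cbrt (t - sg)) in *. set (e := sqrt s). assert (He : 0 < e) by now apply sqrt_lt_R0.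
      assert (Hee : e * e = s) by (apply sqrt_sqrt; lra).
      assert (Hn := tnice_nice d h sg Hh).
      change (slice (tD (tD (tD h))) sg) with (D (D (D (slice h sg)))).
      set (X := Cmod (E s (D (D (D (slice h sg)))) y)). assert (HX : 0 <= X) by apply Cmod_ge_0.
      assert (X1 : s ^ 3 * X <= BW * C1 / e).
      { assert (Q := f_equal Cmod (E_D3_eq3 psi K k kp HK d c0 Hc0 d_lip d_cone s (slice h sg) y Hn Hy ltac:(lra))).
        rewrite Cmod_mult, Cmod_opp, Cmod_RtoC_pos in Q by (apply pow_le; lra). unfold X. rewrite Q.
        apply EK_h_bound; auto. exact (kern3 psi K k kp HK). }
      assert (X2 : s ^ 2 * X <= 12 * K * CW * BW / m ^ 3).
      { assert (Q := f_equal Cmod (E_D3_eq2 psi K k kp HK d c0 Hc0 d_lip d_cone s (slice h sg) y Hn Hy ltac:(lra))).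
        rewrite Cmod_mult, Cmod_RtoC_pos in Q by (apply pow_le; lra). unfold X. rewrite Q.
        replace (12 * K * CW * BW / m ^ 3) with (3 * (K * (4 * CW * BW / m^3))) by (field; lra).
        apply (EK_bound psi d c0 Hc0 d_cone); auto; try lra.
        - exact (kern2 psi K k kp HK).
        - now apply (nice_D d d_lip).
        - intros i x Hi Hx. assert (Hxs : 0 <= x * s) by (apply Rmult_le_pos; lra).
          assert (Hz := cone_d psi d c0 Hc0 d_cone y i (x * s) Hi Hxs). set (z := (y + RtoC (x * s) * edir psi i)%C) in *.
          eapply Rle_trans; [apply (Dh_bound z sg); lra|].
          assert (Hmz : m <= mu z) by (apply mu_mono; auto).
          unfold Rdiv. apply Rmult_le_compat.
          + apply Rmult_le_pos; [lra|]. apply Rmult_le_pos; auto. apply W_pos. lra.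
          + apply Rlt_le, Rinv_0_lt_compat, pow_lt. lra.
          + apply Rmult_le_compat_l; [lra|]. unfold BW. apply Rmult_le_compat_l; auto. apply W_cone; auto.
          + apply Rinv_le_contravar; [now apply pow_lt|]. apply pow_incr; lra. }
      replace (- (c * BW / m) * (- / (6 * s ^ 2 * e) / m * / (1 + (e / m) ^ 2))) with (c * BW / (6 * s ^ 2 * e * (m * m + e * e))).
      2:{ field. repeat split; try lra. assert (0 < m * m) by nra. nra. }
      assert (He2 : 0 < e * e) by nra. assert (Hm2 : 0 < m * m) by nra. assert (Hs2 : 0 < s^2) by now apply pow_lt.
      apply le_div_intro; [apply Rmult_lt_0_compat; [|lra]; apply Rmult_lt_0_compat; lra|].
      destruct (Rle_dec e m) as [Hem|Hem].
      * apply Rle_trans with ((s ^ 2 * X * m ^ 3) * 12).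
        -- replace (X * (6 * s ^ 2 * e * (m * m + e * e))) with ((s ^ 2 * X) * (6 * e * (m * m + e * e))) by ring.
           replace (s ^ 2 * X * m ^ 3 * 12) with ((s^2 * X) * (12 * m^3)) by ring.
           apply Rmult_le_compat_l; [apply Rmult_le_pos; lra|]. assert (e * e <= m * m) by nra.
           assert (e * (m * m + e * e) <= m * (m * m + m * m)) by (apply Rmult_le_compat; lra). simpl. nra.
        -- apply (Rmult_le_compat_r (m^3)) in X2; [|apply Rlt_le, pow_lt; auto].
           replace (12 * K * CW * BW / m ^ 3 * m ^ 3) with (12 * K * CW * BW) in X2 by (field; lra).
           unfold c. assert (0 <= C1 * BW) by (apply Rmult_le_pos; auto). lra.
      * apply Rle_trans with ((s ^ 3 * X * e) * 12).
        -- replace (X * (6 * s ^ 2 * e * (m * m + e * e))) with ((s ^ 2 * X * e) * (6 * (m * m + e * e))) by ring.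
           replace (s ^ 3 * X * e * 12) with ((s ^ 2 * X * e) * (12 * s)) by ring.
           apply Rmult_le_compat_l; [apply Rmult_le_pos; [apply Rmult_le_pos|]; lra|]. rewrite <- Hee. nra.
        -- apply (Rmult_le_compat_r e) in X1; [|lra]. replace (BW * C1 / e * e) with (BW * C1) in X1 by (field; lra).
           unfold c. assert (0 <= 12 * K * CW * BW) by (apply Rmult_le_pos; auto). lra.
  - unfold P. rewrite Rminus_diag, (cbrt_neg 0), sqrt_0 by lra. replace (0 / m) with 0 by (field; lra). rewrite atan_0.
    assert (Ha := atan_bound (sqrt (cbrt (t - 0)) / m)). assert (HP := PI_4).
    assert (Hcb : 0 <= c * BW / m) by (apply le_div_intro; auto; rewrite Rmult_0_l; apply Rmult_le_pos; auto).
    replace (24 * (C1 + 12 * K * CW) * BW / m) with (c * BW / m * 2) by (unfold c; field; lra).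
    assert (c * BW / m * atan (sqrt (cbrt (t - 0)) / m) <= c * BW / m * 2) by (apply Rmult_le_compat_l; lra). lra.
Qed.

Let CL := Cest K c0 T CW.
Let part1 : 0 <= C1 * (1 + S)^2 * 6 * sqrt S.
Proof. apply Rmult_le_pos; [|apply sqrt_pos]. apply Rmult_le_pos; [|lra]. apply Rmult_le_pos; auto. apply pow2_ge_0. Qed.
Let part2 : 0 <= 24 * (C1 + 12 * K * CW).
Proof. assert (0 <= 12 * K * CW) by (apply Rmult_le_pos; nra). lra. Qed.

Lemma L_est : Cmod (L h y t) <= CL * B * W y /\ Cmod (L (tD h) y t) <= CL * B * W y /\
  Cmod (L (tD (tD h)) y t) <= CL * B * W y /\ Cmod (L (tD (tD (tD h))) y t) <= CL * B * W y / mu y.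
Proof using All.
  assert (ECL : CL = C1 * (1 + S)^2 * 6 * sqrt S + 24 * (C1 + 12 * K * CW)) by reflexivity.
  assert (Low : BW * (C1 * (1 + S)^2 * 6 * sqrt S) <= CL * B * W y).
  { rewrite ECL. replace ((C1 * (1 + S)^2 * 6 * sqrt S + 24 * (C1 + 12 * K * CW)) * B * W y) with
     (BW * (C1 * (1 + S)^2 * 6 * sqrt S) + BW * (24 * (C1 + 12 * K * CW))) by (unfold BW; ring).
    assert (0 <= BW * (24 * (C1 + 12 * K * CW))) by (apply Rmult_le_pos; auto). lra. }
  assert (N1 := tnice_tD d d_lip h Hh). assert (N2 := tnice_tD d d_lip _ N1).
  repeat split.
  - eapply Rle_trans; [|exact Low]. apply (L_est_low 0); auto. intros s sg Hs HsS. rewrite pow_O, Rmult_1_l.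
    apply EK_h_bound; auto. exact (kern0 psi K k kp HK).
  - eapply Rle_trans; [|exact Low]. apply (L_est_low 1); auto. intros s sg Hs HsS. rewrite pow_1.
    change (slice (tD h) sg) with (D (slice h sg)).
    assert (Q := f_equal Cmod (E_parts1 psi K k kp HK d c0 Hc0 d_lip d_cone s (slice h sg) y (tnice_nice d h sg Hh) Hy ltac:(lra))).
    rewrite Cmod_mult, Cmod_opp, Cmod_RtoC_pos in Q by lra. rewrite Q. apply EK_h_bound; auto. exact (kern1 psi K k kp HK).
  - eapply Rle_trans; [|exact Low]. apply (L_est_low 2); auto. intros s sg Hs HsS.
    change (slice (tD (tD h)) sg) with (D (D (slice h sg))).
    assert (Q := f_equal Cmod (E_D2_eq psi K k kp HK d c0 Hc0 d_lip d_cone s (slice h sg) y (tnice_nice d h sg Hh) Hy ltac:(lra))).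
    rewrite Cmod_mult, Cmod_RtoC_pos in Q by (apply pow_le; lra). rewrite Q. apply EK_h_bound; auto. exact (kern2 psi K k kp HK).
  - eapply Rle_trans; [apply L_est_top|]. apply Rmult_le_compat_r; [apply Rlt_le, Rinv_0_lt_compat, mu_pos; auto|].
    rewrite ECL. replace ((C1 * (1 + S)^2 * 6 * sqrt S + 24 * (C1 + 12 * K * CW)) * B * W y) with
     (BW * (C1 * (1 + S)^2 * 6 * sqrt S) + 24 * (C1 + 12 * K * CW) * BW) by (unfold BW; ring).
    assert (0 <= BW * (C1 * (1 + S)^2 * 6 * sqrt S)) by (apply Rmult_le_pos; auto). lra.
Qed.
End AtPoint.
End Weighted.

(** * The nonlinearity *)

Definition psum (a : nat -> C) (n : nat) : C := sum_n (G := C_AbelianMonoid) a n.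
Lemma psum_0 a : psum a 0 = a 0%nat.
Proof. apply sum_O. Qed.
Lemma psum_S a n : psum a (S n) = (psum a n + a (S n))%C.
Proof. unfold psum. rewrite sum_Sn. reflexivity. Qed.
Definition Csum (a : nat -> C) : C := Clim (psum a).

Definition geo (a : nat -> C) (A : R) := forall k, Cmod (a k) <= A * (/2)^k.

Lemma geo_pos a A : geo a A -> 0 <= A.
Proof. intros H. specialize (H 0%nat). simpl in H. rewrite Rmult_1_r in H. eapply Rle_trans; [apply Cmod_ge_0|eauto]. Qed.

Lemma geo_tail a A n m : geo a A -> Cmod (psum a (n + m) - psum a n)%C <= A * ((/2)^n - (/2)^(n + m)).
Proof.
  intros H. induction m.
  - rewrite Nat.add_0_r. replace (psum a n - psum a n)%C with (RtoC 0) by ring. rewrite Cmod_0. lra.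
  - rewrite Nat.add_succ_r, psum_S. specialize (H (S (n + m))).
    replace (psum a (n + m) + a (S (n + m)) - psum a n)%C with ((psum a (n + m) - psum a n) + a (S (n + m)))%C by ring.
    eapply Rle_trans; [apply Cmod_triangle|]. simpl ((/2) ^ S (n + m)) in *. lra.
Qed.

Lemma geo_bound a A n : geo a A -> Cmod (psum a n) <= 2 * A.
Proof.
  intros H. assert (HA := geo_pos a A H). assert (T := geo_tail a A 0 n H). rewrite psum_0 in T. simpl plus in T.
  assert (H0 := H 0%nat). simpl in H0, T.
  replace (psum a n) with ((psum a n - a 0%nat) + a 0%nat)%C by ring. eapply Rle_trans; [apply Cmod_triangle|].
  assert (0 <= (/2)^n) by (apply pow_le; lra). nra.
Qed.

Lemma geo_cv a A : geo a A -> Ccv (psum a) (Csum a).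
Proof.
  intros H. assert (HA := geo_pos a A H). apply Ccauchy_cv. intros e He.
  destruct (half_pow_small A e He) as [N HN]. exists N.
  assert (W : forall n m, (N <= n)%nat -> (n <= m)%nat -> Cmod (psum a n - psum a m)%C < e).
  { intros n m Hn Hm. rewrite Cmod_minus_sym. replace m with (n + (m - n))%nat by lia.
    eapply Rle_lt_trans; [apply (geo_tail a A); auto|]. eapply Rle_lt_trans; [|exact HN].
    apply Rmult_le_compat_l; auto. assert (0 <= (/2)^(n + (m - n))) by (apply pow_le; lra).
    assert ((/2)^n <= (/2)^N). { replace n with (N + (n - N))%nat by lia. rewrite pow_add. assert (0 < (/2)^N) by (apply pow_lt; lra).
      assert ((/2)^(n - N) <= 1). { rewrite <- (pow1 (n - N)). apply pow_incr. lra. } nra. }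
    lra. }
  intros n m Hn Hm. destruct (Nat.le_ge_cases n m); auto. rewrite Cmod_minus_sym. auto.
Qed.

Lemma geo_sum_bound a A : geo a A -> Cmod (Csum a) <= 2 * A.
Proof. intros H. eapply Ccv_bound0; [eapply geo_cv; eauto|]. exists 0%nat. intros. now apply geo_bound. Qed.

Lemma geo_sum_tail a A n : geo a A -> Cmod (Csum a - psum a n)%C <= A * (/2)^n.
Proof.
  intros H. assert (HA := geo_pos a A H). eapply Ccv_bound; [eapply geo_cv; eauto|]. exists n. intros m Hm. replace m with (n + (m - n))%nat by lia.
  eapply Rle_trans; [apply (geo_tail a A); auto|]. apply Rmult_le_compat_l; auto. assert (0 <= (/2)^(n + (m - n))) by (apply pow_le; lra). lra.
Qed.

Lemma psum_minus a b n : (psum a n - psum b n)%C = psum (fun k => a k - b k)%C n.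
Proof. induction n; [now rewrite !psum_0|]. rewrite !psum_S, <- IHn. ring. Qed.

Lemma geo_sum_minus a b A B : geo a A -> geo b B -> (Csum a - Csum b)%C = Csum (fun k => a k - b k)%C.
Proof.
  intros Ha Hb. symmetry. apply Ccv_Clim.
  apply Ccv_ext with (fun n => psum a n + RtoC (-1) * psum b n)%C.
  - intros n. rewrite <- psum_minus. ring.
  - replace (Csum a - Csum b)%C with (Csum a + RtoC (-1) * Csum b)%C by ring. apply Ccv_plus; [|apply Ccv_scal]; eapply geo_cv; eauto.
Qed.

Lemma Cseries_iff a l : Cseries a l <-> Ccv (psum a) l.
Proof. unfold Cseries, is_series. rewrite Ccv_filterlim. reflexivity. Qed.

Lemma Cpow_diff (w v : C) n : Cmod w <= 1 -> Cmod v <= 1 -> Cmod (w ^ n - v ^ n)%C <= INR n * Cmod (w - v)%C.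
Proof.
  intros Hw Hv. induction n.
  - simpl (w ^ 0)%C. simpl (v ^ 0)%C. replace (1 - 1)%C with (RtoC 0) by ring. rewrite Cmod_0. simpl. lra.
  - rewrite !Cpow_S, S_INR. replace (w * w ^ n - v * v ^ n)%C with (w * (w ^ n - v ^ n) + (w - v) * v ^ n)%C by ring.
    eapply Rle_trans; [apply Cmod_triangle|]. rewrite !Cmod_mult, Cmod_pow.
    assert (Cmod v ^ n <= 1). { rewrite <- (pow1 n). apply pow_incr. split; auto using Cmod_ge_0. }
    assert (P1 := Cmod_ge_0 (w ^ n - v ^ n)%C). assert (P2 := Cmod_ge_0 (w - v)%C). assert (P3 := Cmod_ge_0 w). nra.
Qed.

Lemma INR_le_pow2 n : INR n <= 2 ^ n.
Proof. induction n; [simpl; lra|]. rewrite S_INR. simpl. assert (1 <= 2^n) by (apply pow_R1_Rle; lra). lra. Qed.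

Section Nonlin.
Variables (d : C -> R).
Hypothesis d_lip : forall y z, Rabs (d y - d z) <= Cmod (y - z)%C.
Notation tnice := (tnice d).
Notation mu := (mu d).

Lemma tnice_plus f g : tnice f -> tnice g -> tnice (fun z t => f z t + g z t)%C.
Proof using.
  intros [f1 [f2 f3]] [g1 [g2 g3]]. repeat split.
  - intros z t Hz. destruct (f1 z t Hz) as [a Ha]. destruct (g1 z t Hz) as [b Hb]. eexists. apply (cder_plus (slice f t) (slice g t)); eauto.
  - intros del Hd. destruct (f2 del Hd) as [M HM]. destruct (g2 del Hd) as [N HN]. exists (M + N). intros z t Hz.
    eapply Rle_trans; [apply Cmod_triangle|]. specialize (HM z t Hz). specialize (HN z t Hz). lra.
  - intros z t Hz. apply ccont_plus; auto.
Qed.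
Lemma tnice_minus f g : tnice f -> tnice g -> tnice (fun z t => f z t - g z t)%C.
Proof using.
  intros [f1 [f2 f3]] [g1 [g2 g3]]. repeat split.
  - intros z t Hz. destruct (f1 z t Hz) as [a Ha]. destruct (g1 z t Hz) as [b Hb]. eexists. apply (cder_minus (slice f t) (slice g t)); eauto.
  - intros del Hd. destruct (f2 del Hd) as [M HM]. destruct (g2 del Hd) as [N HN]. exists (M + N). intros z t Hz.
    eapply Rle_trans; [apply Cmod_triangle_minus|]. specialize (HM z t Hz). specialize (HN z t Hz). lra.
  - intros z t Hz. apply ccont_minus; auto.
Qed.
Lemma tnice_mult f g : tnice f -> tnice g -> tnice (fun z t => f z t * g z t)%C.
Proof using.
  intros [f1 [f2 f3]] [g1 [g2 g3]]. repeat split.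
  - intros z t Hz. destruct (f1 z t Hz) as [a Ha]. destruct (g1 z t Hz) as [b Hb]. eexists. apply (cder_mult (slice f t) (slice g t)); eauto.
  - intros del Hd. destruct (f2 del Hd) as [M HM]. destruct (g2 del Hd) as [N HN]. exists (M * N). intros z t Hz.
    rewrite Cmod_mult. apply Rmult_le_compat; auto using Cmod_ge_0.
  - intros z t Hz. apply ccont_mult; auto.
Qed.

Lemma tD_ext f g : (forall z t, 0 < d z -> f z t = g z t) -> tnice f -> forall z t, 0 < d z -> tD f z t = tD g z t.
Proof using d_lip.
  intros H Hf z t Hz. unfold tD. apply (D_ext d d_lip (slice f t) (slice g t)); auto.
  - intros u Hu. apply H; auto.
  - now apply tnice_nice.
Qed.
Lemma tnice_ext f g : (forall z t, 0 < d z -> f z t = g z t) -> tnice f -> tnice g.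
Proof using d_lip.
  intros H [f1 [f2 f3]]. repeat split.
  - intros z t Hz. destruct (f1 z t Hz) as [l Hl]. exists l. apply (cder_ext_loc (slice f t)) with (d := d z); auto.
    intros u Hu. apply H. now apply (d_open d d_lip z).
  - intros del Hd. destruct (f2 del Hd) as [M HM]. exists M. intros z t Hz. rewrite <- H by lra. auto.
  - intros z t Hz. eapply ccont_ext; [|apply f3; eauto]. intros; apply H; auto.
Qed.
Lemma tD_minus f g z t : tnice f -> tnice g -> 0 < d z -> tD (fun z t => f z t - g z t)%C z t = (tD f z t - tD g z t)%C.
Proof using.
  intros Hf Hg Hz. unfold tD. apply (D_minus d (slice f t) (slice g t)); auto; now apply tnice_nice.
Qed.
Lemma tD_plus f g z t : tnice f -> tnice g -> 0 < d z -> tD (fun z t => f z t + g z t)%C z t = (tD f z t + tD g z t)%C.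
Proof using.
  intros Hf Hg Hz. unfold tD. apply D_unique. apply (cder_plus (slice f t) (slice g t)); apply (nice_cder d); auto; now apply tnice_nice.
Qed.

Variables (bb : nat -> nat -> C -> R -> C) (eps : R).
Hypothesis Heps : 0 <= eps.
Hypothesis b_an : forall j k z t, (j < 4)%nat -> 0 < d z -> exists l, cder (slice (bb j k) t) z l.
Hypothesis b_bd : forall j k z t, (j < 4)%nat -> 0 < d z -> Cmod (bb j k z t) <= eps * (/4)^k.
Hypothesis b_ct : forall j k z t, (j < 4)%nat -> 0 < d z -> ccont (bb j k z) t.

Definition Bterm (j : nat) (f : C -> R -> C) (z : C) (t : R) (k : nat) : C := (bb j k z t * f z t ^ k)%C.
Definition Bf (j : nat) (f : C -> R -> C) (z : C) (t : R) : C := Csum (Bterm j f z t).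

Definition unit_bd (f : C -> R -> C) := forall z t, 0 < d z -> Cmod (f z t) <= 1.

Lemma quarter_half k : (/4)^k <= (/2)^k.
Proof using. apply pow_incr. lra. Qed.

Lemma Bterm_geo j f z t : (j < 4)%nat -> unit_bd f -> 0 < d z -> geo (Bterm j f z t) eps.
Proof using Heps b_bd.
  intros Hj Hf Hz k. unfold Bterm. rewrite Cmod_mult, Cmod_pow.
  assert (H1 : Cmod (f z t) ^ k <= 1). { rewrite <- (pow1 k). apply pow_incr. split; auto using Cmod_ge_0. }
  assert (H0 : 0 <= Cmod (f z t) ^ k) by (apply pow_le, Cmod_ge_0).
  assert (H2 := b_bd j k z t Hj Hz). assert (H3 := quarter_half k). assert (H4 := Cmod_ge_0 (bb j k z t)).
  assert (eps * (/4)^k <= eps * (/2)^k) by (apply Rmult_le_compat_l; auto). nra.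
Qed.

Lemma Bf_bound j f z t : (j < 4)%nat -> unit_bd f -> 0 < d z -> Cmod (Bf j f z t) <= 2 * eps.
Proof using Heps b_bd. intros. apply geo_sum_bound. now apply Bterm_geo. Qed.

Lemma Bf_lip j f g z t : (j < 4)%nat -> unit_bd f -> unit_bd g -> 0 < d z ->
  Cmod (Bf j f z t - Bf j g z t)%C <= 2 * eps * Cmod (f z t - g z t)%C.
Proof using Heps b_bd.
  intros Hj Hf Hg Hz. unfold Bf. rewrite (geo_sum_minus _ _ eps eps) by now apply Bterm_geo.
  rewrite Rmult_assoc. apply geo_sum_bound. intros k. unfold Bterm.
  replace (bb j k z t * f z t ^ k - bb j k z t * g z t ^ k)%C with (bb j k z t * (f z t ^ k - g z t ^ k))%C by ring.
  rewrite Cmod_mult. assert (H1 := Cpow_diff (f z t) (g z t) k (Hf z t Hz) (Hg z t Hz)). assert (H2 := b_bd j k z t Hj Hz).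
  assert (H3 := INR_le_pow2 k). assert (P := Cmod_ge_0 (f z t - g z t)%C).
  apply Rle_trans with (eps * (/4)^k * (2^k * Cmod (f z t - g z t)%C)).
  - apply Rmult_le_compat; auto using Cmod_ge_0. eapply Rle_trans; [exact H1|]. apply Rmult_le_compat_r; auto.
  - right. replace (/2) with (/4 * 2) by field. rewrite Rpow_mult_distr. ring.
Qed.

Lemma Bpart_holo j f t n z : (j < 4)%nat -> tnice f -> 0 < d z -> exists l, cder (fun z => psum (Bterm j f z t) n) z l.
Proof using b_an.
  intros Hj [f1 _] Hz. destruct (f1 z t Hz) as [fl Hfl].
  assert (Hp : forall k, exists l, cder (fun z => f z t ^ k)%C z l).
  { induction k.
    - exists 0. apply (cder_const 1).
    - destruct IHk as [l Hl]. eexists. apply (cder_mult (slice f t) (fun z => f z t ^ k)%C); eauto. }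
  assert (Ht : forall k, exists l, cder (fun z => Bterm j f z t k) z l).
  { intros k. destruct (Hp k) as [l Hl]. destruct (b_an j k z t Hj Hz) as [m Hm]. eexists. apply (cder_mult (slice (bb j k) t)); eauto. }
  induction n.
  - destruct (Ht 0%nat) as [l Hl]. exists l. apply cder_ext_loc with (fun z => Bterm j f z t 0) 1; auto; [lra|]. intros; now rewrite psum_0.
  - destruct IHn as [l Hl]. destruct (Ht (S n)) as [m Hm]. eexists.
    apply cder_ext_loc with (fun z => psum (Bterm j f z t) n + Bterm j f z t (S n))%C 1; [lra| |apply cder_plus; eauto]. intros; now rewrite psum_S.
Qed.

Lemma Bpart_cont j f n z t : (j < 4)%nat -> tnice f -> 0 < d z -> ccont (fun u => psum (Bterm j f z u) n) t.
Proof using b_ct.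
  intros Hj [_ [_ f3]] Hz.
  assert (Hp : forall k, ccont (fun u => f z u ^ k)%C t).
  { induction k; [apply (ccont_const 1)|]. apply (ccont_mult (f z)); auto. }
  assert (Ht : forall k, ccont (fun u => Bterm j f z u k) t) by (intros k; apply ccont_mult; auto).
  induction n.
  - eapply ccont_ext; [|apply (Ht 0%nat)]. intros; now rewrite psum_0.
  - eapply ccont_ext; [|apply (ccont_plus _ _ _ IHn (Ht (S n)))]. intros; now rewrite psum_S.
Qed.

Lemma Bf_tnice j f : (j < 4)%nat -> tnice f -> unit_bd f -> tnice (Bf j f).
Proof using d_lip Heps b_an b_bd b_ct.
  intros Hj Hf Hu. repeat split.
  - intros z t Hz.
    destruct (limit_holo eventually (fun n z => psum (Bterm j f z t) n) (slice (Bf j f) t) z (d z / 2) (2 * eps) ltac:(lra)) as [l [Hl _]].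
    + intros n u Huz. apply Bpart_holo; auto. assert (W := d_ball d d_lip z u (d z / 2) Huz). lra.
    + intros n u Huz. apply geo_bound. apply Bterm_geo; auto. assert (W := d_ball d d_lip z u (d z / 2) Huz). lra.
    + intros u Huz e He. assert (W := d_ball d d_lip z u (d z / 2) Huz). apply (geo_cv (Bterm j f u t) eps); auto. apply Bterm_geo; auto. lra.
    + eauto.
  - intros del Hd. exists (2 * eps). intros z t Hz. apply Bf_bound; auto. lra.
  - intros z t Hz e He. destruct (half_pow_small eps (e/4)) as [n Hn]; [lra|].
    destruct (Bpart_cont j f n z t Hj Hf Hz (e/4)) as [del [Hdel HH]]; [lra|]. exists del. split; auto. intros u Hut. specialize (HH u Hut).
    assert (T1 := geo_sum_tail (Bterm j f z u) eps n (Bterm_geo j f z u Hj Hu Hz)).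
    assert (T2 := geo_sum_tail (Bterm j f z t) eps n (Bterm_geo j f z t Hj Hu Hz)).
    change (Cmod (Csum (Bterm j f z u) - Csum (Bterm j f z t))%C < e).
    replace (Csum (Bterm j f z u) - Csum (Bterm j f z t))%C with ((Csum (Bterm j f z u) - psum (Bterm j f z u) n) + (psum (Bterm j f z u) n - psum (Bterm j f z t) n) - (Csum (Bterm j f z t) - psum (Bterm j f z t) n))%C by ring.
    eapply Rle_lt_trans; [apply Cmod_triangle_minus|]. eapply Rle_lt_trans; [apply Rplus_le_compat_r, Cmod_triangle|]. lra.
Qed.

Definition NL (f : C -> R -> C) (z : C) (t : R) : C :=
  (Bf 0 f z t * f z t + Bf 1 f z t * tD f z t + Bf 2 f z t * tD (tD f) z t + Bf 3 f z t * tD (tD (tD f)) z t)%C.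

Lemma NL_tnice f : tnice f -> unit_bd f -> tnice (NL f).
Proof using d_lip Heps b_an b_bd b_ct.
  intros Hf Hu. unfold NL. assert (N1 := tnice_tD d d_lip f Hf). assert (N2 := tnice_tD d d_lip _ N1). assert (N3 := tnice_tD d d_lip _ N2).
  repeat apply tnice_plus; apply tnice_mult; auto; apply Bf_tnice; auto.
Qed.

Variable W : C -> R.
Hypothesis W_pos : forall z, 0 < d z -> 0 <= W z.

Definition bnd (Rr : R) (f : C -> R -> C) := forall z t, 0 < d z ->
  Cmod (f z t) <= Rr * W z /\ Cmod (tD f z t) <= Rr * W z /\ Cmod (tD (tD f) z t) <= Rr * W z /\ Cmod (tD (tD (tD f)) z t) <= Rr * W z / mu z.
Definition bndd (Rr : R) (f g : C -> R -> C) := forall z t, 0 < d z ->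
  Cmod (f z t - g z t)%C <= Rr * W z /\ Cmod (tD f z t - tD g z t)%C <= Rr * W z /\
  Cmod (tD (tD f) z t - tD (tD g) z t)%C <= Rr * W z /\ Cmod (tD (tD (tD f)) z t - tD (tD (tD g)) z t)%C <= Rr * W z / mu z.
Definition unit4 (g : C -> R -> C) := forall z t, 0 < d z ->
  Cmod (g z t) <= 1 /\ Cmod (tD g z t) <= 1 /\ Cmod (tD (tD g) z t) <= 1 /\ Cmod (tD (tD (tD g)) z t) <= / mu z.

Lemma le_mu X z : 0 < d z -> 0 <= X -> X <= X / mu z.
Proof using.
  intros Hz HX. assert (Hm := mu_pos d z Hz). assert (Hm1 := mu_le1 d z). apply le_div_intro; auto. nra.
Qed.

Lemma NL_bound f Rr z t : unit_bd f -> bnd Rr f -> 0 <= Rr -> 0 < d z -> Cmod (NL f z t) <= 8 * eps * Rr * W z / mu z.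
Proof using Heps b_bd W_pos.
  intros Hu Hb HR Hz. destruct (Hb z t Hz) as [b0 [b1 [b2 b3]]].
  assert (HX : 0 <= Rr * W z) by (apply Rmult_le_pos; auto). assert (Q := le_mu (Rr * W z) z Hz HX).
  set (X := Rr * W z / mu z) in *.
  replace (8 * eps * Rr * W z / mu z) with (2 * eps * X + 2 * eps * X + 2 * eps * X + 2 * eps * X) by (unfold X; field; apply Rgt_not_eq, mu_pos; auto).
  unfold NL. eapply Rle_trans; [apply Cmod_triangle|]. apply Rplus_le_compat.
  1: eapply Rle_trans; [apply Cmod_triangle|]; apply Rplus_le_compat.
  1: eapply Rle_trans; [apply Cmod_triangle|]; apply Rplus_le_compat.
  all: rewrite Cmod_mult; apply Rmult_le_compat; auto using Cmod_ge_0; try (apply Bf_bound; auto); lra.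
Qed.

Lemma NL_lip f g dl z t : unit_bd f -> unit4 g -> bndd dl f g -> 0 <= dl -> 0 < d z ->
  Cmod (NL f z t - NL g z t)%C <= 16 * eps * dl * W z / mu z.
Proof using Heps b_bd W_pos.
  intros Hu Hg Hb HR Hz. destruct (Hb z t Hz) as [b0 [b1 [b2 b3]]]. destruct (Hg z t Hz) as [g0 [g1 [g2 g3]]].
  assert (Hug : unit_bd g) by (intros u s Hus; apply Hg; auto).
  assert (HX : 0 <= dl * W z) by (apply Rmult_le_pos; auto). assert (Q := le_mu (dl * W z) z Hz HX).
  assert (Hm := mu_pos d z Hz). assert (Hm1 := mu_le1 d z). assert (Hmi : 1 <= / mu z) by (rewrite <- Rinv_1; apply Rinv_le_contravar; auto).
  set (X := dl * W z / mu z) in *.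
  assert (T : forall j F G, (j < 4)%nat -> Cmod (F - G)%C <= X -> Cmod G <= / mu z -> Cmod (Bf j f z t * F - Bf j g z t * G)%C <= 4 * eps * X).
  { intros j F G Hj HFG HG. replace (Bf j f z t * F - Bf j g z t * G)%C with (Bf j f z t * (F - G) + (Bf j f z t - Bf j g z t) * G)%C by ring.
    eapply Rle_trans; [apply Cmod_triangle|]. rewrite !Cmod_mult.
    assert (A1 : Cmod (Bf j f z t) * Cmod (F - G)%C <= (2 * eps) * X) by (apply Rmult_le_compat; auto using Cmod_ge_0; apply Bf_bound; auto).
    assert (A2 : Cmod (Bf j f z t - Bf j g z t)%C * Cmod G <= (2 * eps * (dl * W z)) * / mu z).
    { apply Rmult_le_compat; auto using Cmod_ge_0. eapply Rle_trans; [apply Bf_lip; auto|]. apply Rmult_le_compat_l; lra. }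
    replace (2 * eps * (dl * W z) * / mu z) with (2 * eps * X) in A2 by (unfold X, Rdiv; ring). lra. }
  replace (16 * eps * dl * W z / mu z) with (4 * eps * X + 4 * eps * X + 4 * eps * X + 4 * eps * X) by (unfold X; field; lra).
  unfold NL.
  match goal with |- Cmod (?a1 + ?a2 + ?a3 + ?a4 - (?b1 + ?b2 + ?b3 + ?b4))%C <= _ =>
    replace (a1 + a2 + a3 + a4 - (b1 + b2 + b3 + b4))%C with ((a1 - b1) + (a2 - b2) + (a3 - b3) + (a4 - b4))%C by ring end.
  eapply Rle_trans; [apply Cmod_triangle|]. apply Rplus_le_compat.
  1: eapply Rle_trans; [apply Cmod_triangle|]; apply Rplus_le_compat.
  1: eapply Rle_trans; [apply Cmod_triangle|]; apply Rplus_le_compat.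
  all: apply T; auto; lra.
Qed.
End Nonlin.

(** * The fixed point *)

Section Picard.
Variables (psi K : R) (k kp : nat -> R -> C).
Hypothesis HK : kernel_ok psi K k kp.
Variables (d : C -> R) (c0 : R).
Hypothesis Hc0 : 0 < c0.
Hypothesis d_lip : forall y z, Rabs (d y - d z) <= Cmod (y - z)%C.
Hypothesis d_cone : forall y i s, (i < 3)%nat -> 0 <= s -> d y + c0 * s <= d (y + RtoC s * edir psi i)%C.
Variables (W : C -> R) (CW T : R).
Hypothesis HT : 0 <= T.
Hypothesis W_pos : forall z, 0 < d z -> 0 <= W z.
Hypothesis HCW : 0 <= CW.
Hypothesis W_cone : forall y i s, (i < 3)%nat -> 0 <= s -> 0 < d y -> W (y + RtoC s * edir psi i)%C <= W y.
Hypothesis W_loc : forall z u, 0 < d z -> Cmod (u - z)%C <= d z / 2 -> Cmod (u - z)%C <= / 2 -> W u <= CW * W z.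

Notation tnice := (tnice d).
Notation mu := (mu d).
Notation L := (L psi k).
Notation Lc := (Lc psi k T).
Notation bnd := (bnd d W).
Notation bndd := (bndd d W).
Notation unit4 := (unit4 d).
Notation unit_bd := (unit_bd d).
Let CL := Cest K c0 T CW.

Lemma E_ext s g1 g2 y : (forall z, 0 < d z -> g1 z = g2 z) -> 0 < d y -> 0 <= s -> E psi k s g1 y = E psi k s g2 y.
Proof using d_cone Hc0.
  intros H Hy Hs. apply sum3_ext. intros i Hi. apply Iinf_ext. intros x Hx. rewrite H; auto.
  assert (Q := cone_d psi d c0 Hc0 d_cone y i (x * s) Hi (Rmult_le_pos _ _ Hx Hs)). lra.
Qed.

Lemma L_ext h1 h2 y t : (forall z u, 0 < d z -> h1 z u = h2 z u) -> 0 < d y -> 0 <= t -> L h1 y t = L h2 y t.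
Proof using d_cone Hc0.
  intros H Hy Ht. apply CI_ext; auto. intros sg _. apply E_ext; auto using cbrt_pos. intros; apply H; auto.
Qed.

Lemma L_minus h1 h2 y t : tnice h1 -> tnice h2 -> 0 < d y -> 0 <= t ->
  L (fun z u => h1 z u - h2 z u)%C y t = (L h1 y t - L h2 y t)%C.
Proof using HK d_lip d_cone Hc0.
  intros H1 H2 Hy Ht. unfold L. rewrite <- CI_minus; auto.
  - apply CI_ext; auto. intros sg _. unfold Lint, E.
    apply (EK_minus psi d c0 Hc0 d_cone _ K); auto using cbrt_pos; try now apply tnice_nice. exact (kern0 psi K k kp HK).
  - apply (Lint_con psi K k kp HK d c0 Hc0 d_lip d_cone); auto.
  - apply (Lint_con psi K k kp HK d c0 Hc0 d_lip d_cone); auto.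
Qed.

Lemma Lc_tD h z t : tnice h -> 0 < d z -> tD (Lc h) z t = Lc (tD h) z t.
Proof using HK d_lip d_cone Hc0 HT.
  intros Hh Hz. apply D_unique. apply (Lc_cder psi K k kp HK d c0 Hc0 d_lip d_cone); auto.
Qed.
Lemma Lc_nice h : tnice h -> tnice (Lc h).
Proof using HK d_lip d_cone Hc0 HT. apply (Lc_tnice psi K k kp HK d c0 Hc0 d_lip d_cone); auto. Qed.

Lemma tD_form u a h : tnice a -> tnice h -> (forall z t, 0 < d z -> u z t = (a z t + Lc h z t)%C) ->
  forall z t, 0 < d z -> tD u z t = (tD a z t + Lc (tD h) z t)%C.
Proof using HK d_lip d_cone Hc0 HT.
  intros Ha Hh H z t Hz. rewrite <- (tD_ext d d_lip (fun z t => a z t + Lc h z t)%C u); auto.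
  - rewrite (tD_plus d a (Lc h)); auto using Lc_nice. now rewrite Lc_tD.
  - intros; symmetry; auto.
  - apply tnice_plus; auto using Lc_nice.
Qed.

Lemma Lc_est h B z t : tnice h -> 0 <= B -> (forall z t, 0 < d z -> Cmod (h z t) <= B * W z / mu z) -> 0 < d z ->
  Cmod (Lc h z t) <= CL * B * W z /\ Cmod (Lc (tD h) z t) <= CL * B * W z /\
  Cmod (Lc (tD (tD h)) z t) <= CL * B * W z /\ Cmod (Lc (tD (tD (tD h))) z t) <= CL * B * W z / mu z.
Proof using All.
  intros Hh HB Hb Hz. apply (L_est psi K k kp HK d c0 Hc0 d_lip d_cone W CW T); auto. now apply clamp_in.
Qed.

Lemma Lc_diff h1 h2 B z t : tnice h1 -> tnice h2 -> 0 <= B ->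
  (forall z t, 0 < d z -> Cmod (h1 z t - h2 z t)%C <= B * W z / mu z) -> 0 < d z ->
  Cmod (Lc h1 z t - Lc h2 z t)%C <= CL * B * W z /\ Cmod (Lc (tD h1) z t - Lc (tD h2) z t)%C <= CL * B * W z /\
  Cmod (Lc (tD (tD h1)) z t - Lc (tD (tD h2)) z t)%C <= CL * B * W z /\
  Cmod (Lc (tD (tD (tD h1))) z t - Lc (tD (tD (tD h2))) z t)%C <= CL * B * W z / mu z.
Proof using All.
  intros H1 H2 HB Hb Hz.
  set (hd := fun z u => (h1 z u - h2 z u)%C). assert (Hhd : tnice hd) by (apply tnice_minus; auto).
  assert (Q := Lc_est hd B z t Hhd HB Hb Hz).
  assert (A1 := tnice_tD d d_lip h1 H1). assert (B1 := tnice_tD d d_lip _ A1). assert (C1 := tnice_tD d d_lip _ B1).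
  assert (A2 := tnice_tD d d_lip h2 H2). assert (B2 := tnice_tD d d_lip _ A2). assert (C2 := tnice_tD d d_lip _ B2).
  assert (E1 : forall z u, 0 < d z -> tD hd z u = (tD h1 z u - tD h2 z u)%C) by (intros; apply (tD_minus d); auto).
  assert (N1 := tnice_tD d d_lip hd Hhd).
  assert (E2 : forall z u, 0 < d z -> tD (tD hd) z u = (tD (tD h1) z u - tD (tD h2) z u)%C).
  { intros x u Hx. rewrite (tD_ext d d_lip _ _ E1 N1 x u Hx). apply (tD_minus d); auto. }
  assert (N2 := tnice_tD d d_lip _ N1).
  assert (E3 : forall z u, 0 < d z -> tD (tD (tD hd)) z u = (tD (tD (tD h1)) z u - tD (tD (tD h2)) z u)%C).
  { intros x u Hx. rewrite (tD_ext d d_lip _ _ E2 N2 x u Hx). apply (tD_minus d); auto. }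
  assert (Hcl := clamp_in 0 T t HT).
  unfold Lc in *. rewrite (L_ext _ _ z _ E1), (L_ext _ _ z _ E2), (L_ext _ _ z _ E3) in Q by (auto; lra).
  unfold hd in Q. rewrite !L_minus in Q by (auto; lra). exact Q.
Qed.

Variables (bb : nat -> nat -> C -> R -> C) (eps : R).
Hypothesis Heps : 0 <= eps.
Hypothesis b_an : forall j k z t, (j < 4)%nat -> 0 < d z -> exists l, cder (slice (bb j k) t) z l.
Hypothesis b_bd : forall j k z t, (j < 4)%nat -> 0 < d z -> Cmod (bb j k z t) <= eps * (/4)^k.
Hypothesis b_ct : forall j k z t, (j < 4)%nat -> 0 < d z -> ccont (bb j k z) t.
Notation NL := (NL bb).
Hypothesis Hsmall : 16 * eps * CL <= / 2.

Let CLp : 0 <= CL.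
Proof.
  assert (Kp := K_pos psi K k kp HK). assert (Hs0 : 0 < sqrt c0) by now apply sqrt_lt_R0.
  assert (C1p : 0 <= Cest1 K c0 T).
  { unfold Cest1. apply Rmult_le_pos; [lra|]. assert (0 <= 4 / sqrt c0) by (apply le_div_intro; lra).
    assert (0 <= sqrt (cbrt T)) by apply sqrt_pos. lra. }
  unfold CL, Cest. assert (0 <= 12 * K * CW) by (apply Rmult_le_pos; nra).
  assert (0 <= Cest1 K c0 T * (1 + cbrt T) ^ 2 * 6 * sqrt (cbrt T)); [|lra].
  apply Rmult_le_pos; [|apply sqrt_pos]. apply Rmult_le_pos; [|lra]. apply Rmult_le_pos; auto. apply pow2_ge_0.
Qed.

Variables (fI rr : C -> R -> C) (CI0 Cr : R).
Hypothesis fI_nice : tnice fI.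
Hypothesis r_nice : tnice rr.
Hypothesis HCI0 : 0 <= CI0.
Hypothesis HCr : 0 <= Cr.
Hypothesis fI_bnd : bnd CI0 fI.
Hypothesis r_bnd : forall z t, 0 < d z -> Cmod (rr z t) <= Cr * W z.
Let Rr := 2 * (CI0 + CL * (CI0 + Cr)).
Hypothesis W_small : forall z, 0 < d z -> Rr * W z <= 1.

Definition Hrhs (f : C -> R -> C) : C -> R -> C := fun z t => (tD (tD (tD fI)) z t + rr z t + NL f z t)%C.
Definition Phi (f : C -> R -> C) : C -> R -> C := fun z t => (fI z t + Lc (Hrhs f) z t)%C.

Let Rrp : 0 <= Rr.
Proof. unfold Rr. assert (0 <= CL * (CI0 + Cr)) by (apply Rmult_le_pos; lra). lra. Qed.

Lemma bnd_unit4 f : bnd Rr f -> unit4 f.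
Proof using W_small.
  intros H z t Hz. destruct (H z t Hz) as [a [b [c e]]]. assert (Q := W_small z Hz). repeat split; try lra.
  eapply Rle_trans; [exact e|]. unfold Rdiv. rewrite <- (Rmult_1_l (/ mu z)) at 2. apply Rmult_le_compat_r; auto.
  apply Rlt_le, Rinv_0_lt_compat, mu_pos; auto.
Qed.
Lemma unit4_unit f : unit4 f -> unit_bd f.
Proof using. intros H z t Hz. apply H; auto. Qed.

Let tnD3fI : tnice (tD (tD (tD fI))).
Proof. repeat apply (tnice_tD d d_lip); auto. Qed.

Lemma Hrhs_tnice f : tnice f -> unit_bd f -> tnice (Hrhs f).
Proof using All.
  intros Hf Hu. unfold Hrhs. apply tnice_plus; [apply tnice_plus; auto|]. apply (NL_tnice d d_lip bb eps); auto.
Qed.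

Lemma Phi_D f : tnice f -> unit_bd f -> tnice (Phi f) /\ forall z t, 0 < d z ->
  tD (Phi f) z t = (tD fI z t + Lc (tD (Hrhs f)) z t)%C /\
  tD (tD (Phi f)) z t = (tD (tD fI) z t + Lc (tD (tD (Hrhs f))) z t)%C /\
  tD (tD (tD (Phi f))) z t = (tD (tD (tD fI)) z t + Lc (tD (tD (tD (Hrhs f)))) z t)%C.
Proof using All.
  intros Hf Hu. assert (HN := Hrhs_tnice f Hf Hu).
  assert (N1 := tnice_tD d d_lip _ HN). assert (N2 := tnice_tD d d_lip _ N1).
  assert (F1 := tnice_tD d d_lip _ fI_nice). assert (F2 := tnice_tD d d_lip _ F1).
  assert (E0 : forall z t, 0 < d z -> Phi f z t = (fI z t + Lc (Hrhs f) z t)%C) by reflexivity.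
  assert (E1 := tD_form _ _ _ fI_nice HN E0). assert (E2 := tD_form _ _ _ F1 N1 E1). assert (E3 := tD_form _ _ _ F2 N2 E2).
  split; [|intros; auto]. apply tnice_plus; auto. now apply Lc_nice.
Qed.

Lemma Phi_bnd f : tnice f -> bnd Rr f -> bnd Rr (Phi f).
Proof using All.
  intros Hf Hb. assert (U4 := bnd_unit4 f Hb). assert (Hu := unit4_unit f U4). assert (HN := Hrhs_tnice f Hf Hu).
  destruct (Phi_D f Hf Hu) as [_ HD]. intros z t Hz. destruct (HD z t Hz) as [D1 [D2 D3]].
  assert (HM := mu_pos d z Hz).
  assert (Q := Lc_est (Hrhs f) (CI0 + Cr + 8 * eps * Rr) z t HN).
  assert (H8 : 0 <= 8 * eps * Rr) by (apply Rmult_le_pos; lra).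
  destruct Q as [q0 [q1 [q2 q3]]]; auto.
  { lra. }
  { intros u s Hu'. unfold Hrhs. destruct (fI_bnd u s Hu') as [_ [_ [_ f3]]]. assert (r1 := r_bnd u s Hu').
    assert (n1 := NL_bound d bb eps Heps b_bd W W_pos f Rr u s Hu Hb Rrp Hu').
    assert (HX : 0 <= Cr * W u) by (apply Rmult_le_pos; auto). assert (L1 := le_mu d (Cr * W u) u Hu' HX).
    replace ((CI0 + Cr + 8 * eps * Rr) * W u / mu u) with (CI0 * W u / mu u + Cr * W u / mu u + 8 * eps * Rr * W u / mu u) by (unfold Rdiv; ring).
    eapply Rle_trans; [apply Cmod_triangle|]. apply Rplus_le_compat; auto.
    eapply Rle_trans; [apply Cmod_triangle|]. apply Rplus_le_compat; auto. lra. }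
  destruct (fI_bnd z t Hz) as [f0 [f1 [f2 f3]]]. assert (HW := W_pos z Hz).
  assert (Key : CI0 + CL * (CI0 + Cr + 8 * eps * Rr) <= Rr).
  { unfold Rr at 2. replace (CL * (CI0 + Cr + 8 * eps * Rr)) with (CL * (CI0 + Cr) + /2 * (16 * eps * CL) * Rr) by field.
    assert (/ 2 * (16 * eps * CL) * Rr <= / 4 * Rr) by (apply Rmult_le_compat_r; auto; lra). unfold Rr in *. lra. }
  assert (KW : CI0 * W z + CL * (CI0 + Cr + 8 * eps * Rr) * W z <= Rr * W z).
  { rewrite <- Rmult_plus_distr_r. apply Rmult_le_compat_r; auto. }
  rewrite D1, D2, D3. unfold Phi. repeat split.
  - eapply Rle_trans; [apply Cmod_triangle|]. lra.
  - eapply Rle_trans; [apply Cmod_triangle|]. lra.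
  - eapply Rle_trans; [apply Cmod_triangle|]. lra.
  - eapply Rle_trans; [apply Cmod_triangle|]. apply Rle_trans with ((CI0 * W z + CL * (CI0 + Cr + 8 * eps * Rr) * W z) / mu z).
    + unfold Rdiv in *. rewrite Rmult_plus_distr_r. lra.
    + apply Rmult_le_compat_r; auto. apply Rlt_le, Rinv_0_lt_compat; auto.
Qed.

Lemma Lc_Hrhs_diff f g dl z t : tnice f -> tnice g -> unit_bd f -> unit4 g -> bndd dl f g -> 0 <= dl -> 0 < d z ->
  Cmod (Lc (Hrhs f) z t - Lc (Hrhs g) z t)%C <= dl / 2 * W z /\
  Cmod (Lc (tD (Hrhs f)) z t - Lc (tD (Hrhs g)) z t)%C <= dl / 2 * W z /\
  Cmod (Lc (tD (tD (Hrhs f))) z t - Lc (tD (tD (Hrhs g))) z t)%C <= dl / 2 * W z /\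
  Cmod (Lc (tD (tD (tD (Hrhs f)))) z t - Lc (tD (tD (tD (Hrhs g)))) z t)%C <= dl / 2 * W z / mu z.
Proof using All.
  intros Hf Hg Uf Ug Hb Hdl Hz.
  assert (Q := Lc_diff (Hrhs f) (Hrhs g) (16 * eps * dl) z t (Hrhs_tnice f Hf Uf) (Hrhs_tnice g Hg (unit4_unit g Ug))).
  destruct Q as [q0 [q1 [q2 q3]]]; auto.
  - apply Rmult_le_pos; lra.
  - intros u s Hu. unfold Hrhs.
    replace (tD (tD (tD fI)) u s + rr u s + NL f u s - (tD (tD (tD fI)) u s + rr u s + NL g u s))%C with (NL f u s - NL g u s)%C by ring.
    apply (NL_lip d bb eps Heps b_bd W W_pos); auto.
  - assert (HW := W_pos z Hz). assert (Hm := mu_pos d z Hz).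
    assert (B : CL * (16 * eps * dl) * W z <= dl / 2 * W z).
    { apply Rmult_le_compat_r; auto. replace (CL * (16 * eps * dl)) with (16 * eps * CL * dl) by ring.
      replace (dl / 2) with (/2 * dl) by field. apply Rmult_le_compat_r; auto. }
    repeat split; try lra. eapply Rle_trans; [exact q3|]. apply Rmult_le_compat_r; auto. apply Rlt_le, Rinv_0_lt_compat; auto.
Qed.

Lemma Phi_contr f g dl : tnice f -> tnice g -> bnd Rr f -> bnd Rr g -> bndd dl f g -> 0 <= dl -> bndd (dl / 2) (Phi f) (Phi g).
Proof using All.
  intros Hf Hg Bf Bg Hb Hdl z t Hz. assert (Uf := bnd_unit4 f Bf). assert (Ug := bnd_unit4 g Bg).
  assert (Q := Lc_Hrhs_diff f g dl z t Hf Hg (unit4_unit f Uf) Ug Hb Hdl Hz).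
  destruct (proj2 (Phi_D f Hf (unit4_unit f Uf)) z t Hz) as [D1 [D2 D3]].
  destruct (proj2 (Phi_D g Hg (unit4_unit g Ug)) z t Hz) as [E1 [E2 E3]].
  rewrite D1, D2, D3, E1, E2, E3. unfold Phi.
  assert (A : forall a b c : C, (a + b - (a + c))%C = (b - c)%C) by (intros; ring). rewrite !A. exact Q.
Qed.

Fixpoint pic (n : nat) : C -> R -> C := match n with O => fI | S n => Phi (pic n) end.

Lemma pic_ok n : tnice (pic n) /\ bnd Rr (pic n).
Proof using All.
  induction n; simpl.
  - split; auto. intros z t Hz. destruct (fI_bnd z t Hz) as [a [b [c e]]]. assert (HW := W_pos z Hz).
    assert (CI0 * W z <= Rr * W z). { apply Rmult_le_compat_r; auto. unfold Rr. assert (0 <= CL * (CI0 + Cr)) by (apply Rmult_le_pos; lra). lra. }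
    repeat split; try lra. eapply Rle_trans; [exact e|]. apply Rmult_le_compat_r; auto. apply Rlt_le, Rinv_0_lt_compat, mu_pos; auto.
  - destruct IHn as [H1 H2]. split; [|now apply Phi_bnd]. apply Phi_D; auto. apply unit4_unit, bnd_unit4; auto.
Qed.

Lemma bnd_bndd f g A B : bnd A f -> bnd B g -> bndd (A + B) f g.
Proof using.
  intros Hf Hg z t Hz. destruct (Hf z t Hz) as [a0 [a1 [a2 a3]]]. destruct (Hg z t Hz) as [b0 [b1 [b2 b3]]].
  rewrite Rmult_plus_distr_r. repeat split; try (eapply Rle_trans; [apply Cmod_triangle_minus|]; lra).
Qed.

Let dl0 := Rr + Rr.

Lemma pic_step n : bndd (dl0 * (/2)^n) (pic (S n)) (pic n).
Proof using All.
  induction n.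
  - simpl ((/2)^0). rewrite Rmult_1_r. apply bnd_bndd; [apply (pic_ok 1)|apply (pic_ok 0)].
  - replace (dl0 * (/2)^(S n)) with (dl0 * (/2)^n / 2) by (simpl; field).
    apply (Phi_contr (pic (S n)) (pic n)); try apply pic_ok; auto.
    apply Rmult_le_pos; [unfold dl0; lra|apply pow_le; lra].
Qed.

Lemma pic_geo n m : bndd (dl0 * 2 * ((/2)^n - (/2)^(n + m))) (pic (n + m)) (pic n).
Proof using All.
  induction m; intros z t Hz.
  - rewrite Nat.add_0_r, Rminus_diag, Rmult_0_r.
    assert (Z : forall a : C, Cmod (a - a)%C = 0) by (intros; replace (a - a)%C with (RtoC 0) by ring; apply Cmod_0).
    rewrite !Z. unfold Rdiv. rewrite !Rmult_0_l. lra.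
  - rewrite Nat.add_succ_r. destruct (IHm z t Hz) as [a0 [a1 [a2 a3]]]. destruct (pic_step (n + m) z t Hz) as [b0 [b1 [b2 b3]]].
    replace (dl0 * 2 * ((/ 2) ^ n - (/ 2) ^ S (n + m))) with (dl0 * 2 * ((/ 2) ^ n - (/ 2) ^ (n + m)) + dl0 * (/2)^(n + m)) by (simpl; field).
    rewrite Rmult_plus_distr_r.
    assert (Tr : forall a b c X Y, Cmod (b - c)%C <= X -> Cmod (a - b)%C <= Y -> Cmod (a - c)%C <= X + Y).
    { intros a b c X Y H1 H2. assert (Q := Cmod_tri3 a b c). lra. }
    repeat split; try (eapply Tr; eauto; fail).
    unfold Rdiv in *. rewrite Rmult_plus_distr_r. eapply Tr; eauto.
Qed.

Lemma seq_cauchy (u : nat -> C) A : 0 <= A -> (forall n m, Cmod (u (n + m)%nat - u n)%C <= A * (/2)^n) -> Ccv u (Clim u) /\ forall n, Cmod (Clim u - u n)%C <= A * (/2)^n.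
Proof using.
  intros HA H. assert (Hcv : Ccv u (Clim u)).
  { apply Ccauchy_cv. intros e He. destruct (half_pow_small (2 * A) e He) as [N HN]. exists N. intros n m Hn Hm.
    assert (W1 := H N (n - N)%nat). assert (W2 := H N (m - N)%nat).
    replace (N + (n - N))%nat with n in W1 by lia. replace (N + (m - N))%nat with m in W2 by lia.
    assert (Q := Cmod_tri3 (u n) (u N) (u m)). rewrite (Cmod_minus_sym (u N) (u m)) in Q. lra. }
  split; auto. intros n. eapply Ccv_bound; [exact Hcv|]. exists n. intros m Hm. replace m with (n + (m - n))%nat by lia. apply H.
Qed.

Lemma limit_family (u : nat -> C -> R -> C) (A : C -> R) (M : R -> R) :
  (forall n, tnice (u n)) -> (forall z, 0 < d z -> 0 <= A z) ->
  (forall n m z t, 0 < d z -> Cmod (u (n + m)%nat z t - u n z t)%C <= A z * (/2)^n) ->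
  (forall n del z t, 0 < del -> del <= d z -> Cmod (u n z t) <= M del) ->
  let v := fun z t => Clim (fun n => u n z t) in
  tnice v /\ (forall z t, 0 < d z -> Ccv (fun n => u n z t) (v z t)) /\
  (forall z t, 0 < d z -> Ccv (fun n => tD (u n) z t) (tD v z t)).
Proof using d_lip.
  intros Hn HA Hc HM v.
  assert (Hcv : forall z t, 0 < d z -> Ccv (fun n => u n z t) (v z t) /\ forall n, Cmod (v z t - u n z t)%C <= A z * (/2)^n).
  { intros z t Hz. apply (seq_cauchy (fun n => u n z t) (A z)); auto. }
  assert (Hlim : forall z t, 0 < d z -> exists l, cder (slice v t) z l /\ forall e, 0 < e -> eventually (fun n => Cmod (D (slice (u n) t) z - l)%C < e)).
  { intros z t Hz. apply (limit_holo eventually (fun n => slice (u n) t) (slice v t) z (d z / 2) (M (d z / 2)) ltac:(lra)).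
    - intros n. apply (nice_hball d d_lip); [apply tnice_nice; auto|lra].
    - intros n x Hx. assert (Q := d_ball d d_lip z x _ Hx). apply HM; lra.
    - intros x Hx e He. assert (Q := d_ball d d_lip z x _ Hx). destruct (Hcv x t ltac:(lra)) as [Q1 _]. apply (Q1 e He). }
  split; [|split].
  - repeat split.
    + intros z t Hz. destruct (Hlim z t Hz) as [l [Hl _]]. eauto.
    + intros del Hd. exists (M del). intros z t Hz. eapply Ccv_bound0; [apply (Hcv z t); lra|]. exists 0%nat. intros; apply HM; auto.
    + intros z t Hz e He. destruct (half_pow_small (A z) (e/4)) as [n Hnn]; [lra|].
      destruct (proj2 (proj2 (Hn n)) z t Hz (e/4)) as [del [Hdel HH]]; [lra|]. exists del. split; auto. intros s Hs. specialize (HH s Hs).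
      assert (T1 := proj2 (Hcv z s Hz) n). assert (T2 := proj2 (Hcv z t Hz) n).
      replace (v z s - v z t)%C with ((v z s - u n z s) + (u n z s - u n z t) - (v z t - u n z t))%C by ring.
      eapply Rle_lt_trans; [apply Cmod_triangle_minus|]. eapply Rle_lt_trans; [apply Rplus_le_compat_r, Cmod_triangle|]. lra.
  - intros z t Hz. apply Hcv; auto.
  - intros z t Hz. destruct (Hlim z t Hz) as [l [Hl HL]]. unfold tD at 2. rewrite (D_unique _ _ _ Hl). exact HL.
Qed.

Theorem picard_solution : exists f, tnice f /\ bnd Rr f /\ unit4 f /\ forall z t, 0 < d z -> f z t = (fI z t + Lc (Hrhs f) z t)%C.
Proof using All.
  set (A := dl0 * 2). assert (HA : 0 <= A) by (unfold A, dl0; lra).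
  assert (Hp : forall n, 0 < (/2)^n) by (intros; apply pow_lt; lra).
  assert (G : forall n m z t, 0 < d z ->
     Cmod (pic (n + m) z t - pic n z t)%C <= A * W z * (/2)^n /\ Cmod (tD (pic (n + m)) z t - tD (pic n) z t)%C <= A * W z * (/2)^n /\
     Cmod (tD (tD (pic (n + m))) z t - tD (tD (pic n)) z t)%C <= A * W z * (/2)^n /\
     Cmod (tD (tD (tD (pic (n + m)))) z t - tD (tD (tD (pic n))) z t)%C <= A * W z / mu z * (/2)^n).
  { intros n m z t Hz. destruct (pic_geo n m z t Hz) as [a0 [a1 [a2 a3]]]. assert (HW := W_pos z Hz). assert (Hpn := Hp n). assert (Hpm := Hp (n + m)%nat).
    assert (B : dl0 * 2 * ((/ 2) ^ n - (/ 2) ^ (n + m)) * W z <= A * W z * (/2)^n).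
    { fold A. replace (A * W z * (/2)^n) with (A * (/2)^n * W z) by ring. apply Rmult_le_compat_r; auto. apply Rmult_le_compat_l; lra. }
    repeat split; try lra. eapply Rle_trans; [exact a3|].
    replace (A * W z / mu z * (/2)^n) with (A * W z * (/2)^n / mu z) by (unfold Rdiv; ring). apply Rmult_le_compat_r; auto. apply Rlt_le, Rinv_0_lt_compat, mu_pos; auto. }
  assert (NN : forall n, tnice (pic n)) by apply pic_ok.
  assert (N1 : forall n, tnice (tD (pic n))) by (intros; apply (tnice_tD d d_lip); auto).
  assert (N2 : forall n, tnice (tD (tD (pic n)))) by (intros; apply (tnice_tD d d_lip); auto).
  assert (U : forall n z t, 0 < d z -> Cmod (pic n z t) <= 1 /\ Cmod (tD (pic n) z t) <= 1 /\ Cmod (tD (tD (pic n)) z t) <= 1 /\ Cmod (tD (tD (tD (pic n))) z t) <= / mu z).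
  { intros n z t Hz. apply (bnd_unit4 (pic n)); auto. apply pic_ok. }
  assert (AW : forall z, 0 < d z -> 0 <= A * W z) by (intros; apply Rmult_le_pos; auto).
  set (f := fun z t => Clim (fun n => pic n z t)).
  destruct (limit_family pic (fun z => A * W z) (fun _ => 1) NN AW) as [F0 [c0' c1]].
  { intros n m z t Hz. destruct (G n m z t Hz) as [g0 [g1 [g2 g3]]]. exact g0. } { intros n del z t Hd Hz. destruct (U n z t ltac:(lra)) as [g0 [g1 [g2 g3]]]. exact g0. }
  fold f in F0, c0', c1.
  assert (F1 := tnice_tD d d_lip f F0).
  destruct (limit_family (fun n => tD (pic n)) (fun z => A * W z) (fun _ => 1) N1 AW) as [_ [c1' c2]].
  { intros n m z t Hz. destruct (G n m z t Hz) as [g0 [g1 [g2 g3]]]. exact g1. } { intros n del z t Hd Hz. destruct (U n z t ltac:(lra)) as [g0 [g1 [g2 g3]]]. exact g1. }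
  assert (E1 : forall z t, 0 < d z -> Clim (fun n => tD (pic n) z t) = tD f z t) by (intros z t Hz; apply Ccv_Clim; apply c1; auto).
  assert (c2' : forall z t, 0 < d z -> Ccv (fun n => tD (tD (pic n)) z t) (tD (tD f) z t)).
  { intros z t Hz. specialize (c2 z t Hz). rewrite (tD_ext d d_lip _ (tD f)) in c2; auto.
    eapply (tnice_ext d d_lip); [|exact F1]. intros; symmetry; auto. }
  destruct (limit_family (fun n => tD (tD (pic n))) (fun z => A * W z) (fun _ => 1) N2 AW) as [_ [_ c3]].
  { intros n m z t Hz. destruct (G n m z t Hz) as [g0 [g1 [g2 g3]]]. exact g2. } { intros n del z t Hd Hz. destruct (U n z t ltac:(lra)) as [g0 [g1 [g2 g3]]]. exact g2. }
  assert (E2 : forall z t, 0 < d z -> Clim (fun n => tD (tD (pic n)) z t) = tD (tD f) z t) by (intros z t Hz; apply Ccv_Clim; apply c2'; auto).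
  assert (c3' : forall z t, 0 < d z -> Ccv (fun n => tD (tD (tD (pic n))) z t) (tD (tD (tD f)) z t)).
  { intros z t Hz. specialize (c3 z t Hz). rewrite (tD_ext d d_lip _ (tD (tD f))) in c3; auto.
    eapply (tnice_ext d d_lip); [|exact (tnice_tD d d_lip _ F1)]. intros; symmetry; auto. }
  assert (Bf : bnd Rr f).
  { intros z t Hz. assert (PB : forall n, bnd Rr (pic n)) by apply pic_ok. repeat split.
    - eapply Ccv_bound0; [apply c0'; auto|]. exists 0%nat. intros n _. destruct (PB n z t Hz) as [g0 [g1 [g2 g3]]]. exact g0.
    - eapply Ccv_bound0; [apply c1; auto|]. exists 0%nat. intros n _. destruct (PB n z t Hz) as [g0 [g1 [g2 g3]]]. exact g1.
    - eapply Ccv_bound0; [apply c2'; auto|]. exists 0%nat. intros n _. destruct (PB n z t Hz) as [g0 [g1 [g2 g3]]]. exact g2.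
    - eapply Ccv_bound0; [apply c3'; auto|]. exists 0%nat. intros n _. destruct (PB n z t Hz) as [g0 [g1 [g2 g3]]]. exact g3. }
  assert (U4 := bnd_unit4 f Bf).
  assert (Bd : forall n, bndd (A * (/2)^n) (pic n) f).
  { intros n z t Hz.
    assert (SW : forall (u : nat -> C) l X, Ccv u l -> (forall m, Cmod (u (n + m)%nat - u n)%C <= X) -> Cmod (u n - l)%C <= X).
    { intros u l X Hcv H. rewrite Cmod_minus_sym. eapply Ccv_bound; [exact Hcv|]. exists n. intros m Hm. replace m with (n + (m - n))%nat by lia. apply H. }
    replace (A * (/2)^n * W z) with (A * W z * (/2)^n) by ring.
    repeat split.
    - apply (SW (fun n => pic n z t)); [auto|]. intros m. destruct (G n m z t Hz) as [g0 [g1 [g2 g3]]]. exact g0.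
    - apply (SW (fun n => tD (pic n) z t)); [auto|]. intros m. destruct (G n m z t Hz) as [g0 [g1 [g2 g3]]]. exact g1.
    - apply (SW (fun n => tD (tD (pic n)) z t)); [auto|]. intros m. destruct (G n m z t Hz) as [g0 [g1 [g2 g3]]]. exact g2.
    - replace (A * W z * (/2)^n / mu z) with (A * W z / mu z * (/2)^n) by (unfold Rdiv; ring).
      apply (SW (fun n => tD (tD (tD (pic n))) z t)); [auto|]. intros m. destruct (G n m z t Hz) as [g0 [g1 [g2 g3]]]. exact g3. }
  exists f. split; [exact F0|split; [exact Bf|split; [exact U4|]]]. intros z t Hz.
  apply Cmod_eps_eq. intros e He. destruct (half_pow_small (2 * A * W z) e He) as [n Hn].
  assert (P1 := proj1 (Bd (S n) z t Hz)).
  assert (P2 := proj1 (Lc_Hrhs_diff (pic n) f (A * (/2)^n) z t (NN n) F0 (unit4_unit _ (bnd_unit4 _ (proj2 (pic_ok n)))) U4 (Bd n)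
     ltac:(apply Rmult_le_pos; [auto|apply pow_le; lra]) Hz)).
  change (pic (S n) z t) with (fI z t + Lc (Hrhs (pic n)) z t)%C in P1. rewrite Cmod_minus_sym in P1.
  replace (f z t - (fI z t + Lc (Hrhs f) z t))%C with ((f z t - (fI z t + Lc (Hrhs (pic n)) z t)) + (Lc (Hrhs (pic n)) z t - Lc (Hrhs f) z t))%C by ring.
  eapply Rle_trans; [apply Cmod_triangle|]. simpl in P1. assert (HW := AW z Hz). assert (Hpn := Hp n). nra.
Qed.
End Picard.

(** * Passage to the differential equation, and uniqueness *)

Definition wder (T : R) (g : R -> C) (t : R) (l : C) := forall e, 0 < e -> exists del, 0 < del /\
  forall h, Rabs h < del -> 0 <= t + h <= T -> Cmod (g (t + h)%R - g t - RtoC h * l)%C <= e * Rabs h.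

Lemma quot_identity (a l : C) h : h <> 0 -> Cmod (a / RtoC h - l)%C * Rabs h = Cmod (a - RtoC h * l)%C.
Proof.
  intros Hh. rewrite <- Cmod_R, <- Cmod_mult. f_equal. field. intros Q. apply Hh. now apply RtoC_inj.
Qed.

Lemma tderiv_wder T g t l : tderiv_within T g t l <-> wder T g t l.
Proof.
  unfold tderiv_within. rewrite (filterlim_C_iff (within _ (locally 0))). split.
  - intros H e He. specialize (H e He). apply locally_R_iff in H. destruct H as [del [Hd H]]. exists del. split; auto.
    intros h Hh Ht. destruct (Req_dec h 0) as [->|Hh0].
    + rewrite Rplus_0_r. replace (g t - g t - 0 * l)%C with (RtoC 0) by ring. rewrite Cmod_0, Rabs_R0. lra.
    + specialize (H h). rewrite Rminus_0_r in H. specialize (H Hh (conj Hh0 Ht)).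
      rewrite <- quot_identity by auto. apply Rmult_le_compat_r; [apply Rabs_pos|]. apply Rlt_le. exact H.
  - intros H e He. destruct (H (e/2) ltac:(lra)) as [del [Hd HH]]. apply locally_R_iff. exists del. split; auto.
    intros h Hh [Hh0 Ht]. rewrite Rminus_0_r in Hh. specialize (HH h Hh Ht). rewrite <- quot_identity in HH by auto.
    assert (0 < Rabs h) by now apply Rabs_pos_lt. apply Rmult_le_reg_r in HH; auto. apply Rle_lt_trans with (e/2); [exact HH|lra].
Qed.

Lemma wder_rder T g t l : 0 < t < T -> wder T g t l -> rder g t l.
Proof.
  intros Ht H e He. destruct (H e He) as [del [Hd HH]]. exists (Rmin del (Rmin t (T - t))). split.
  - repeat apply Rmin_glb_lt; lra.
  - intros h Hh. assert (Rabs h < del) by (eapply Rlt_le_trans; [exact Hh|apply Rmin_l]).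
    assert (Hh' : Rabs h < Rmin t (T - t)) by (eapply Rlt_le_trans; [exact Hh|apply Rmin_r]).
    assert (Rabs h < t) by (eapply Rlt_le_trans; [exact Hh'|apply Rmin_l]).
    assert (Rabs h < T - t) by (eapply Rlt_le_trans; [exact Hh'|apply Rmin_r]).
    apply HH; auto. assert (Q := Rabs_def2 _ _ H1). assert (Q2 := Rabs_def2 _ _ H2). lra.
Qed.

Lemma rder_wder T g t l : rder g t l -> wder T g t l.
Proof. intros H e He. destruct (H e He) as [del [Hd HH]]. exists del. split; auto. Qed.

Lemma wder_quad T g t l M : 0 <= t <= T -> (forall t', 0 <= t' <= T -> Cmod (g t' - g t - RtoC (t' - t) * l)%C <= M * (t' - t)^2) -> wder T g t l.
Proof.
  intros Ht H e He. exists (e / (Rabs M + 1)). assert (HM := Rabs_pos M). split; [apply Rdiv_lt_0_compat; lra|].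
  intros h Hh Hth. specialize (H (t + h) Hth). replace (t + h - t) with h in H by ring.
  eapply Rle_trans; [exact H|]. rewrite <- pow2_abs. assert (Hp := Rabs_pos h). simpl. rewrite Rmult_1_r, <- Rmult_assoc.
  apply Rmult_le_compat_r; auto. assert (V := Rle_abs M).
  apply Rle_trans with ((Rabs M + 1) * Rabs h); [apply Rmult_le_compat_r; lra|].
  apply (Rmult_lt_compat_l (Rabs M + 1)) in Hh; [|lra]. replace ((Rabs M + 1) * (e / (Rabs M + 1))) with e in Hh by (field; lra). lra.
Qed.

Lemma wder_plus T f g t a b : wder T f t a -> wder T g t b -> wder T (fun s => f s + g s)%C t (a + b)%C.
Proof.
  intros Hf Hg e He. destruct (Hf (e/2) ltac:(lra)) as [d1 [Hd1 H1]]. destruct (Hg (e/2) ltac:(lra)) as [d2 [Hd2 H2]].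
  exists (Rmin d1 d2). split; [now apply Rmin_glb_lt|]. intros h Hh Ht.
  assert (A1 : Rabs h < d1) by (eapply Rlt_le_trans; [exact Hh|apply Rmin_l]).
  assert (A2 : Rabs h < d2) by (eapply Rlt_le_trans; [exact Hh|apply Rmin_r]).
  specialize (H1 h A1 Ht). specialize (H2 h A2 Ht).
  replace (f (t + h)%R + g (t + h)%R - (f t + g t) - RtoC h * (a + b))%C with
    ((f (t + h)%R - f t - RtoC h * a) + (g (t + h)%R - g t - RtoC h * b))%C by ring.
  eapply Rle_trans; [apply Cmod_triangle|]. lra.
Qed.

Lemma wder_ext T f g t l : 0 <= t <= T -> (forall s, 0 <= s <= T -> f s = g s) -> wder T f t l -> wder T g t l.
Proof.
  intros Ht E H e He. destruct (H e He) as [del [Hd HH]]. exists del. split; auto. intros h Hh Hth. rewrite <- !E by auto. auto.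
Qed.

Lemma wder_clamp_ccont T g : 0 <= T -> (forall t, 0 <= t <= T -> exists l, wder T g t l) -> forall t, ccont (fun s => g (clamp 0 T s)) t.
Proof.
  intros HT H t e He. set (u := clamp 0 T t). assert (Hu := clamp_in 0 T t HT). destruct (H u Hu) as [l Hl].
  destruct (Hl 1 Rlt_0_1) as [del [Hd HH]]. set (M := Cmod l + 1). assert (HM : 0 < M) by (unfold M; assert (Q := Cmod_ge_0 l); lra).
  exists (Rmin del (e / M)). split; [apply Rmin_glb_lt; auto; apply Rdiv_lt_0_compat; auto|]. intros s Hs.
  assert (A1 : Rabs (s - t) < del) by (eapply Rlt_le_trans; [exact Hs|apply Rmin_l]).
  assert (A2 : Rabs (s - t) < e / M) by (eapply Rlt_le_trans; [exact Hs|apply Rmin_r]).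
  assert (Hc := clamp_lip 0 T s t). fold u in Hc. set (h := clamp 0 T s - u) in *.
  assert (Eh : clamp 0 T s = u + h) by (unfold h; ring). assert (Hin := clamp_in 0 T s HT).
  fold u. rewrite Eh in *. specialize (HH h ltac:(lra) Hin).
  replace (g (u + h)%R - g u)%C with ((g (u + h)%R - g u - RtoC h * l) + RtoC h * l)%C by ring.
  eapply Rle_lt_trans; [apply Cmod_triangle|]. rewrite Cmod_mult, Cmod_R.
  apply Rle_lt_trans with (M * Rabs h); [unfold M; lra|]. apply Rle_lt_trans with (M * Rabs (s - t)); [apply Rmult_le_compat_l; lra|].
  apply (Rmult_lt_compat_l M) in A2; auto. replace (M * (e / M)) with e in A2 by (field; lra). exact A2.
Qed.

Section Solve.
Variables (psi K : R) (k kp : nat -> R -> C).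
Hypothesis HK : kernel_ok psi K k kp.
Variables (d : C -> R) (c0 : R).
Hypothesis Hc0 : 0 < c0.
Hypothesis d_lip : forall y z, Rabs (d y - d z) <= Cmod (y - z)%C.
Hypothesis d_cone : forall y i s, (i < 3)%nat -> 0 <= s -> d y + c0 * s <= d (y + RtoC s * edir psi i)%C.
Variable T : R.
Hypothesis HT : 0 <= T.
Notation tnice := (tnice d).
Notation Lc := (Lc psi k T).
Notation tD3 h := (tD (tD (tD h))).

Lemma Lc_wder h y t : tnice h -> 0 < d y -> 0 <= t <= T -> wder T (Lc h y) t (h y t + Lc (tD3 h) y t)%C.
Proof using HK d_lip d_cone Hc0 HT.
  intros Hh Hy Ht. destruct (L_time psi K k kp HK d c0 Hc0 d_lip d_cone h y T Hh Hy HT) as [C0 HC].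
  assert (A : wder T (fun s => CI (h y) 0 s) t (h y t)). { apply rder_wder, rder_CI. intros u. apply Hh; auto. }
  assert (B : wder T (fun s => L psi k h y s - CI (h y) 0 s)%C t (L psi k (tD3 h) y t)).
  { apply (wder_quad T _ t _ C0); auto. }
  unfold Lc. rewrite clamp_id by auto.
  apply (wder_ext T (fun s => CI (h y) 0 s + (L psi k h y s - CI (h y) 0 s))%C); auto.
  - intros s Hs. rewrite clamp_id by auto. ring.
  - apply wder_plus; auto.
Qed.

Lemma tD3_form u a h : tnice a -> tnice h -> (forall z t, 0 < d z -> u z t = (a z t + Lc h z t)%C) ->
  forall z t, 0 < d z -> tD3 u z t = (tD3 a z t + Lc (tD3 h) z t)%C.
Proof using HK d_lip d_cone Hc0 HT.
  intros Ha Hh H. assert (F := tD_form psi K k kp HK d c0 Hc0 d_lip d_cone T HT).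
  assert (A1 := tnice_tD d d_lip a Ha). assert (A2 := tnice_tD d d_lip _ A1).
  assert (H1 := tnice_tD d d_lip h Hh). assert (H2 := tnice_tD d d_lip _ H1).
  apply F; auto.
Qed.

Lemma duhamel_pde f a h z t : tnice a -> tnice h -> (forall z t, 0 < d z -> a z t = a z 0) ->
  (forall z t, 0 < d z -> f z t = (a z t + Lc h z t)%C) -> 0 < d z -> 0 <= t <= T ->
  wder T (f z) t (tD3 f z t - tD3 a z t + h z t)%C.
Proof using HK d_lip d_cone Hc0 HT.
  intros Ha Hh Hc Hf Hz Ht. rewrite (tD3_form f a h) by auto.
  replace (tD3 a z t + Lc (tD3 h) z t - tD3 a z t + h z t)%C with (0 + (h z t + Lc (tD3 h) z t))%C by ring.
  apply (wder_ext T (fun s => a z 0 + Lc h z s)%C); auto.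
  - intros s Hs. rewrite Hf, (Hc z s); auto.
  - apply wder_plus; [|now apply Lc_wder]. apply rder_wder. apply rder_const.
Qed.

Variables (W : C -> R) (CW : R).
Hypothesis W_pos : forall z, 0 < d z -> 0 <= W z.
Hypothesis HCW : 0 <= CW.
Hypothesis W_cone : forall y i s, (i < 3)%nat -> 0 <= s -> 0 < d y -> W (y + RtoC s * edir psi i)%C <= W y.
Hypothesis W_loc : forall z u, 0 < d z -> Cmod (u - z)%C <= d z / 2 -> Cmod (u - z)%C <= / 2 -> W u <= CW * W z.
Variables (bb : nat -> nat -> C -> R -> C) (eps : R).
Hypothesis Heps : 0 <= eps.
Hypothesis b_an : forall j k z t, (j < 4)%nat -> 0 < d z -> exists l, cder (slice (bb j k) t) z l.
Hypothesis b_bd : forall j k z t, (j < 4)%nat -> 0 < d z -> Cmod (bb j k z t) <= eps * (/4)^k.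
Hypothesis b_ct : forall j k z t, (j < 4)%nat -> 0 < d z -> ccont (bb j k z) t.
Hypothesis Hsmall : 16 * eps * Cest K c0 T CW <= / 2.
Notation NL := (NL bb).

Lemma pde_uniqueness f g rr dl0 : tnice f -> tnice g -> unit4 d f -> unit4 d g -> 0 <= dl0 -> bndd d W dl0 f g ->
  (forall z t, 0 < d z -> f z t = f z (clamp 0 T t)) -> (forall z t, 0 < d z -> g z t = g z (clamp 0 T t)) ->
  (forall z t, 0 < d z -> 0 <= t <= T -> wder T (f z) t (tD3 f z t + rr z t + NL f z t)%C) ->
  (forall z t, 0 < d z -> 0 <= t <= T -> wder T (g z) t (tD3 g z t + rr z t + NL g z t)%C) ->
  (forall z, 0 < d z -> f z 0 = g z 0) ->
  forall z t, 0 < d z -> f z t = g z t.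
Proof using All.
  intros Nf Ng Uf Ug Hdl0 Hb Cf Cg Pf Pg H0.
  assert (Uf1 := unit4_unit d f Uf). assert (Ug1 := unit4_unit d g Ug).
  assert (NNf := NL_tnice d d_lip bb eps Heps b_an b_bd b_ct f Nf Uf1).
  assert (NNg := NL_tnice d d_lip bb eps Heps b_an b_bd b_ct g Ng Ug1).
  set (h := fun z t => (NL f z t - NL g z t)%C). assert (Nh : tnice h) by (apply tnice_minus; auto).
  assert (LcN := Lc_nice psi K k kp HK d c0 Hc0 d_lip d_cone T HT).
  set (w := fun z t => (f z t - g z t - Lc h z t)%C).
  assert (Nfg : tnice (fun z t => f z t - g z t)%C) by (apply tnice_minus; auto).
  assert (Nw : tnice w) by (apply tnice_minus; auto).
  assert (tDm := tD_minus d).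
  assert (Hw : forall y t, 0 < d y -> 0 <= t <= T -> w y t = 0).
  { apply (linear_uniqueness psi K k kp HK d c0 Hc0 d_lip d_cone T w HT Nw).
    - intros y t Hy Ht. assert (Ht' : 0 <= t <= T) by lra.
      assert (E : tD3 w y t = (tD3 f y t - tD3 g y t - Lc (tD3 h) y t)%C).
      { change (tD3 w y t) with (D (D (D (fun z => (fun u => f u t - g u t)%C z - slice (Lc h) t z)%C)) y).
        rewrite (D3_minus d d_lip (fun u => f u t - g u t)%C (slice (Lc h) t)) by solve [auto|exact (tnice_nice d _ t Nfg)|exact (tnice_nice d _ t (LcN h Nh))].
        rewrite (D3_minus d d_lip (slice f t) (slice g t)) by (auto; now apply tnice_nice).
        f_equal. f_equal. change (D (D (D (slice (Lc h) t))) y) with (tD3 (Lc h) y t).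
        rewrite (tD3_form (Lc h) (fun _ _ => 0) h); auto.
        - assert (Z : forall z t, tD (fun _ _ => 0 : C) z t = 0) by (intros; apply D_unique; apply (cder_const 0)).
          assert (Z2 : forall z t, tD (tD (fun _ _ => 0 : C)) z t = 0).
          { intros. apply D_unique. apply (cder_ext_loc (fun _ => 0)) with (d := 1); [lra| |apply (cder_const 0)]. intros; symmetry; apply Z. }
          assert (Z3 : tD3 (fun _ _ => 0 : C) y t = 0).
          { apply D_unique. apply (cder_ext_loc (fun _ => 0)) with (d := 1); [lra| |apply (cder_const 0)]. intros; symmetry; apply Z2. }
          rewrite Z3. ring.
        - repeat split.
          + intros. eexists. apply (cder_const 0).
          + intros. exists 0. intros. rewrite Cmod_0. lra.
          + intros. apply (ccont_const 0).
        - intros. ring. }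
      rewrite E. apply (wder_rder T); [lra|].
      assert (Q1 := Pf y t Hy Ht'). assert (Q2 := Pg y t Hy Ht'). assert (Q3 := Lc_wder h y t Nh Hy Ht').
      assert (M : forall u v l m, wder T u t l -> wder T v t m -> wder T (fun s => u s - v s)%C t (l - m)%C).
      { intros u v l m Hu Hv. assert (Hv' : wder T (fun s => - v s)%C t (- m)%C).
        { intros e He. destruct (Hv e He) as [del [Hd HH]]. exists del. split; auto. intros x Hx Hxt. specialize (HH x Hx Hxt).
          replace (- v (t + x)%R - - v t - RtoC x * - m)%C with (- (v (t + x)%R - v t - RtoC x * m))%C by ring. now rewrite Cmod_opp. }
        exact (wder_plus T u (fun s => - v s)%C t l (- m)%C Hu Hv'). }
      assert (R := M _ _ _ _ (M _ _ _ _ Q1 Q2) Q3).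
      replace (tD3 f y t - tD3 g y t - Lc (tD3 h) y t)%C with
        (tD3 f y t + rr y t + NL f y t - (tD3 g y t + rr y t + NL g y t) - (h y t + Lc (tD3 h) y t))%C by (unfold h; ring).
      exact R.
    - intros y Hy. unfold w. rewrite H0 by auto. rewrite Lc_zero by auto. ring. }
  assert (Eq : forall z t, 0 < d z -> f z t = (g z t + Lc h z t)%C).
  { intros z t Hz. assert (Hcl := clamp_in 0 T t HT). assert (Q := Hw z _ Hz Hcl). unfold w in Q.
    rewrite <- Cf, <- Cg in Q by auto. unfold Lc in Q. rewrite (clamp_id 0 T (clamp 0 T t)) in Q by auto.
    change (L psi k h z (clamp 0 T t)) with (Lc h z t) in Q.
    replace (f z t) with ((f z t - g z t - Lc h z t) + (g z t + Lc h z t))%C by ring. rewrite Q. ring. }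
  assert (F := tD_form psi K k kp HK d c0 Hc0 d_lip d_cone T HT).
  assert (G1 := tnice_tD d d_lip g Ng). assert (G2 := tnice_tD d d_lip _ G1).
  assert (h1 := tnice_tD d d_lip h Nh). assert (h2 := tnice_tD d d_lip _ h1).
  assert (E1 := F _ _ _ Ng Nh Eq). assert (E2 := F _ _ _ G1 h1 E1). assert (E3 := F _ _ _ G2 h2 E2).
  assert (Half : forall dl, 0 <= dl -> bndd d W dl f g -> bndd d W (dl / 2) f g).
  { intros dl Hdl B z t Hz.
    assert (C1 : forall u s, 0 < d u -> Cmod (h u s) <= 16 * eps * dl * W u / mu d u).
    { intros u s Hu. apply (NL_lip d bb eps Heps b_bd W W_pos); auto. }
    destruct (Lc_est psi K k kp HK d c0 Hc0 d_lip d_cone W CW T HT W_pos HCW W_cone W_loc h (16 * eps * dl) z t) as [q0 [q1 [q2 q3]]]; auto.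
    { apply Rmult_le_pos; lra. }
    assert (Hm := mu_pos d z Hz). assert (HW := W_pos z Hz).
    assert (Bd : Cest K c0 T CW * (16 * eps * dl) * W z <= dl / 2 * W z).
    { apply Rmult_le_compat_r; auto. replace (Cest K c0 T CW * (16 * eps * dl)) with (16 * eps * Cest K c0 T CW * dl) by ring.
      replace (dl / 2) with (/2 * dl) by field. apply Rmult_le_compat_r; auto. }
    rewrite (Eq z t Hz), (E1 z t Hz), (E2 z t Hz), (E3 z t Hz).
    assert (A : forall a b : C, (a + b - a)%C = b) by (intros; ring). rewrite !A. repeat split; try lra.
    eapply Rle_trans; [exact q3|]. apply Rmult_le_compat_r; auto. apply Rlt_le, Rinv_0_lt_compat; auto. }
  assert (Iter : forall n, bndd d W (dl0 * (/2)^n) f g).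
  { induction n; [simpl; now rewrite Rmult_1_r|]. replace (dl0 * (/2)^(S n)) with (dl0 * (/2)^n / 2) by (simpl; field).
    apply Half; auto. apply Rmult_le_pos; auto. apply pow_le; lra. }
  intros z t Hz. apply Cmod_eps_eq. intros e He. destruct (half_pow_small (dl0 * W z) e He) as [n Hn].
  destruct (Iter n z t Hz) as [q _]. lra.
Qed.
End Solve.

(** * The identity theorem along a ray *)

Lemma cder_Cinv (z : C) : z <> 0 -> cder (fun u => / u)%C z (- / (z * z))%C.
Proof.
  intros Hz. assert (Hm : 0 < Cmod z) by (apply Cmod_gt_0; exact Hz).
  apply (cder_quad _ _ _ (2 / (Cmod z)^3) (Cmod z / 2)); [lra|]. intros v Hv.
  assert (Hzv : Cmod z / 2 <= Cmod (z + v)%C).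
  { assert (Q := Cmod_triangle_minus (z + v)%C v). replace (z + v - v)%C with z in Q by ring. lra. }
  assert (Hne : (z + v)%C <> 0) by (apply Cmod_gt_0; lra).
  replace (/ (z + v) - / z - v * - / (z * z))%C with (v * v * (/ (z * z * (z + v))))%C by (field; split; [exact Hz|exact Hne]).
  rewrite !Cmod_mult, Cmod_inv, !Cmod_mult by (repeat apply Cmult_neq_0; auto). simpl.
  assert (Hi : / (Cmod z * Cmod z * Cmod (z + v)%C) <= 2 / (Cmod z * (Cmod z * (Cmod z * 1)))).
  { replace (2 / (Cmod z * (Cmod z * (Cmod z * 1)))) with (/ (Cmod z * Cmod z * (Cmod z / 2))) by (field; lra).
    apply Rinv_le_contravar; [|apply Rmult_le_compat_l; [nra|exact Hzv]]. apply Rmult_lt_0_compat; [nra|lra]. }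
  replace (Cmod v * (Cmod v * 1)) with (Cmod v * Cmod v) by ring. rewrite (Rmult_comm (2 / _)).
  apply Rmult_le_compat_l; [apply Rle_0_sqr|exact Hi].
Qed.

Lemma cder_Cpow g z l n : cder g z l -> exists m, cder (fun u => g u ^ n)%C z m.
Proof.
  intros Hg. induction n.
  - exists 0. apply (cder_const 1).
  - destruct IHn as [m Hm]. eexists. apply (cder_mult g (fun u => g u ^ n)%C); eauto.
Qed.

(* Divide by [(u - c)^n], which is harmless because [h] vanishes near [c], and apply the Cauchy estimate centred at [p]:
   on the circle the quotient [|p - c| / |u - c|] is bounded away from 1. *)
Lemma zero_spreads h p c R e : 0 < e -> hball p R h -> (forall u, Cmod (u - c)%C < e -> h u = 0) -> 2 * Cmod (p - c)%C < R -> h p = 0.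
Proof.
  intros He Hh Hz Hpc. set (a := Cmod (p - c)%C) in *. assert (Ha := Cmod_ge_0 (p - c)%C). fold a in Ha.
  destruct (Req_dec a 0) as [Ha0|Ha0]. { apply Hz. fold a. lra. }
  assert (HR : 0 < R) by lra.
  assert (Bm : exists M, forall v, 0 <= v <= 2 * PI -> Cmod (h (p + circ R v)%C) <= M).
  { assert (HPI := PI_RGT_0).
    destruct (continuity_ab_maj (fun v => Cmod (h (p + circ R v)%C)) 0 (2 * PI)) as [x [Hx _]]; [lra| |].
    - intros v _. apply continuity_pt_filterlim. apply (ccont_Cmod (fun v => h (p + circ R v)%C)).
      apply (ccont_comp_z h (fun v => (p + circ R v)%C)).
      + destruct (Hh (p + circ R v)%C) as [l Hl].
        { replace (p + circ R v - p)%C with (circ R v) by ring. rewrite Cmod_circ; lra. }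
        eapply cder_czcont; eauto.
      + apply ccont_plus; [apply ccont_const|apply ccont_circ].
    - exists (Cmod (h (p + circ R x)%C)). auto. }
  destruct Bm as [M HM].
  assert (HM0 : 0 <= M). { eapply Rle_trans; [apply Cmod_ge_0|]. apply (HM 0). assert (HPI := PI_RGT_0). lra. }
  set (q := a / (R - a)). assert (Hq : 0 <= q < 1).
  { unfold q. split; [apply le_div_intro; lra|]. apply Rlt_div_l; lra. }
  assert (Bn : forall n, Cmod (h p) <= M * q ^ n).
  { intros n. set (F := fun u => ((u - p) * (h u * ((p - c) * / (u - c)) ^ n))%C).
    assert (HF : forall u l, u <> c -> cder h u l -> exists m, cder (fun u => h u * ((p - c) * / (u - c)) ^ n)%C u m).
    { intros u l Huc Hl.
      assert (D1 : cder (fun u => (p - c) * / (u - c))%C u ((p - c) * ((1 - 0) * (- / ((u - c) * (u - c)))))%C).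
      { apply (cder_scal (p - c)%C (fun u => / (u - c))%C). apply (cder_comp (fun w => / w)%C (fun u => u - c)%C).
        - apply (cder_minus (fun u => u) (fun _ => c)); [apply cder_id|apply cder_const].
        - apply cder_Cinv. intros Q. apply Huc. replace u with (u - c + c)%C by ring. rewrite Q. ring. }
      destruct (cder_Cpow _ _ _ n D1) as [m Hm]. eexists. apply (cder_mult h); eauto. }
    assert (hF : hball p R F).
    { intros u Hu. destruct (Rlt_dec (Cmod (u - c)%C) e) as [Huc|Huc].
      - exists 0. apply (cder_ext_loc (fun _ => 0)) with (d := e - Cmod (u - c)%C); [lra| |apply (cder_const 0)].
        intros w Hw. unfold F. rewrite Hz; [ring|]. assert (Q := Cmod_tri3 w u c). lra.
      - destruct (Hh u Hu) as [l Hl]. destruct (HF u l) as [m Hm]; auto.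
        { intros ->. apply Huc. replace (c - c)%C with (RtoC 0) by ring. rewrite Cmod_0. auto. }
        eexists. apply (cder_mult (fun u => u - p)%C); eauto.
        apply (cder_minus (fun u => u) (fun _ => p)); [apply cder_id|apply cder_const]. }
    assert (dF : cder F p (h p)).
    { destruct (Hh p) as [l Hl]. { replace (p - p)%C with (RtoC 0) by ring. rewrite Cmod_0. lra. }
      assert (Hpne : p <> c). { intros ->. apply Ha0. unfold a. replace (c - c)%C with (RtoC 0) by ring. apply Cmod_0. }
      assert (Hpne' : (p - c)%C <> 0). { intros Q. apply Hpne. replace p with (p - c + c)%C by ring. rewrite Q. ring. }
      destruct (HF p l) as [m Hm]; auto.
      assert (Q := cder_mult (fun u => u - p)%C _ p _ _ (cder_minus (fun u => u) (fun _ => p) p 1 0 (cder_id p) (cder_const p p)) Hm).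
      cbv beta in Q. replace ((p - c) * / (p - c))%C with (RtoC 1) in Q by (field; auto).
      assert (E1 : (RtoC 1 ^ n)%C = 1). { clear. induction n; simpl; [reflexivity|]. rewrite IHn. ring. }
      rewrite E1 in Q. replace ((1 - 0) * (h p * 1) + (p - p) * m)%C with (h p) in Q by ring. exact Q. }
    replace (M * q ^ n) with ((R * (M * q ^ n)) / R) by (field; lra).
    apply (cauchy_bound_circle F p R (h p)); auto. intros v Hv. unfold F.
    set (u := (p + circ R v)%C). replace (u - p)%C with (circ R v) by (unfold u; ring).
    assert (Q := Cmod_tri3 u c p). replace (u - p)%C with (circ R v) in Q by (unfold u; ring). rewrite Cmod_circ, (Cmod_minus_sym c p) in Q by auto. fold a in Q.
    rewrite !Cmod_mult, Cmod_circ, Cmod_pow, Cmod_mult, Cmod_inv by (auto; apply Cmod_gt_0; lra). fold a.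
    apply Rmult_le_compat_l; [lra|]. apply Rmult_le_compat; auto using Cmod_ge_0.
    - apply pow_le. apply Rmult_le_pos; auto. apply Rlt_le, Rinv_0_lt_compat. lra.
    - apply HM; auto.
    - apply pow_incr. split.
      + apply Rmult_le_pos; auto. apply Rlt_le, Rinv_0_lt_compat. lra.
      + unfold q, Rdiv. apply Rmult_le_compat_l; auto. apply Rinv_le_contravar; lra. }
  apply Cmod_eq_0. apply Rle_antisym; [|apply Cmod_ge_0]. apply Rnot_lt_le. intros Hp.
  destruct (pow_lt_1_zero q) with (y := Cmod (h p) / (M + 1)) as [N HN].
  - rewrite Rabs_pos_eq; lra.
  - apply Rdiv_lt_0_compat; lra.
  - specialize (HN N (le_n N)). specialize (Bn N). rewrite Rabs_pos_eq in HN by (apply pow_le; lra).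
    apply (Rmult_lt_compat_l (M + 1)) in HN; [|lra]. replace ((M + 1) * (Cmod (h p) / (M + 1))) with (Cmod (h p)) in HN by (field; lra).
    assert (0 <= q ^ N) by (apply pow_le; lra). nra.
Qed.

Lemma zero_along_ray h y w R S : 0 < R -> Cmod w = 1 -> 0 <= S ->
  (forall s u, 0 <= s -> Cmod (u - (y + RtoC s * w))%C < R -> exists l, cder h u l) ->
  (forall s u, S <= s -> Cmod (u - (y + RtoC s * w))%C < R -> h u = 0) -> h y = 0.
Proof.
  intros HR Hw HS Hh Hz. set (r := R / 8).
  assert (St : forall n s u, 0 <= s -> S - INR n * r <= s -> Cmod (u - (y + RtoC s * w))%C < r -> h u = 0).
  { induction n; intros s u Hs HsS Hu.
    - simpl in HsS. apply (Hz s); auto; unfold r in Hu; lra.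
    - rewrite S_INR in HsS. assert (0 < r) by (unfold r; lra).
      apply (zero_spreads h u (y + RtoC (s + r) * w)%C (R / 2) r); auto.
      + intros x Hx. apply (Hh s); auto. assert (Q := Cmod_tri3 x u (y + RtoC s * w)%C). unfold r in *. lra.
      + intros x Hx. apply (IHn (s + r)); auto; lra.
      + assert (Q := Cmod_tri3 u (y + RtoC s * w)%C (y + RtoC (s + r) * w)%C).
        replace (y + RtoC s * w - (y + RtoC (s + r) * w))%C with (- (RtoC r * w))%C in Q by (rewrite RtoC_plus; ring).
        rewrite Cmod_opp, Cmod_mult, Hw, Cmod_RtoC_pos in Q by lra. unfold r in *. lra. }
  destruct (INR_unbounded (S / r)) as [n Hn].
  apply (St n 0); try lra.
  - assert (0 < r) by (unfold r; lra). apply (Rmult_lt_compat_r r) in Hn; auto. replace (S / r * r) with S in Hn by (field; lra). lra.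
  - replace (y - (y + 0 * w))%C with (RtoC 0) by ring. rewrite Cmod_0. unfold r. lra.
Qed.

(** * Geometry of the sector *)

(* [vp ph y = |y| cos (|arg y| - ph)]: its positivity describes the sector, and it grows linearly along the rays of the kernel. *)
Definition vp (ph : R) (y : C) : R := cos ph * Re y + sin ph * Rabs (Im y).

Lemma vp_lip ph y z : Rabs (vp ph y - vp ph z) <= Cmod (y - z)%C.
Proof.
  unfold vp. destruct y as [y1 y2], z as [z1 z2]. unfold Cmod. simpl Re. simpl Im. simpl fst. simpl snd.
  replace (y1 + - z1) with (y1 - z1) by ring. replace (y2 + - z2) with (y2 - z2) by ring.
  set (a := y1 - z1). set (b := Rabs y2 - Rabs z2).
  replace (cos ph * y1 + sin ph * Rabs y2 - (cos ph * z1 + sin ph * Rabs z2)) with (cos ph * a + sin ph * b) by (unfold a, b; ring).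
  assert (Hb : b * b <= (y2 - z2) * (y2 - z2)).
  { assert (Q := Rabs_triang_inv2 y2 z2). fold b in Q. apply Rsqr_le_abs_1 in Q. exact Q. }
  rewrite <- sqrt_Rsqr_abs. apply sqrt_le_1_alt. unfold Rsqr.
  assert (T := sin2_cos2 ph). unfold Rsqr in T.
  assert (S := Rle_0_sqr (sin ph * a - cos ph * b)). unfold Rsqr in S.
  assert (E : (cos ph * a + sin ph * b) * (cos ph * a + sin ph * b) = (sin ph * sin ph + cos ph * cos ph) * (a * a + b * b) - (sin ph * a - cos ph * b) * (sin ph * a - cos ph * b)) by ring.
  rewrite E, T. simpl. lra.
Qed.

Lemma vp_le_mod ph y : vp ph y <= Cmod y.
Proof.
  assert (Q := vp_lip ph y 0). unfold vp in Q at 2. simpl in Q. rewrite Rabs_R0, !Rmult_0_r, Rplus_0_r, Rminus_0_r in Q.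
  replace (y - 0)%C with y in Q by ring. assert (V := Rle_abs (vp ph y)). lra.
Qed.

Lemma vp_add ph y w s : 0 <= sin ph -> 0 <= s -> vp ph y + s * (cos ph * Re w - sin ph * Rabs (Im w)) <= vp ph (y + RtoC s * w)%C.
Proof.
  intros Hs H. unfold vp. destruct y as [y1 y2], w as [w1 w2]. simpl.
  assert (Q : Rabs y2 - s * Rabs w2 <= Rabs (y2 + (s * w2 + 0 * w1))).
  { replace (y2 + (s * w2 + 0 * w1)) with (y2 - - (s * w2)) by ring.
    assert (Q := Rabs_triang_inv y2 (- (s * w2))). rewrite Rabs_Ropp, Rabs_mult, (Rabs_pos_eq s) in Q by auto. exact Q. }
  apply (Rmult_le_compat_l (sin ph)) in Q; auto. nra.
Qed.

Lemma vp_cone ph psi y i s : 0 <= ph -> 0 <= psi -> ph + psi <= PI / 2 -> (i < 3)%nat -> 0 <= s ->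
  vp ph y + cos (ph + psi) * s <= vp ph (y + RtoC s * edir psi i)%C.
Proof.
  intros H1 H2 H3 Hi Hs. assert (HPI := PI_RGT_0).
  assert (S1 : 0 <= sin ph) by (apply sin_ge_0; lra). assert (S2 : 0 <= sin psi) by (apply sin_ge_0; lra).
  assert (Q := vp_add ph y (edir psi i) s S1 Hs). eapply Rle_trans; [|exact Q]. apply Rplus_le_compat_l.
  rewrite Rmult_comm. apply Rmult_le_compat_l; auto. rewrite cos_plus.
  destruct i as [|[|[|i]]]; [| | |lia]; unfold edir, cis; simpl.
  - rewrite Rabs_pos_eq by auto. lra.
  - rewrite Rabs_R0. assert (C0 : 0 <= cos ph) by (apply cos_ge_0; lra). assert (C1 := COS_bound psi). nra.
  - rewrite cos_neg, sin_neg, Rabs_Ropp, Rabs_pos_eq by auto. lra.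
Qed.

Lemma polar (y : C) : 0 < Cmod y -> exists a, - PI <= a <= PI /\ y = (Cmod y * cos a, Cmod y * sin a).
Proof.
  intros Hy. destruct y as [y1 y2]. set (r := Cmod (y1, y2)) in *.
  assert (Hr : r * r = y1 * y1 + y2 * y2). { unfold r, Cmod. simpl. rewrite sqrt_sqrt; [ring|]. nra. }
  assert (Hb : -1 <= y1 / r <= 1).
  { assert (Q : Rabs y1 <= Rabs r) by (apply Rsqr_le_abs_0; unfold Rsqr; nra). rewrite (Rabs_pos_eq r) in Q by lra.
    apply Rabs_le_between in Q. split; [apply Rle_div_r; auto|apply Rle_div_l; auto]; lra. }
  assert (Hc := cos_acos _ Hb). assert (Hab := acos_bound (y1 / r)).
  assert (Hsn : sin (acos (y1 / r)) = Rabs y2 / r).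
  { apply Rsqr_inj; [apply sin_ge_0; lra|apply le_div_intro; auto; rewrite Rmult_0_l; apply Rabs_pos|].
    rewrite sin2, Hc. unfold Rsqr. replace (Rabs y2 / r * (Rabs y2 / r)) with (Rabs y2 * Rabs y2 / (r * r)) by (field; lra).
    rewrite <- (Rabs_mult y2 y2), (Rabs_pos_eq (y2 * y2)) by nra. replace (y2 * y2) with (r * r - y1 * y1) by lra. field. lra. }
  destruct (Rle_dec 0 y2) as [H|H].
  - exists (acos (y1 / r)). split; [lra|]. rewrite Hc, Hsn, Rabs_pos_eq by auto. f_equal; field; lra.
  - exists (- acos (y1 / r)). split; [lra|]. rewrite cos_neg, sin_neg, Hc, Hsn, Rabs_left by lra. f_equal; field; lra.
Qed.

Lemma Cmod_polar r a : 0 <= r -> Cmod (r * cos a, r * sin a) = r.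
Proof.
  intros Hr. unfold Cmod. simpl. replace (r * cos a * (r * cos a * 1) + r * sin a * (r * sin a * 1)) with (r * r * (Rsqr (sin a) + Rsqr (cos a))) by (unfold Rsqr; ring).
  rewrite sin2_cos2, Rmult_1_r. now apply sqrt_square.
Qed.

Lemma vp_polar ph r a : 0 <= r -> - PI <= a <= PI -> vp ph (r * cos a, r * sin a) = r * cos (Rabs a - ph).
Proof.
  intros Hr Ha. unfold vp. simpl. rewrite Rabs_mult, (Rabs_pos_eq r) by auto. rewrite cos_minus.
  unfold Rabs at 2 3. destruct (Rcase_abs a).
  - rewrite cos_neg, sin_neg. assert (sin (- a) >= 0) by (apply Rle_ge, sin_ge_0; lra). rewrite sin_neg in H.
    rewrite Rabs_left1 by lra. ring.
  - rewrite Rabs_pos_eq; [ring|]. apply sin_ge_0; lra.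
Qed.

Lemma sector_of_vp ph y : 0 <= ph < PI / 2 -> 0 < vp ph y -> in_sector (PI / 2 + ph) y.
Proof.
  intros Hph H. assert (HPI := PI_RGT_0). assert (Hm := vp_le_mod ph y). destruct (polar y) as [a [Ha Hy]]; [lra|].
  exists (Cmod y), a. split; [lra|split; [|exact Hy]]. set (r := Cmod y) in *. assert (Hr : 0 < r) by lra. rewrite Hy, vp_polar in H by lra.
  assert (Hab : Rabs a <= PI) by (apply Rabs_le; lra). assert (Hap := Rabs_pos a).
  apply Rabs_lt_between. apply Rnot_le_lt. intros Hle.
  assert (cos (Rabs a - ph) <= 0).
  { replace (Rabs a - ph) with ((Rabs a - ph - PI / 2) + PI / 2) by ring. rewrite cos_plus, cos_PI2, sin_PI2.
    assert (0 <= sin (Rabs a - ph - PI / 2)) by (apply sin_ge_0; lra). lra. }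
  nra.
Qed.

Lemma vp_sector phi ph y : 0 <= phi <= ph -> ph <= PI / 6 -> in_sector (PI / 2 + phi) y -> sin (ph - phi) * Cmod y <= vp ph y /\ 0 < vp phi y.
Proof.
  intros H1 H2 [r [a [Hr [Ha Hy]]]]. assert (HPI := PI_RGT_0). subst y. rewrite Cmod_polar by lra.
  rewrite !vp_polar by lra. assert (Hap := Rabs_pos a). assert (Hab : Rabs a < PI / 2 + phi) by (apply Rabs_lt_between; lra). split.
  - rewrite Rmult_comm. apply Rmult_le_compat_l; [lra|]. rewrite <- cos_shift.
    assert (W : forall x, 0 <= x <= PI / 2 - (ph - phi) -> cos (PI / 2 - (ph - phi)) <= cos x) by (intros x Hx; apply cos_decr_1; lra).
    destruct (Rle_dec 0 (Rabs a - ph)); [apply W; lra|]. rewrite <- (cos_neg (Rabs a - ph)). apply W. lra.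
  - apply Rmult_lt_0_compat; auto. apply cos_gt_0; lra.
Qed.

Lemma in_sector_mono th th' y : th <= th' -> in_sector th y -> in_sector th' y.
Proof. intros H [r [a [Hr [Ha Hy]]]]. exists r, a. repeat split; auto; lra. Qed.

Lemma vp_Dom0 ph rho0 T y t : 0 <= ph <= PI / 6 -> 0 <= rho0 -> rho0 < vp ph y -> 0 <= t <= T -> Dom0 rho0 T y t.
Proof.
  intros Hph Hr Hv Ht. assert (HPI := PI_RGT_0). assert (Q := vp_le_mod ph y). repeat split; try lra.
  apply (in_sector_mono (PI / 2 + ph)); [lra|]. apply sector_of_vp; lra.
Qed.

(* The ray points in the direction of half the argument of [y]. *)
Lemma escape_ray phi rho y : 0 < phi < PI / 6 -> 0 <= rho -> in_sector (PI / 2 + phi) y -> rho < Cmod y ->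
  exists w R c, Cmod w = 1 /\ 0 < R /\ 0 < c /\
   (forall s u, 0 <= s -> Cmod (u - (y + RtoC s * w))%C < R -> in_sector (PI / 2 + phi) u /\ rho < Cmod u) /\
   (forall s u, 0 <= s -> Cmod (u - (y + RtoC s * w))%C < R -> vp 0 y + c * s - R <= vp 0 u).
Proof.
  intros Hphi Hrho Hsec Hmod. assert (HPI := PI_RGT_0).
  assert (Hv := proj2 (vp_sector phi phi y ltac:(lra) ltac:(lra) Hsec)).
  destruct Hsec as [r [a [Hr [Ha Hy]]]].
  assert (Hm : Cmod y = r) by (rewrite Hy; apply Cmod_polar; lra).
  set (w := cis (a / 2)).
  assert (Ca : 0 < cos (a / 2)) by (apply cos_gt_0; lra).
  assert (Hab : Rabs (a / 2) < PI / 4 + phi / 2) by (apply Rabs_lt_between; lra).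
  assert (Hap := Rabs_pos (a / 2)).
  assert (Cabs : cos (Rabs (a / 2)) = cos (a / 2)).
  { unfold Rabs. destruct (Rcase_abs _); [apply cos_neg|reflexivity]. }
  assert (Sabs : Rabs (sin (a / 2)) = sin (Rabs (a / 2))).
  { unfold Rabs at 2. destruct (Rcase_abs (a / 2)).
    - rewrite sin_neg. apply Rabs_left1. assert (0 <= sin (- (a / 2))) by (apply sin_ge_0; lra). rewrite sin_neg in H. lra.
    - apply Rabs_pos_eq, sin_ge_0; lra. }
  assert (G : forall ph u s, 0 <= ph <= phi -> 0 <= s -> vp ph u + s * cos (ph + Rabs (a / 2)) <= vp ph (u + RtoC s * w)%C).
  { intros ph u s Hph Hs. assert (Q := vp_add ph u w s ltac:(apply sin_ge_0; lra) Hs). unfold w, cis in Q. simpl Re in Q. simpl Im in Q.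
    rewrite cos_plus, Cabs, <- Sabs. exact Q. }
  set (R := Rmin (vp phi y) (Rmin (r - rho) (r * cos (a / 2)))).
  assert (HR : 0 < R) by (unfold R; repeat apply Rmin_glb_lt; [lra|lra|apply Rmult_lt_0_compat; auto]).
  assert (R1 : R <= vp phi y) by apply Rmin_l.
  assert (R2 : R <= r - rho) by (unfold R; eapply Rle_trans; [apply Rmin_r|apply Rmin_l]).
  assert (R3 : R <= r * cos (a / 2)) by (unfold R; eapply Rle_trans; [apply Rmin_r|apply Rmin_r]).
  exists w, R, (cos (a / 2)). split; [|split; [auto|split; [auto|split]]].
  - unfold w, cis. assert (Q := Cmod_polar 1 (a / 2) ltac:(lra)). rewrite !Rmult_1_l in Q. exact Q.
  - intros s u Hs Hu. set (x := (u - RtoC s * w)%C).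
    assert (Ex : u = (x + RtoC s * w)%C) by (unfold x; ring).
    assert (Hx : Cmod (x - y)%C < R). { replace (x - y)%C with (u - (y + RtoC s * w))%C by (unfold x; ring). exact Hu. }
    assert (Hvx := vp_lip phi x y). apply Rabs_le_between in Hvx.
    assert (Hg := G phi x s ltac:(lra) Hs). rewrite <- Ex in Hg.
    assert (Hcp : 0 <= cos (phi + Rabs (a / 2))) by (apply cos_ge_0; lra).
    assert (0 <= s * cos (phi + Rabs (a / 2))) by (apply Rmult_le_pos; auto).
    split; [apply sector_of_vp; lra|].
    assert (Hxm : rho < Cmod x). { assert (Q := Cmod_triangle_minus x (x - y)%C). replace (x - (x - y))%C with y in Q by ring. lra. }
    apply Rlt_le_trans with (Cmod x); auto. rewrite Ex.
    assert (Hin : 0 <= Re x * cos (a / 2) + Im x * sin (a / 2)).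
    { assert (Q := vp_lip 0 ((x - y) * cis (- (a / 2)))%C 0). unfold vp in Q. rewrite cos_0, sin_0 in Q.
      replace ((x - y) * cis (- (a / 2)) - 0)%C with ((x - y) * cis (- (a / 2)))%C in Q by ring.
      assert (M1 : Cmod (cis (- (a / 2))) = 1). { assert (Z := Cmod_polar 1 (- (a / 2)) ltac:(lra)). rewrite !Rmult_1_l in Z. exact Z. }
      rewrite Cmod_mult, M1, Rmult_1_r in Q. simpl Re in Q at 2. simpl Im in Q at 2.
      replace (1 * 0 + 0 * Rabs 0) with 0 in Q by ring.
      assert (E1 : Re ((x - y) * cis (- (a / 2)))%C = (Re x * cos (a / 2) + Im x * sin (a / 2)) - r * cos (a / 2)).
      { rewrite Hy. unfold cis. destruct x as [x1 x2]. simpl. rewrite cos_neg, sin_neg.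
        assert (Ec : cos (a / 2) = cos a * cos (a / 2) + sin a * sin (a / 2)) by (rewrite <- cos_minus; f_equal; field).
        transitivity ((x1 * cos (a / 2) + x2 * sin (a / 2)) - r * (cos a * cos (a / 2) + sin a * sin (a / 2))); [ring|now rewrite <- Ec]. }
      rewrite E1 in Q. apply Rabs_le_between in Q. lra. }
    assert (Hsq := sin2_cos2 (a / 2)). unfold Rsqr in Hsq.
    unfold Cmod. apply sqrt_le_1_alt. destruct x as [x1 x2]. unfold w, cis. simpl in *.
    replace ((x1 + (s * cos (a / 2) - 0 * sin (a / 2))) * ((x1 + (s * cos (a / 2) - 0 * sin (a / 2))) * 1) + (x2 + (s * sin (a / 2) + 0 * cos (a / 2))) * ((x2 + (s * sin (a / 2) + 0 * cos (a / 2))) * 1))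
     with (x1 * x1 + x2 * x2 + 2 * s * (x1 * cos (a / 2) + x2 * sin (a / 2)) + s * s * (sin (a / 2) * sin (a / 2) + cos (a / 2) * cos (a / 2))) by ring.
    rewrite Hsq. assert (0 <= s * (x1 * cos (a / 2) + x2 * sin (a / 2))) by (apply Rmult_le_pos; auto). nra.
  - intros s u Hs Hu. assert (Hg := G 0 y s ltac:(lra) Hs). rewrite Rplus_0_l, Cabs in Hg.
    assert (Q := vp_lip 0 u (y + RtoC s * w)%C). apply Rabs_le_between in Q. lra.
Qed.

(** * Existence and uniqueness *)

Definition evt (P : R -> Prop) := exists X, forall x, X <= x -> P x.
Lemma evt_and P Q : evt P -> evt Q -> evt (fun x => P x /\ Q x).
Proof.
  intros [X HX] [Y HY]. exists (Rmax X Y). intros x Hx. assert (L1 := Rmax_l X Y). assert (L2 := Rmax_r X Y). split; [apply HX|apply HY]; lra.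
Qed.
Lemma evt_ge c : evt (fun x => c <= x).
Proof. exists c. auto. Qed.
Lemma evt_Rpower a N : 0 < a -> evt (fun x => N <= Rpower x a).
Proof.
  intros Ha. set (N' := Rmax N 1). assert (HN : 0 < N') by (assert (Q := Rmax_r N 1); unfold N'; lra).
  exists (Rpower N' (/ a)). intros x Hx. apply Rle_trans with N'; [apply Rmax_l|].
  rewrite <- (Rpower_1 N') by auto. replace 1 with (/ a * a) at 1 by (field; lra). rewrite <- Rpower_mult.
  apply Rle_Rpower_l; [lra|]. split; [apply exp_pos|auto].
Qed.
Lemma evt_ex P : evt P -> exists x, P x.
Proof. intros [X H]. exists X. apply H. lra. Qed.

Lemma D_bounds3 d : (forall y z, Rabs (d y - d z) <= Cmod (y - z)%C) -> forall g z M, nice d g -> 3 < d z ->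
  (forall u, d z - 3 <= d u -> Cmod (g u) <= M) -> Cmod (D g z) <= M /\ Cmod (D (D g) z) <= M /\ Cmod (D (D (D g)) z) <= M.
Proof.
  intros d_lip g z M Hg Hz HM.
  assert (B : forall g z N, nice d g -> 1 < d z -> (forall u, d z - 1 <= d u -> Cmod (g u) <= N) -> Cmod (D g z) <= N).
  { intros g' z' N H1 H2 H3. rewrite <- (Rdiv_1_r N). apply (D_bound_d d d_lip); auto. lra. }
  assert (N1 := nice_D d d_lip g Hg). assert (N2 := nice_D d d_lip _ N1).
  repeat split; repeat (apply B; [assumption|lra|intros]); apply HM; lra.
Qed.

Definition tclamp (T : R) (h : C -> R -> C) : C -> R -> C := fun z t => h z (clamp 0 T t).

Lemma within_ccont T (g : R -> C) : 0 <= T ->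
  (forall t, 0 <= t <= T -> filterlim g (within (fun s => 0 <= s <= T) (locally t)) (locally (T := C_UniformSpace) (g t))) ->
  forall t, ccont (fun s => g (clamp 0 T s)) t.
Proof.
  intros HT H t e He. assert (Hc := clamp_in 0 T t HT). specialize (H _ Hc).
  rewrite (filterlim_C_iff (within _ (locally (clamp 0 T t)))) in H. specialize (H e He). apply locally_R_iff in H.
  destruct H as [del [Hd HH]]. exists del. split; auto. intros s Hs. apply HH; [|now apply clamp_in].
  eapply Rle_lt_trans; [apply clamp_lip|auto].
Qed.

Section Data.
Variables (rho0 T beta : R) (alpha : nat -> R) (b : nat -> nat -> C -> R -> C) (Ab : R).
Hypothesis (Hrho0 : 0 < rho0) (HT : 0 < T).
Variable ph : R.
Hypothesis Hph : 0 <= ph <= PI / 6.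

Lemma tclamp_cder h z t : (forall t, 0 <= t <= T -> analytic_on (fun y => Dom0 rho0 T y t) (fun y => h y t)) ->
  rho0 < vp ph z -> exists l, cder (slice (tclamp T h) t) z l.
Proof using Hrho0 HT Hph.
  intros H Hz. assert (Hc := clamp_in 0 T t (Rlt_le _ _ HT)). destruct (H _ Hc z) as [l Hl].
  - apply (vp_Dom0 ph); lra.
  - exists l. now apply Cderiv_cder.
Qed.

Lemma tclamp_ccont h z t : (forall y t, Dom0 rho0 T y t -> filterlim (fun s => h y s) (within (fun s => 0 <= s <= T) (locally t)) (locally (h y t))) ->
  rho0 < vp ph z -> ccont (tclamp T h z) t.
Proof using Hrho0 HT Hph.
  intros H Hz. apply (within_ccont T (h z)); [lra|]. intros u Hu. apply H. apply (vp_Dom0 ph); lra.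
Qed.

Hypothesis b_bd : forall j k y t, (j < 4)%nat -> Dom0 rho0 T y t ->
  Rpower (Cmod y) (alpha j + INR k * beta) * Cmod (b j k y t) < Ab.
Hypothesis Halpha : forall j, (j < 4)%nat -> 0 < alpha j.
Hypothesis Hbeta : 0 < beta.

Lemma coef_bound x0 eps j k z t : 0 < eps -> rho0 <= x0 -> 4 <= Rpower x0 beta -> Ab <= Rpower x0 (alpha j) * eps ->
  (j < 4)%nat -> 0 < vp ph z - x0 -> Cmod (tclamp T (b j k) z t) <= eps * (/4)^k.
Proof using All.
  intros He Hx Hb Ha Hj Hz. assert (Hc := clamp_in 0 T t (Rlt_le _ _ HT)). assert (Hm := vp_le_mod ph z).
  assert (Q := b_bd j k z (clamp 0 T t) Hj ltac:(apply (vp_Dom0 ph); lra)). unfold tclamp. set (X := Cmod (b j k z (clamp 0 T t))) in *.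
  assert (HX : 0 <= X) by apply Cmod_ge_0.
  rewrite Rpower_plus, (Rmult_comm (INR k)), <- Rpower_mult, Rpower_pow in Q by apply exp_pos.
  set (P := Rpower (Cmod z) (alpha j)) in *. set (B := Rpower (Cmod z) beta) in *.
  assert (HP : Rpower x0 (alpha j) <= P) by (apply Rle_Rpower_l; [apply Rlt_le, Halpha; auto|lra]).
  assert (HB : 4 <= B) by (eapply Rle_trans; [exact Hb|]; apply Rle_Rpower_l; lra).
  assert (HPp : 0 < P) by apply exp_pos.
  assert (H4 : 4 ^ k <= B ^ k) by (apply pow_incr; lra). assert (H4p : 0 < 4 ^ k) by (apply pow_lt; lra).
  assert (Q2 : P * (B ^ k * X) <= P * eps).
  { apply Rle_trans with (Rpower x0 (alpha j) * eps); [lra|]. apply Rmult_le_compat_r; lra. }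
  apply Rmult_le_reg_l in Q2; auto. rewrite pow_inv. apply le_div_intro; auto.
  apply Rle_trans with (B ^ k * X); auto. rewrite Rmult_comm. apply Rmult_le_compat_r; auto.
Qed.
End Data.

Definition Wt (ph a : R) (z : C) : R := / Rpower (vp ph z) a.

Section Weight.
Variables (ph psi a x0 : R).
Hypothesis (Hph : 0 <= ph) (Hpsi : 0 <= psi) (Hsum : ph + psi <= PI / 2) (Ha : 0 <= a) (Hx0 : 1 <= x0).

Lemma Wt_pos z : 0 < Wt ph a z.
Proof using. apply Rinv_0_lt_compat, exp_pos. Qed.
Lemma Wt_mono c z u : 0 < c -> 0 < vp ph z -> vp ph z <= c * vp ph u -> Wt ph a u <= Rpower c a * Wt ph a z.
Proof using Ha.
  intros Hc Hz H. unfold Wt. assert (Hu : 0 < vp ph u) by nra.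
  assert (P1 : 0 < Rpower (vp ph z) a) by apply exp_pos. assert (P2 : 0 < Rpower (vp ph u) a) by apply exp_pos.
  assert (Q : Rpower (vp ph z) a <= Rpower c a * Rpower (vp ph u) a).
  { rewrite Rpower_mult_distr by auto. apply Rle_Rpower_l; auto. }
  apply Rmult_le_reg_r with (Rpower (vp ph u) a); auto. rewrite Rinv_l by lra.
  apply Rmult_le_reg_r with (Rpower (vp ph z) a); auto.
  replace (Rpower c a * / Rpower (vp ph z) a * Rpower (vp ph u) a * Rpower (vp ph z) a) with (Rpower c a * Rpower (vp ph u) a) by (field; lra). lra.
Qed.
Lemma Wt_cone y i s : (i < 3)%nat -> 0 <= s -> 0 < vp ph y - x0 -> Wt ph a (y + RtoC s * edir psi i)%C <= Wt ph a y.
Proof using All.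
  intros Hi Hs Hy. assert (Q := vp_cone ph psi y i s Hph Hpsi Hsum Hi Hs).
  assert (0 <= cos (ph + psi)) by (apply cos_ge_0; assert (HPI := PI_RGT_0); lra).
  assert (E : Rpower 1 a = 1) by (unfold Rpower; rewrite ln_1, Rmult_0_r; apply exp_0).
  rewrite <- (Rmult_1_l (Wt ph a y)), <- E. apply Wt_mono; try lra. nra.
Qed.
Lemma Wt_loc z u : 0 < vp ph z - x0 -> Cmod (u - z)%C <= (vp ph z - x0) / 2 -> Cmod (u - z)%C <= / 2 -> Wt ph a u <= Rpower 2 a * Wt ph a z.
Proof using All.
  intros Hz _ Hu. assert (Q := vp_lip ph u z). apply Rabs_le_between in Q. apply Wt_mono; lra.
Qed.
End Weight.

Lemma Bf_series b T j f z t eps d : 0 <= eps -> (forall j k z t, (j < 4)%nat -> 0 < d z -> Cmod (tclamp T (b j k) z t) <= eps * (/4)^k) ->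
  (j < 4)%nat -> unit_bd d f -> 0 < d z -> 0 <= t <= T ->
  Cseries (fun k => Cmult (b j k z t) (pow_n (K := C_Ring) (f z t) k)) (Bf (fun j k => tclamp T (b j k)) j f z t).
Proof.
  intros He Hb Hj Hf Hz Ht. apply Cseries_iff.
  assert (G := geo_cv _ _ (Bterm_geo d (fun j k => tclamp T (b j k)) eps He Hb j f z t Hj Hf Hz)).
  apply (Ccv_ext (psum (Bterm (fun j k => tclamp T (b j k)) j f z t))); [|exact G].
  intros n. unfold psum. apply sum_n_ext. intros k. unfold Bterm, tclamp. rewrite clamp_id by auto. reflexivity.
Qed.

Lemma small_eps CL : exists eps, 0 < eps /\ 16 * eps * CL <= / 2.
Proof.
  assert (Q := Rabs_pos CL). assert (Q2 := Rle_abs CL). exists (/ (32 * (Rabs CL + 1))). split; [apply Rinv_0_lt_compat; lra|].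
  apply Rle_trans with (16 * / (32 * (Rabs CL + 1)) * (Rabs CL + 1)).
  - apply Rmult_le_compat_l; [|lra]. apply Rmult_le_pos; [lra|]. apply Rlt_le, Rinv_0_lt_compat; lra.
  - right. field. lra.
Qed.

Lemma vpx_lip ph x y z : Rabs ((vp ph y - x) - (vp ph z - x)) <= Cmod (y - z)%C.
Proof. replace (vp ph y - x - (vp ph z - x)) with (vp ph y - vp ph z) by ring. apply vp_lip. Qed.

Lemma decay_Wt ph a A X u : 0 <= a -> 0 < vp ph u -> 0 <= X -> Rpower (Cmod u) a * X < A -> X <= Rabs A * Wt ph a u.
Proof.
  intros Ha Hu HX H. assert (Hm := vp_le_mod ph u). unfold Wt. assert (P := exp_pos (a * ln (vp ph u))). fold (Rpower (vp ph u) a) in P.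
  assert (Q : Rpower (vp ph u) a <= Rpower (Cmod u) a) by (apply Rle_Rpower_l; lra). assert (V := Rle_abs A).
  apply le_div_intro; auto. apply Rle_trans with (Rpower (Cmod u) a * X); [|lra]. rewrite Rmult_comm. apply Rmult_le_compat_r; auto.
Qed.

Lemma Wt_le ph a x z : 0 <= a -> 0 < x -> x <= vp ph z -> Wt ph a z <= / Rpower x a.
Proof. intros Ha Hx Hz. apply Rinv_le_contravar; [apply exp_pos|]. apply Rle_Rpower_l; lra. Qed.

Section Main.
Variables (rho0 T alpha_r beta : R) (alpha : nat -> R)
  (r : C -> R -> C) (b : nat -> nat -> C -> R -> C) (fI : C -> C) (Ar Ab AfI : R).
Hypotheses (Hrho0 : 0 < rho0) (HT : 0 < T) (Har : 1 <= alpha_r) (Hbeta : 0 < beta)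
  (Halpha : forall j, (j < 4)%nat -> 0 < alpha j)
  (Hr_an : forall t, 0 <= t <= T -> analytic_on (fun y => Dom0 rho0 T y t) (fun y => r y t))
  (Hr_bd : forall y t, Dom0 rho0 T y t -> Rpower (Cmod y) alpha_r * Cmod (r y t) < Ar)
  (Hb_an : forall j k t, (j < 4)%nat -> 0 <= t <= T -> analytic_on (fun y => Dom0 rho0 T y t) (fun y => b j k y t))
  (Hb_bd : forall j k y t, (j < 4)%nat -> Dom0 rho0 T y t -> Rpower (Cmod y) (alpha j + INR k * beta) * Cmod (b j k y t) < Ab)
  (Hr_ct : forall y t, Dom0 rho0 T y t ->
     filterlim (fun s => r y s) (within (fun s => 0 <= s <= T) (locally t)) (locally (r y t)))
  (Hb_ct : forall j k y t, (j < 4)%nat -> Dom0 rho0 T y t ->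
     filterlim (fun s => b j k y s) (within (fun s => 0 <= s <= T) (locally t)) (locally (b j k y t)))
  (HfI_an : analytic_on (fun y => in_sector (2 * PI / 3) y /\ rho0 < Cmod y) fI)
  (HfI_bd : forall y, in_sector (2 * PI / 3) y -> rho0 < Cmod y -> Rpower (Cmod y) alpha_r * Cmod (fI y) < AfI).

Let bb := fun j k => tclamp T (b j k).

Section Angle.
Variables (ph x0 eps : R).
Hypotheses (Hph : 0 <= ph <= PI / 6) (Hx0 : rho0 <= x0) (Heps : 0 < eps) (Hxb : 4 <= Rpower x0 beta)
  (Hxa : forall j, (j < 4)%nat -> Ab <= Rpower x0 (alpha j) * eps).

Lemma bb_an j k z t : (j < 4)%nat -> 0 < vp ph z - x0 -> exists l, cder (slice (bb j k) t) z l.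
Proof using Hrho0 HT Hph Hx0 Hb_an. intros Hj Hz. apply (tclamp_cder rho0 T Hrho0 HT ph Hph); [|lra]. intros; apply Hb_an; auto. Qed.
Lemma bb_bd j k z t : (j < 4)%nat -> 0 < vp ph z - x0 -> Cmod (bb j k z t) <= eps * (/4)^k.
Proof using Hrho0 HT Hph Hx0 Heps Hxb Hxa Hb_bd Halpha Hbeta.
  intros Hj Hz. apply (coef_bound rho0 T beta alpha b Ab Hrho0 HT ph Hph Hb_bd Halpha Hbeta x0); auto.
Qed.
Lemma bb_ct j k z t : (j < 4)%nat -> 0 < vp ph z - x0 -> ccont (bb j k z) t.
Proof using Hrho0 HT Hph Hx0 Hb_ct. intros Hj Hz. apply (tclamp_ccont rho0 T Hrho0 HT ph Hph); [|lra]. intros; apply Hb_ct; auto. Qed.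
End Angle.

Lemma evt_coef eps : 0 < eps -> evt (fun x => 4 <= Rpower x beta /\ forall j, (j < 4)%nat -> Ab <= Rpower x (alpha j) * eps).
Proof using Hbeta Halpha.
  intros He. apply evt_and; [now apply evt_Rpower|].
  assert (A : forall j, (j < 4)%nat -> evt (fun x => Ab <= Rpower x (alpha j) * eps)).
  { intros j Hj. destruct (evt_Rpower (alpha j) (Ab / eps) (Halpha j Hj)) as [X HX]. exists X. intros x Hx. specialize (HX x Hx).
    apply (Rmult_le_compat_r eps) in HX; [|lra]. replace (Ab / eps * eps) with Ab in HX by (field; lra). exact HX. }
  destruct (evt_and _ _ (evt_and _ _ (A 0%nat ltac:(lia)) (A 1%nat ltac:(lia))) (evt_and _ _ (A 2%nat ltac:(lia)) (A 3%nat ltac:(lia)))) as [X HX].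
  exists X. intros x Hx j Hj. destruct (HX x Hx) as [[h0 h1] [h2 h3]]. destruct j as [|[|[|[|j]]]]; auto; lia.
Qed.

Theorem existence phi : 0 < phi < PI / 6 ->
  exists rho_t f, rho0 < rho_t /\ is_solution T r b fI (Dphi phi rho_t T) f /\ bigO_inv alpha_r (Dphi phi rho_t T) f.
Proof using All.
  intros Hphi. assert (HPI := PI_RGT_0). assert (HT0 : 0 <= T) by lra. assert (Ha0 : 0 <= alpha_r) by lra.
  set (ph := (phi + PI / 6) / 2). assert (Hph : phi < ph < PI / 6) by (unfold ph; lra).
  set (psi := (PI / 3 + (PI / 2 - ph)) / 2). assert (Hpsi : PI / 3 < psi < PI / 2 - ph) by (unfold psi; lra).
  destruct (airy_kernels psi ltac:(lra)) as [K [k [kp HK]]].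
  set (c0 := cos (ph + psi)). assert (Hc0 : 0 < c0) by (apply cos_gt_0; lra).
  set (CW := Rpower 2 alpha_r). assert (HCW : 0 < CW) by apply exp_pos.
  set (CL := Cest K c0 T CW). destruct (small_eps CL) as [eps [Heps Hsm]].
  set (CI0 := Rabs AfI * CW). assert (HCI0 : 0 <= CI0) by (apply Rmult_le_pos; [apply Rabs_pos|lra]).
  set (Cr := Rabs Ar). assert (HCr : 0 <= Cr) by apply Rabs_pos.
  set (Rr := 2 * (CI0 + CL * (CI0 + Cr))).
  destruct (evt_ex _ (evt_and _ _ (evt_and _ _ (evt_ge (rho0 + 3)) (evt_ge 6)) (evt_and _ _ (evt_coef eps Heps) (evt_Rpower alpha_r Rr ltac:(lra)))))
    as [x0 [[Hx1 Hx2] [[Hxb Hxa] HxR]]].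
  set (d := fun y => vp ph y - x0).
  assert (d_lip : forall y z, Rabs (d y - d z) <= Cmod (y - z)%C) by (intros; apply vpx_lip).
  assert (d_cone : forall y i s, (i < 3)%nat -> 0 <= s -> d y + c0 * s <= d (y + RtoC s * edir psi i)%C).
  { intros y i s Hi Hs. unfold d. assert (Q := vp_cone ph psi y i s ltac:(lra) ltac:(lra) ltac:(lra) Hi Hs). fold c0 in Q. lra. }
  set (W := Wt ph alpha_r).
  assert (W_pos : forall z, 0 < d z -> 0 <= W z) by (intros; apply Rlt_le, Wt_pos).
  assert (W_le : forall z, 0 < d z -> W z <= / Rpower x0 alpha_r) by (intros z Hz; unfold d in Hz; apply Wt_le; lra).
  assert (DomV : forall z t, rho0 < vp ph z -> 0 <= t <= T -> Dom0 rho0 T z t) by (intros; apply (vp_Dom0 ph); lra).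
  set (fI' := fun (z : C) (t : R) => fI z). set (rr := tclamp T r).
  assert (fI_W : forall u, rho0 < vp ph u -> Cmod (fI u) <= Rabs AfI * W u).
  { intros u Hu. destruct (DomV u 0 Hu ltac:(lra)) as [q1 [q2 _]]. apply decay_Wt; auto using Cmod_ge_0. lra. }
  assert (fI_d : forall u, rho0 < vp ph u -> exists l, cder fI u l).
  { intros u Hu. destruct (DomV u 0 Hu ltac:(lra)) as [q1 [q2 _]]. destruct (HfI_an u (conj q1 q2)) as [l Hl]. exists l. now apply Cderiv_cder. }
  assert (W1 : forall z, 1 <= vp ph z -> W z <= 1).
  { intros z Hz. apply Rle_trans with (/ Rpower 1 alpha_r); [apply Wt_le; lra|]. unfold Rpower. rewrite ln_1, Rmult_0_r, exp_0. lra. }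
  assert (r_bnd : forall z t, 0 < d z -> Cmod (rr z t) <= Cr * W z).
  { intros z t Hz. unfold d in Hz. assert (Hc := clamp_in 0 T t HT0). apply decay_Wt; auto using Cmod_ge_0; [lra|]. apply Hr_bd. apply DomV; lra. }
  assert (r_nice : tnice d rr).
  { repeat split.
    - intros z t Hz. unfold d in Hz. apply (tclamp_cder rho0 T Hrho0 HT ph); auto; lra.
    - intros del Hdel. exists Cr. intros z t Hz. eapply Rle_trans; [apply r_bnd; lra|]. rewrite <- (Rmult_1_r Cr) at 2.
      apply Rmult_le_compat_l; auto. apply W1. unfold d in Hz. lra.
    - intros z t Hz. unfold d in Hz. apply (tclamp_ccont rho0 T Hrho0 HT ph); auto; lra. }
  assert (fI_nice : tnice d fI').
  { repeat split.
    - intros z t Hz. unfold d in Hz. apply fI_d. lra.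
    - intros del Hdel. exists (Rabs AfI). intros z t Hz. unfold d in Hz. eapply Rle_trans; [apply fI_W; lra|]. rewrite <- (Rmult_1_r (Rabs AfI)) at 2.
      apply Rmult_le_compat_l; [apply Rabs_pos|]. apply W1. lra.
    - intros z t Hz. apply ccont_const. }
  assert (fI_bnd : bnd d W CI0 fI').
  { intros z t Hz. unfold d in Hz.
    set (d3 := fun y => vp ph y - (x0 - 3)).
    assert (d3_lip : forall y z, Rabs (d3 y - d3 z) <= Cmod (y - z)%C) by (intros; apply vpx_lip).
    assert (N3 : nice d3 fI).
    { split.
      - intros u Hu. unfold d3 in Hu. apply fI_d. lra.
      - intros del Hdel. exists (Rabs AfI). intros u Hu. unfold d3 in Hu. eapply Rle_trans; [apply fI_W; lra|]. rewrite <- (Rmult_1_r (Rabs AfI)) at 2.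
        apply Rmult_le_compat_l; [apply Rabs_pos|]. apply W1. lra. }
    assert (Bu : forall u, d3 z - 3 <= d3 u -> Cmod (fI u) <= CI0 * W z).
    { intros u Hu. unfold d3 in Hu. eapply Rle_trans; [apply fI_W; lra|]. unfold CI0. rewrite Rmult_assoc. apply Rmult_le_compat_l; [apply Rabs_pos|].
      apply Wt_mono; lra. }
    destruct (D_bounds3 d3 d3_lip fI z (CI0 * W z) N3) as [B1 [B2 B3]]; auto. { unfold d3. lra. }
    assert (B0 : Cmod (fI z) <= CI0 * W z) by (apply Bu; lra).
    repeat split; auto.
    eapply Rle_trans; [exact B3|]. apply le_mu; auto. apply Rmult_le_pos; auto. }
  assert (ban := bb_an ph x0 ltac:(lra) ltac:(lra)).
  assert (bbd := bb_bd ph x0 eps ltac:(lra) ltac:(lra) Heps Hxb Hxa).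
  assert (bct := bb_ct ph x0 ltac:(lra) ltac:(lra)).
  assert (W_cone : forall y i s, (i < 3)%nat -> 0 <= s -> 0 < d y -> W (y + RtoC s * edir psi i)%C <= W y).
  { intros y i s Hi Hs Hy. apply (Wt_cone ph psi alpha_r x0); auto; lra. }
  assert (W_loc : forall z u, 0 < d z -> Cmod (u - z)%C <= d z / 2 -> Cmod (u - z)%C <= / 2 -> W u <= CW * W z).
  { intros z u Hz H1 H2. apply (Wt_loc ph psi alpha_r x0); auto; lra. }
  assert (W_small : forall z, 0 < d z -> Rr * W z <= 1).
  { intros z Hz. assert (P := exp_pos (alpha_r * ln x0)). fold (Rpower x0 alpha_r) in P.
    assert (Hw := W_le z Hz). assert (Hwp := W_pos z Hz).
    apply Rle_trans with (Rpower x0 alpha_r * W z); [apply Rmult_le_compat_r; auto|].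
    apply (Rmult_le_compat_l (Rpower x0 alpha_r)) in Hw; [|lra]. rewrite Rinv_r in Hw by lra. exact Hw. }
  destruct (picard_solution psi K k kp HK d c0 Hc0 d_lip d_cone W CW T HT0 W_pos (Rlt_le _ _ HCW) W_cone W_loc bb eps (Rlt_le _ _ Heps)
    ban bbd bct Hsm fI' rr CI0 Cr fI_nice r_nice HCI0 HCr fI_bnd r_bnd W_small) as [f [Nf [Bf' [Uf Ff]]]].
  fold CL Rr in Bf'.
  assert (Uf1 := unit4_unit d f Uf).
  assert (NH : tnice d (Hrhs bb fI' rr f)).
  { apply (Hrhs_tnice psi K k kp HK d c0 Hc0 d_lip d_cone W CW T HT0 W_pos (Rlt_le _ _ HCW) W_cone W_loc bb eps (Rlt_le _ _ Heps)
    ban bbd bct Hsm fI' rr CI0 Cr fI_nice r_nice HCI0 HCr fI_bnd r_bnd W_small); auto. }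
  assert (N1 := tnice_tD d d_lip f Nf). assert (N2 := tnice_tD d d_lip _ N1).
  set (kap := sin (ph - phi)). assert (Hkap : 0 < kap <= 1). { split; [apply sin_gt_0; unfold ph; lra|apply SIN_bound]. }
  set (rho_t := x0 / kap).
  assert (Hrt : x0 <= rho_t). { unfold rho_t. apply le_div_intro; [lra|]. nra. }
  assert (Hd : forall y t, Dphi phi rho_t T y t -> 0 < d y /\ kap * Cmod y <= vp ph y).
  { intros y t [Hs [Hm _]]. destruct (vp_sector phi ph y ltac:(lra) ltac:(lra) Hs) as [Q _]. fold kap in Q. split; auto. unfold d.
    apply (Rmult_lt_compat_l kap) in Hm; [|lra]. unfold rho_t in Hm. replace (kap * (x0 / kap)) with x0 in Hm by (field; lra). lra. }
  assert (cd : forall h z t, tnice d h -> 0 < d z -> Cderiv (fun u => h u t) z (tD h z t)).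
  { intros h z t Hh Hz. apply Cderiv_cder. apply (nice_cder d (slice h t)); auto. now apply tnice_nice. }
  exists rho_t, f. split; [lra|split].
  - split; [|split].
    + intros t Ht y Hy. exists (tD f y t). apply cd; auto. now apply (Hd y t).
    + intros y Hy. destruct (Hd y 0 Hy) as [Hdy _]. rewrite Ff by auto. rewrite Lc_zero by auto. unfold fI'. ring.
    + exists (tD f), (tD (tD f)), (tD (tD (tD f))). split.
      * intros y t Hy. destruct (Hd y t Hy) as [Hdy _]. repeat split; apply cd; auto.
      * intros y t Hy. destruct (Hd y t Hy) as [Hdy _]. destruct Hy as [_ [_ Ht]].
        exists (tD (tD (tD f)) y t - tD (tD (tD fI')) y t + Hrhs bb fI' rr f y t)%C, (fun j => Bf bb j f y t). split; [|split].
        -- apply tderiv_wder. apply (duhamel_pde psi K k kp HK d c0 Hc0 d_lip d_cone T HT0 f fI'); auto.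
        -- intros j Hj. apply (Bf_series b T j f y t eps d); auto. lra.
        -- unfold Hrhs, NL, rr, tclamp. rewrite clamp_id by auto. ring.
  - exists (Rabs Rr * / Rpower kap alpha_r), 0. intros y t Hy _. destruct (Hd y t Hy) as [Hdy Hky].
    destruct (Bf' y t Hdy) as [q _]. eapply Rle_trans; [exact q|].
    assert (HW := W_pos y Hdy). apply Rle_trans with (Rabs Rr * W y); [apply Rmult_le_compat_r; auto; apply Rle_abs|].
    unfold Rdiv. rewrite Rmult_assoc. apply Rmult_le_compat_l; [apply Rabs_pos|]. rewrite <- Rinv_mult.
    unfold W, Wt. assert (Hym : 0 < Cmod y). { destruct Hy as [_ [Hm _]]. lra. }
    apply Rinv_le_contravar.
    + apply Rmult_lt_0_compat; apply exp_pos.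
    + rewrite Rpower_mult_distr by lra. apply Rle_Rpower_l; [lra|]. split; [apply Rmult_lt_0_compat; lra|auto].
Qed.

Section AtInfinity.
Variables (phi rho : R).
Hypotheses (Hphi : 0 < phi < PI / 6) (Hrho : rho0 < rho).
Notation Dm := (Dphi phi rho T).

Lemma half_plane_Dphi z t : rho < vp 0 z -> 0 <= t <= T -> Dm z t.
Proof using Hrho0 Hphi Hrho.
  intros Hz Ht. assert (HPI := PI_RGT_0). assert (Q := vp_le_mod 0 z). repeat split; try lra.
  apply (in_sector_mono (PI / 2 + 0)); [lra|]. apply sector_of_vp; lra.
Qed.

Lemma solution_at_infinity g X eps : is_solution T r b fI Dm g -> rho <= X - 3 -> rho0 <= X -> 0 < eps -> 4 <= Rpower X beta ->
  (forall j, (j < 4)%nat -> Ab <= Rpower X (alpha j) * eps) ->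
  (forall z t, X - 3 < vp 0 z -> 0 <= t <= T -> Cmod (g z t) <= 1) ->
  let d := fun y => vp 0 y - X in let gc := tclamp T g in
  tnice d gc /\ unit4 d gc /\
  (forall z t, 0 < d z -> 0 <= t <= T -> wder T (gc z) t (tD (tD (tD gc)) z t + tclamp T r z t + NL bb gc z t)%C) /\
  (forall z, 0 < d z -> gc z 0 = fI z).
Proof using All.
  intros [Han [Hini [f1 [f2 [f3 [Hf Hpde]]]]]] HX1 HX2 Heps Hxb Hxa Hg1 d gc.
  assert (HT0 : 0 <= T) by lra. assert (HPI := PI_RGT_0). assert (Hc := fun t => clamp_in 0 T t HT0).
  assert (Hd : forall z t, X - 3 < vp 0 z -> 0 <= t <= T -> Dm z t) by (intros; apply half_plane_Dphi; lra).
  assert (d_lip : forall y z, Rabs (d y - d z) <= Cmod (y - z)%C) by (intros; apply vpx_lip).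
  assert (Nc : tnice (fun y => vp 0 y - (X - 3)) gc).
  { repeat split.
    - intros z t Hz. destruct (Han _ (Hc t) z) as [l Hl]; [apply Hd; auto; lra|]. exists l. now apply Cderiv_cder.
    - intros del Hdel. exists 1. intros z t Hz. apply Hg1; auto. lra.
    - intros z t Hz. apply (wder_clamp_ccont T (g z)); auto. intros u Hu. destruct (Hpde z u) as [ft [B [Hft _]]]; [apply Hd; auto; lra|].
      exists ft. now apply tderiv_wder. }
  assert (N : tnice d gc).
  { destruct Nc as [c1 [c2 c3]]. unfold d. repeat split.
    - intros z t Hz. apply c1. lra.
    - intros del Hdel. destruct (c2 del Hdel) as [M HM]. exists M. intros z t Hz. apply HM. lra.
    - intros z t Hz. apply c3. lra. }
  assert (U : unit4 d gc).
  { intros z t Hz. unfold d in Hz.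
    destruct (D_bounds3 (fun y => vp 0 y - (X - 3)) (vpx_lip 0 (X - 3)) (slice gc t) z 1 (tnice_nice _ _ t Nc)) as [B1 [B2 B3]]; [lra| |].
    - intros u Hu. apply Hg1; auto. lra.
    - split; [apply Hg1; auto; lra|split; [exact B1|split; [exact B2|]]]. eapply Rle_trans; [exact B3|].
      rewrite <- Rinv_1. apply Rinv_le_contravar; [apply mu_pos; exact Hz|apply mu_le1]. }
  split; [exact N|split; [exact U|split]].
  - intros z t Hz Ht. assert (Hz' : X < vp 0 z) by (unfold d in Hz; lra).
    assert (Hn : forall u, Cmod (u - z)%C < d z -> X < vp 0 u).
    { intros u Hu. assert (Q := d_open d d_lip z Hz u Hu). unfold d in Q. lra. }
    assert (E1 : forall u, X < vp 0 u -> tD gc u t = f1 u t).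
    { intros u Hu. apply D_unique. apply Cderiv_cder. unfold slice, gc, tclamp. rewrite clamp_id by auto. apply Hf. apply Hd; auto; lra. }
    assert (op : forall u, X < vp 0 u -> exists del, 0 < del /\ forall v, Cmod (v - u)%C < del -> X < vp 0 v).
    { intros u Hu. exists (d u). split; [unfold d; lra|]. intros v Hv. assert (Q := d_open d d_lip u ltac:(unfold d; lra) v Hv). unfold d in Q. lra. }
    assert (E2 : forall u, X < vp 0 u -> tD (tD gc) u t = f2 u t).
    { intros u Hu. apply D_unique. destruct (op u Hu) as [del [Hdel Hv]].
      apply (cder_ext_loc (fun z => f1 z t)) with (d := del); auto.
      - intros v Hvu. symmetry. apply E1; auto.
      - apply Cderiv_cder. apply Hf. apply Hd; auto; lra. }
    assert (E3 : tD (tD (tD gc)) z t = f3 z t).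
    { apply D_unique. destruct (op z Hz') as [del [Hdel Hv]].
      apply (cder_ext_loc (fun z => f2 z t)) with (d := del); auto.
      - intros v Hvu. symmetry. apply E2; auto.
      - apply Cderiv_cder. apply Hf. apply Hd; auto; lra. }
    destruct (Hpde z t) as [ft [B [Hft [HB Heq]]]]; [apply Hd; auto; lra|].
    assert (Eg : gc z t = g z t) by (unfold gc, tclamp; now rewrite clamp_id).
    assert (bbd := bb_bd 0 X eps ltac:(lra) HX2 Heps Hxb Hxa).
    assert (EB : forall j, (j < 4)%nat -> Bf bb j gc z t = B j).
    { intros j Hj. assert (S1 := Bf_series b T j gc z t eps d ltac:(lra) bbd Hj (unit4_unit d gc U) Hz Ht).
      rewrite Eg in S1. specialize (HB j Hj). apply Cseries_iff in S1, HB. rewrite <- (Ccv_Clim _ _ HB). symmetry. now apply Ccv_Clim. }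
    assert (Eft : ft = (tD (tD (tD gc)) z t + tclamp T r z t + NL bb gc z t)%C).
    { unfold NL. rewrite E3, (E2 z Hz'), (E1 z Hz'), !EB, Eg by lia. unfold tclamp. rewrite clamp_id by auto.
      replace ft with ((ft - f3 z t) + f3 z t)%C by ring. rewrite Heq. ring. }
    rewrite <- Eft. apply tderiv_wder in Hft. apply (wder_ext T (g z)); auto.
    intros s Hs. unfold gc, tclamp. now rewrite clamp_id.
  - intros z Hz. unfold gc, tclamp. rewrite clamp_id by lra. apply Hini. apply Hd; unfold d in Hz; lra.
Qed.

Lemma bigO_small g : bigO_inv 1 Dm g -> evt (fun X => forall z t, X - 3 < vp 0 z -> 0 <= t <= T -> Cmod (g z t) <= 1).
Proof using Hrho0 Hphi Hrho.
  intros [K [M H]]. exists (Rmax (rho + 3) (Rmax (M + 3) (Rabs K + 3))). intros X HX z t Hz Ht.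
  assert (L1 := Rmax_l (rho + 3) (Rmax (M + 3) (Rabs K + 3))). assert (L2 := Rmax_r (rho + 3) (Rmax (M + 3) (Rabs K + 3))).
  assert (L3 := Rmax_l (M + 3) (Rabs K + 3)). assert (L4 := Rmax_r (M + 3) (Rabs K + 3)). assert (Hm := vp_le_mod 0 z).
  eapply Rle_trans; [apply (H z t)|].
  - apply half_plane_Dphi; lra.
  - lra.
  - rewrite Rpower_1 by lra. apply Rle_div_l; [lra|]. assert (V := Rle_abs K). lra.
Qed.

Lemma uniqueness_at_infinity f g : is_solution T r b fI Dm f -> is_solution T r b fI Dm g -> bigO_inv 1 Dm f -> bigO_inv 1 Dm g ->
  exists X, forall z t, X < vp 0 z -> 0 <= t <= T -> f z t = g z t.
Proof using All.
  intros Sf Sg Of Og. assert (HPI := PI_RGT_0). assert (HT0 : 0 <= T) by lra.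
  set (psi := 5 * PI / 12). destruct (airy_kernels psi ltac:(unfold psi; lra)) as [K [k [kp HK]]].
  set (c0 := cos (0 + psi)). assert (Hc0 : 0 < c0) by (apply cos_gt_0; unfold psi; lra).
  destruct (small_eps (Cest K c0 T 1)) as [eps [Heps Hsm]].
  destruct (evt_ex _ (evt_and _ _ (evt_and _ _ (evt_ge (rho + 3)) (evt_coef eps Heps)) (evt_and _ _ (bigO_small f Of) (bigO_small g Og))))
    as [X [[HX1 [Hxb Hxa]] [Hf1 Hg1]]].
  destruct (solution_at_infinity f X eps Sf ltac:(lra) ltac:(lra) Heps Hxb Hxa Hf1) as [Nf [Uf [Pf If]]].
  destruct (solution_at_infinity g X eps Sg ltac:(lra) ltac:(lra) Heps Hxb Hxa Hg1) as [Ng [Ug [Pg Ig]]].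
  set (d := fun y => vp 0 y - X) in *.
  assert (d_lip : forall y z, Rabs (d y - d z) <= Cmod (y - z)%C) by (intros; apply vpx_lip).
  assert (d_cone : forall y i s, (i < 3)%nat -> 0 <= s -> d y + c0 * s <= d (y + RtoC s * edir psi i)%C).
  { intros y i s Hi Hs. unfold d. assert (Q := vp_cone 0 psi y i s ltac:(lra) ltac:(unfold psi; lra) ltac:(unfold psi; lra) Hi Hs). fold c0 in Q. lra. }
  assert (ban := bb_an 0 X ltac:(lra) ltac:(lra)).
  assert (bbd := bb_bd 0 X eps ltac:(lra) ltac:(lra) Heps Hxb Hxa).
  assert (bct := bb_ct 0 X ltac:(lra) ltac:(lra)).
  assert (Cl : forall h z t, tclamp T h z t = tclamp T h z (clamp 0 T t)).
  { intros h z t. unfold tclamp. rewrite (clamp_id 0 T (clamp 0 T t)) by now apply clamp_in. reflexivity. }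
  assert (B1 : forall h, unit4 d h -> bnd d (fun _ => 1) 1 h).
  { intros h Hh z t Hz. destruct (Hh z t Hz) as [h0 [h1 [h2 h3]]]. rewrite Rmult_1_l. unfold Rdiv. rewrite Rmult_1_l. auto. }
  exists X. intros z t Hz Ht.
  assert (Q := pde_uniqueness psi K k kp HK d c0 Hc0 d_lip d_cone T HT0 (fun _ => 1) 1 ltac:(intros; lra) ltac:(lra) ltac:(intros; lra) ltac:(intros; lra)
    bb eps ltac:(lra) ban bbd bct Hsm (tclamp T f) (tclamp T g) (tclamp T r) (1 + 1) Nf Ng Uf Ug ltac:(lra)
    (bnd_bndd d (fun _ => 1) _ _ 1 1 (B1 _ Uf) (B1 _ Ug)) (fun z t _ => Cl f z t) (fun z t _ => Cl g z t) Pf Pg).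
  assert (Q' : tclamp T f z t = tclamp T g z t).
  { apply Q; [|unfold d; lra]. intros u Hu. rewrite If, Ig; auto. }
  unfold tclamp in Q'. rewrite clamp_id in Q' by auto. exact Q'.
Qed.

Lemma uniqueness f g : is_solution T r b fI Dm f -> is_solution T r b fI Dm g -> bigO_inv 1 Dm f -> bigO_inv 1 Dm g ->
  forall y t, Dm y t -> g y t = f y t.
Proof using All.
  intros Sf Sg Of Og y t [Hs [Hm Ht]]. destruct (uniqueness_at_infinity f g Sf Sg Of Og) as [X HX].
  destruct (escape_ray phi rho y Hphi ltac:(lra) Hs Hm) as [w [R [c [Hw [HR [Hc [Hin Hgrow]]]]]]].
  set (S := (Rabs X + Rabs (vp 0 y) + R + 1) / c).
  assert (HXp := Rabs_pos X). assert (Hvp := Rabs_pos (vp 0 y)). assert (HXa := Rle_abs X). assert (Hva := Rle_abs (- vp 0 y)). rewrite Rabs_Ropp in Hva.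
  assert (Z : (g y t - f y t)%C = 0).
  { apply (zero_along_ray (fun u => g u t - f u t)%C y w R S); auto.
    - apply le_div_intro; auto. lra.
    - intros s u Hs0 Hu. destruct (Hin s u Hs0 Hu) as [i1 i2]. assert (Hd : Dm u t) by (repeat split; auto; lra).
      destruct (proj1 Sf t Ht u Hd) as [l1 Hl1]. destruct (proj1 Sg t Ht u Hd) as [l2 Hl2].
      exists (l2 - l1)%C. apply (cder_minus (fun u => g u t) (fun u => f u t)); now apply Cderiv_cder.
    - intros s u HsS Hu. assert (Hs0 : 0 <= s). { apply Rle_trans with S; auto. apply le_div_intro; auto. lra. }
      assert (Q := Hgrow s u Hs0 Hu). apply (Rmult_le_compat_l c) in HsS; [|lra]. unfold S in HsS.
      replace (c * ((Rabs X + Rabs (vp 0 y) + R + 1) / c)) with (Rabs X + Rabs (vp 0 y) + R + 1) in HsS by (field; lra).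
      rewrite HX; [ring|lra|auto]. }
  replace (g y t) with ((g y t - f y t) + f y t)%C by ring. rewrite Z. ring.
Qed.
End AtInfinity.
End Main.

Lemma bigO_inv_weaken a c D f : a <= c -> bigO_inv c D f -> bigO_inv a D f.
Proof.
  intros Hac [K [M H]]. exists (Rabs K), (Rmax M 1). intros y t Hy Hm. assert (L1 := Rmax_l M 1). assert (L2 := Rmax_r M 1).
  eapply Rle_trans; [apply (H y t); auto; lra|].
  assert (P1 : 0 < Rpower (Cmod y) a) by apply exp_pos. assert (P2 : 0 < Rpower (Cmod y) c) by apply exp_pos.
  apply Rle_trans with (Rabs K / Rpower (Cmod y) c).
  - apply Rmult_le_compat_r; [apply Rlt_le, Rinv_0_lt_compat; auto|apply Rle_abs].
  - apply Rmult_le_compat_l; [apply Rabs_pos|]. apply Rinv_le_contravar; auto. apply Rle_Rpower; lra.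
Qed.

Theorem theorem2
  (rho0 T alpha_r beta : R) (alpha : nat -> R)
  (r : C -> R -> C) (b : nat -> nat -> C -> R -> C) (fI : C -> C)
  (Hrho0 : 0 < rho0) (HT : 0 < T) (Har : 1 <= alpha_r) (Hbeta : 0 < beta)
  (Halpha : forall j, (j < 4)%nat -> 0 < alpha j)
  (* r analytic in y on D_{rho0}, |y^{alpha_r} r| < A_r *)
  (Hr_an : forall t, 0 <= t <= T -> analytic_on (fun y => Dom0 rho0 T y t) (fun y => r y t))
  (Hr_bd : exists Ar, forall y t, Dom0 rho0 T y t ->
             Rpower (Cmod y) alpha_r * Cmod (r y t) < Ar)
  (* b_{j,k} analytic in y on D_{rho0}, |y^{alpha_j + k beta} b_{j,k}| < A_b *)
  (Hb_an : forall j k t, (j < 4)%nat -> 0 <= t <= T ->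
             analytic_on (fun y => Dom0 rho0 T y t) (fun y => b j k y t))
  (Hb_bd : exists Ab, forall j k y t, (j < 4)%nat -> Dom0 rho0 T y t ->
             Rpower (Cmod y) (alpha j + INR k * beta) * Cmod (b j k y t) < Ab)
  (* the series sum_k b_{j,k} f^k converges in D_{phi,rho} when |f| < rho^beta *)
  (Hb_ser : forall phi rho, 0 < phi < PI / 6 -> rho0 < rho ->
             forall j y t (w : C), (j < 4)%nat -> Dphi phi rho T y t ->
               Cmod w < Rpower rho beta ->
               Cex_series (fun k => Cmult (b j k y t) (pow_n (K := C_Ring) w k)))
  (* implicit regularity in t (see NOTES.md, FIDELITY) *)
  (Hr_ct : forall y t, Dom0 rho0 T y t ->
             filterlim (fun s => r y s) (within (fun s => 0 <= s <= T) (locally t))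
               (locally (r y t)))
  (Hb_ct : forall j k y t, (j < 4)%nat -> Dom0 rho0 T y t ->
             filterlim (fun s => b j k y s) (within (fun s => 0 <= s <= T) (locally t))
               (locally (b j k y t)))
  (* initial datum *)
  (HfI_an : analytic_on (fun y => in_sector (2 * PI / 3) y /\ rho0 < Cmod y) fI)
  (HfI_bd : exists AfI, forall y, in_sector (2 * PI / 3) y -> rho0 < Cmod y ->
             Rpower (Cmod y) alpha_r * Cmod (fI y) < AfI) :
  forall phi, 0 < phi < PI / 6 ->
  exists rho_t, rho0 < rho_t /\
    exists f : C -> R -> C,
      is_solution T r b fI (Dphi phi rho_t T) f /\
      bigO_inv 1 (Dphi phi rho_t T) f /\
      (forall g : C -> R -> C,
         is_solution T r b fI (Dphi phi rho_t T) g ->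
         bigO_inv 1 (Dphi phi rho_t T) g ->
         forall y t, Dphi phi rho_t T y t -> g y t = f y t) /\
      bigO_inv alpha_r (Dphi phi rho_t T) f.
Proof.
  destruct Hr_bd as [Ar Hr]. destruct Hb_bd as [Ab Hb]. destruct HfI_bd as [AfI HfI]. intros phi Hphi.
  destruct (existence rho0 T alpha_r beta alpha r b fI Ar Ab AfI Hrho0 HT Har Hbeta Halpha Hr_an Hr Hb_an Hb Hr_ct Hb_ct HfI_an HfI phi Hphi)
    as [rho_t [f [Hrho [Sf Of]]]].
  assert (Of1 := bigO_inv_weaken 1 alpha_r _ f Har Of).
  exists rho_t. split; [exact Hrho|]. exists f. split; [exact Sf|split; [exact Of1|split; [|exact Of]]].
  intros g Sg Og.
  exact (uniqueness rho0 T alpha_r beta alpha r b fI Ar Ab AfI Hrho0 HT Har Hbeta Halpha Hr_an Hr Hb_an Hb Hr_ct Hb_ct HfI_an HfI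
    phi rho_t Hphi Hrho f g Sf Sg Of1 Og).
Qed.
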